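(* Over $\mathsf{RCA}_0^\omega$ the following are equivalent: (a) $\mathsf{WKL}_0$ together with: every usco function $f:\mathbb{R}\to\mathbb{R}$ is bounded above by some continuous $g:\mathbb{R}\to\mathbb{R}$; (b) for every sequence $(f_n)_{n\in\mathbb{N}}$ of usco functions on $[0,1]$ there is $g\in\mathbb{N}^\mathbb{N}$ with $f_n(x)\le g(n)$ for all $n\in\mathbb{N}$, $x\in[0,1]$; (c) for every sequence $(O_n)_{n\in\mathbb{N}}$ of open sets with $\mathbb{R}=\bigcup_n O_n$, there is $g\in\mathbb{N}^\mathbb{N}$ such that $[-n,n]\subseteq\bigcup_{m\le g(n)}O_m$ for all $n$; (d) ($\mathsf{HBC}_{\mathsf{s}}^{\mathsf{seq}}$) for all sequences $(O_{n,m})_{n,m\in\mathbb{N}}$ of open sets and $(C_n)_{n\in\mathbb{N}}$ of closed sets in $[0,1]$ such that $C_n\subseteq\bigcup_{m}O_{n,m}$ for all $n$, there is $g\in\mathbb{N}^\mathbb{N}$ such that $C_n\subseteq\bigcup_{m\le g(n)}O_{n,m}$ for all $n$; (e) $\mathsf{OC}^{0,0}$ together with any one of the following statements (each such conjunction being equivalent to (a)): (e1) every usco $f:[0,1]\to\mathbb{R}$ is bounded above; (e2) for every lsco $f:[0,1]\to\mathbb{R}^+$ there is $N$ with $f(x)>2^{-N}$ for all $x\in[0,1]$; (e3) for every sequence $(O_n)$ of open sets covering $[0,1]$ some finite union $\bigcup_{n\le n_0}O_n$ covers $[0,1]$; (e4) every nested sequence $C_{n+1}\subseteq C_n\subseteq[0,1]$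 of non-empty closed sets has non-empty intersection; (e5) for every increasing sequence $(f_n)$ of lsco functions on $[0,1]$ and usco $g:[0,1]\to\mathbb{R}$, $(\forall x)(\exists n)(f_n(x)>g(x))\to(\exists m)(\forall x)(f_m(x)>g(x))$; (e6) for every closed $C\subseteq[0,1]$ and sequence $(O_n)$ of open sets covering $C$, some $\bigcup_{n\le n_0}O_n$ covers $C$; (e7) every usco $f:[0,1]\to\mathbb{R}$ with supremum $y$ attains $y$; (e8) every usco $f:[0,1]\to\mathbb{R}$ with supremum $y$ and at most one maximum attains $y$.
   Context: Framework: Kohlenbach's higher-order reverse mathematics; $\mathsf{RCA}_0^\omega$ is Kohlenbach's base theory (extensional primitive recursive arithmetic in all finite types with $\mathsf{QF\text{-}AC}^{1,0}$). Reals are represented by fast-converging Cauchy sequences of rationals. $\mathsf{WKL}_0$ denotes weak K\''onig's lemma. An open set $U\subseteq\mathbb{R}$ is given by $h_U:\mathbb{R}\to\mathbb{R}$, with $x\in U$ meaning $h_U(x)>0$, such that $y\in U$ implies $(\exists N)(\forall z\in B(y,2^{-N}))(z\in U)$; a set is closed if its complement is open; sequences of such sets are sequences of representing functions. $f$ is usco at $x_0$ if for every $k$ there is $N$ with $f(y)<f(x_0)+2^{-k}$ for all $y$ in the domain with $|y-x_0|<2^{-N}$; lsco at $x_0$ if $f(y)>f(x_0)-2^{-k}$ for all such $y$; usco/lsco means so at every point. ''Supremum $y$'' means least upper bound; $f$ with supremum $y$ has at most one maximum if $(\forall x\ne x')(f(x)<y\vee f(x')<y)$. $\mathsf{OC}^{0,0}$: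 for every increasing sequence $(O_n)$ of open sets in $\mathbb{R}$ ($O_n\subseteq O_{n+1}$): if $(\forall n\in\mathbb{N})(\exists m\in\mathbb{N})([-n,n]\subseteq O_m)$ then $(\exists g\in\mathbb{N}^\mathbb{N})(\forall n\in\mathbb{N})([-n,n]\subseteq O_{g(n)})$. *)

(* Defs.v *)
From Stdlib Require Import List.
Import ListNotations.

Inductive ty : Set := o : ty | arr : ty -> ty -> ty.

Declare Scope ty_scope.
Delimit Scope ty_scope with ty.
Bind Scope ty_scope with ty.
Notation "s ~> t" := (arr s t) (at level 60, right associativity) : ty_scope.
Local Open Scope ty_scope.

Definition ty_eq_dec (s t : ty) : {s = t} + {s <> t}.
Proof. decide equality. Defined.

(* De Bruijn indices are counted separately for each type: [Var t n] refers to
   the n-th enclosing quantifier over type t, those over other types being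
   skipped. *)
Inductive term : ty -> Type :=
| Var (t : ty) : nat -> term t
| Zero : term o
| Succ : term (o ~> o)
| Kc (s t : ty) : term (s ~> t ~> s)
| Sc (r s t : ty) : term ((r ~> s ~> t) ~> (r ~> s) ~> r ~> t)
| Rec : term (o ~> o ~> (o ~> o ~> o) ~> o)
| App (s t : ty) : term (s ~> t) -> term s -> term t.
Arguments Kc {s t}.
Arguments Sc {r s t}.
Arguments App {s t}.

(* The only prime formulas are equations of type o; the other connectives are
   their classical definitions. *)
Inductive form : Type :=
| FEq : term o -> term o -> form
| FBot : form
| FImp : form -> form -> form
| FAll : ty -> form -> form.

Definition FNeg (p : form) : form := FImp p FBot.
Definition FEx (t : ty) (p : form) : form := FNeg (FAll t (FNeg p)).

Inductive qf : form -> Prop :=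
| qf_eq u v : qf (FEq u v)
| qf_bot : qf FBot
| qf_imp p q : qf p -> qf q -> qf (FImp p q).

Definition substitution := forall t : ty, nat -> term t.

Definition scons {t : ty} (u : term t) (sg : substitution) : substitution :=
  fun s => match ty_eq_dec t s with
           | left e => fun n => match n with
                                | 0 => eq_rect t term u s e
                                | S m => sg s m
                                end
           | right _ => sg s
           end.

Definition shift_by (t : ty) : substitution :=
  fun s n => if ty_eq_dec t s then Var s (S n) else Var s n.

Fixpoint subst_term {t : ty} (sg : substitution) (u : term t) : term t :=
  match u in term t return term t with
  | Var t n => sg t n
  | Zero => Zero
  | Succ => Succ
  | Kc => Kc
  | Sc => Sc
  | Rec => Rec
  | App u v => App (subst_term sg u) (subst_term sg v)
  end.

Definition up (t : ty) (sg : substitution) : substitution :=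
  scons (Var t 0) (fun s n => subst_term (shift_by t) (sg s n)).

Fixpoint subst (sg : substitution) (p : form) : form :=
  match p with
  | FEq u v => FEq (subst_term sg u) (subst_term sg v)
  | FBot => FBot
  | FImp p q => FImp (subst sg p) (subst sg q)
  | FAll t p => FAll t (subst (up t sg) p)
  end.

Definition shift (t : ty) (p : form) : form := subst (shift_by t) p.

Definition inst {t : ty} (u : term t) (p : form) : form := subst (scons u Var) p.

(* The rule for the universal quantifier has no side condition on Ax, so free
   variables of an axiom are implicitly universally quantified. *)
Inductive prv (Ax : form -> Prop) : list form -> form -> Prop :=
| prv_ax G p : Ax p -> prv Ax G p
| prv_hyp G p : In p G -> prv Ax G p
| prv_impI G p q : prv Ax (p :: G) q -> prv Ax G (FImp p q)
| prv_impE G p q : prv Ax G (FImp p q) -> prv Ax G p -> prv Ax G q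
| prv_raa G p : prv Ax (FNeg p :: G) FBot -> prv Ax G p
| prv_allI G t p : prv Ax (map (shift t) G) p -> prv Ax G (FAll t p)
| prv_allE G t p (u : term t) : prv Ax G (FAll t p) -> prv Ax G (inst u p).

(* [bterm]/[bform] are expressions waiting for the number of binders of each
   type in whose scope they occur; this lets bound variables be written as Rocq
   variables.  A variable bound at level [d t] and used at depth [d'] has de
   Bruijn index [d' t - (d t + 1)]. *)
Definition depth := ty -> nat.
Definition bterm (t : ty) := depth -> term t.
Definition bform := depth -> form.

Definition under (t : ty) (d : depth) : depth :=
  fun s => if ty_eq_dec t s then S (d s) else d s.
Definition bvar (t : ty) (d : depth) : bterm t :=
  fun d' => Var t (d' t - S (d t)).

Definition All {t : ty} (p : bterm t -> bform) : bform :=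
  fun d => FAll t (p (bvar t d) (under t d)).
Definition Bot : bform := fun _ => FBot.
Definition Eqn (u v : bterm o) : bform := fun d => FEq (u d) (v d).
Definition Imp (p q : bform) : bform := fun d => FImp (p d) (q d).
Definition Neg (p : bform) : bform := Imp p Bot.
Definition And (p q : bform) : bform := Neg (Imp p (Neg q)).
Definition Or (p q : bform) : bform := Imp (Neg p) q.
Definition Ex {t : ty} (p : bterm t -> bform) : bform :=
  Neg (All (fun x => Neg (p x))).

Definition close (p : bform) : form := p (fun _ => 0).

Declare Scope obj_scope.
Delimit Scope obj_scope with obj.
Bind Scope obj_scope with bform.
Bind Scope obj_scope with bterm.
Open Scope obj_scope.

Definition app {s t : ty} (u : bterm (s ~> t)) (v : bterm s) : bterm t :=
  fun d => App (u d) (v d).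
Notation "u @ v" := (app u v) (at level 11, left associativity) : obj_scope.

Notation "u == v" := (Eqn u v) (at level 70, no associativity) : obj_scope.
Notation "~~ p" := (Neg p) (at level 75, right associativity) : obj_scope.
Notation "p &&& q" := (And p q) (at level 80, right associativity) : obj_scope.
Notation "p ||| q" := (Or p q) (at level 85, right associativity) : obj_scope.
Notation "p --> q" := (Imp p q) (at level 90, right associativity) : obj_scope.
Notation "'ALL' x : t , p" := (All (fun x : bterm t => p))
  (at level 200, x name, t at level 60, p at level 200) : obj_scope.
Notation "'EX' x : t , p" := (Ex (fun x : bterm t => p))
  (at level 200, x name, t at level 60, p at level 200) : obj_scope.

(* Lambda abstraction of [Var t 0], by the usual bracket abstraction.  [strip t u]
   is u with its variables of type t lowered by one, if [Var t 0] does not occur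
   in u. *)
Definition Ic (t : ty) : term (t ~> t) := App (App Sc Kc) (@Kc t t).

Fixpoint strip (t : ty) {s : ty} (u : term s) : option (term s) :=
  match u in term s return option (term s) with
  | Var s n => if ty_eq_dec t s
               then match n with 0 => None | S m => Some (Var s m) end
               else Some (Var s n)
  | App u v => match strip t u, strip t v with
               | Some u', Some v' => Some (App u' v')
               | _, _ => None
               end
  | c => Some c
  end.

Fixpoint abs (t : ty) {s : ty} (u : term s) : term (t ~> s) :=
  match strip t u with
  | Some u' => App Kc u'
  | None =>
    match u in term s return term (t ~> s) with
    | Var s n => match ty_eq_dec t s with
                 | left e => eq_rect t (fun r => term (t ~> r)) (Ic t) s e
                 | right _ => App Kc (Var s n)
                 end
    | App u v => App (App Sc (abs t u)) (abs t v)
    | c => App Kc c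
    end
  end.

Definition lam {s t : ty} (f : bterm s -> bterm t) : bterm (s ~> t) :=
  fun d => abs s (f (bvar s d) (under s d)).
Notation "'\' x .. y => b" := (lam (fun x => .. (lam (fun y => b)) ..))
  (at level 200, x binder, y binder, b at level 200) : obj_scope.

Definition zero : bterm o := fun _ => Zero.
Definition succ (n : bterm o) : bterm o := (fun _ => Succ) @ n.
Definition K {s t : ty} : bterm (s ~> t ~> s) := fun _ => Kc.
Definition Sg {r s t : ty} : bterm ((r ~> s ~> t) ~> (r ~> s) ~> r ~> t) :=
  fun _ => Sc.
Definition R0 : bterm (o ~> o ~> (o ~> o ~> o) ~> o) := fun _ => Rec.

Fixpoint eqt (t : ty) : bterm t -> bterm t -> bform :=
  match t with
  | o => fun u v => u == v
  | s ~> t => fun u v => ALL x : s, eqt t (u @ x) (v @ x)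
  end.

(* The theory RCA_0^omega: extensional primitive recursive arithmetic in all
   finite types, with the recursor of type 0 only, plus QF-AC^{1,0}.
   Induction: the induction variable of A is [Var o 0].
   QF-AC^{1,0}: in A, the variable x of type 1 is [Var (o ~> o) 0] and y is
   [Var o 0]; A being quantifier-free, these two indices do not interact. *)
Inductive RCA0w : form -> Prop :=
| ax_refl : RCA0w (close (ALL x : o, x == x))
| ax_eucl : RCA0w (close (ALL x : o, ALL y : o, ALL z : o,
    x == y --> x == z --> y == z))
| ax_ext (s t : ty) : RCA0w (close (ALL z : s ~> t, ALL x : s, ALL y : s,
    eqt s x y --> eqt t (z @ x) (z @ y)))
| ax_succ_nz : RCA0w (close (ALL x : o, ~~ (succ x == zero)))
| ax_succ_inj : RCA0w (close (ALL x : o, ALL y : o, succ x == succ y --> x == y))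
| ax_K (s t : ty) : RCA0w (close (ALL x : s, ALL y : t, eqt s (K @ x @ y) x))
| ax_S (r s t : ty) : RCA0w (close
    (ALL x : r ~> s ~> t, ALL y : r ~> s, ALL z : r,
       eqt t (Sg @ x @ y @ z) (x @ z @ (y @ z))))
| ax_rec0 : RCA0w (close (ALL y : o, ALL z : o ~> o ~> o,
    R0 @ zero @ y @ z == y))
| ax_recS : RCA0w (close (ALL x : o, ALL y : o, ALL z : o ~> o ~> o,
    R0 @ succ x @ y @ z == z @ (R0 @ x @ y @ z) @ x))
| ax_ind (A : form) : qf A ->
    RCA0w (FImp (inst Zero A)
          (FImp (FAll o (FImp A
                   (subst (scons (App Succ (Var o 0)) (shift_by o)) A)))
                (FAll o A)))
| ax_qfac (A : form) : qf A ->
    RCA0w (FImp (FAll (o ~> o) (FEx o A))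
          (FEx ((o ~> o) ~> o) (FAll (o ~> o)
             (inst (App (Var ((o ~> o) ~> o) 0) (Var (o ~> o) 0))
                   (shift ((o ~> o) ~> o) A))))).

Definition RCA0w_proves (p : bform) : Prop := prv RCA0w [] (close p).

Notation natO := (bterm o).

Definition addT : bterm (o ~> o ~> o) :=
  \ a b => R0 @ b @ a @ (\ u (_ : natO) => succ u).
Definition add (a b : natO) : natO := addT @ a @ b.
Definition mulT : bterm (o ~> o ~> o) :=
  \ a b => R0 @ b @ zero @ (\ u (_ : natO) => add u a).
Definition mul (a b : natO) : natO := mulT @ a @ b.
Definition predT : bterm (o ~> o) :=
  \ a => R0 @ a @ zero @ (\ (_ : natO) k => k).
Definition pred (a : natO) : natO := predT @ a.
Definition subT : bterm (o ~> o ~> o) :=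
  \ a b => R0 @ b @ a @ (\ u (_ : natO) => pred u).
Definition sub (a b : natO) : natO := subT @ a @ b.
Definition one : natO := succ zero.
Definition pow2T : bterm (o ~> o) :=
  \ a => R0 @ a @ one @ (\ u (_ : natO) => add u u).
Definition pow2 (a : natO) : natO := pow2T @ a.
(* [ifzero c a b] is a if c = 0, and b otherwise. *)
Definition ifzeroT : bterm (o ~> o ~> o ~> o) :=
  \ c a b => R0 @ c @ a @ (\ (_ _ : natO) => b).
Definition ifzero (c a b : natO) : natO := ifzeroT @ c @ a @ b.

Definition le (a b : natO) : bform := sub a b == zero.
Definition lt (a b : natO) : bform := le (succ a) b.

(* Cantor pairing (a, b) |-> (a + b)(a + b + 1)/2 + b; [diag n] is the largest w
   with w (w + 1)/2 <= n. *)
Definition triT : bterm (o ~> o) :=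
  \ a => R0 @ a @ zero @ (\ u k => add u (succ k)).
Definition tri (a : natO) : natO := triT @ a.
Definition diagT : bterm (o ~> o) :=
  \ a => R0 @ a @ zero @
     (\ w k => ifzero (sub (tri (succ w)) (succ k)) (succ w) w).
Definition diag (a : natO) : natO := diagT @ a.
Definition pairT : bterm (o ~> o ~> o) := \ a b => add (tri (add a b)) b.
Definition pair (a b : natO) : natO := pairT @ a @ b.
Definition pi2T : bterm (o ~> o) := \ n => sub n (tri (diag n)).
Definition pi2 (n : natO) : natO := pi2T @ n.
Definition pi1T : bterm (o ~> o) := \ n => sub (diag n) (pi2 n).
Definition pi1 (n : natO) : natO := pi1T @ n.

(* The number coding (a, (b, c)) represents the rational (a - b)/(c + 1). *)
Definition rat (a b c : natO) : natO := pair a (pair b c).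
Definition qpos (q : natO) : natO := pi1 q.
Definition qneg (q : natO) : natO := pi1 (pi2 q).
Definition qden (q : natO) : natO := succ (pi2 (pi2 q)).

Definition qaddT : bterm (o ~> o ~> o) :=
  \ q r => rat (add (mul (qpos q) (qden r)) (mul (qpos r) (qden q)))
               (add (mul (qneg q) (qden r)) (mul (qneg r) (qden q)))
               (pred (mul (qden q) (qden r))).
Definition qadd (q r : natO) : natO := qaddT @ q @ r.
Definition qoppT : bterm (o ~> o) :=
  \ q => rat (qneg q) (qpos q) (pred (qden q)).
Definition qopp (q : natO) : natO := qoppT @ q.
Definition qsub (q r : natO) : natO := qadd q (qopp r).
(* One of the two truncated differences vanishes. *)
Definition qabsT : bterm (o ~> o) :=
  \ q => rat (add (sub (qpos q) (qneg q)) (sub (qneg q) (qpos q)))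
             zero (pred (qden q)).
Definition qabs (q : natO) : natO := qabsT @ q.
Definition qlt (q r : natO) : bform :=
  lt (add (mul (qpos q) (qden r)) (mul (qneg r) (qden q)))
     (add (mul (qpos r) (qden q)) (mul (qneg q) (qden r))).
Definition qle (q r : natO) : bform := ~~ qlt r q.
Definition qnat (n : natO) : natO := rat n zero zero.
(* 2^{-n} and 2^{-n+1} *)
Definition qexp (n : natO) : natO := rat one zero (pred (pow2 n)).
Definition qexp' (n : natO) : natO := qadd (qexp n) (qexp n).

Notation rl := (o ~> o).
Notation fn := (rl ~> rl).

Definition isReal (x : bterm rl) : bform :=
  ALL n : o, ALL i : o, qlt (qabs (qsub (x @ n) (x @ add n i))) (qexp n).

Definition req (x y : bterm rl) : bform :=
  ALL n : o, qle (qabs (qsub (x @ n) (y @ n))) (qexp' n).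
Definition rlt (x y : bterm rl) : bform :=
  EX n : o, qlt (qadd (x @ n) (qexp' n)) (y @ n).
Definition rle (x y : bterm rl) : bform := ~~ rlt y x.

Definition raddT : bterm (rl ~> rl ~> rl) :=
  \ x y n => qadd (x @ succ n) (y @ succ n).
Definition radd (x y : bterm rl) : bterm rl := raddT @ x @ y.
Definition roppT : bterm (rl ~> rl) := \ x n => qopp (x @ n).
Definition ropp (x : bterm rl) : bterm rl := roppT @ x.
Definition rsub (x y : bterm rl) : bterm rl := radd x (ropp y).
Definition rabsT : bterm (rl ~> rl) := \ x n => qabs (x @ n).
Definition rabs (x : bterm rl) : bterm rl := rabsT @ x.
Definition rnat (n : natO) : bterm rl := K @ qnat n.
Definition rexp (n : natO) : bterm rl := K @ qexp n.

(* Subsets of R at the level of formulas; quantifiers over reals are relativized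
   to them. *)
Definition dom := bterm rl -> bform.
Definition inR : dom := isReal.
Definition inI : dom := fun x => isReal x &&& rle (rnat zero) x &&& rle x (rnat one).
Definition inSym (n : natO) : dom :=
  fun x => isReal x &&& rle (ropp (rnat n)) x &&& rle x (rnat n).

Definition AllIn (D : dom) (p : bterm rl -> bform) : bform :=
  ALL x : rl, D x --> p x.
Definition ExIn (D : dom) (p : bterm rl -> bform) : bform :=
  EX x : rl, D x &&& p x.
Notation "'ALL' x 'in' D , p" := (AllIn D (fun x => p))
  (at level 200, x name, D at level 60, p at level 200) : obj_scope.
Notation "'EX' x 'in' D , p" := (ExIn D (fun x => p))
  (at level 200, x name, D at level 60, p at level 200) : obj_scope.

Definition isFun (D : dom) (f : bterm fn) : bform :=
  (ALL x in D, isReal (f @ x)) &&&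
  (ALL x in D, ALL y in D, req x y --> req (f @ x) (f @ y)).

Definition near (N : natO) (x y : bterm rl) : bform := rlt (rabs (rsub x y)) (rexp N).

Definition usco (D : dom) (f : bterm fn) : bform :=
  isFun D f &&&
  ALL x in D, ALL k : o, EX N : o, ALL y in D,
    near N x y --> rlt (f @ y) (radd (f @ x) (rexp k)).

Definition lsco (D : dom) (f : bterm fn) : bform :=
  isFun D f &&&
  ALL x in D, ALL k : o, EX N : o, ALL y in D,
    near N x y --> rlt (rsub (f @ x) (rexp k)) (f @ y).

Definition cont (D : dom) (f : bterm fn) : bform :=
  isFun D f &&&
  ALL x in D, ALL k : o, EX N : o, ALL y in D,
    near N x y --> near k (f @ x) (f @ y).

Definition mem (x : bterm rl) (U : bterm fn) : bform := rlt (rnat zero) (U @ x).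

Definition isOpen (U : bterm fn) : bform :=
  isFun inR U &&&
  ALL y in inR, mem y U -->
    EX N : o, ALL z in inR, near N y z --> mem z U.

(* A closed set C is represented by the function h of its open complement:
   x is in C iff not h(x) > 0. *)
Definition memC (x : bterm rl) (C : bterm fn) : bform := ~~ mem x C.
Definition isClosed (C : bterm fn) : bform := isOpen C.
Definition isClosedI (C : bterm fn) : bform :=
  isClosed C &&& ALL x in inR, memC x C --> inI x.

Definition memUpTo (x : bterm rl) (O : bterm (o ~> fn)) (n : natO) : bform :=
  EX m : o, le m n &&& mem x (O @ m).

Definition isSup (f : bterm fn) (y : bterm rl) : bform :=
  isReal y &&& (ALL x in inI, rle (f @ x) y) &&&
  (ALL z in inR, (ALL x in inI, rle (f @ x) z) --> rle y z).

Definition atMostOneMax (f : bterm fn) (y : bterm rl) : bform :=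
  ALL x in inI, ALL x' in inI, ~~ req x x' --> (rlt (f @ x) y ||| rlt (f @ x') y).

Definition attains (f : bterm fn) (y : bterm rl) : bform :=
  EX x in inI, req (f @ x) y.

(* A finite binary sequence is coded by the number whose binary expansion is a 1
   followed by the sequence: the sequences of length n are the s with
   2^n <= s < 2^{n+1}, and the extensions of s by k bits are the s 2^k + r with
   r < 2^k.  [initseg b n] is the code of (b 0, ..., b (n-1)). *)
Definition initsegT : bterm ((o ~> o) ~> o ~> o) :=
  \ b n => R0 @ n @ one @ (\ u k => add (add u u) (b @ k)).
Definition initseg (b : bterm (o ~> o)) (n : natO) : natO := initsegT @ b @ n.

Definition WKL : bform :=
  ALL T : o ~> o,
    (ALL s : o, ALL k : o, ALL r : o, le one s --> lt r (pow2 k) -->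
       T @ add (mul s (pow2 k)) r == zero --> T @ s == zero) -->
    (ALL n : o, EX s : o,
       le (pow2 n) s &&& lt s (pow2 (succ n)) &&& T @ s == zero) -->
    EX b : o ~> o, (ALL n : o, le (b @ n) one) &&&
      ALL n : o, T @ initseg b n == zero.

Definition stmt_a : bform :=
  WKL &&&
  ALL f : fn, usco inR f -->
    EX g : fn, cont inR g &&& ALL x in inR, rle (f @ x) (g @ x).

Definition stmt_b : bform :=
  ALL f : o ~> fn, (ALL n : o, usco inI (f @ n)) -->
    EX g : o ~> o, ALL n : o, ALL x in inI, rle (f @ n @ x) (rnat (g @ n)).

Definition stmt_c : bform :=
  ALL O : o ~> fn, (ALL n : o, isOpen (O @ n)) -->
    (ALL x in inR, EX n : o, mem x (O @ n)) -->
    EX g : o ~> o, ALL n : o, ALL x in inSym n, memUpTo x O (g @ n).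

Definition stmt_d : bform :=
  ALL O : o ~> o ~> fn, ALL C : o ~> fn,
    (ALL n : o, ALL m : o, isOpen (O @ n @ m)) -->
    (ALL n : o, isClosedI (C @ n)) -->
    (ALL n : o, ALL x in inR, memC x (C @ n) --> EX m : o, mem x (O @ n @ m)) -->
    EX g : o ~> o, ALL n : o, ALL x in inR,
      memC x (C @ n) --> memUpTo x (O @ n) (g @ n).

Definition OC00 : bform :=
  ALL O : o ~> fn, (ALL n : o, isOpen (O @ n)) -->
    (ALL n : o, ALL x in inR, mem x (O @ n) --> mem x (O @ succ n)) -->
    (ALL n : o, EX m : o, ALL x in inSym n, mem x (O @ m)) -->
    EX g : o ~> o, ALL n : o, ALL x in inSym n, mem x (O @ (g @ n)).

Definition stmt_e1 : bform :=
  ALL f : fn, usco inI f --> EX N : o, ALL x in inI, rle (f @ x) (rnat N).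

Definition stmt_e2 : bform :=
  ALL f : fn, lsco inI f --> (ALL x in inI, rlt (rnat zero) (f @ x)) -->
    EX N : o, ALL x in inI, rlt (rexp N) (f @ x).

Definition stmt_e3 : bform :=
  ALL O : o ~> fn, (ALL n : o, isOpen (O @ n)) -->
    (ALL x in inI, EX n : o, mem x (O @ n)) -->
    EX n0 : o, ALL x in inI, memUpTo x O n0.

Definition stmt_e4 : bform :=
  ALL C : o ~> fn, (ALL n : o, isClosedI (C @ n)) -->
    (ALL n : o, ALL x in inR, memC x (C @ succ n) --> memC x (C @ n)) -->
    (ALL n : o, EX x in inR, memC x (C @ n)) -->
    EX x in inR, ALL n : o, memC x (C @ n).

Definition stmt_e5 : bform :=
  ALL f : o ~> fn, ALL g : fn, (ALL n : o, lsco inI (f @ n)) -->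
    (ALL n : o, ALL x in inI, rle (f @ n @ x) (f @ succ n @ x)) -->
    usco inI g -->
    (ALL x in inI, EX n : o, rlt (g @ x) (f @ n @ x)) -->
    EX m : o, ALL x in inI, rlt (g @ x) (f @ m @ x).

Definition stmt_e6 : bform :=
  ALL C : fn, ALL O : o ~> fn, isClosedI C --> (ALL n : o, isOpen (O @ n)) -->
    (ALL x in inR, memC x C --> EX n : o, mem x (O @ n)) -->
    EX n0 : o, ALL x in inR, memC x C --> memUpTo x O n0.

Definition stmt_e7 : bform :=
  ALL f : fn, ALL y : rl, usco inI f --> isSup f y --> attains f y.

Definition stmt_e8 : bform :=
  ALL f : fn, ALL y : rl, usco inI f --> isSup f y --> atMostOneMax f y -->
    attains f y.

Definition equivalents : list bform :=
  [stmt_a; stmt_b; stmt_c; stmt_d;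
   OC00 &&& stmt_e1; OC00 &&& stmt_e2; OC00 &&& stmt_e3; OC00 &&& stmt_e4;
   OC00 &&& stmt_e5; OC00 &&& stmt_e6; OC00 &&& stmt_e7; OC00 &&& stmt_e8].

(* Main.v *)
(* By Henkin's completeness theorem it is enough to show that the statements have the same
   truth value in every extensional model of RCA_0^omega, so that the rest of the argument
   is classical mathematics about one such model, with its own natural numbers, rationals
   and reals; closure of the model under lambda abstraction takes the place of
   definability.

   Everything is compared with (c).  The key fact is that every open cover (O_n) of the line
   has a usco rank F and a positive lsco rank phi: if F x <= N, or phi x > 2^-N, then x lies
   in some O_m with m <= N.  If Kleene's quantifier E^2 exists in the model, the least m with
   x in O_m is a function of x and will do; otherwise every function on the reals is
   continuous by Grilliot's argument, and phi can be the supremum of min(2^-n, h_n^+), where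
   h_n represents O_n, and F = 1 / phi.  Boundedness principles for semicontinuous functions
   thus imply covering principles; the converses use the covers {f < m}, and OC^{0,0} or a
   cover of countably many disjoint translates supplies uniformity.

   Weak Koenig's lemma comes out of (e4) by means of binary expansions.  In (a) it bounds
   continuous functions on [0, 1] uniformly in a parameter: it yields points at which a given
   bound is exceeded if it is exceeded anywhere, and the values at these points decide
   whether it is; an unbounded function would bound the search for such points, and hence
   give arithmetical comprehension and a point of discontinuity. *)

(* The models need not be standard: [M o] may contain infinite numbers, and induction is available
   for quantifier-free formulas only. So each use of induction, minimization or choice has to come
   with a proof that its predicate is decidable ([Dec]), and each function with a proof that it is
   represented by a term ([Rep], [RepQ], [RepR]). Order and equality of reals are not decidable in
   the model. This is the obstacle behind the case distinction on E^2: an index of an open set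
   containing x can be found by search, but it depends on the Cauchy sequence x and not just on the
   real number.

   Real analysis takes place in one ordered field per model, built in the metatheory from Cauchy
   sequences indexed by the numbers of the model. It may be larger than the set [Mr] of values of
   the model's reals, to which quantifiers are therefore restricted. In exchange, estimates are
   ordinary linear arithmetic, and representatives appear only where a function of the model has to
   be produced. *)
Require Defs.
From Stdlib Require List Arith Lia Cantor Eqdep_dec Setoid Ring.
From Stdlib Require Classical ClassicalEpsilon FunctionalExtensionality PropExtensionality ProofIrrelevance.

(** * Henkin completeness for the many-sorted calculus *)

Module Completeness.
Import Defs List Arith Lia Classical ClassicalEpsilon FunctionalExtensionality PropExtensionality ProofIrrelevance.
Import ListNotations.
Local Open Scope ty_scope.

Lemma ty_eq_dec_refl (t : ty) : ty_eq_dec t t = left eq_refl.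
Proof.
  destruct (ty_eq_dec t t) as [e|e]; [|congruence].
  f_equal. apply Eqdep_dec.UIP_dec, ty_eq_dec.
Qed.

(** Generic in [D], so that the same lemmas serve substitutions, where [push] is convertible to
    [scons], and environments of a structure. *)
Definition push {D : ty -> Type} {t : ty} (a : D t) (r : forall s, nat -> D s) :
    forall s, nat -> D s :=
  fun s => match ty_eq_dec t s with
           | left e => fun n => match n with
                                | 0 => eq_rect t D a s e
                                | S m => r s m
                                end
           | right _ => r s
           end.

Lemma push_0 {D : ty -> Type} {t} (a : D t) r : push a r t 0 = a.
Proof. unfold push. rewrite ty_eq_dec_refl. reflexivity. Qed.

Lemma push_S {D : ty -> Type} {t} (a : D t) r n : push a r t (S n) = r t n.
Proof. unfold push. rewrite ty_eq_dec_refl. reflexivity. Qed.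

Lemma push_neq {D : ty -> Type} {t} (a : D t) r s n : t <> s -> push a r s n = r s n.
Proof. intros h. unfold push. destruct (ty_eq_dec t s); [congruence|reflexivity]. Qed.

Lemma env_ext {D : ty -> Type} (r r' : forall s, nat -> D s) :
  (forall s n, r s n = r' s n) -> r = r'.
Proof.
  intros h. apply functional_extensionality_dep; intros s.
  apply functional_extensionality; intros n. apply h.
Qed.

Lemma push_ext {D : ty -> Type} {t} (a : D t) r (r' : forall s, nat -> D s) :
  a = r' t 0 -> (forall n, r t n = r' t (S n)) ->
  (forall s n, t <> s -> r s n = r' s n) -> push a r = r'.
Proof.
  intros h0 hS hn. apply env_ext; intros s n.
  destruct (ty_eq_dec t s) as [<-|e].
  - destruct n; [rewrite push_0|rewrite push_S]; auto.
  - rewrite push_neq; auto.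
Qed.

Lemma scons_push {t} (u : term t) sg : scons u sg = push u sg.
Proof. reflexivity. Qed.

Lemma shift_by_same t n : shift_by t t n = Var t (S n).
Proof. unfold shift_by. destruct (ty_eq_dec t t); congruence. Qed.

Lemma shift_by_neq t s n : t <> s -> shift_by t s n = Var s n.
Proof. unfold shift_by. destruct (ty_eq_dec t s); congruence. Qed.

Definition comp (sg tau : substitution) : substitution :=
  fun s n => subst_term sg (tau s n).

Lemma subst_term_comp {t} (sg tau : substitution) (u : term t) :
  subst_term sg (subst_term tau u) = subst_term (comp sg tau) u.
Proof. induction u; simpl; try reflexivity. rewrite IHu1, IHu2. reflexivity. Qed.

Lemma subst_term_Var {t} (u : term t) : subst_term Var u = u.
Proof. induction u; simpl; congruence. Qed.

Lemma up_0 t sg : up t sg t 0 = Var t 0.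
Proof. unfold up. rewrite scons_push. apply push_0. Qed.

Lemma up_S t sg n : up t sg t (S n) = subst_term (shift_by t) (sg t n).
Proof. unfold up. rewrite scons_push, push_S. reflexivity. Qed.

Lemma up_neq t sg s n : t <> s -> up t sg s n = subst_term (shift_by t) (sg s n).
Proof. intros h. unfold up. rewrite scons_push, push_neq by assumption. reflexivity. Qed.

Lemma comp_up_shift t sg : comp (up t sg) (shift_by t) = comp (shift_by t) sg.
Proof.
  apply env_ext; intros s n. unfold comp.
  destruct (ty_eq_dec t s) as [<-|h].
  - rewrite shift_by_same. apply up_S.
  - rewrite shift_by_neq by assumption. apply up_neq; assumption.
Qed.

Lemma up_comp t sg tau : up t (comp sg tau) = comp (up t sg) (up t tau).
Proof.
  apply push_ext; unfold comp; intros.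
  - rewrite up_0. symmetry; apply up_0.
  - rewrite up_S, !subst_term_comp, comp_up_shift. reflexivity.
  - rewrite up_neq, !subst_term_comp, comp_up_shift by assumption. reflexivity.
Qed.

Lemma up_Var t : up t Var = Var.
Proof.
  apply push_ext; intros; simpl; auto using shift_by_same, shift_by_neq.
Qed.

Lemma subst_comp sg tau p : subst sg (subst tau p) = subst (comp sg tau) p.
Proof.
  revert sg tau; induction p; intros sg tau; simpl.
  - rewrite !subst_term_comp. reflexivity.
  - reflexivity.
  - rewrite IHp1, IHp2. reflexivity.
  - rewrite IHp, up_comp. reflexivity.
Qed.

Lemma subst_Var p : subst Var p = p.
Proof.
  induction p; simpl; rewrite ?subst_term_Var, ?up_Var; congruence.
Qed.

Lemma subst_inst {t} sg (u : term t) p :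
  subst sg (inst u p) = inst (subst_term sg u) (subst (up t sg) p).
Proof.
  unfold inst. rewrite !subst_comp. f_equal. rewrite !scons_push.
  symmetry. apply env_ext; intros s n. unfold comp.
  destruct (ty_eq_dec t s) as [<-|h]; [destruct n|].
  - rewrite up_0, push_0. simpl. apply push_0.
  - rewrite up_S, push_S, subst_term_comp. simpl.
    rewrite <- subst_term_Var. f_equal. apply env_ext; intros s k. unfold comp.
    destruct (ty_eq_dec t s) as [<-|h].
    + rewrite shift_by_same. apply (push_S (D := term)).
    + rewrite shift_by_neq by assumption. apply (push_neq (D := term)); assumption.
  - rewrite up_neq, push_neq, subst_term_comp by assumption. simpl.
    rewrite <- subst_term_Var. f_equal. apply env_ext; intros s' k. unfold comp.
    destruct (ty_eq_dec t s') as [<-|h'].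
    + rewrite shift_by_same. apply (push_S (D := term)).
    + rewrite shift_by_neq by assumption. apply (push_neq (D := term)); assumption.
Qed.

(** In the term model environments are substitutions. This turns a pushed environment into an
    instance, for the quantifier case of the truth lemma. *)
Lemma inst_up {t} (a : term t) sg p : inst a (subst (up t sg) p) = subst (push a sg) p.
Proof.
  unfold inst. rewrite subst_comp. f_equal. rewrite scons_push.
  symmetry. apply push_ext; unfold comp; intros.
  - rewrite up_0. symmetry. apply push_0.
  - rewrite up_S, subst_term_comp. symmetry.
    rewrite <- subst_term_Var. f_equal. apply env_ext; intros s k. unfold comp.
    destruct (ty_eq_dec t s) as [<-|h].
    + rewrite shift_by_same. apply (push_S (D := term)).
    + rewrite shift_by_neq by assumption. apply (push_neq (D := term)); assumption.
  - rewrite up_neq, subst_term_comp by assumption. symmetry.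
    rewrite <- subst_term_Var. f_equal. apply env_ext; intros s' k. unfold comp.
    destruct (ty_eq_dec t s') as [<-|h'].
    + rewrite shift_by_same. apply (push_S (D := term)).
    + rewrite shift_by_neq by assumption. apply (push_neq (D := term)); assumption.
Qed.

Lemma subst_shift t sg p : subst (up t sg) (shift t p) = shift t (subst sg p).
Proof. unfold shift. rewrite !subst_comp, comp_up_shift. reflexivity. Qed.

(** One bound serves the indices of all types, and [form_bound] does not lower it at a quantifier:
    to choose a fresh variable any upper bound on the free indices will do. *)
Fixpoint term_bound {t} (u : term t) : nat :=
  match u with
  | Var _ n => S n
  | App u v => max (term_bound u) (term_bound v)
  | _ => 0
  end.

Fixpoint form_bound (p : form) : nat :=
  match p with
  | FEq u v => max (term_bound u) (term_bound v)
  | FBot => 0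
  | FImp p q => max (form_bound p) (form_bound q)
  | FAll _ p => form_bound p
  end.

Definition agree (k : nat) (sg tau : substitution) :=
  forall s n, n < k -> sg s n = tau s n.

Lemma subst_term_agree {t} (u : term t) sg tau :
  agree (term_bound u) sg tau -> subst_term sg u = subst_term tau u.
Proof.
  induction u; simpl; intros h; try reflexivity.
  - apply h; lia.
  - rewrite IHu1, IHu2; [reflexivity| |]; intros s' n hn; apply h; lia.
Qed.

Lemma subst_agree p : forall sg tau,
  agree (form_bound p) sg tau -> subst sg p = subst tau p.
Proof.
  induction p; simpl; intros sg tau h; try reflexivity.
  - rewrite (subst_term_agree t sg tau), (subst_term_agree t0 sg tau);
      [reflexivity| |]; intros s' n hn; apply h; lia.
  - rewrite (IHp1 sg tau), (IHp2 sg tau); [reflexivity| |];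
      intros s' n hn; apply h; lia.
  - f_equal. apply IHp. intros s n hn.
    destruct (ty_eq_dec t s) as [<-|e]; [destruct n|].
    + rewrite !up_0; reflexivity.
    + rewrite !up_S, (h t n) by lia; reflexivity.
    + rewrite !up_neq, (h s n) by assumption; reflexivity.
Qed.

Section Derivations.
Variable Ax : form -> Prop.
Hypothesis Ax_subst : forall sg p, Ax p -> Ax (subst sg p).

Lemma prv_weak G p : prv Ax G p -> forall G', incl G G' -> prv Ax G' p.
Proof.
  induction 1; intros G' hG.
  - apply prv_ax; assumption.
  - apply prv_hyp; auto.
  - apply prv_impI, IHprv. intros x [<-|h]; simpl; auto.
  - apply prv_impE with p; auto.
  - apply prv_raa, IHprv. intros x [<-|h]; simpl; auto.
  - apply prv_allI, IHprv, incl_map; assumption.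
  - apply prv_allE; auto.
Qed.

Lemma prv_subst G p : prv Ax G p ->
  forall sg, prv Ax (map (subst sg) G) (subst sg p).
Proof.
  induction 1; intros sg; simpl.
  - apply prv_ax; auto.
  - apply prv_hyp, in_map; assumption.
  - apply prv_impI, (IHprv sg).
  - apply prv_impE with (subst sg p); [apply (IHprv1 sg)|auto].
  - apply prv_raa, (IHprv sg).
  - apply prv_allI. specialize (IHprv (up t sg)).
    rewrite map_map in IHprv. rewrite map_map.
    erewrite map_ext; [exact IHprv|]. intros a. symmetry; apply subst_shift.
  - rewrite subst_inst. apply prv_allE, (IHprv sg).
Qed.

(* Renames the free variable k of type t to the one bound by a new quantifier. *)
Definition unbind (t : ty) (k : nat) : substitution :=
  fun s n => if ty_eq_dec t s
             then if Nat.eq_dec n k then Var s 0 else Var s (S n)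
             else Var s n.

(** Above these bounds the index [k] is fresh, so [unbind] acts on the context as a shift and undoes
    the instantiation of [q]. *)
Lemma prv_generalize G t k q :
  (forall p, In p G -> form_bound p <= k) -> form_bound q <= k ->
  prv Ax G (inst (Var t k) q) -> prv Ax G (FAll t q).
Proof.
  intros hG hq h. apply prv_allI.
  assert (hs : forall p, form_bound p <= k -> subst (unbind t k) p = shift t p).
  { intros p hp. apply subst_agree. intros s n hn. unfold unbind, shift_by.
    destruct (ty_eq_dec t s); [|reflexivity].
    destruct (Nat.eq_dec n k); [lia|reflexivity]. }
  apply prv_subst with (sg := unbind t k) in h.
  replace (map (shift t) G) with (map (subst (unbind t k)) G)
    by (apply map_ext_in; auto).
  replace q with (subst (unbind t k) (inst (Var t k) q)) at 1; [exact h|].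
  unfold inst. rewrite subst_comp. rewrite <- subst_Var. apply subst_agree.
  intros s n hn. unfold comp. rewrite scons_push.
  destruct (ty_eq_dec t s) as [<-|e]; [destruct n|].
  - rewrite push_0. simpl. unfold unbind. rewrite ty_eq_dec_refl.
    destruct (Nat.eq_dec k k); congruence.
  - rewrite push_S. simpl. unfold unbind. rewrite ty_eq_dec_refl.
    destruct (Nat.eq_dec n k); [lia|reflexivity].
  - rewrite push_neq by assumption. simpl. unfold unbind.
    destruct (ty_eq_dec t s); [congruence|reflexivity].
Qed.

End Derivations.

(** Finite stages that exhaust the types, and after them the terms and the formulas. They lead to
    the enumeration [form_enum] along which the Henkin theory is built. *)
Fixpoint types_upto (n : nat) : list ty :=
  match n with
  | 0 => [o]
  | S n => types_upto n ++
      map (fun ab => arr (fst ab) (snd ab)) (list_prod (types_upto n) (types_upto n))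
  end.

Definition mk_app (x y : {t & term t}) : list {t & term t} :=
  match x, y with
  | existT _ (arr s t) u, existT _ s' v =>
      match ty_eq_dec s' s with
      | left e => [existT _ t (App u (eq_rect s' term v s e))]
      | right _ => []
      end
  | _, _ => []
  end.

Fixpoint terms_upto (n : nat) : list {t & term t} :=
  match n with
  | 0 => []
  | S n => terms_upto n
      ++ map (fun tk => existT _ (fst tk) (Var (fst tk) (snd tk)))
             (list_prod (types_upto n) (seq 0 n))
      ++ [existT _ _ Zero; existT _ _ Succ; existT _ _ Rec]
      ++ map (fun st => existT _ _ (@Kc (fst st) (snd st)))
             (list_prod (types_upto n) (types_upto n))
      ++ map (fun rst => existT _ _ (@Sc (fst rst) (fst (snd rst)) (snd (snd rst))))
             (list_prod (types_upto n) (list_prod (types_upto n) (types_upto n)))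
      ++ flat_map (fun xy => mk_app (fst xy) (snd xy))
             (list_prod (terms_upto n) (terms_upto n))
  end.

Definition mk_eq (x y : {t & term t}) : list form :=
  match x, y with
  | existT _ o u, existT _ o v => [FEq u v]
  | _, _ => []
  end.

Fixpoint forms_upto (n : nat) : list form :=
  match n with
  | 0 => [FBot]
  | S n => forms_upto n
      ++ flat_map (fun xy => mk_eq (fst xy) (snd xy))
             (list_prod (terms_upto n) (terms_upto n))
      ++ map (fun pq => FImp (fst pq) (snd pq)) (list_prod (forms_upto n) (forms_upto n))
      ++ map (fun tp => FAll (fst tp) (snd tp)) (list_prod (types_upto n) (forms_upto n))
  end.

Lemma upto_le {X} (f : nat -> list X) (hf : forall n x, In x (f n) -> In x (f (S n)))
  n m x : n <= m -> In x (f n) -> In x (f m).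
Proof. induction 1; auto. Qed.

Lemma types_upto_le n m x : n <= m -> In x (types_upto n) -> In x (types_upto m).
Proof. apply upto_le. intros; simpl; apply in_or_app; auto. Qed.

Lemma terms_upto_le n m x : n <= m -> In x (terms_upto n) -> In x (terms_upto m).
Proof. apply upto_le. intros; simpl; apply in_or_app; auto. Qed.

Lemma forms_upto_le n m x : n <= m -> In x (forms_upto n) -> In x (forms_upto m).
Proof. apply upto_le. intros; simpl; apply in_or_app; auto. Qed.

Lemma types_upto_all t : exists n, In t (types_upto n).
Proof.
  induction t as [|s [n hn] t [m hm]]; [exists 0; simpl; auto|].
  exists (S (max n m)). simpl. apply in_or_app; right.
  apply in_map_iff. exists (s, t). split; [reflexivity|].
  apply in_prod; [apply (types_upto_le n)|apply (types_upto_le m)]; auto; lia.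
Qed.

Lemma terms_upto_all {t} (u : term t) : exists n, In (existT _ t u) (terms_upto n).
Proof.
  induction u as [t k| | |s t|r s t| |s t u [n hn] v [m hm]].
  - destruct (types_upto_all t) as [n hn]. exists (S (max n (S k))). cbn [terms_upto].
    apply in_or_app; right; apply in_or_app; left. apply in_map_iff.
    exists (t, k). split; [reflexivity|]. apply in_prod.
    + apply (types_upto_le n); auto; lia.
    + apply in_seq; lia.
  - exists 1. simpl. auto.
  - exists 1. simpl. auto.
  - destruct (types_upto_all s) as [n hn], (types_upto_all t) as [m hm].
    exists (S (max n m)). cbn [terms_upto]. do 3 (apply in_or_app; right).
    apply in_or_app; left.
    apply in_map_iff. exists (s, t). split; [reflexivity|].
    apply in_prod; [apply (types_upto_le n)|apply (types_upto_le m)]; auto; lia.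
  - destruct (types_upto_all r) as [k hk], (types_upto_all s) as [n hn],
      (types_upto_all t) as [m hm].
    exists (S (max k (max n m))). cbn [terms_upto]. do 4 (apply in_or_app; right).
    apply in_or_app; left.
    apply in_map_iff. exists (r, (s, t)). split; [reflexivity|].
    apply in_prod; [apply (types_upto_le k); auto; lia|].
    apply in_prod; [apply (types_upto_le n)|apply (types_upto_le m)]; auto; lia.
  - exists 1. simpl. auto.
  - exists (S (max n m)). cbn [terms_upto]. do 5 (apply in_or_app; right).
    apply in_flat_map. exists (existT _ _ u, existT _ _ v). split.
    + apply in_prod; [apply (terms_upto_le n)|apply (terms_upto_le m)]; auto; lia.
    + simpl. rewrite ty_eq_dec_refl. simpl. auto.
Qed.

Lemma forms_upto_all p : exists n, In p (forms_upto n).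
Proof.
  induction p as [u v| |p [n hn] q [m hm]|t p [n hn]].
  - destruct (terms_upto_all u) as [n hn], (terms_upto_all v) as [m hm].
    exists (S (max n m)). simpl. apply in_or_app; right. apply in_or_app; left.
    apply in_flat_map. exists (existT _ _ u, existT _ _ v). split; [|simpl; auto].
    apply in_prod; [apply (terms_upto_le n)|apply (terms_upto_le m)]; auto; lia.
  - exists 0. simpl; auto.
  - exists (S (max n m)). simpl. do 2 (apply in_or_app; right).
    apply in_or_app; left. apply in_map_iff. exists (p, q). split; [reflexivity|].
    apply in_prod; [apply (forms_upto_le n)|apply (forms_upto_le m)]; auto; lia.
  - destruct (types_upto_all t) as [m hm].
    exists (S (max n m)). simpl. do 3 (apply in_or_app; right).
    apply in_map_iff. exists (t, p). split; [reflexivity|].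
    apply in_prod; [apply (types_upto_le m)|apply (forms_upto_le n)]; auto; lia.
Qed.

Definition form_enum (n : nat) : form :=
  nth (snd (Cantor.of_nat n)) (forms_upto (fst (Cantor.of_nat n))) FBot.

Lemma form_enum_surj p : exists n, form_enum n = p.
Proof.
  destruct (forms_upto_all p) as [n hn].
  destruct (In_nth _ _ FBot hn) as [k [_ hk]].
  exists (Cantor.to_nat (n, k)). unfold form_enum.
  rewrite Cantor.cancel_of_to. exact hk.
Qed.

Section Henkin.
Variable Ax : form -> Prop.
Hypothesis Ax_subst : forall sg p, Ax p -> Ax (subst sg p).

Definition con (G : list form) := ~ prv Ax G FBot.

Definition ctx_bound (G : list form) : nat := list_max (map form_bound G).

Lemma ctx_bound_le G p : In p G -> form_bound p <= ctx_bound G.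
Proof.
  intros h. unfold ctx_bound.
  pose proof (proj1 (list_max_le (map form_bound G) _) (le_n _)) as H.
  rewrite Forall_forall in H. apply H, in_map, h.
Qed.

(* Variables serve as Henkin constants: a finite context leaves almost all of them free. *)
Definition witness (G : list form) (p : form) : list form :=
  match p with
  | FImp (FAll t q) FBot => [FNeg (inst (Var t (ctx_bound (p :: G))) q)]
  | _ => []
  end.

Definition step (G : list form) (p : form) : list form :=
  if excluded_middle_informative (con (p :: G)) then witness G p ++ p :: G else G.

(** If the counterexample led to a contradiction, the fresh variable would satisfy [q]; generalizing
    it would refute the negated universal formula just added. *)
Lemma witness_con G p : con (p :: G) -> con (witness G p ++ p :: G).
Proof.
  intros h. destruct p as [| |[| | |t q] [| | |]|]; try exact h.
  intros hb. cbn [witness app] in hb. apply h.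
  change (FImp (FAll t q) FBot) with (FNeg (FAll t q)) in *.
  set (G' := FNeg (FAll t q) :: G) in *.
  apply prv_impE with (FAll t q); [apply prv_hyp; simpl; auto|].
  apply prv_generalize with (k := ctx_bound G'); auto.
  - intros p hp. apply ctx_bound_le, hp.
  - transitivity (form_bound (FNeg (FAll t q))).
    + simpl. lia.
    + apply ctx_bound_le. simpl; auto.
  - apply prv_raa. exact hb.
Qed.

Variable G0 : list form.
Hypothesis G0_con : con G0.

Fixpoint stage (n : nat) : list form :=
  match n with 0 => G0 | S n => step (stage n) (form_enum n) end.

Lemma stage_con n : con (stage n).
Proof.
  induction n as [|n IH]; simpl; [exact G0_con|]. unfold step.
  destruct excluded_middle_informative; [apply witness_con|]; assumption.
Qed.

Lemma stage_incl n m : n <= m -> incl (stage n) (stage m).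
Proof.
  induction 1 as [|m _ IH]; [apply incl_refl|]. intros p hp. simpl. unfold step.
  destruct excluded_middle_informative; [|auto].
  apply in_or_app; right; right; auto.
Qed.

Definition Th (p : form) := exists n, prv Ax (stage n) p.

Lemma Th_weak n m p : n <= m -> prv Ax (stage n) p -> prv Ax (stage m) p.
Proof. intros h hp. eapply prv_weak; [exact hp|apply stage_incl, h]. Qed.

Lemma Th_bot : ~ Th FBot.
Proof. intros [n h]. exact (stage_con n h). Qed.

Lemma Th_mp p q : Th (FImp p q) -> Th p -> Th q.
Proof.
  intros [n hn] [m hm]. exists (max n m). apply prv_impE with p.
  - apply (Th_weak n); auto; lia.
  - apply (Th_weak m); auto; lia.
Qed.

Lemma Th_lem p : Th p \/ Th (FNeg p).
Proof.
  destruct (form_enum_surj p) as [n <-].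
  destruct (classic (con (form_enum n :: stage n))) as [h|h].
  - left. exists (S n). apply prv_hyp. simpl. unfold step.
    destruct excluded_middle_informative; [|contradiction].
    apply in_or_app; right; simpl; auto.
  - right. exists n. apply prv_impI. apply NNPP. exact h.
Qed.

Lemma Th_neg p : Th (FNeg p) <-> ~ Th p.
Proof.
  split.
  - intros h h'. exact (Th_bot (Th_mp _ _ h h')).
  - intros h. destruct (Th_lem p); [contradiction|assumption].
Qed.

Lemma Th_imp p q : Th (FImp p q) <-> (Th p -> Th q).
Proof.
  split; [apply Th_mp|]. intros h. destruct (Th_lem p) as [hp|[n hn]].
  - destruct (h hp) as [n hn]. exists n. apply prv_impI.
    eapply prv_weak; [exact hn|]. intros x; simpl; auto.
  - exists n. apply prv_impI. apply prv_raa. apply prv_impE with p.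
    + eapply prv_weak; [exact hn|]. intros x; simpl; auto.
    + apply prv_hyp; simpl; auto.
Qed.

(** If the universal formula is not in the theory, its negation is consistent at the stage where it
    is enumerated, and enters together with a counterexample. *)
Lemma Th_all t q : Th (FAll t q) <-> forall u : term t, Th (inst u q).
Proof.
  split.
  - intros [n hn] u. exists n. apply prv_allE, hn.
  - intros h. apply NNPP. intros hn.
    destruct (form_enum_surj (FNeg (FAll t q))) as [n en].
    assert (hc : con (form_enum n :: stage n)).
    { intros hb. apply hn. exists n. apply prv_raa. rewrite <- en. exact hb. }
    set (k := ctx_bound (form_enum n :: stage n)).
    assert (hw : Th (FNeg (inst (Var t k) q))).
    { exists (S n). apply prv_hyp. simpl. unfold step.
      destruct excluded_middle_informative; [|contradiction].
      apply in_or_app; left. unfold k. rewrite en. simpl. auto. }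
    rewrite Th_neg in hw. apply hw, h.
Qed.

End Henkin.

(** Equality is an arbitrary relation, because the term model interprets an equation by its
    membership in the theory. It becomes identity in the quotient below. *)
Record structure := {
  Dom :> ty -> Type;
  ap : forall {s t}, Dom (s ~> t) -> Dom s -> Dom t;
  s_zero : Dom o;
  s_succ : Dom (o ~> o);
  s_K : forall s t, Dom (s ~> t ~> s);
  s_S : forall r s t, Dom ((r ~> s ~> t) ~> (r ~> s) ~> r ~> t);
  s_rec : Dom (o ~> o ~> (o ~> o ~> o) ~> o);
  s_eq : Dom o -> Dom o -> Prop
}.
Arguments ap {_ s t}.
Arguments s_K {_}.
Arguments s_S {_}.
Arguments s_eq {_}.

Section Satisfaction.
Variable A : structure.

Fixpoint eval (r : forall t, nat -> A t) {t} (u : term t) : A t :=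
  match u in term t return A t with
  | Var t n => r t n
  | Zero => s_zero A
  | Succ => s_succ A
  | @Kc s t => s_K s t
  | @Sc r s t => s_S r s t
  | Rec => s_rec A
  | App u v => ap (eval r u) (eval r v)
  end.

Fixpoint sat (r : forall t, nat -> A t) (p : form) : Prop :=
  match p with
  | FEq u v => s_eq (eval r u) (eval r v)
  | FBot => False
  | FImp p q => sat r p -> sat r q
  | FAll t p => forall a : A t, sat (push a r) p
  end.

End Satisfaction.
Arguments eval {A} r {t}.
Arguments sat {A}.

Lemma henkin_completeness (Ax : form -> Prop) (p : form) :
  (forall sg q, Ax q -> Ax (subst sg q)) ->
  (forall A : structure, (forall q r, Ax q -> sat (A := A) r q) ->
     forall r, sat (A := A) r p) ->
  prv Ax [] p.
Proof.
  intros hs hp. apply NNPP. intros hn.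
  assert (hc : con Ax [FNeg p]). { intros h. apply hn. apply prv_raa, h. }
  set (T := Th Ax [FNeg p]).
  (* The term model: its elements are terms with their free variables, its environments are
     substitutions, and evaluation is substitution. *)
  set (A := {| Dom := term; ap := @App; s_zero := Zero; s_succ := Succ;
               s_K := @Kc; s_S := @Sc; s_rec := Rec;
               s_eq := fun u v => T (FEq u v) |}).
  assert (he : forall r t (u : term t), eval (A := A) r u = subst_term r u).
  { intros r t u. induction u; simpl; try reflexivity. rewrite IHu1, IHu2. reflexivity. }
  assert (ht : forall q r, sat (A := A) r q <-> T (subst r q)).
  { induction q; intros r; simpl.
    - rewrite !he. reflexivity.
    - split; [contradiction|]. apply Th_bot; auto.
    - rewrite IHq1, IHq2. symmetry. apply Th_imp; auto.
    - unfold T. rewrite Th_all by auto. split; intros h a; specialize (h a).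
      + rewrite inst_up. apply IHq, h.
      + rewrite inst_up in h. apply IHq, h. }
  assert (hm : sat (A := A) Var p).
  { apply hp. intros q r hq. apply ht. exists 0. apply prv_ax, hs, hq. }
  apply ht in hm. rewrite subst_Var in hm.
  eapply Th_neg; [auto..| |exact hm]; auto.
  exists 0. apply prv_hyp. simpl; auto.
Qed.

End Completeness.

(** * Evaluation of higher-order syntax, and extensional models of the theory *)

Module Semantics.
Import Defs Completeness List Arith Lia Classical ClassicalEpsilon FunctionalExtensionality PropExtensionality ProofIrrelevance.
Import ListNotations.
Local Open Scope ty_scope.

Definition depth_le (d d' : depth) := forall s, d s <= d' s.

Lemma depth_le_under t d : depth_le d (under t d).
Proof. intros s. unfold under. destruct ty_eq_dec; lia. Qed.

Lemma under_same t d : under t d t = S (d t).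
Proof. unfold under. rewrite ty_eq_dec_refl. reflexivity. Qed.

Lemma under_neq t d s : t <> s -> under t d s = d s.
Proof. intros h. unfold under. destruct ty_eq_dec; [congruence|reflexivity]. Qed.

Definition fixes (sg : substitution) (d : depth) :=
  forall s n, n < d s -> sg s n = Var s n.

(** All deeper scopes [d'] are considered, since under a binder the same expression is used at a
    greater depth. *)
Definition closed_term {t} (u : bterm t) (d : depth) :=
  forall d' sg, depth_le d d' -> fixes sg d' -> subst_term sg (u d') = u d'.

Definition closed_form (p : bform) (d : depth) :=
  forall d' sg, depth_le d d' -> fixes sg d' -> subst sg (p d') = p d'.

Lemma closed_term_mono {t} (u : bterm t) d d' :
  depth_le d d' -> closed_term u d -> closed_term u d'.
Proof. intros h hu d'' sg h' hs. apply hu; auto. intros s. etransitivity; auto. Qed.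

Lemma fixes_up t sg d : fixes sg d -> fixes (up t sg) (under t d).
Proof.
  intros h s n hn. destruct (ty_eq_dec t s) as [<-|e]; [destruct n|].
  - apply up_0.
  - rewrite up_S, h; [apply shift_by_same|]. rewrite under_same in hn. lia.
  - rewrite up_neq, h by (rewrite ?under_neq in hn; auto). apply shift_by_neq, e.
Qed.

Lemma closed_app {s t} (u : bterm (s ~> t)) v d :
  closed_term u d -> closed_term v d -> closed_term (u @ v) d.
Proof. intros hu hv d' sg h hs. unfold app. simpl. rewrite hu, hv; auto. Qed.

Lemma closed_eqn u v d : closed_term u d -> closed_term v d -> closed_form (u == v) d.
Proof. intros hu hv d' sg h hs. unfold Eqn. simpl. rewrite hu, hv; auto. Qed.

Lemma closed_imp p q d : closed_form p d -> closed_form q d -> closed_form (p --> q) d.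
Proof. intros hu hv d' sg h hs. unfold Imp. simpl. rewrite hu, hv; auto. Qed.

Lemma closed_bot d : closed_form Bot d.
Proof. intros d' sg h hs. reflexivity. Qed.

Lemma closed_all {t} (p : bterm t -> bform) d :
  (forall d' x, depth_le d d' -> closed_term x d' -> closed_form (p x) d') ->
  closed_form (All p) d.
Proof.
  intros hp d' sg h hs. unfold All. simpl. f_equal.
  apply (hp (under t d')); [| |intros s; lia|apply fixes_up, hs].
  - intros s. etransitivity; [apply h|apply depth_le_under].
  - intros d'' tau h' ht. simpl. apply ht. specialize (h' t).
    rewrite under_same in h'. lia.
Qed.

Lemma closed_eqt t : forall u v d,
  closed_term u d -> closed_term v d -> closed_form (eqt t u v) d.
Proof.
  induction t as [|s _ t IH]; intros u v d hu hv; simpl.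
  - apply closed_eqn; assumption.
  - apply closed_all. intros d' x h hx.
    apply IH; apply closed_app; eauto using closed_term_mono.
Qed.

Lemma closed_const {t} (c : term t) d : (forall sg, subst_term sg c = c) ->
  closed_term (fun _ => c) d.
Proof. intros h d' sg _ _. apply h. Qed.

Lemma subst_close sg p : closed_form p (fun _ => 0) -> subst sg (close p) = close p.
Proof. intros h. apply h; intros s; [lia|]. intros n hn; lia. Qed.

Lemma qf_subst A sg : qf A -> qf (subst sg A).
Proof. induction 1; simpl; constructor; auto. Qed.

(** Indices are counted separately for each type, so binders over different types do not interact.
    The scheme of choice has binders over three types. *)
Lemma up_swap s t sg : s <> t -> up s (up t sg) = up t (up s sg).
Proof.
  intros h.
  assert (hc : forall r (u : term r), subst_term (shift_by s) (subst_term (shift_by t) u)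
     = subst_term (shift_by t) (subst_term (shift_by s) u)).
  { intros r u. rewrite !subst_term_comp. f_equal. apply env_ext. intros q n. unfold comp.
    destruct (ty_eq_dec s q) as [<-|h1]; [|destruct (ty_eq_dec t q) as [<-|h2]].
    - rewrite (shift_by_neq t), !shift_by_same by congruence. simpl.
      rewrite shift_by_same, shift_by_neq by congruence. reflexivity.
    - rewrite (shift_by_neq s), !shift_by_same by congruence. simpl.
      rewrite shift_by_same, shift_by_neq by congruence. reflexivity.
    - rewrite (shift_by_neq s), (shift_by_neq t) by congruence. simpl.
      rewrite !shift_by_neq by congruence. reflexivity. }
  apply env_ext. intros r n.
  destruct (ty_eq_dec s r) as [<-|h1]; [|destruct (ty_eq_dec t r) as [<-|h2]].
  - rewrite (up_neq t) by congruence. destruct n.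
    + rewrite !up_0. simpl. symmetry. apply shift_by_neq. congruence.
    + rewrite !up_S, up_neq by congruence. apply hc.
  - rewrite (up_neq s) by congruence. destruct n.
    + rewrite !up_0. simpl. apply shift_by_neq. congruence.
    + rewrite !up_S, up_neq by congruence. apply hc.
  - rewrite !up_neq by congruence. apply hc.
Qed.

(** Only the formula [A] of the two schemes can bring free variables into an axiom, and there
    substitution produces the instance of the scheme for a substituted [A]. *)
Lemma RCA0w_subst sg p : RCA0w p -> RCA0w (subst sg p).
Proof.
  intros h. destruct h.
  1-9: rewrite subst_close; [constructor|];
    repeat first [apply closed_all; intros | apply closed_imp
      | apply closed_bot | apply closed_eqt | apply closed_eqn | apply closed_app
      | assumption | (apply closed_const; reflexivity)
      | (eapply closed_term_mono; [|eassumption]; first [assumption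
          | intros ?; etransitivity; eauto | intros ?; do 2 (etransitivity; eauto)])].
  - assert (e : subst sg (FImp (inst Zero A)
        (FImp (FAll o (FImp A (subst (scons (App Succ (Var o 0)) (shift_by o)) A)))
           (FAll o A))) =
      let A' := subst (up o sg) A in FImp (inst Zero A')
        (FImp (FAll o (FImp A' (subst (scons (App Succ (Var o 0)) (shift_by o)) A')))
           (FAll o A'))); [|rewrite e; apply ax_ind, qf_subst, H].
    simpl. rewrite subst_inst, !subst_comp. do 5 f_equal.
    symmetry. rewrite scons_push. apply env_ext; intros s n; unfold comp.
    destruct (ty_eq_dec o s) as [<-|hs]; [destruct n|].
    + rewrite up_0, push_0. simpl. rewrite push_0, up_0. reflexivity.
    + rewrite up_S, push_S, subst_term_comp, shift_by_same. simpl. rewrite up_S.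
      f_equal. apply env_ext; intros q k; unfold comp.
      destruct (ty_eq_dec o q) as [<-|hq].
      * rewrite shift_by_same. simpl. rewrite push_S. apply shift_by_same.
      * rewrite shift_by_neq by assumption. simpl.
        rewrite push_neq by assumption. apply shift_by_neq, hq.
    + rewrite up_neq, push_neq, subst_term_comp, shift_by_neq by assumption. simpl.
      rewrite up_neq by assumption.
      f_equal. apply env_ext; intros q k; unfold comp.
      destruct (ty_eq_dec o q) as [<-|hq].
      * rewrite shift_by_same. simpl. rewrite push_S. apply shift_by_same.
      * rewrite shift_by_neq by assumption. simpl.
        rewrite push_neq by assumption. apply shift_by_neq, hq.
  - assert (e : subst sg (FImp (FAll (o ~> o) (FEx o A))
        (FEx ((o ~> o) ~> o) (FAll (o ~> o)
          (inst (App (Var ((o ~> o) ~> o) 0) (Var (o ~> o) 0))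
            (shift ((o ~> o) ~> o) A))))) =
      let A' := subst (up o (up (o ~> o) sg)) A in
      FImp (FAll (o ~> o) (FEx o A'))
        (FEx ((o ~> o) ~> o) (FAll (o ~> o)
          (inst (App (Var ((o ~> o) ~> o) 0) (Var (o ~> o) 0))
            (shift ((o ~> o) ~> o) A')))));
      [|rewrite e; apply ax_qfac, qf_subst, H].
    simpl. do 6 f_equal. rewrite subst_inst, <- subst_shift.
    rewrite (up_swap ((o ~> o) ~> o) o), (up_swap ((o ~> o) ~> o) (o ~> o)) by congruence.
    reflexivity.
Qed.

Section Evaluation.
Variable A : structure.

(** A scope with values for its variables: the depth is what an expression of the higher-order
    syntax waits for, the environment gives the values by index. *)
Record world := World { w_env : forall t, nat -> A t; w_depth : depth }.

(** [w'] lies under further binders: an index of [w] is raised by the number of new binders over its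
    type. *)
Definition w_le (w w' : world) :=
  depth_le (w_depth w) (w_depth w') /\
  forall s n, w_env w' s (n + (w_depth w' s - w_depth w s)) = w_env w s n.

Definition w_push {t} (a : A t) (w : world) : world :=
  World (push a (w_env w)) (under t (w_depth w)).

(* [u] denotes the element [a] in every scope extending [w]. *)
Definition ev {t} (u : bterm t) (w : world) (a : A t) :=
  forall w', w_le w w' -> eval (w_env w') (u (w_depth w')) = a.

Definition fev (p : bform) (w : world) (P : Prop) :=
  forall w', w_le w w' -> (sat (w_env w') (p (w_depth w')) <-> P).

Lemma w_le_refl w : w_le w w.
Proof. split; [intros s; lia|]. intros s n. f_equal. lia. Qed.

Lemma w_le_trans w1 w2 w3 : w_le w1 w2 -> w_le w2 w3 -> w_le w1 w3.
Proof.
  intros [h1 e1] [h2 e2]. split.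
  - intros s. etransitivity; auto.
  - intros s n. specialize (h1 s). specialize (h2 s).
    rewrite <- e1, <- e2. f_equal. lia.
Qed.

Lemma w_le_push {t} (a : A t) w : w_le w (w_push a w).
Proof.
  split; [apply depth_le_under|]. intros s n. simpl.
  destruct (ty_eq_dec t s) as [<-|h].
  - rewrite under_same. replace (n + _) with (S n) by lia. apply push_S.
  - rewrite under_neq, push_neq by assumption. f_equal. lia.
Qed.

Lemma ev_mono {t} (u : bterm t) w w' a : w_le w w' -> ev u w a -> ev u w' a.
Proof. intros h hu w'' h'. apply hu. eapply w_le_trans; eassumption. Qed.

Lemma ev_const {t} (c : term t) a w : (forall r, eval r c = a) -> ev (fun _ => c) w a.
Proof. intros h w' _. apply h. Qed.

Lemma ev_app {s t} (u : bterm (s ~> t)) v w f a :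
  ev u w f -> ev v w a -> ev (u @ v) w (ap f a).
Proof. intros hu hv w' h. unfold app. simpl. rewrite hu, hv; auto. Qed.

Lemma ev_bvar {t} (a : A t) w : ev (bvar t (w_depth w)) (w_push a w) a.
Proof.
  intros w' [h e]. unfold bvar. simpl.
  specialize (e t 0). simpl in e. rewrite under_same, push_0 in e. exact e.
Qed.

Lemma fev_eqn u v w a b : ev u w a -> ev v w b -> fev (u == v) w (s_eq a b).
Proof. intros hu hv w' h. unfold Eqn. simpl. rewrite hu, hv; tauto. Qed.

Lemma fev_bot w : fev Bot w False.
Proof. intros w' _. simpl. tauto. Qed.

Lemma fev_imp p q w P Q : fev p w P -> fev q w Q -> fev (p --> q) w (P -> Q).
Proof. intros hp hq w' h. specialize (hp w' h). specialize (hq w' h). simpl. tauto. Qed.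

Lemma fev_neg p w P : fev p w P -> fev (~~ p) w (~ P).
Proof. intros hp. apply fev_imp; [exact hp|apply fev_bot]. Qed.

Lemma fev_iff p w P Q : (P <-> Q) -> fev p w P -> fev p w Q.
Proof. intros e h w' h'. rewrite <- e. auto. Qed.

Lemma fev_and p q w P Q : fev p w P -> fev q w Q -> fev (p &&& q) w (P /\ Q).
Proof.
  intros hp hq. eapply fev_iff; [|apply fev_neg, fev_imp; [exact hp|apply fev_neg, hq]].
  destruct (classic P), (classic Q); tauto.
Qed.

Lemma fev_or p q w P Q : fev p w P -> fev q w Q -> fev (p ||| q) w (P \/ Q).
Proof.
  intros hp hq. eapply fev_iff; [|apply fev_imp; [apply fev_neg, hp|exact hq]].
  destruct (classic P), (classic Q); tauto.
Qed.

Lemma fev_all {t} (p : bterm t -> bform) w (P : A t -> Prop) :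
  (forall w' x a, w_le w w' -> ev x w' a -> fev (p x) w' (P a)) ->
  fev (All p) w (forall a, P a).
Proof.
  intros hp w' h. unfold All. simpl.
  assert (e : forall a, sat (push a (w_env w'))
      (p (bvar t (w_depth w')) (under t (w_depth w'))) <-> P a).
  { intros a. refine (hp (w_push a w') (bvar t (w_depth w')) a _ _ (w_push a w') _).
    - eapply w_le_trans; [exact h|apply w_le_push].
    - apply ev_bvar.
    - apply w_le_refl. }
  split; intros H a; apply e, H.
Qed.

Lemma fev_ex {t} (p : bterm t -> bform) w (P : A t -> Prop) :
  (forall w' x a, w_le w w' -> ev x w' a -> fev (p x) w' (P a)) ->
  fev (Ex p) w (exists a, P a).
Proof.
  intros hp. unfold Ex. eapply fev_iff; [|apply fev_neg, (fev_all _ _ (fun a => ~ P a))].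
  - split; [intros h; apply NNPP|]; firstorder.
  - intros. apply fev_neg; auto.
Qed.

Fixpoint ext_eq (t : ty) : A t -> A t -> Prop :=
  match t with
  | o => s_eq
  | s ~> t => fun f g => forall x, ext_eq t (ap f x) (ap g x)
  end.

Lemma fev_eqt t : forall u v w a b,
  ev u w a -> ev v w b -> fev (eqt t u v) w (ext_eq t a b).
Proof.
  induction t as [|s _ t IH]; intros u v w a b hu hv; simpl.
  - apply fev_eqn; assumption.
  - apply (fev_all _ _ (fun x => ext_eq t (ap a x) (ap b x))).
    intros w' x c h hx. apply IH; apply ev_app; eauto using ev_mono.
Qed.

Lemma fev_close p r P : fev p (World r (fun _ => 0)) P -> (sat r (close p) <-> P).
Proof. intros h. apply (h _ (w_le_refl _)). Qed.

End Evaluation.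
Arguments World {A}.
Arguments ev {A t}.
Arguments fev {A}.
Arguments ext_eq {A}.

Ltac ev_up h :=
  repeat match goal with
  | H : ev _ ?w _ |- _ =>
    match type of h with w_le _ w ?w' => apply (ev_mono _ _ _ _ _ h) in H end
  end; clear h.

Definition base (A : structure) (r : forall t, nat -> A t) : world A :=
  World r (fun _ => 0).

Lemma eval_subst A r {t} (u : term t) sg :
  eval (A := A) r (subst_term sg u) = eval (fun s n => eval r (sg s n)) u.
Proof. induction u; simpl; try reflexivity. rewrite IHu1, IHu2. reflexivity. Qed.

Lemma sat_subst A p : forall r sg,
  sat (A := A) r (subst sg p) <-> sat (fun s n => eval r (sg s n)) p.
Proof.
  induction p; intros r sg; simpl.
  - rewrite !eval_subst. reflexivity.
  - reflexivity.
  - rewrite IHp1, IHp2. reflexivity.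
  - assert (e : forall a : A t, (fun s n => eval (push a r) (up t sg s n))
        = push a (fun s n => eval r (sg s n))).
    { intros a. symmetry. apply push_ext; intros.
      - rewrite up_0. simpl. symmetry; apply push_0.
      - rewrite up_S, eval_subst. f_equal. apply env_ext. intros s k.
        destruct (ty_eq_dec t s) as [<-|h].
        + rewrite shift_by_same. symmetry. apply push_S.
        + rewrite shift_by_neq by assumption. symmetry. apply push_neq, h.
      - rewrite up_neq, eval_subst by assumption. f_equal. apply env_ext. intros s' k.
        destruct (ty_eq_dec t s') as [<-|h'].
        + rewrite shift_by_same. symmetry. apply push_S.
        + rewrite shift_by_neq by assumption. symmetry. apply push_neq, h'. }
    split; intros h a; specialize (h a); [rewrite IHp, e in h|rewrite IHp, e]; exact h.
Qed.

(** Induction is asked for a disjunction of two equations: dichotomies such as [zero_or_succ] and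
    [sub_total] have to be proved by induction before there is arithmetic enough to code a decidable
    formula by a single equation. *)
Record model := {
  M_str :> structure;
  M_eq : forall a b : M_str o, s_eq a b <-> a = b;
  M_ext : forall s t (f g : M_str (s ~> t)), (forall x, ap f x = ap g x) -> f = g;
  M_K : forall s t (a : M_str s) (b : M_str t), ap (ap (s_K s t) a) b = a;
  M_S : forall r s t (a : M_str (r ~> s ~> t)) (b : M_str (r ~> s)) (c : M_str r),
    ap (ap (ap (s_S r s t) a) b) c = ap (ap a c) (ap b c);
  M_rec0 : forall a f, ap (ap (ap (s_rec M_str) (s_zero M_str)) a) f = a;
  M_recS : forall n a f, ap (ap (ap (s_rec M_str) (ap (s_succ M_str) n)) a) f
    = ap (ap f (ap (ap (ap (s_rec M_str) n) a) f)) n;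
  M_succ_nz : forall n, ap (s_succ M_str) n <> s_zero M_str;
  M_succ_inj : forall m n, ap (s_succ M_str) m = ap (s_succ M_str) n -> m = n;
  M_ind : forall F G H K : M_str (o ~> o),
    let P n := ap F n = ap G n \/ ap H n = ap K n in
    P (s_zero M_str) -> (forall n, P n -> P (ap (s_succ M_str) n)) -> forall n, P n;
  M_qfac : forall F : M_str ((o ~> o) ~> o ~> o),
    (forall x, exists n, ap (ap F x) n = s_zero M_str) ->
    exists Y, forall x, ap (ap F x) (ap Y x) = s_zero M_str
}.

Section Quotient.
Variable A : structure.
Hypothesis A_ax : forall q r, RCA0w q -> sat (A := A) r q.

Fixpoint dflt (t : ty) : A t :=
  match t with o => s_zero A | s ~> t => ap (s_K t s) (dflt t) end.

Let r0 : forall t, nat -> A t := fun t _ => dflt t.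

Lemma A_sem p P : RCA0w (close p) -> fev p (base A r0) P -> P.
Proof. intros h e. apply (fev_close _ _ _ _ e), A_ax, h. Qed.

Ltac sem_ax :=
  repeat first
    [ assumption
    | apply fev_all; let h := fresh in intros ? ? ? h ?; ev_up h; cbn beta
    | apply fev_neg | apply fev_imp | apply fev_bot | apply fev_eqt | apply fev_eqn
    | apply ev_app | (apply ev_const; reflexivity) ].

Lemma eq0_refl a : @s_eq A a a.
Proof. revert a. eapply A_sem; [apply ax_refl|]. sem_ax. Qed.

Lemma eq0_eucl a b c : @s_eq A a b -> s_eq a c -> s_eq b c.
Proof. revert a b c. eapply A_sem; [apply ax_eucl|]. sem_ax. Qed.

Lemma ext_eq_refl t a : ext_eq (A := A) t a a.
Proof. induction t; simpl; auto using eq0_refl. Qed.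

Lemma ext_eq_eucl t a b c : ext_eq (A := A) t a b -> ext_eq t a c -> ext_eq t b c.
Proof. induction t; simpl; [apply eq0_eucl|]. intros h h' x. eauto. Qed.

Lemma ext_eq_sym t a b : ext_eq (A := A) t a b -> ext_eq t b a.
Proof. intros h. eapply ext_eq_eucl; [exact h|apply ext_eq_refl]. Qed.

Lemma ext_eq_trans t a b c : ext_eq (A := A) t a b -> ext_eq t b c -> ext_eq t a c.
Proof. intros h. apply ext_eq_eucl, ext_eq_sym, h. Qed.

Lemma ext_eq_ap s t (f g : A (s ~> t)) a b :
  ext_eq _ f g -> ext_eq _ a b -> ext_eq _ (ap f a) (ap g b).
Proof.
  intros hf ha. eapply ext_eq_trans; [|apply hf].
  clear hf. revert f a b ha. eapply A_sem; [apply (ax_ext s t)|]. sem_ax.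
Qed.

(** The quotient by extensional equality is realized by canonical representatives: [epsilon] picks
    the same element from equal classes. *)
Definition can t (a : A t) : A t := epsilon (inhabits a) (ext_eq t a).

Lemma can_spec t a : ext_eq t a (can t a).
Proof. apply (epsilon_spec (inhabits a) (ext_eq t a)). exists a. apply ext_eq_refl. Qed.

Lemma can_eq t a b : ext_eq t a b -> can t a = can t b.
Proof.
  intros h. unfold can. f_equal; [apply proof_irrelevance|].
  apply functional_extensionality. intros c. apply propositional_extensionality.
  split; apply ext_eq_eucl; [exact h|apply ext_eq_sym, h].
Qed.

Definition quo t : Type := {a : A t | can t a = a}.
Definition rep t (a : quo t) : A t := proj1_sig a.
Definition cls t (a : A t) : quo t :=
  exist _ (can t a) (eq_sym (can_eq _ _ _ (can_spec t a))).

Lemma quo_eq t (a b : quo t) : rep t a = rep t b -> a = b.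
Proof.
  destruct a as [a ha], b as [b hb]. simpl. intros <-.
  f_equal. apply proof_irrelevance.
Qed.

Lemma cls_eq t a b : cls t a = cls t b <-> ext_eq t a b.
Proof.
  split.
  - intros h. apply (f_equal (rep t)) in h. simpl in h.
    eapply ext_eq_trans; [apply can_spec|]. rewrite h. apply ext_eq_sym, can_spec.
  - intros h. apply quo_eq, can_eq, h.
Qed.

Lemma cls_rep t a : cls t (rep t a) = a.
Proof. apply quo_eq. simpl. exact (proj2_sig a). Qed.

Definition Q_str : structure := {|
  Dom := quo;
  ap s t f a := cls t (ap (rep _ f) (rep _ a));
  s_zero := cls o (s_zero A);
  s_succ := cls _ (s_succ A);
  s_K s t := cls _ (s_K s t);
  s_S r s t := cls _ (s_S r s t);
  s_rec := cls _ (s_rec A);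
  s_eq := fun a b => a = b |}.

Lemma cls_ap s t (f : A (s ~> t)) a :
  @ap Q_str s t (cls _ f) (cls _ a) = cls _ (ap f a).
Proof. simpl. apply cls_eq, ext_eq_ap; apply ext_eq_sym, can_spec. Qed.

Lemma cls_eval r t (u : term t) :
  eval (A := Q_str) (fun s n => cls s (r s n)) u = cls t (eval r u).
Proof.
  induction u; try reflexivity. cbn [eval]. rewrite IHu1, IHu2. apply cls_ap.
Qed.

Lemma cls_sat p : forall r, sat (A := Q_str) (fun s n => cls s (r s n)) p <-> sat r p.
Proof.
  induction p; intros r; simpl.
  - rewrite !cls_eval. apply cls_eq.
  - reflexivity.
  - rewrite IHp1, IHp2. reflexivity.
  - assert (e : forall a, push (cls t a) (fun s n => cls s (r s n))
        = fun s n => cls s (push a r s n)).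
    { intros a. apply (push_ext (D := quo)); intros.
      - f_equal. symmetry; apply push_0.
      - f_equal. symmetry; apply push_S.
      - f_equal. symmetry; apply push_neq; assumption. }
    split; intros h a.
    + apply IHp. rewrite <- e. apply h.
    + rewrite <- (cls_rep t a), e. apply IHp, h.
Qed.

Lemma Q_ax q r : RCA0w q -> sat (A := Q_str) r q.
Proof.
  intros h. replace r with (fun s n => cls s (rep s (r s n))).
  - apply cls_sat, A_ax, h.
  - apply env_ext. intros. apply cls_rep.
Qed.

End Quotient.

Section QuotientModel.
Variable A : structure.
Hypothesis A_ax : forall q r, RCA0w q -> sat (A := A) r q.

Let Q := Q_str A A_ax.
Let rq : forall t, nat -> Q t := fun t _ => cls A A_ax t (dflt A t).

Lemma Q_sem p P : RCA0w (close p) -> fev p (base Q rq) P -> P.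
Proof. intros h e. apply (fev_close _ _ _ _ e), Q_ax, h. Qed.

Lemma Q_ext s t (f g : Q (s ~> t)) : (forall x, ap f x = ap g x) -> f = g.
Proof.
  intros h. rewrite <- (cls_rep A A_ax _ f), <- (cls_rep A A_ax _ g) in *.
  apply cls_eq. intros x. apply (cls_eq A A_ax).
  rewrite <- !cls_ap. apply h.
Qed.

Lemma Q_ext_eq t (a b : Q t) : ext_eq t a b <-> a = b.
Proof.
  revert a b; induction t as [|s _ t IH]; simpl; intros a b; [reflexivity|].
  split; [|intros <- x; apply IH; reflexivity].
  intros h. apply Q_ext. intros x. apply IH, h.
Qed.

Ltac Q_ax_sem ax :=
  eapply Q_sem; [apply ax|]; repeat first
    [ assumption
    | apply fev_all; let h := fresh in intros ? ? ? h ?; ev_up h; cbn beta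
    | apply fev_neg | apply fev_imp | apply fev_bot
    | eapply fev_iff; [apply Q_ext_eq|apply fev_eqt] | apply (fev_eqn Q)
    | apply ev_app | (apply ev_const; reflexivity) ].

Lemma Q_K s t (a : Q s) (b : Q t) : ap (ap (s_K s t) a) b = a.
Proof. revert a b. Q_ax_sem ax_K. Qed.

Lemma Q_S r s t (a : Q (r ~> s ~> t)) (b : Q (r ~> s)) (c : Q r) :
  ap (ap (ap (s_S r s t) a) b) c = ap (ap a c) (ap b c).
Proof. revert a b c. Q_ax_sem ax_S. Qed.

Lemma Q_rec0 a (f : Q (o ~> o ~> o)) :
  ap (ap (ap (s_rec Q) (s_zero Q)) a) f = a.
Proof. revert a f. Q_ax_sem ax_rec0. Qed.

Lemma Q_recS n a (f : Q (o ~> o ~> o)) : ap (ap (ap (s_rec Q) (ap (s_succ Q) n)) a) f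
    = ap (ap f (ap (ap (ap (s_rec Q) n) a) f)) n.
Proof. revert n a f. Q_ax_sem ax_recS. Qed.

Lemma Q_succ_nz n : ap (s_succ Q) n <> s_zero Q.
Proof. revert n. Q_ax_sem ax_succ_nz. Qed.

Lemma Q_succ_inj m n : ap (s_succ Q) m = ap (s_succ Q) n -> m = n.
Proof. revert m n. Q_ax_sem ax_succ_inj. Qed.

Lemma Q_ind (F G H K : Q (o ~> o)) :
  let P n := ap F n = ap G n \/ ap H n = ap K n in
  P (s_zero Q) -> (forall n, P n -> P (ap (s_succ Q) n)) -> forall n, P n.
Proof.
  intros P. set (v i := App (Var (o ~> o) i) (Var o 0)).
  (* The disjunction of the two equations as a quantifier-free formula, in its classical form. *)
  set (B := FImp (FNeg (FEq (v 0) (v 1))) (FEq (v 2) (v 3))).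
  assert (hB : qf B) by repeat constructor.
  pose proof (Q_ax A A_ax _ (push F (push G (push H (push K rq)))) (ax_ind B hB)) as h.
  assert (e : forall n, sat (A := Q) (push n (push F (push G (push H (push K rq))))) B
      <-> P n).
  { intros n. unfold P. simpl. split; [|tauto].
    intros h1. destruct (classic (ap F n = ap G n)); [left|right; apply h1]; assumption. }
  intros h0 hS n. apply e. revert n. apply h.
  - apply sat_subst. apply (proj2 (e _) h0).
  - intros n hn. apply sat_subst. apply e in hn. apply hS, e in hn. exact hn.
Qed.

Lemma Q_qfac (F : Q ((o ~> o) ~> o ~> o)) :
  (forall x, exists n, ap (ap F x) n = s_zero Q) ->
  exists Y, forall x, ap (ap F x) (ap Y x) = s_zero Q.
Proof.
  set (B := FEq (App (App (Var ((o ~> o) ~> o ~> o) 0) (Var (o ~> o) 0)) (Var o 0)) Zero).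
  assert (hB : qf B) by constructor.
  pose proof (Q_ax A A_ax _ (push F rq) (ax_qfac B hB)) as H.
  intros h. apply NNPP. intros hn. apply H.
  - intros x hx. destruct (h x) as [n en]. apply (hx n). exact en.
  - intros Y hY. apply hn. exists Y. intros x. specialize (hY x).
    apply sat_subst, sat_subst in hY. exact hY.
Qed.

Definition Q_model : model := {|
  M_str := Q;
  M_eq a b := iff_refl (a = b);
  M_ext := Q_ext; M_K := Q_K; M_S := Q_S; M_rec0 := Q_rec0; M_recS := Q_recS;
  M_succ_nz := Q_succ_nz; M_succ_inj := Q_succ_inj; M_ind := Q_ind;
  M_qfac := Q_qfac |}.

End QuotientModel.

Theorem RCA0w_completeness (p : bform) :
  (forall (M : model) r, sat (A := M) r (close p)) -> RCA0w_proves p.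
Proof.
  intros h. apply henkin_completeness; [apply RCA0w_subst|].
  intros A hA r. apply (cls_sat A hA). apply (h (Q_model A hA)).
Qed.
End Semantics.

(** * The definitions and statements read in a model *)

Module Interpretation.
Import Defs Completeness Semantics Classical ClassicalEpsilon.

Local Open Scope ty_scope.

Declare Scope model_scope.
Delimit Scope model_scope with model.
Notation "f $ x" := (ap f x) (at level 11, left associativity) : model_scope.
Local Open Scope model_scope.

Section Lambda.
Variable M : model.

(* Junk unless the function is represented by an element of the model. *)
Definition mlam {s t} (f : M s -> M t) : M (s ~> t) :=
  epsilon (inhabits (dflt M (s ~> t))) (fun F => forall x, F $ x = f x).

Lemma mlam_eq {s t} (f : M s -> M t) F : (forall x, F $ x = f x) -> mlam f = F.
Proof.
  intros h. apply M_ext. intros x. rewrite h.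
  apply (epsilon_spec (inhabits (dflt M (s ~> t))) (fun F => forall x, F $ x = f x)).
  exists F. exact h.
Qed.

Lemma Some_eq {X} (x y : X) : Some x = Some y -> x = y.
Proof. congruence. Qed.

Lemma strip_spec t {s} (u : term s) u' : strip t u = Some u' ->
  forall (a : M t) r, eval (push a r) u = eval r u'.
Proof.
  revert u'. induction u as [q n| | | | | |s q u IHu v IHv]; simpl; intros u' h a rho;
    try (apply Some_eq in h; subst u'; reflexivity).
  - destruct (ty_eq_dec t q) as [<-|e].
    + destruct n; [discriminate|]. apply Some_eq in h; subst u'. simpl. apply push_S.
    + apply Some_eq in h; subst u'. simpl. apply push_neq, e.
  - destruct (strip t u) as [u1|]; [|discriminate].
    destruct (strip t v) as [v1|]; [|discriminate].
    apply Some_eq in h; subst u'. simpl. rewrite (IHu u1), (IHv v1); reflexivity.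
Qed.

Lemma abs_spec t {s} (u : term s) (a : M t) r :
  eval r (abs t u) $ a = eval (push a r) u.
Proof.
  induction u as [q n| | | | | |s q u IHu v IHv]; simpl; try apply M_K.
  - destruct (ty_eq_dec t q) as [<-|e].
    + destruct n; simpl.
      * rewrite M_S, M_K. symmetry. apply push_0.
      * rewrite M_K. symmetry. apply push_S.
    + simpl. rewrite M_K. symmetry. apply push_neq, e.
  - destruct (strip t u) as [u1|] eqn:eu; [destruct (strip t v) as [v1|] eqn:ev|].
    + simpl. rewrite M_K, (strip_spec t u u1 eu), (strip_spec t v v1 ev). reflexivity.
    + simpl. rewrite M_S, IHu, IHv. reflexivity.
    + simpl. rewrite M_S, IHu, IHv. reflexivity.
Qed.

(** Bracket abstraction yields an element that represents [F], so [mlam F] is not junk when [F] is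
    the meaning of a term. *)
Lemma ev_lam {s t} (f : bterm s -> bterm t) w (F : M s -> M t) :
  (forall w' x a, w_le M w w' -> ev x w' a -> ev (f x) w' (F a)) ->
  ev (lam f) w (mlam F).
Proof.
  intros hf w' h. symmetry. apply mlam_eq. intros a. unfold lam. rewrite abs_spec.
  refine (hf (w_push M a w') (bvar s (w_depth M w')) a _ _ (w_push M a w') _).
  - eapply w_le_trans; [exact h|apply w_le_push].
  - apply ev_bvar.
  - apply w_le_refl.
Qed.

End Lambda.
Arguments mlam {M s t}.

Section Interp.
Variable M : model.
Notation N := (M o).
Notation "\ x .. y => b" := (mlam (fun x => .. (mlam (fun y => b)) ..))
  (at level 200, x binder, y binder, b at level 200) : model_scope.

Definition zero : N := s_zero M.
Definition succ (n : N) : N := s_succ M $ n.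
Definition rec (n a : N) (f : M (o ~> o ~> o)) : N := s_rec M $ n $ a $ f.

Definition addT : M (o ~> o ~> o) := \ a b => rec b a (\ u (_ : N) => succ u).
Definition add (a b : N) : N := addT $ a $ b.
Definition mulT : M (o ~> o ~> o) := \ a b => rec b zero (\ u (_ : N) => add u a).
Definition mul (a b : N) : N := mulT $ a $ b.
Definition predT : M (o ~> o) := \ a => rec a zero (\ (_ : N) k => k).
Definition pred (a : N) : N := predT $ a.
Definition subT : M (o ~> o ~> o) := \ a b => rec b a (\ u (_ : N) => pred u).
Definition sub (a b : N) : N := subT $ a $ b.
Definition one : N := succ zero.
Definition pow2T : M (o ~> o) := \ a => rec a one (\ u (_ : N) => add u u).
Definition pow2 (a : N) : N := pow2T $ a.
Definition ifzeroT : M (o ~> o ~> o ~> o) := \ c a b => rec c a (\ (_ _ : N) => b).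
Definition ifzero (c a b : N) : N := ifzeroT $ c $ a $ b.
Definition le (a b : N) : Prop := sub a b = zero.
Definition lt (a b : N) : Prop := le (succ a) b.
Definition triT : M (o ~> o) := \ a => rec a zero (\ u k => add u (succ k)).
Definition tri (a : N) : N := triT $ a.
Definition diagT : M (o ~> o) := \ a => rec a zero
  (\ w k => ifzero (sub (tri (succ w)) (succ k)) (succ w) w).
Definition diag (a : N) : N := diagT $ a.
Definition pairT : M (o ~> o ~> o) := \ a b => add (tri (add a b)) b.
Definition pair (a b : N) : N := pairT $ a $ b.
Definition pi2T : M (o ~> o) := \ n => sub n (tri (diag n)).
Definition pi2 (n : N) : N := pi2T $ n.
Definition pi1T : M (o ~> o) := \ n => sub (diag n) (pi2 n).
Definition pi1 (n : N) : N := pi1T $ n.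

Definition rat (a b c : N) : N := pair a (pair b c).
Definition qpos (q : N) : N := pi1 q.
Definition qneg (q : N) : N := pi1 (pi2 q).
Definition qden (q : N) : N := succ (pi2 (pi2 q)).
Definition qaddT : M (o ~> o ~> o) :=
  \ q r => rat (add (mul (qpos q) (qden r)) (mul (qpos r) (qden q)))
               (add (mul (qneg q) (qden r)) (mul (qneg r) (qden q)))
               (pred (mul (qden q) (qden r))).
Definition qadd (q r : N) : N := qaddT $ q $ r.
Definition qoppT : M (o ~> o) := \ q => rat (qneg q) (qpos q) (pred (qden q)).
Definition qopp (q : N) : N := qoppT $ q.
Definition qsub (q r : N) : N := qadd q (qopp r).
Definition qabsT : M (o ~> o) :=
  \ q => rat (add (sub (qpos q) (qneg q)) (sub (qneg q) (qpos q)))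
             zero (pred (qden q)).
Definition qabs (q : N) : N := qabsT $ q.
Definition qlt (q r : N) : Prop :=
  lt (add (mul (qpos q) (qden r)) (mul (qneg r) (qden q)))
     (add (mul (qpos r) (qden q)) (mul (qneg q) (qden r))).
Definition qle (q r : N) : Prop := ~ qlt r q.
Definition qnat (n : N) : N := rat n zero zero.
Definition qexp (n : N) : N := rat one zero (pred (pow2 n)).
Definition qexp' (n : N) : N := qadd (qexp n) (qexp n).

Notation rl := (o ~> o).
Notation fn := (rl ~> rl).
Notation RL := (M rl).
Notation FN := (M fn).

Definition isReal (x : RL) : Prop :=
  forall n i : N, qlt (qabs (qsub (x $ n) (x $ add n i))) (qexp n).
Definition req (x y : RL) : Prop :=
  forall n : N, qle (qabs (qsub (x $ n) (y $ n))) (qexp' n).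
Definition rlt (x y : RL) : Prop :=
  exists n : N, qlt (qadd (x $ n) (qexp' n)) (y $ n).
Definition rle (x y : RL) : Prop := ~ rlt y x.

Definition raddT : M (rl ~> rl ~> rl) :=
  \ x y n => qadd (x $ succ n) (y $ succ n).
Definition radd (x y : RL) : RL := raddT $ x $ y.
Definition roppT : M (rl ~> rl) := \ x n => qopp (x $ n).
Definition ropp (x : RL) : RL := roppT $ x.
Definition rsub (x y : RL) : RL := radd x (ropp y).
Definition rabsT : M (rl ~> rl) := \ x n => qabs (x $ n).
Definition rabs (x : RL) : RL := rabsT $ x.
Definition rnat (n : N) : RL := s_K o o $ qnat n.
Definition rexp (n : N) : RL := s_K o o $ qexp n.

Definition inR (x : RL) : Prop := isReal x.
Definition inI (x : RL) : Prop := isReal x /\ rle (rnat zero) x /\ rle x (rnat one).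
Definition inSym (n : N) (x : RL) : Prop :=
  isReal x /\ rle (ropp (rnat n)) x /\ rle x (rnat n).

Definition isFun (D : RL -> Prop) (f : FN) : Prop :=
  (forall x, D x -> isReal (f $ x)) /\
  (forall x, D x -> forall y, D y -> req x y -> req (f $ x) (f $ y)).

Definition near (n : N) (x y : RL) : Prop := rlt (rabs (rsub x y)) (rexp n).

Definition usco (D : RL -> Prop) (f : FN) : Prop :=
  isFun D f /\
  forall x, D x -> forall k : N, exists n : N, forall y, D y ->
    near n x y -> rlt (f $ y) (radd (f $ x) (rexp k)).

Definition lsco (D : RL -> Prop) (f : FN) : Prop :=
  isFun D f /\
  forall x, D x -> forall k : N, exists n : N, forall y, D y ->
    near n x y -> rlt (rsub (f $ x) (rexp k)) (f $ y).

Definition cont (D : RL -> Prop) (f : FN) : Prop :=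
  isFun D f /\
  forall x, D x -> forall k : N, exists n : N, forall y, D y ->
    near n x y -> near k (f $ x) (f $ y).

Definition mem (x : RL) (U : FN) : Prop := rlt (rnat zero) (U $ x).

Definition isOpen (U : FN) : Prop :=
  isFun inR U /\
  forall y, inR y -> mem y U ->
    exists n : N, forall z, inR z -> near n y z -> mem z U.

Definition memC (x : RL) (C : FN) : Prop := ~ mem x C.
Definition isClosedI (C : FN) : Prop :=
  isOpen C /\ forall x, inR x -> memC x C -> inI x.

Definition memUpTo (x : RL) (O : M (o ~> fn)) (n : N) : Prop :=
  exists m : N, le m n /\ mem x (O $ m).

Definition isSup (f : FN) (y : RL) : Prop :=
  isReal y /\ (forall x, inI x -> rle (f $ x) y) /\
  (forall z, inR z -> (forall x, inI x -> rle (f $ x) z) -> rle y z).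

Definition atMostOneMax (f : FN) (y : RL) : Prop :=
  forall x, inI x -> forall x', inI x' -> ~ req x x' -> rlt (f $ x) y \/ rlt (f $ x') y.

Definition attains (f : FN) (y : RL) : Prop := exists x, inI x /\ req (f $ x) y.

Definition initsegT : M ((o ~> o) ~> o ~> o) :=
  \ b n => rec n one (\ u k => add (add u u) (b $ k)).
Definition initseg (b : RL) (n : N) : N := initsegT $ b $ n.

Definition WKL : Prop :=
  forall T : RL,
    (forall s k r : N, le one s -> lt r (pow2 k) ->
       T $ add (mul s (pow2 k)) r = zero -> T $ s = zero) ->
    (forall n : N, exists s : N,
       le (pow2 n) s /\ lt s (pow2 (succ n)) /\ T $ s = zero) ->
    exists b : RL, (forall n : N, le (b $ n) one) /\
      forall n : N, T $ initseg b n = zero.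

Definition stmt_a : Prop :=
  WKL /\
  forall f : FN, usco inR f ->
    exists g : FN, cont inR g /\ forall x, inR x -> rle (f $ x) (g $ x).

Definition stmt_b : Prop :=
  forall f : M (o ~> fn), (forall n, usco inI (f $ n)) ->
    exists g : M (o ~> o), forall n x, inI x -> rle (f $ n $ x) (rnat (g $ n)).

Definition stmt_c : Prop :=
  forall O : M (o ~> fn), (forall n, isOpen (O $ n)) ->
    (forall x, inR x -> exists n : N, mem x (O $ n)) ->
    exists g : M (o ~> o), forall n x, inSym n x -> memUpTo x O (g $ n).

Definition stmt_d : Prop :=
  forall (O : M (o ~> o ~> fn)) (C : M (o ~> fn)),
    (forall n m, isOpen (O $ n $ m)) ->
    (forall n, isClosedI (C $ n)) ->
    (forall n x, inR x -> memC x (C $ n) -> exists m : N, mem x (O $ n $ m)) ->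
    exists g : M (o ~> o), forall n x, inR x ->
      memC x (C $ n) -> memUpTo x (O $ n) (g $ n).

Definition OC00 : Prop :=
  forall O : M (o ~> fn), (forall n, isOpen (O $ n)) ->
    (forall n x, inR x -> mem x (O $ n) -> mem x (O $ succ n)) ->
    (forall n, exists m : N, forall x, inSym n x -> mem x (O $ m)) ->
    exists g : M (o ~> o), forall n x, inSym n x -> mem x (O $ (g $ n)).

Definition stmt_e1 : Prop :=
  forall f : FN, usco inI f -> exists n : N, forall x, inI x -> rle (f $ x) (rnat n).

Definition stmt_e2 : Prop :=
  forall f : FN, lsco inI f -> (forall x, inI x -> rlt (rnat zero) (f $ x)) ->
    exists n : N, forall x, inI x -> rlt (rexp n) (f $ x).

Definition stmt_e3 : Prop :=
  forall O : M (o ~> fn), (forall n, isOpen (O $ n)) ->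
    (forall x, inI x -> exists n : N, mem x (O $ n)) ->
    exists n0 : N, forall x, inI x -> memUpTo x O n0.

Definition stmt_e4 : Prop :=
  forall C : M (o ~> fn), (forall n, isClosedI (C $ n)) ->
    (forall n x, inR x -> memC x (C $ succ n) -> memC x (C $ n)) ->
    (forall n, exists x, inR x /\ memC x (C $ n)) ->
    exists x, inR x /\ forall n, memC x (C $ n).

Definition stmt_e5 : Prop :=
  forall (f : M (o ~> fn)) (g : FN), (forall n, lsco inI (f $ n)) ->
    (forall n x, inI x -> rle (f $ n $ x) (f $ succ n $ x)) ->
    usco inI g ->
    (forall x, inI x -> exists n : N, rlt (g $ x) (f $ n $ x)) ->
    exists m : N, forall x, inI x -> rlt (g $ x) (f $ m $ x).

Definition stmt_e6 : Prop :=
  forall (C : FN) (O : M (o ~> fn)), isClosedI C -> (forall n, isOpen (O $ n)) ->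
    (forall x, inR x -> memC x C -> exists n : N, mem x (O $ n)) ->
    exists n0 : N, forall x, inR x -> memC x C -> memUpTo x O n0.

Definition stmt_e7 : Prop :=
  forall (f : FN) (y : RL), usco inI f -> isSup f y -> attains f y.

Definition stmt_e8 : Prop :=
  forall (f : FN) (y : RL), usco inI f -> isSup f y -> atMostOneMax f y ->
    attains f y.

End Interp.


(** * Agreement of the formulas with their readings *)

Section Translation.
Variable M : model.

Definition fdom (D : Defs.dom) (w : world M) (S : M (o ~> o) -> Prop) :=
  forall w' x a, w_le M w w' -> ev x w' a -> fev (D x) w' (S a).

Lemma fdom_mono D w w' S : w_le M w w' -> fdom D w S -> fdom D w' S.
Proof. intros h hD w'' x a h'. apply hD. eapply w_le_trans; eassumption. Qed.

Lemma fdom_apply D w S x a : fdom D w S -> ev x w a -> fev (D x) w (S a).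
Proof. intros h. apply h, w_le_refl. Qed.

Create HintDb interp discriminated.
#[local] Hint Constants Opaque : interp.
#[local] Hint Resolve fdom_apply ev_app : interp.

Ltac up h :=
  repeat match goal with
  | H : fdom _ ?w _ |- _ =>
    match type of h with w_le _ w ?w' => apply (fdom_mono _ _ _ _ h) in H end
  end; ev_up h; cbn beta.
Ltac interp_step :=
  lazymatch goal with
  | |- ev (lam _) _ _ => apply ev_lam; let h := fresh in intros ? ? ? h ?; up h
  | |- ev (app _ _) _ _ => apply ev_app
  | |- ev (fun _ => _) _ _ => apply ev_const; reflexivity
  | |- ev ?u _ _ => first [assumption | solve [auto with interp nocore]
                          | progress unfold u | match u with ?f _ => progress unfold f
                            | ?f _ _ => progress unfold f | ?f _ _ _ => progress unfold f end]
  | |- fdom _ _ _ => let h := fresh in intros ? ? ? h ?; up h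
  | |- fev (All _) _ _ => apply fev_all; let h := fresh in intros ? ? ? h ?; up h
  | |- fev (Ex _) _ _ => apply fev_ex; let h := fresh in intros ? ? ? h ?; up h
  | |- fev (AllIn _ _) _ _ => unfold AllIn
  | |- fev (ExIn _ _) _ _ => unfold ExIn
  | |- fev (And _ _) _ _ => apply fev_and
  | |- fev (Or _ _) _ _ => apply fev_or
  | |- fev (Neg _) _ _ => apply fev_neg
  | |- fev (Imp _ _) _ _ => apply fev_imp
  | |- fev (Eqn _ _) _ _ => eapply fev_iff; [apply M_eq|apply fev_eqn]
  | |- fev _ _ _ => solve [eauto 30 with interp nocore]
  end.
Ltac interp := repeat interp_step.

Lemma ev_zero (w : world M) : ev Defs.zero w (zero M).
Proof. unfold Defs.zero, zero. interp. Qed.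
#[local] Hint Resolve ev_zero : interp.

Lemma ev_succ u0 (w : world M) a0 : ev u0 w a0 -> 
  ev (Defs.succ u0) w (succ M a0).
Proof. intros. unfold Defs.succ, succ. interp. Qed.
#[local] Hint Resolve ev_succ : interp.

Lemma ev_addT (w : world M) : ev Defs.addT w (addT M).
Proof. unfold Defs.addT, addT. interp. Qed.
#[local] Hint Resolve ev_addT : interp.

Lemma ev_add u0 u1 (w : world M) a0 a1 : ev u0 w a0 -> ev u1 w a1 -> 
  ev (Defs.add u0 u1) w (add M a0 a1).
Proof. intros. unfold Defs.add, add. interp. Qed.
#[local] Hint Resolve ev_add : interp.

Lemma ev_mulT (w : world M) : ev Defs.mulT w (mulT M).
Proof. unfold Defs.mulT, mulT. interp. Qed.
#[local] Hint Resolve ev_mulT : interp.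

Lemma ev_mul u0 u1 (w : world M) a0 a1 : ev u0 w a0 -> ev u1 w a1 -> 
  ev (Defs.mul u0 u1) w (mul M a0 a1).
Proof. intros. unfold Defs.mul, mul. interp. Qed.
#[local] Hint Resolve ev_mul : interp.

Lemma ev_predT (w : world M) : ev Defs.predT w (predT M).
Proof. unfold Defs.predT, predT. interp. Qed.
#[local] Hint Resolve ev_predT : interp.

Lemma ev_pred u0 (w : world M) a0 : ev u0 w a0 -> 
  ev (Defs.pred u0) w (pred M a0).
Proof. intros. unfold Defs.pred, pred. interp. Qed.
#[local] Hint Resolve ev_pred : interp.

Lemma ev_subT (w : world M) : ev Defs.subT w (subT M).
Proof. unfold Defs.subT, subT. interp. Qed.
#[local] Hint Resolve ev_subT : interp.

Lemma ev_sub u0 u1 (w : world M) a0 a1 : ev u0 w a0 -> ev u1 w a1 -> 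
  ev (Defs.sub u0 u1) w (sub M a0 a1).
Proof. intros. unfold Defs.sub, sub. interp. Qed.
#[local] Hint Resolve ev_sub : interp.

Lemma ev_one (w : world M) : ev Defs.one w (one M).
Proof. unfold Defs.one, one. interp. Qed.
#[local] Hint Resolve ev_one : interp.

Lemma ev_pow2T (w : world M) : ev Defs.pow2T w (pow2T M).
Proof. unfold Defs.pow2T, pow2T. interp. Qed.
#[local] Hint Resolve ev_pow2T : interp.

Lemma ev_pow2 u0 (w : world M) a0 : ev u0 w a0 -> 
  ev (Defs.pow2 u0) w (pow2 M a0).
Proof. intros. unfold Defs.pow2, pow2. interp. Qed.
#[local] Hint Resolve ev_pow2 : interp.

Lemma ev_ifzeroT (w : world M) : ev Defs.ifzeroT w (ifzeroT M).
Proof. unfold Defs.ifzeroT, ifzeroT. interp. Qed.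
#[local] Hint Resolve ev_ifzeroT : interp.

Lemma ev_ifzero u0 u1 u2 (w : world M) a0 a1 a2 : ev u0 w a0 -> ev u1 w a1 -> ev u2 w a2 -> 
  ev (Defs.ifzero u0 u1 u2) w (ifzero M a0 a1 a2).
Proof. intros. unfold Defs.ifzero, ifzero. interp. Qed.
#[local] Hint Resolve ev_ifzero : interp.

Lemma ev_triT (w : world M) : ev Defs.triT w (triT M).
Proof. unfold Defs.triT, triT. interp. Qed.
#[local] Hint Resolve ev_triT : interp.

Lemma ev_tri u0 (w : world M) a0 : ev u0 w a0 -> 
  ev (Defs.tri u0) w (tri M a0).
Proof. intros. unfold Defs.tri, tri. interp. Qed.
#[local] Hint Resolve ev_tri : interp.

Lemma ev_diagT (w : world M) : ev Defs.diagT w (diagT M).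
Proof. unfold Defs.diagT, diagT. interp. Qed.
#[local] Hint Resolve ev_diagT : interp.

Lemma ev_diag u0 (w : world M) a0 : ev u0 w a0 -> 
  ev (Defs.diag u0) w (diag M a0).
Proof. intros. unfold Defs.diag, diag. interp. Qed.
#[local] Hint Resolve ev_diag : interp.

Lemma ev_pairT (w : world M) : ev Defs.pairT w (pairT M).
Proof. unfold Defs.pairT, pairT. interp. Qed.
#[local] Hint Resolve ev_pairT : interp.

Lemma ev_pair u0 u1 (w : world M) a0 a1 : ev u0 w a0 -> ev u1 w a1 -> 
  ev (Defs.pair u0 u1) w (pair M a0 a1).
Proof. intros. unfold Defs.pair, pair. interp. Qed.
#[local] Hint Resolve ev_pair : interp.

Lemma ev_pi2T (w : world M) : ev Defs.pi2T w (pi2T M).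
Proof. unfold Defs.pi2T, pi2T. interp. Qed.
#[local] Hint Resolve ev_pi2T : interp.

Lemma ev_pi2 u0 (w : world M) a0 : ev u0 w a0 -> 
  ev (Defs.pi2 u0) w (pi2 M a0).
Proof. intros. unfold Defs.pi2, pi2. interp. Qed.
#[local] Hint Resolve ev_pi2 : interp.

Lemma ev_pi1T (w : world M) : ev Defs.pi1T w (pi1T M).
Proof. unfold Defs.pi1T, pi1T. interp. Qed.
#[local] Hint Resolve ev_pi1T : interp.

Lemma ev_pi1 u0 (w : world M) a0 : ev u0 w a0 -> 
  ev (Defs.pi1 u0) w (pi1 M a0).
Proof. intros. unfold Defs.pi1, pi1. interp. Qed.
#[local] Hint Resolve ev_pi1 : interp.

Lemma ev_rat u0 u1 u2 (w : world M) a0 a1 a2 : ev u0 w a0 -> ev u1 w a1 -> ev u2 w a2 -> 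
  ev (Defs.rat u0 u1 u2) w (rat M a0 a1 a2).
Proof. intros. unfold Defs.rat, rat. interp. Qed.
#[local] Hint Resolve ev_rat : interp.

Lemma ev_qpos u0 (w : world M) a0 : ev u0 w a0 -> 
  ev (Defs.qpos u0) w (qpos M a0).
Proof. intros. unfold Defs.qpos, qpos. interp. Qed.
#[local] Hint Resolve ev_qpos : interp.

Lemma ev_qneg u0 (w : world M) a0 : ev u0 w a0 -> 
  ev (Defs.qneg u0) w (qneg M a0).
Proof. intros. unfold Defs.qneg, qneg. interp. Qed.
#[local] Hint Resolve ev_qneg : interp.

Lemma ev_qden u0 (w : world M) a0 : ev u0 w a0 -> 
  ev (Defs.qden u0) w (qden M a0).
Proof. intros. unfold Defs.qden, qden. interp. Qed.
#[local] Hint Resolve ev_qden : interp.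

Lemma ev_qaddT (w : world M) : ev Defs.qaddT w (qaddT M).
Proof. unfold Defs.qaddT, qaddT. interp. Qed.
#[local] Hint Resolve ev_qaddT : interp.

Lemma ev_qadd u0 u1 (w : world M) a0 a1 : ev u0 w a0 -> ev u1 w a1 -> 
  ev (Defs.qadd u0 u1) w (qadd M a0 a1).
Proof. intros. unfold Defs.qadd, qadd. interp. Qed.
#[local] Hint Resolve ev_qadd : interp.

Lemma ev_qoppT (w : world M) : ev Defs.qoppT w (qoppT M).
Proof. unfold Defs.qoppT, qoppT. interp. Qed.
#[local] Hint Resolve ev_qoppT : interp.

Lemma ev_qopp u0 (w : world M) a0 : ev u0 w a0 -> 
  ev (Defs.qopp u0) w (qopp M a0).
Proof. intros. unfold Defs.qopp, qopp. interp. Qed.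
#[local] Hint Resolve ev_qopp : interp.

Lemma ev_qsub u0 u1 (w : world M) a0 a1 : ev u0 w a0 -> ev u1 w a1 -> 
  ev (Defs.qsub u0 u1) w (qsub M a0 a1).
Proof. intros. unfold Defs.qsub, qsub. interp. Qed.
#[local] Hint Resolve ev_qsub : interp.

Lemma ev_qabsT (w : world M) : ev Defs.qabsT w (qabsT M).
Proof. unfold Defs.qabsT, qabsT. interp. Qed.
#[local] Hint Resolve ev_qabsT : interp.

Lemma ev_qabs u0 (w : world M) a0 : ev u0 w a0 -> 
  ev (Defs.qabs u0) w (qabs M a0).
Proof. intros. unfold Defs.qabs, qabs. interp. Qed.
#[local] Hint Resolve ev_qabs : interp.

Lemma ev_qnat u0 (w : world M) a0 : ev u0 w a0 -> 
  ev (Defs.qnat u0) w (qnat M a0).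
Proof. intros. unfold Defs.qnat, qnat. interp. Qed.
#[local] Hint Resolve ev_qnat : interp.

Lemma ev_qexp u0 (w : world M) a0 : ev u0 w a0 -> 
  ev (Defs.qexp u0) w (qexp M a0).
Proof. intros. unfold Defs.qexp, qexp. interp. Qed.
#[local] Hint Resolve ev_qexp : interp.

Lemma ev_qexp' u0 (w : world M) a0 : ev u0 w a0 -> 
  ev (Defs.qexp' u0) w (qexp' M a0).
Proof. intros. unfold Defs.qexp', qexp'. interp. Qed.
#[local] Hint Resolve ev_qexp' : interp.

Lemma ev_raddT (w : world M) : ev Defs.raddT w (raddT M).
Proof. unfold Defs.raddT, raddT. interp. Qed.
#[local] Hint Resolve ev_raddT : interp.

Lemma ev_radd u0 u1 (w : world M) a0 a1 : ev u0 w a0 -> ev u1 w a1 -> 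
  ev (Defs.radd u0 u1) w (radd M a0 a1).
Proof. intros. unfold Defs.radd, radd. interp. Qed.
#[local] Hint Resolve ev_radd : interp.

Lemma ev_roppT (w : world M) : ev Defs.roppT w (roppT M).
Proof. unfold Defs.roppT, roppT. interp. Qed.
#[local] Hint Resolve ev_roppT : interp.

Lemma ev_ropp u0 (w : world M) a0 : ev u0 w a0 -> 
  ev (Defs.ropp u0) w (ropp M a0).
Proof. intros. unfold Defs.ropp, ropp. interp. Qed.
#[local] Hint Resolve ev_ropp : interp.

Lemma ev_rsub u0 u1 (w : world M) a0 a1 : ev u0 w a0 -> ev u1 w a1 -> 
  ev (Defs.rsub u0 u1) w (rsub M a0 a1).
Proof. intros. unfold Defs.rsub, rsub. interp. Qed.
#[local] Hint Resolve ev_rsub : interp.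

Lemma ev_rabsT (w : world M) : ev Defs.rabsT w (rabsT M).
Proof. unfold Defs.rabsT, rabsT. interp. Qed.
#[local] Hint Resolve ev_rabsT : interp.

Lemma ev_rabs u0 (w : world M) a0 : ev u0 w a0 -> 
  ev (Defs.rabs u0) w (rabs M a0).
Proof. intros. unfold Defs.rabs, rabs. interp. Qed.
#[local] Hint Resolve ev_rabs : interp.

Lemma ev_rnat u0 (w : world M) a0 : ev u0 w a0 -> 
  ev (Defs.rnat u0) w (rnat M a0).
Proof. intros. unfold Defs.rnat, rnat. interp. Qed.
#[local] Hint Resolve ev_rnat : interp.

Lemma ev_rexp u0 (w : world M) a0 : ev u0 w a0 -> 
  ev (Defs.rexp u0) w (rexp M a0).
Proof. intros. unfold Defs.rexp, rexp. interp. Qed.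
#[local] Hint Resolve ev_rexp : interp.

Lemma ev_initsegT (w : world M) : ev Defs.initsegT w (initsegT M).
Proof. unfold Defs.initsegT, initsegT. interp. Qed.
#[local] Hint Resolve ev_initsegT : interp.

Lemma ev_initseg u0 u1 (w : world M) a0 a1 : ev u0 w a0 -> ev u1 w a1 -> 
  ev (Defs.initseg u0 u1) w (initseg M a0 a1).
Proof. intros. unfold Defs.initseg, initseg. interp. Qed.
#[local] Hint Resolve ev_initseg : interp.

Lemma fev_le u0 u1 (w : world M) a0 a1 : ev u0 w a0 -> ev u1 w a1 -> 
  fev (Defs.le u0 u1) w (le M a0 a1).
Proof. intros. unfold Defs.le, le. interp. Qed.
#[local] Hint Resolve fev_le : interp.

Lemma fev_lt u0 u1 (w : world M) a0 a1 : ev u0 w a0 -> ev u1 w a1 -> 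
  fev (Defs.lt u0 u1) w (lt M a0 a1).
Proof. intros. unfold Defs.lt, lt. interp. Qed.
#[local] Hint Resolve fev_lt : interp.

Lemma fev_qlt u0 u1 (w : world M) a0 a1 : ev u0 w a0 -> ev u1 w a1 -> 
  fev (Defs.qlt u0 u1) w (qlt M a0 a1).
Proof. intros. unfold Defs.qlt, qlt. interp. Qed.
#[local] Hint Resolve fev_qlt : interp.

Lemma fev_qle u0 u1 (w : world M) a0 a1 : ev u0 w a0 -> ev u1 w a1 -> 
  fev (Defs.qle u0 u1) w (qle M a0 a1).
Proof. intros. unfold Defs.qle, qle. interp. Qed.
#[local] Hint Resolve fev_qle : interp.

Lemma fev_isReal u0 (w : world M) a0 : ev u0 w a0 -> 
  fev (Defs.isReal u0) w (isReal M a0).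
Proof. intros. unfold Defs.isReal, isReal. interp. Qed.
#[local] Hint Resolve fev_isReal : interp.

Lemma fev_req u0 u1 (w : world M) a0 a1 : ev u0 w a0 -> ev u1 w a1 -> 
  fev (Defs.req u0 u1) w (req M a0 a1).
Proof. intros. unfold Defs.req, req. interp. Qed.
#[local] Hint Resolve fev_req : interp.

Lemma fev_rlt u0 u1 (w : world M) a0 a1 : ev u0 w a0 -> ev u1 w a1 -> 
  fev (Defs.rlt u0 u1) w (rlt M a0 a1).
Proof. intros. unfold Defs.rlt, rlt. interp. Qed.
#[local] Hint Resolve fev_rlt : interp.

Lemma fev_rle u0 u1 (w : world M) a0 a1 : ev u0 w a0 -> ev u1 w a1 -> 
  fev (Defs.rle u0 u1) w (rle M a0 a1).
Proof. intros. unfold Defs.rle, rle. interp. Qed.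
#[local] Hint Resolve fev_rle : interp.

Lemma fdom_inR (w : world M) : fdom Defs.inR w (inR M).
Proof. interp. unfold Defs.inR, inR. interp. Qed.
#[local] Hint Resolve fdom_inR : interp.

Lemma fdom_inI (w : world M) : fdom Defs.inI w (inI M).
Proof. interp. unfold Defs.inI, inI. interp. Qed.
#[local] Hint Resolve fdom_inI : interp.

Lemma fdom_inSym u (w : world M) a : ev u w a -> fdom (Defs.inSym u) w (inSym M a).
Proof. intros. interp_step. unfold Defs.inSym, inSym. interp. Qed.
#[local] Hint Resolve fdom_inSym : interp.

Lemma fev_isFun D u0 (w : world M) S a0 : fdom D w S -> ev u0 w a0 -> 
  fev (Defs.isFun D u0) w (isFun M S a0).
Proof. intros. unfold Defs.isFun, isFun. interp. Qed.
#[local] Hint Resolve fev_isFun : interp.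

Lemma fev_near u0 u1 u2 (w : world M) a0 a1 a2 : ev u0 w a0 -> ev u1 w a1 -> ev u2 w a2 -> 
  fev (Defs.near u0 u1 u2) w (near M a0 a1 a2).
Proof. intros. unfold Defs.near, near. interp. Qed.
#[local] Hint Resolve fev_near : interp.

Lemma fev_usco D u0 (w : world M) S a0 : fdom D w S -> ev u0 w a0 -> 
  fev (Defs.usco D u0) w (usco M S a0).
Proof. intros. unfold Defs.usco, usco. interp. Qed.
#[local] Hint Resolve fev_usco : interp.

Lemma fev_lsco D u0 (w : world M) S a0 : fdom D w S -> ev u0 w a0 -> 
  fev (Defs.lsco D u0) w (lsco M S a0).
Proof. intros. unfold Defs.lsco, lsco. interp. Qed.
#[local] Hint Resolve fev_lsco : interp.

Lemma fev_cont D u0 (w : world M) S a0 : fdom D w S -> ev u0 w a0 -> 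
  fev (Defs.cont D u0) w (cont M S a0).
Proof. intros. unfold Defs.cont, cont. interp. Qed.
#[local] Hint Resolve fev_cont : interp.

Lemma fev_mem u0 u1 (w : world M) a0 a1 : ev u0 w a0 -> ev u1 w a1 -> 
  fev (Defs.mem u0 u1) w (mem M a0 a1).
Proof. intros. unfold Defs.mem, mem. interp. Qed.
#[local] Hint Resolve fev_mem : interp.

Lemma fev_isOpen u0 (w : world M) a0 : ev u0 w a0 -> 
  fev (Defs.isOpen u0) w (isOpen M a0).
Proof. intros. unfold Defs.isOpen, isOpen. interp. Qed.
#[local] Hint Resolve fev_isOpen : interp.

#[local] Hint Extern 1 (fev (isClosed _) _ _) => unfold isClosed : interp.

Lemma fev_memC u0 u1 (w : world M) a0 a1 : ev u0 w a0 -> ev u1 w a1 -> 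
  fev (Defs.memC u0 u1) w (memC M a0 a1).
Proof. intros. unfold Defs.memC, memC. interp. Qed.
#[local] Hint Resolve fev_memC : interp.

Lemma fev_isClosedI u0 (w : world M) a0 : ev u0 w a0 -> 
  fev (Defs.isClosedI u0) w (isClosedI M a0).
Proof. intros. unfold Defs.isClosedI, isClosedI. interp. Qed.
#[local] Hint Resolve fev_isClosedI : interp.

Lemma fev_memUpTo u0 u1 u2 (w : world M) a0 a1 a2 : ev u0 w a0 -> ev u1 w a1 -> ev u2 w a2 -> 
  fev (Defs.memUpTo u0 u1 u2) w (memUpTo M a0 a1 a2).
Proof. intros. unfold Defs.memUpTo, memUpTo. interp. Qed.
#[local] Hint Resolve fev_memUpTo : interp.

Lemma fev_isSup u0 u1 (w : world M) a0 a1 : ev u0 w a0 -> ev u1 w a1 -> 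
  fev (Defs.isSup u0 u1) w (isSup M a0 a1).
Proof. intros. unfold Defs.isSup, isSup. interp. Qed.
#[local] Hint Resolve fev_isSup : interp.

Lemma fev_atMostOneMax u0 u1 (w : world M) a0 a1 : ev u0 w a0 -> ev u1 w a1 -> 
  fev (Defs.atMostOneMax u0 u1) w (atMostOneMax M a0 a1).
Proof. intros. unfold Defs.atMostOneMax, atMostOneMax. interp. Qed.
#[local] Hint Resolve fev_atMostOneMax : interp.

Lemma fev_attains u0 u1 (w : world M) a0 a1 : ev u0 w a0 -> ev u1 w a1 -> 
  fev (Defs.attains u0 u1) w (attains M a0 a1).
Proof. intros. unfold Defs.attains, attains. interp. Qed.
#[local] Hint Resolve fev_attains : interp.

Lemma fev_WKL (w : world M) : fev Defs.WKL w (WKL M).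
Proof. unfold Defs.WKL, WKL. interp. Qed.
#[local] Hint Resolve fev_WKL : interp.

Lemma fev_stmt_a (w : world M) : fev Defs.stmt_a w (stmt_a M).
Proof. unfold Defs.stmt_a, stmt_a. interp. Qed.
#[local] Hint Resolve fev_stmt_a : interp.

Lemma fev_stmt_b (w : world M) : fev Defs.stmt_b w (stmt_b M).
Proof. unfold Defs.stmt_b, stmt_b. interp. Qed.
#[local] Hint Resolve fev_stmt_b : interp.

Lemma fev_stmt_c (w : world M) : fev Defs.stmt_c w (stmt_c M).
Proof. unfold Defs.stmt_c, stmt_c. interp. Qed.
#[local] Hint Resolve fev_stmt_c : interp.

Lemma fev_stmt_d (w : world M) : fev Defs.stmt_d w (stmt_d M).
Proof. unfold Defs.stmt_d, stmt_d. interp. Qed.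
#[local] Hint Resolve fev_stmt_d : interp.

Lemma fev_OC00 (w : world M) : fev Defs.OC00 w (OC00 M).
Proof. unfold Defs.OC00, OC00. interp. Qed.
#[local] Hint Resolve fev_OC00 : interp.

Lemma fev_stmt_e1 (w : world M) : fev Defs.stmt_e1 w (stmt_e1 M).
Proof. unfold Defs.stmt_e1, stmt_e1. interp. Qed.
#[local] Hint Resolve fev_stmt_e1 : interp.

Lemma fev_stmt_e2 (w : world M) : fev Defs.stmt_e2 w (stmt_e2 M).
Proof. unfold Defs.stmt_e2, stmt_e2. interp. Qed.
#[local] Hint Resolve fev_stmt_e2 : interp.

Lemma fev_stmt_e3 (w : world M) : fev Defs.stmt_e3 w (stmt_e3 M).
Proof. unfold Defs.stmt_e3, stmt_e3. interp. Qed.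
#[local] Hint Resolve fev_stmt_e3 : interp.

Lemma fev_stmt_e4 (w : world M) : fev Defs.stmt_e4 w (stmt_e4 M).
Proof. unfold Defs.stmt_e4, stmt_e4. interp. Qed.
#[local] Hint Resolve fev_stmt_e4 : interp.

Lemma fev_stmt_e5 (w : world M) : fev Defs.stmt_e5 w (stmt_e5 M).
Proof. unfold Defs.stmt_e5, stmt_e5. interp. Qed.
#[local] Hint Resolve fev_stmt_e5 : interp.

Lemma fev_stmt_e6 (w : world M) : fev Defs.stmt_e6 w (stmt_e6 M).
Proof. unfold Defs.stmt_e6, stmt_e6. interp. Qed.
#[local] Hint Resolve fev_stmt_e6 : interp.

Lemma fev_stmt_e7 (w : world M) : fev Defs.stmt_e7 w (stmt_e7 M).
Proof. unfold Defs.stmt_e7, stmt_e7. interp. Qed.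
#[local] Hint Resolve fev_stmt_e7 : interp.

Lemma fev_stmt_e8 (w : world M) : fev Defs.stmt_e8 w (stmt_e8 M).
Proof. unfold Defs.stmt_e8, stmt_e8. interp. Qed.
#[local] Hint Resolve fev_stmt_e8 : interp.

End Translation.

Lemma proves_imp (p q : bform) (P Q : model -> Prop) :
  (forall (M : model) (w : world M), fev p w (P M)) ->
  (forall (M : model) (w : world M), fev q w (Q M)) ->
  (forall M, P M -> Q M) -> RCA0w_proves (p --> q).
Proof.
  intros hp hq h. apply RCA0w_completeness. intros M r.
  apply (fev_close M (p --> q) r (P M -> Q M)); [|apply h].
  apply fev_imp; [apply hp|apply hq].
Qed.

End Interpretation.

From HB Require Import structures.
From mathcomp Require ssreflect ssrfun ssrbool eqtype choice ssralg ssrnum order boolp.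
From mathcomp Require ring lra.

(** * Representable functions, decidable predicates, induction and choice in a model *)

Module Arithmetic.
Import ssreflect ssrfun Setoid Ring Classical ClassicalEpsilon FunctionalExtensionality.
Import Completeness Semantics Interpretation.
Local Open Scope model_scope.
Notation o := Defs.o.
Notation "s ~> t" := (Defs.arr s t) (at level 60, right associativity) : model_scope.
Notation "\ x .. y => b" := (mlam (fun x => .. (mlam (fun y => b)) ..))
  (at level 200, x binder, y binder, b at level 200) : model_scope.
Arguments zero {M}.
Arguments one {M}.
Arguments succ {M}.
Arguments rec {M}.
Arguments add {M}.
Arguments mul {M}.
Arguments pred {M}.
Arguments sub {M}.
Arguments pow2 {M}.
Arguments le {M}.
Arguments lt {M}.

Section Representability.
Variable M : model.
Notation N := (M o).

Fixpoint env (G : list Defs.ty) : Type :=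
  match G with nil => unit | cons s G => (env G * M s)%type end.

(* [f] is given by a term in the variables of [G], with parameters from the model. *)
Fixpoint Rep (G : list Defs.ty) {t} : (env G -> M t) -> Prop :=
  match G with
  | nil => fun f => True
  | cons s G => fun f =>
      exists g : env G -> M (s ~> t), Rep G g /\ forall e x, g e $ x = f (e, x)
  end.
Arguments Rep {G t}.

Lemma Rep_ext G t (f g : env G -> M t) : (forall e, f e = g e) -> Rep f -> Rep g.
Proof. move=> h. have -> : f = g by apply: functional_extensionality. by []. Qed.

Lemma Rep_const G t (a : M t) : Rep (fun _ : env G => a).
Proof.
elim: G t a => [//|s G IH] t a. exists (fun _ => s_K t s $ a); split; first exact: IH.
by move=> e x; rewrite M_K.
Qed.

(** The combinator S carries an abstraction through an application, as K does for constants; the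
    context is treated one variable at a time. *)
Lemma Rep_ap G s t (f : env G -> M (s ~> t)) (g : env G -> M s) :
  Rep f -> Rep g -> Rep (fun e => f e $ g e).
Proof.
elim: G s t f g => [//|r G IH] s t f g [f' [hf ef]] [g' [hg eg]].
exists (fun e => s_S r s t $ f' e $ g' e); split.
  apply: (IH _ _ (fun e => s_S r s t $ f' e)) => //. apply: IH => //. exact: Rep_const.
by move=> e x; rewrite M_S ef eg.
Qed.

Lemma Rep_wk G s t (f : env G -> M t) : Rep f -> Rep (fun e : env (cons s G) => f (fst e)).
Proof.
move=> hf. exists (fun e => s_K t s $ f e); split; last by move=> e x; rewrite M_K.
apply: (Rep_ap _ _ _ (fun _ => s_K t s)) => //. exact: Rep_const.
Qed.

Lemma Rep_var0 G s : Rep (fun e : env (cons s G) => snd e).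
Proof.
exists (fun _ => s_S s (s ~> s) s $ s_K _ _ $ s_K _ _); split; first exact: Rep_const.
by move=> e x; rewrite M_S M_K.
Qed.

Lemma Rep_var1 G s r : Rep (fun e : env (cons r (cons s G)) => snd (fst e)).
Proof. exact: (Rep_wk (cons s G) r s (fun e => snd e) (Rep_var0 G s)). Qed.

Lemma Rep_var2 G s r q : Rep (fun e : env (cons q (cons r (cons s G))) => snd (fst (fst e))).
Proof. exact: (Rep_wk (cons r (cons s G)) q s (fun e => snd (fst e)) (Rep_var1 G s r)). Qed.

Lemma Rep_var3 G s r q p :
  Rep (fun e : env (cons p (cons q (cons r (cons s G)))) => snd (fst (fst (fst e)))).
Proof. exact: (Rep_wk (cons q (cons r (cons s G))) p s (fun e => snd (fst (fst e))) (Rep_var2 G s r q)). Qed.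

Lemma Rep_lam G s t (f : env G -> M s -> M t) :
  Rep (fun e : env (cons s G) => f (fst e) (snd e)) -> Rep (fun e => \ x => f e x).
Proof.
move=> [g [hg eg]]. apply: Rep_ext hg => e. symmetry. apply: mlam_eq => x. exact: eg.
Qed.

Lemma beta s t (f : M s -> M t) a :
  Rep (fun e : env (cons s nil) => f (snd e)) -> (\ x => f x) $ a = f a.
Proof.
move=> [g [_ eg]]. rewrite (mlam_eq M f (g tt)); exact: (eg tt).
Qed.

End Representability.
Arguments Rep {M G t}.
Arguments beta {M s t}.

Ltac rep_unfold :=
  unfold initseg, rexp, rnat, rabs, rsub, ropp, radd, qexp', qexp, qnat, qabs, qsub,
    qopp, qadd, qden, qneg, qpos, rat, pi2, pi1, pair, diag, tri, ifzero, pow2, sub,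
    pred, mul, add, rec, succ.
Ltac rep_step :=
  cbn beta;
  lazymatch goal with
  | |- @Rep ?M ?G _ (fun _ => ?a) => refine (Rep_const M G _ a)
  | |- @Rep ?M ?G _ (fun e => ap (@?f e) (@?g e)) => refine (Rep_ap M G _ _ f g _ _)
  | |- @Rep ?M ?G _ (fun e => mlam (@?f e)) => refine (Rep_lam M G _ _ f _)
  | |- Rep (@snd _ _) => refine (Rep_var0 _ _ _)
  | |- Rep (fun e => snd e) => refine (Rep_var0 _ _ _)
  | |- Rep (fun e => snd (fst e)) => refine (Rep_var1 _ _ _ _)
  | |- Rep (fun e => snd (fst (fst e))) => refine (Rep_var2 _ _ _ _ _)
  | |- Rep (fun e => snd (fst (fst (fst e)))) => refine (Rep_var3 _ _ _ _ _ _)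
  | |- @Rep ?M (cons ?s ?G) ?t (fun e => ?f (fst e)) => refine (Rep_wk M G s t f _)
  | |- @Rep ?M (cons ?s (cons ?r ?G)) ?t (fun e => ?f (fst (fst e))) =>
      refine (Rep_wk M (cons r G) s t (fun e : env M (cons r G) => f (fst e)) _)
  | |- @Rep ?M (cons ?s (cons ?r (cons ?q ?G))) ?t (fun e => ?f (fst (fst (fst e)))) =>
      refine (Rep_wk M (cons r (cons q G)) s t
        (fun e : env M (cons r (cons q G)) => f (fst (fst e))) _)
  end.
Ltac rep := intros; rep_unfold; repeat first [assumption | rep_step].

Ltac betas := repeat (rewrite beta; [|solve [rep]]).

Section Numbers.
Variable M : model.
Notation N := (M o).
Implicit Types a b c d m n : N.

Lemma rec0 a (f : M (o ~> o ~> o)) : rec zero a f = a.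
Proof. exact: M_rec0. Qed.

Lemma recS n a (f : M (o ~> o ~> o)) : rec (succ n) a f = f $ rec n a f $ n.
Proof. exact: M_recS. Qed.

Lemma N_ind_or (f g h k : N -> N) :
  Rep (fun e : env M (cons o nil) => f (snd e)) ->
  Rep (fun e : env M (cons o nil) => g (snd e)) ->
  Rep (fun e : env M (cons o nil) => h (snd e)) ->
  Rep (fun e : env M (cons o nil) => k (snd e)) ->
  f zero = g zero \/ h zero = k zero ->
  (forall n, f n = g n \/ h n = k n -> f (succ n) = g (succ n) \/ h (succ n) = k (succ n)) ->
  forall n, f n = g n \/ h n = k n.
Proof.
move=> hf hg hh hk.
have := M_ind M (\ x => f x) (\ x => g x) (\ x => h x) (\ x => k x).
have e F : Rep (fun e : env M (cons o nil) => F (snd e)) -> forall n, mlam F $ n = F n :> N.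
  by move=> hF n; exact: (beta F n hF).
move=> /= H h0 hS n. have := H _ _ n. rewrite !e //. apply=> //.
by move=> m; rewrite !e //; apply: hS.
Qed.

Lemma N_ind_eq (f g : N -> N) :
  Rep (fun e : env M (cons o nil) => f (snd e)) ->
  Rep (fun e : env M (cons o nil) => g (snd e)) ->
  f zero = g zero -> (forall n, f n = g n -> f (succ n) = g (succ n)) ->
  forall n, f n = g n.
Proof.
move=> hf hg h0 hS n. have [//|//] : f n = g n \/ f n = g n.
apply: (N_ind_or f g f g) => //; first by left. by move=> k [] /hS; left.
Qed.

Lemma add0 a : add a zero = a.
Proof. rewrite /add /addT. betas. exact: rec0. Qed.

Lemma addS a b : add a (succ b) = succ (add a b).
Proof. rewrite /add /addT. betas. rewrite recS. by betas. Qed.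

Lemma mul0 a : mul a zero = zero.
Proof. rewrite /mul /mulT. betas. exact: rec0. Qed.

Lemma mulS a b : mul a (succ b) = add (mul a b) a.
Proof. rewrite /mul /mulT. betas. rewrite recS. by betas. Qed.

Lemma pred0 : pred zero = zero :> N.
Proof. rewrite /pred /predT. betas. exact: rec0. Qed.

Lemma predS a : pred (succ a) = a.
Proof. rewrite /pred /predT. betas. rewrite recS. by betas. Qed.

Lemma sub0 a : sub a zero = a.
Proof. rewrite /sub /subT. betas. exact: rec0. Qed.

Lemma subS a b : sub a (succ b) = pred (sub a b).
Proof. rewrite /sub /subT. betas. rewrite recS. by betas. Qed.

Lemma zero_or_succ n : n = zero \/ exists m, n = succ m.
Proof.
have [->|->] : n = zero \/ n = succ (pred n).
- apply: (N_ind_or (fun n => n) (fun _ => zero) (fun n => n) (fun n => succ (pred n)));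
    [by rep..| |].
  + by left.
  + by move=> k _; right; rewrite predS.
- by left.
- by right; exists (pred n).
Qed.

Lemma add0n a : add zero a = a.
Proof.
apply: (N_ind_eq (fun a => add zero a) (fun a => a)); [by rep..| |]; first exact: add0.
by move=> n h; rewrite addS h.
Qed.

Lemma addSn a b : add (succ a) b = succ (add a b).
Proof.
apply: (N_ind_eq (fun b => add (succ a) b) (fun b => succ (add a b))); [by rep..| |].
- by rewrite !add0.
- by move=> n h; rewrite !addS h.
Qed.

Lemma addC a b : add a b = add b a.
Proof.
apply: (N_ind_eq (fun b => add a b) (fun b => add b a)); [by rep..| |].
- by rewrite add0 add0n.
- by move=> n h; rewrite addS addSn h.
Qed.

Lemma addA a b c : add a (add b c) = add (add a b) c.
Proof.
apply: (N_ind_eq (fun c => add a (add b c)) (fun c => add (add a b) c)); [by rep..| |].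
- by rewrite !add0.
- by move=> n h; rewrite !addS h.
Qed.

Lemma mul0n a : mul zero a = zero.
Proof.
apply: (N_ind_eq (fun a => mul zero a) (fun a => zero)); [by rep..| |]; first exact: mul0.
by move=> n h; rewrite mulS h add0.
Qed.

Lemma mulSn a b : mul (succ a) b = add (mul a b) b.
Proof.
apply: (N_ind_eq (fun b => mul (succ a) b) (fun b => add (mul a b) b)); [by rep..| |].
- by rewrite !mul0 add0.
- by move=> n h; rewrite !mulS h !addS -!addA (addC n a).
Qed.

Lemma mulC a b : mul a b = mul b a.
Proof.
apply: (N_ind_eq (fun b => mul a b) (fun b => mul b a)); [by rep..| |].
- by rewrite mul0 mul0n.
- by move=> n h; rewrite mulS mulSn h.
Qed.

Lemma mulDl a b c : mul (add a b) c = add (mul a c) (mul b c).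
Proof.
apply: (N_ind_eq (fun c => mul (add a b) c) (fun c => add (mul a c) (mul b c)));
  [by rep..| |].
- by rewrite !mul0 add0.
- move=> n h; rewrite !mulS h -!addA; congr add. by rewrite !addA (addC _ a).
Qed.

Lemma mulA a b c : mul a (mul b c) = mul (mul a b) c.
Proof.
apply: (N_ind_eq (fun c => mul a (mul b c)) (fun c => mul (mul a b) c)); [by rep..| |].
- by rewrite !mul0.
- by move=> n h; rewrite !mulS -h [LHS]mulC mulDl ![mul _ a]mulC.
Qed.

Lemma mul1n a : mul one a = a.
Proof. by rewrite /one mulSn mul0n add0n. Qed.

Lemma N_semiring : semi_ring_theory (zero : N) one add mul eq.
Proof.
by split; [exact: add0n|exact: addC|exact: addA|exact: mul1n|exact: mul0n
  |exact: mulC|exact: mulA|exact: mulDl].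
Qed.

Lemma succ_inj a b : succ a = succ b -> a = b.
Proof. exact: M_succ_inj. Qed.

Lemma succ_nz a : succ a <> zero.
Proof. exact: M_succ_nz. Qed.

Lemma subSS a b : sub (succ a) (succ b) = sub a b.
Proof.
apply: (N_ind_eq (fun b => sub (succ a) (succ b)) (fun b => sub a b)); [by rep..| |].
- by rewrite subS !sub0 predS.
- by move=> n h; rewrite subS h subS.
Qed.

Lemma addK a d : sub (add a d) a = d.
Proof.
apply: (N_ind_eq (fun a => sub (add a d) a) (fun a => d)); [by rep..| |].
- by rewrite add0n sub0.
- by move=> n h; rewrite addSn subSS.
Qed.

(** Totality of the order in terms of truncated subtraction. It is proved by the disjunctive form of
    induction, as the side that holds may change with [b]. *)
Lemma sub_total a b : add a (sub b a) = b \/ add b (sub a b) = a.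
Proof.
apply: (N_ind_or (fun b => add a (sub b a)) (fun b => b)
  (fun b => add b (sub a b)) (fun b => a)); [by rep..| |].
- by right; rewrite add0n sub0.
- move=> n [h|h].
  + by left; rewrite -{1 2}h -addS addK.
  + have [e|[d e]] := zero_or_succ (sub a n); rewrite e in h.
    * left. rewrite add0 in h. have -> : succ n = add a one by rewrite /one addS add0 h.
      by rewrite addK.
    * right. by rewrite -h addS -addSn addK.
Qed.

Lemma leP a b : le a b <-> exists d, b = add a d.
Proof.
split.
- rewrite /le => h. have [<-|e] := sub_total a b; first by exists (sub b a).
  by exists zero; rewrite -e h !add0.
- move=> [d ->]. rewrite /le.
  apply: (N_ind_eq (fun d => sub a (add a d)) (fun d => zero)); [by rep..| |].
  + by rewrite add0 -{1}(add0 a) addK.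
  + by move=> n h; rewrite addS subS h pred0.
Qed.

Lemma add_cancel a b c : add a b = add a c -> b = c.
Proof. by move=> h; rewrite -(addK a b) h addK. Qed.

Lemma add_eq0 a b : add a b = zero -> a = zero /\ b = zero.
Proof.
have [->|[b' ->]] := zero_or_succ b; first by rewrite add0.
by rewrite addS => /succ_nz.
Qed.

Lemma le_refl a : le a a.
Proof. by apply/leP; exists zero; rewrite add0. Qed.

Lemma le_trans a b c : le a b -> le b c -> le a c.
Proof. by move=> /leP[d ->] /leP[d' ->]; apply/leP; exists (add d d'); rewrite addA. Qed.

Lemma le_anti a b : le a b -> le b a -> a = b.
Proof.
move=> /leP[d ->] /leP[d']; rewrite -addA -{1}(add0 a) => /add_cancel/esym/add_eq0[-> _].
by rewrite add0.
Qed.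

Lemma le_total a b : le a b \/ le b a.
Proof. by have [<-|<-] := sub_total a b; [left|right]; apply/leP; eexists. Qed.

Lemma lt_nle a b : lt a b <-> ~ le b a.
Proof.
split.
- move=> /leP[d ->] /leP[d']; rewrite addSn -addS -addA -{1}(add0 a).
  by move=> /add_cancel; rewrite addSn => /esym/succ_nz.
- move=> h. have [/leP[d e]|//] := le_total a b.
  have [z|[d' z]] := zero_or_succ d; rewrite z in e.
  + by case: h; rewrite e add0; apply: le_refl.
  + by apply/leP; exists d'; rewrite e addS addSn.
Qed.

Lemma le0 a : le zero a.
Proof. by apply/leP; exists a; rewrite add0n. Qed.

Lemma le_succ a b : le a (succ b) <-> le a b \/ a = succ b.
Proof.
split.
- move=> /leP[d e]. have [z|[d' z]] := zero_or_succ d; rewrite z in e.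
  + by right; rewrite e add0.
  + by left; rewrite addS in e; apply/leP; exists d'; apply: succ_inj.
- move=> [/leP[d ->]|->]; last exact: le_refl.
  by apply/leP; exists (succ d); rewrite addS.
Qed.

Lemma lt_succ a b : lt a (succ b) <-> le a b.
Proof. by rewrite /lt /le subSS. Qed.

Lemma mul_eq0 a b : mul a b = zero -> a = zero \/ b = zero.
Proof.
have [->|[b' ->]] := zero_or_succ b; first by right.
by rewrite mulS => /add_eq0[_ ->]; left.
Qed.

Lemma mul_cancel a b c : mul a (succ c) = mul b (succ c) -> a = b.
Proof.
wlog : a b / le a b => [H|/leP[d ->]].
  by have [h|h] := le_total a b; [apply: H|move=> /esym e; symmetry; apply: H].
rewrite mulDl -{1}(add0 (mul a (succ c))) => /add_cancel/esym/mul_eq0[->|/succ_nz//].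
by rewrite add0.
Qed.

(** A representable characteristic function with zero for truth: the counterpart in the model of a
    quantifier-free formula with parameters. Induction, least elements and choice hold for this
    class. *)
Definition Dec {G} (P : env M G -> Prop) : Prop :=
  exists f : env M G -> N, Rep f /\ forall e, f e = zero <-> P e.

(** A case distinction made in the metatheory; for decidable [P], [Rep_ite] computes it by the
    recursor. *)
Definition ite (P : Prop) a b : N :=
  match excluded_middle_informative P with left _ => a | right _ => b end.

Lemma ite_true (P : Prop) a b : P -> ite P a b = a.
Proof. by rewrite /ite; case: excluded_middle_informative. Qed.

Lemma ite_false (P : Prop) a b : ~ P -> ite P a b = b.
Proof. by rewrite /ite; case: excluded_middle_informative. Qed.

Lemma Dec_ext G (P Q : env M G -> Prop) : (forall e, P e <-> Q e) -> Dec P -> Dec Q.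
Proof. by move=> h [f [hf e]]; exists f; split=> // x; rewrite e. Qed.

(** [P] does not depend on the variables, so one of two constants is its characteristic function,
    whether or not one knows which. *)
Lemma Dec_const G (P : Prop) : Dec (fun _ : env M G => P).
Proof.
have [h|h] := classic P.
- by exists (fun _ => zero); split; [apply: Rep_const|].
- by exists (fun _ => one); split; [apply: Rep_const|move=> _; split=> [/succ_nz|]].
Qed.

Lemma Dec_eq G (f g : env M G -> N) : Rep f -> Rep g -> Dec (fun e => f e = g e).
Proof.
move=> hf hg. exists (fun e => add (sub (f e) (g e)) (sub (g e) (f e))); split.
  by rep.
move=> e; split; first by move=> /add_eq0[]; apply: le_anti.
by move=> ->; have h := le_refl (g e); rewrite /le in h; rewrite h add0.
Qed.

Lemma Dec_le G (f g : env M G -> N) : Rep f -> Rep g -> Dec (fun e => le (f e) (g e)).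
Proof.
move=> hf hg. exists (fun e => sub (f e) (g e)); split=> //. by rep.
Qed.

Lemma Dec_lt G (f g : env M G -> N) : Rep f -> Rep g -> Dec (fun e => lt (f e) (g e)).
Proof.
by move=> hf hg; apply: Dec_le => //; rep.
Qed.

Lemma Dec_and G (P Q : env M G -> Prop) : Dec P -> Dec Q -> Dec (fun e => P e /\ Q e).
Proof.
move=> [f [hf ef]] [g [hg eg]]. exists (fun e => add (f e) (g e)); split.
  by rep.
move=> e; rewrite -ef -eg; split; first exact: add_eq0.
by move=> [-> ->]; rewrite add0.
Qed.

Lemma Rep_ite G (P : env M G -> Prop) (f g : env M G -> N) :
  Dec P -> Rep f -> Rep g -> Rep (fun e => ite (P e) (f e) (g e)).
Proof.
move=> [h [hh eh]] hf hg.
apply: (Rep_ext _ _ _ (fun e => rec (h e) (f e) (\ _ _ : N => g e))) => [e|].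
  have [z|[m z]] := zero_or_succ (h e).
  - by rewrite ite_true ?z ?rec0 // -eh.
  - rewrite ite_false; first by rewrite z recS; betas.
    by rewrite -eh z => /succ_nz.
by rep.
Qed.

Lemma Dec_not G (P : env M G -> Prop) : Dec P -> Dec (fun e => ~ P e).
Proof.
move=> hP. exists (fun e => ite (P e) one zero); split.
  by apply: Rep_ite => //; apply: Rep_const.
move=> e; have [h|h] := classic (P e).
- by rewrite ite_true //; split=> [/succ_nz|].
- by rewrite ite_false.
Qed.

Lemma Dec_or G (P Q : env M G -> Prop) : Dec P -> Dec Q -> Dec (fun e => P e \/ Q e).
Proof.
move=> hP hQ. apply: (Dec_ext _ (fun e => ~ (~ P e /\ ~ Q e))).
  by move=> e; have [h|h] := classic (P e); have [h'|h'] := classic (Q e); tauto.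
apply: Dec_not. by apply: Dec_and; apply: Dec_not.
Qed.

Lemma Dec_imp G (P Q : env M G -> Prop) : Dec P -> Dec Q -> Dec (fun e => P e -> Q e).
Proof.
move=> hP hQ. apply: (Dec_ext _ (fun e => ~ P e \/ Q e)).
  by move=> e; have [h|h] := classic (P e); tauto.
by apply: Dec_or => //; apply: Dec_not.
Qed.

Lemma N_ind (P : N -> Prop) : Dec (fun e : env M (cons o nil) => P (snd e)) ->
  P zero -> (forall n, P n -> P (succ n)) -> forall n, P n.
Proof.
move=> [f [hf ef]] h0 hS n. apply/(ef (tt, n)).
apply: (N_ind_eq (fun n => f (tt, n)) (fun _ => zero)); [|by rep| |].
- by apply: Rep_ext hf => -[[] x].
- by apply/ef.
- by move=> m /ef /hS h; apply/ef.
Qed.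

(** The sum of the characteristic values below the bound vanishes iff each of them does. *)
Lemma Dec_all_lt G (P : env M G -> N -> Prop) (f : env M G -> N) :
  Dec (fun e : env M (cons o G) => P (fst e) (snd e)) -> Rep f ->
  Dec (fun e => forall i, lt i (f e) -> P e i).
Proof.
move=> [g [[h [hh eh]] eg]] hf.
exists (fun e => rec (f e) zero (\ u i => add u (h e $ i))); split.
  by rep.
move=> e. move: (f e) => n.
have e0 : forall n, rec (succ n) zero (\ u i => add u (h e $ i)) =
    add (rec n zero (\ u i => add u (h e $ i))) (h e $ n).
  by move=> k; rewrite recS; betas.
have eP i : h e $ i = zero <-> P e i by rewrite eh eg.
split.
- move=> en i hi.
  (* Vanishing passes from a sum to its initial parts, hence downwards from [n]; the induction runs
     over the distance [m] from [n]. *)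
  have hind : forall m, le m n -> rec (sub n m) zero (\ u i => add u (h e $ i)) = zero.
    apply: N_ind.
    + apply: Dec_imp; [apply: Dec_le|apply: Dec_eq]; by rep.
    + by rewrite sub0.
    + move=> m hm /leP[d ed]. rewrite subS. move: hm.
      have -> : sub n m = succ d by rewrite ed addSn -addS addK.
      rewrite predS e0 => H. apply: (proj1 (add_eq0 _ _ (H _))).
      by apply/leP; exists (succ d); rewrite ed addSn addS.
  move: hi => /leP[d ed].
  have : rec (succ i) zero (\ u i => add u (h e $ i)) = zero.
    rewrite -(addK d (succ i)) addC -ed. apply: hind. apply/leP; exists (succ i).
    by rewrite addC.
  by rewrite e0 => /add_eq0[_ /eP].
- move=> H.
  have : le n n -> rec n zero (\ u i => add u (h e $ i)) = zero; last by apply; apply: le_refl.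
  have : forall k, le k n -> rec k zero (\ u i => add u (h e $ i)) = zero; last by apply.
  apply: N_ind.
  + apply: Dec_imp; [apply: Dec_le|apply: Dec_eq]; by rep.
  + by rewrite rec0.
  + move=> m hm hn. rewrite e0 hm; first by rewrite add0n; apply/eP/H.
    by apply: le_trans hn; apply/le_succ; left; apply: le_refl.
Qed.

Lemma Dec_all_le G (P : env M G -> N -> Prop) (f : env M G -> N) :
  Dec (fun e : env M (cons o G) => P (fst e) (snd e)) -> Rep f ->
  Dec (fun e => forall i, le i (f e) -> P e i).
Proof.
move=> hP hf. apply: (Dec_ext _ (fun e => forall i, lt i (succ (f e)) -> P e i)).
  by move=> e; split=> h i; [move/lt_succ|move/lt_succ]; apply: h.
by apply: Dec_all_lt => //; rep.
Qed.

Lemma Dec_ex_lt G (P : env M G -> N -> Prop) (f : env M G -> N) :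
  Dec (fun e : env M (cons o G) => P (fst e) (snd e)) -> Rep f ->
  Dec (fun e => exists i, lt i (f e) /\ P e i).
Proof.
move=> hP hf. apply: (Dec_ext _ (fun e => ~ forall i, lt i (f e) -> ~ P e i)).
  move=> e; split=> [h|[i [h1 h2]] H]; last exact: H h2.
  apply: NNPP => H; apply: h => i h1 h2; apply: H; by exists i.
by apply: Dec_not; apply: (Dec_all_lt _ (fun e i => ~ P e i)) => //; apply: Dec_not.
Qed.

Lemma Dec_ex_le G (P : env M G -> N -> Prop) (f : env M G -> N) :
  Dec (fun e : env M (cons o G) => P (fst e) (snd e)) -> Rep f ->
  Dec (fun e => exists i, le i (f e) /\ P e i).
Proof.
move=> hP hf. apply: (Dec_ext _ (fun e => exists i, lt i (succ (f e)) /\ P e i)).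
  by move=> e; split=> -[i [/lt_succ h1 h2]]; exists i.
by apply: Dec_ex_lt => //; rep.
Qed.

(** Without a least element, induction on [k] shows that none lies below [k]; this is decidable
    because the quantifier is bounded. *)
Lemma N_least (P : N -> Prop) : Dec (fun e : env M (cons o nil) => P (snd e)) ->
  (exists n, P n) -> exists n, P n /\ forall i, lt i n -> ~ P i.
Proof.
move=> hP [n hn]. apply: NNPP => H.
have : forall k i, lt i k -> ~ P i.
  apply: N_ind.
  - apply: (Dec_all_lt _ (fun e i => ~ P i)); last by rep.
    apply: Dec_not. case: hP => f [hf ef].
    exists (fun e => f (tt, snd e)); split; last by move=> e; apply: ef.
    case: hf => g [_ eg]. apply: (Rep_ext _ (cons o (cons o nil)) _ (fun e => g tt $ snd e)).
      by move=> e; apply: eg.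
    by rep.
  - by move=> i /lt_nle; case; apply: le0.
  - move=> k hk i hi. have [->|ne] := classic (i = k).
      by move=> hPk; apply: H; exists k.
    apply: hk. apply/lt_nle => ki. apply: ne. apply: le_anti => //.
    exact/lt_succ.
by move=> /(_ (succ n) n); apply=> //; apply/lt_succ; apply: le_refl.
Qed.

Lemma choice1 (P : M (o ~> o) -> N -> Prop) :
  Dec (fun e : env M (cons o (cons (o ~> o) nil)) => P (snd (fst e)) (snd e)) ->
  (forall x, exists n, P x n) -> exists Y : M ((o ~> o) ~> o), forall x, P x (Y $ x).
Proof.
move=> [f [[g [[h [_ eh]] eg]] ef]] H.
have e x n : h tt $ x $ n = zero <-> P x n by rewrite eh eg ef.
have [Y hY] := M_qfac M (h tt) (fun x => let: ex_intro n hn := H x in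
  ex_intro _ n (proj2 (e x n) hn)).
by exists Y => x; apply/e.
Qed.

(** Choice over numbers from choice over sequences: a number is passed as the constant sequence. *)
Lemma choice0 (P : N -> N -> Prop) :
  Dec (fun e : env M (cons o (cons o nil)) => P (snd (fst e)) (snd e)) ->
  (forall n, exists m, P n m) -> exists g : M (o ~> o), forall n, P n (g $ n).
Proof.
move=> [f [[g [[h [_ eh]] eg]] ef]] H.
have e n m : h tt $ n $ m = zero <-> P n m by rewrite eh eg ef.
have [||Y hY] := choice1 (fun x m => P (x $ zero) m).
- exists (fun e => h tt $ (snd (fst e) $ zero) $ snd e); split; first by rep.
  by move=> x; apply: e.
- by move=> x; apply: H.
exists (\ n => Y $ (s_K o o $ n)) => n. rewrite beta; last by rep.
by have := hY (s_K o o $ n); rewrite M_K.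
Qed.

End Numbers.
Arguments Dec {M G}.
Arguments ite {M}.

Ltac dec_step :=
  cbn beta;
  lazymatch goal with
  | |- @Dec ?M ?G (fun _ => ?P) => refine (Dec_const M G P)
  | |- @Dec ?M ?G (fun e => @?f e = @?g e) => refine (Dec_eq M G f g _ _)
  | |- @Dec ?M ?G (fun e => le (@?f e) (@?g e)) => refine (Dec_le M G f g _ _)
  | |- @Dec ?M ?G (fun e => lt (@?f e) (@?g e)) => refine (Dec_lt M G f g _ _)
  | |- @Dec ?M ?G (fun e => ~ @?P e) => refine (Dec_not M G P _)
  | |- @Dec ?M ?G (fun e => @?P e /\ @?Q e) => refine (Dec_and M G P Q _ _)
  | |- @Dec ?M ?G (fun e => @?P e \/ @?Q e) => refine (Dec_or M G P Q _ _)
  | |- @Dec ?M ?G (fun e => forall i, lt i (@?f e) -> @?P e i) => refine (Dec_all_lt M G P f _ _)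
  | |- @Dec ?M ?G (fun e => forall i, le i (@?f e) -> @?P e i) => refine (Dec_all_le M G P f _ _)
  | |- @Dec ?M ?G (fun e => exists i, lt i (@?f e) /\ @?P e i) => refine (Dec_ex_lt M G P f _ _)
  | |- @Dec ?M ?G (fun e => exists i, le i (@?f e) /\ @?P e i) => refine (Dec_ex_le M G P f _ _)
  | |- @Dec ?M ?G (fun e => @?P e -> @?Q e) => refine (Dec_imp M G P Q _ _)
  end.
Ltac rep_atom :=
  first [assumption | rep_step
    | lazymatch goal with
      | |- @Rep ?M ?G _ (fun e => ite (@?P e) (@?f e) (@?g e)) => refine (Rep_ite M G P f g _ _ _)
      end
    | dec_step ].
Ltac dec := intros; rep_unfold; repeat rep_atom.

End Arithmetic.

(** * Ordered fields from presentations *)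

Module Quotients.
Import HB.structures.
Import ssreflect ssrfun ssrbool eqtype choice ssralg ssrnum order boolp.
Import GRing.Theory Num.Theory.
Import Classical ClassicalEpsilon FunctionalExtensionality PropExtensionality ProofIrrelevance.
Set Implicit Arguments.
Unset Strict Implicit.
Unset Printing Implicit Defensive.

(* Presentation of an ordered field as a quotient: the axioms hold up to [pf_eq]. *)
Record prefield := {
  pf_T : Type;
  pf_eq : pf_T -> pf_T -> Prop;
  pf_zero : pf_T;
  pf_one : pf_T;
  pf_add : pf_T -> pf_T -> pf_T;
  pf_opp : pf_T -> pf_T;
  pf_mul : pf_T -> pf_T -> pf_T;
  pf_ge0 : pf_T -> Prop;
  pf_refl : forall x, pf_eq x x;
  pf_sym : forall x y, pf_eq x y -> pf_eq y x;
  pf_trans : forall x y z, pf_eq x y -> pf_eq y z -> pf_eq x z;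
  pf_add_eq : forall x x' y y', pf_eq x x' -> pf_eq y y' -> pf_eq (pf_add x y) (pf_add x' y');
  pf_opp_eq : forall x x', pf_eq x x' -> pf_eq (pf_opp x) (pf_opp x');
  pf_mul_eq : forall x x' y y', pf_eq x x' -> pf_eq y y' -> pf_eq (pf_mul x y) (pf_mul x' y');
  pf_ge0_eq : forall x x', pf_eq x x' -> pf_ge0 x -> pf_ge0 x';
  pf_addA : forall x y z, pf_eq (pf_add x (pf_add y z)) (pf_add (pf_add x y) z);
  pf_addC : forall x y, pf_eq (pf_add x y) (pf_add y x);
  pf_add0 : forall x, pf_eq (pf_add pf_zero x) x;
  pf_addN : forall x, pf_eq (pf_add (pf_opp x) x) pf_zero;
  pf_mulA : forall x y z, pf_eq (pf_mul x (pf_mul y z)) (pf_mul (pf_mul x y) z);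
  pf_mulC : forall x y, pf_eq (pf_mul x y) (pf_mul y x);
  pf_mul1 : forall x, pf_eq (pf_mul pf_one x) x;
  pf_mulD : forall x y z, pf_eq (pf_mul (pf_add x y) z) (pf_add (pf_mul x z) (pf_mul y z));
  pf_one_nz : ~ pf_eq pf_one pf_zero;
  pf_inv : forall x, ~ pf_eq x pf_zero -> exists y, pf_eq (pf_mul y x) pf_one;
  pf_ge0_add : forall x y, pf_ge0 x -> pf_ge0 y -> pf_ge0 (pf_add x y);
  pf_ge0_mul : forall x y, pf_ge0 x -> pf_ge0 y -> pf_ge0 (pf_mul x y);
  pf_ge0_anti : forall x, pf_ge0 x -> pf_ge0 (pf_opp x) -> pf_eq x pf_zero;
  pf_ge0_total : forall x, pf_ge0 x \/ pf_ge0 (pf_opp x)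
}.

Section Quotient.
Variable P : prefield.
Notation T := (pf_T P).
Notation E := (@pf_eq P).

Definition pf_quot : Type := {A : T -> Prop | exists x, A = E x}.

Definition pf_cls (x : T) : pf_quot := exist _ (E x) (ex_intro _ x erefl).

Lemma pf_quot_eq (p q : pf_quot) : proj1_sig p = proj1_sig q -> p = q.
Proof.
by case: p q => [A hA] [B hB] /= e; subst B; congr exist; apply: proof_irrelevance.
Qed.

Lemma pf_clsP x y : pf_cls x = pf_cls y <-> E x y.
Proof.
split.
- move=> /(f_equal (@proj1_sig _ _)) /= e.
  have : E y y by exact: pf_refl.
  by rewrite -e.
- move=> h. apply: pf_quot_eq => /=. apply: functional_extensionality => z.
  apply: propositional_extensionality.
  by split=> h'; [apply: pf_trans h'; apply: pf_sym|apply: pf_trans h'].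
Qed.

Lemma pf_cls_surj q : exists x, q = pf_cls x.
Proof.
by have [x e] := proj2_sig q; exists x; apply: pf_quot_eq.
Qed.

Definition pf_rep q : T := proj1_sig (constructive_indefinite_description _ (pf_cls_surj q)).

Lemma pf_repK q : pf_cls (pf_rep q) = q.
Proof. by rewrite /pf_rep; case: constructive_indefinite_description. Qed.

Lemma pf_rep_cls x : E (pf_rep (pf_cls x)) x.
Proof. by apply/pf_clsP; rewrite pf_repK. Qed.

Definition q_add x y := pf_cls (pf_add (pf_rep x) (pf_rep y)).
Definition q_opp x := pf_cls (pf_opp (pf_rep x)).
Definition q_mul x y := pf_cls (pf_mul (pf_rep x) (pf_rep y)).
Definition q_ge0 x := pf_ge0 (pf_rep x).

Lemma q_addE x y : q_add (pf_cls x) (pf_cls y) = pf_cls (pf_add x y).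
Proof. by apply/pf_clsP; apply: pf_add_eq; apply: pf_rep_cls. Qed.

Lemma q_oppE x : q_opp (pf_cls x) = pf_cls (pf_opp x).
Proof. by apply/pf_clsP; apply: pf_opp_eq; apply: pf_rep_cls. Qed.

Lemma q_mulE x y : q_mul (pf_cls x) (pf_cls y) = pf_cls (pf_mul x y).
Proof. by apply/pf_clsP; apply: pf_mul_eq; apply: pf_rep_cls. Qed.

Lemma q_ge0E x : q_ge0 (pf_cls x) <-> pf_ge0 x.
Proof.
by split; apply: pf_ge0_eq; [apply: pf_rep_cls|apply: pf_sym; apply: pf_rep_cls].
Qed.

Ltac q_cls := repeat match goal with x : pf_quot |- _ =>
  let y := fresh x in have [y ->] := pf_cls_surj x; clear x; rename y into x end;
  rewrite ?(q_addE, q_mulE, q_oppE).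

Lemma q_addA : associative q_add.
Proof. move=> x y z. q_cls. apply/pf_clsP. exact: pf_addA. Qed.

Lemma q_addC : commutative q_add.
Proof. move=> x y. q_cls. apply/pf_clsP. exact: pf_addC. Qed.

Lemma q_add0 : left_id (pf_cls (pf_zero P)) q_add.
Proof. move=> x. q_cls. apply/pf_clsP. exact: pf_add0. Qed.

Lemma q_addN : left_inverse (pf_cls (pf_zero P)) q_opp q_add.
Proof. move=> x. q_cls. apply/pf_clsP. exact: pf_addN. Qed.

Lemma q_mulA : associative q_mul.
Proof. move=> x y z. q_cls. apply/pf_clsP. exact: pf_mulA. Qed.

Lemma q_mulC : commutative q_mul.
Proof. move=> x y. q_cls. apply/pf_clsP. exact: pf_mulC. Qed.

Lemma q_mul1 : left_id (pf_cls (pf_one P)) q_mul.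
Proof. move=> x. q_cls. apply/pf_clsP. exact: pf_mul1. Qed.

Lemma q_mulD : left_distributive q_mul q_add.
Proof. move=> x y z. q_cls. apply/pf_clsP. exact: pf_mulD. Qed.

HB.instance Definition _ := gen_eqMixin pf_quot.
HB.instance Definition _ := gen_choiceMixin pf_quot.
HB.instance Definition _ := GRing.isZmodule.Build pf_quot q_addA q_addC q_add0 q_addN.

Lemma q_one_nz : pf_cls (pf_one P) != 0%R.
Proof. by apply/eqP => /pf_clsP; apply: pf_one_nz. Qed.

HB.instance Definition _ := GRing.Zmodule_isComNzRing.Build pf_quot
  q_mulA q_mulC q_mul1 q_mulD q_one_nz.

Lemma q_inv_ex (x : pf_quot) :
  exists y : pf_quot, (x <> 0%R -> q_mul y x = pf_cls (pf_one P)) /\ (x = 0%R -> y = 0%R).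
Proof.
have [h|hx] := classic (x = 0%R); first by exists 0%R; split=> // /(_ h).
move: hx. q_cls. move=> hx. have [|y hy] := @pf_inv P x.
  by move=> h; case: hx; apply/pf_clsP.
by exists (pf_cls y); split=> // _; rewrite q_mulE; apply/pf_clsP.
Qed.

Definition q_inv (x : pf_quot) : pf_quot :=
  proj1_sig (constructive_indefinite_description _ (q_inv_ex x)).

Lemma q_mulVf (x : pf_quot) : x != 0%R -> (q_inv x * x = 1)%R.
Proof.
move=> /eqP hx. rewrite /q_inv. case: constructive_indefinite_description => y /= [h _].
exact: h.
Qed.

Lemma q_inv0 : q_inv 0%R = 0%R.
Proof. by rewrite /q_inv; case: constructive_indefinite_description => y /= [_]; apply. Qed.

HB.instance Definition _ := GRing.ComNzRing_isField.Build pf_quot q_mulVf q_inv0.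

Open Scope ring_scope.

Definition q_le (x y : pf_quot) : bool := `[< q_ge0 (y - x) >].
Definition q_lt (x y : pf_quot) : bool := (y != x) && q_le x y.
Definition q_norm (x : pf_quot) : pf_quot := if q_le 0 x then x else - x.

Lemma q_le0 (x : pf_quot) : q_le 0 x <-> q_ge0 x.
Proof. by rewrite /q_le subr0; split=> [/asboolP|h]; last apply/asboolP. Qed.

Lemma q_le0_add (x y : pf_quot) : q_le 0 x -> q_le 0 y -> q_le 0 (x + y).
Proof.
rewrite !q_le0. q_cls. rewrite [(_ + _)%R]q_addE !q_ge0E. exact: pf_ge0_add.
Qed.

Lemma q_le0_mul (x y : pf_quot) : q_le 0 x -> q_le 0 y -> q_le 0 (x * y).
Proof.
rewrite !q_le0. q_cls. rewrite [(_ * _)%R]q_mulE !q_ge0E. exact: pf_ge0_mul.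
Qed.

Lemma q_sub_ge0 (x y : pf_quot) : q_le 0 (y - x) = q_le x y.
Proof. by rewrite /q_le subr0. Qed.

Lemma q_le0_anti (x : pf_quot) : q_le 0 x -> q_le x 0 -> x = 0.
Proof.
rewrite -[q_le x 0]q_sub_ge0 sub0r !q_le0. q_cls. rewrite [(- _)%R]q_oppE !q_ge0E => h1 h2.
by apply/pf_clsP; apply: pf_ge0_anti.
Qed.

Lemma q_le0_total (x : pf_quot) : q_le 0 x || q_le x 0.
Proof.
apply/orP. rewrite -[q_le x 0]q_sub_ge0 sub0r !q_le0. q_cls.
by rewrite [(- _)%R]q_oppE !q_ge0E; apply: pf_ge0_total.
Qed.

Lemma q_ge0_norm (x : pf_quot) : q_le 0 x -> q_norm x = x.
Proof. by rewrite /q_norm => ->. Qed.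

Lemma q_normN (x : pf_quot) : q_norm (- x) = q_norm x.
Proof.
rewrite /q_norm opprK. have := q_le0_total x. rewrite -[q_le x 0]q_sub_ge0 sub0r.
case h1 : (q_le 0 x); case h2 : (q_le 0 (- x)) => //= _.
have -> : x = 0 by apply: q_le0_anti => //; rewrite -q_sub_ge0 sub0r.
exact: oppr0.
Qed.

HB.instance Definition _ := Num.IntegralDomain_isLeReal.Build pf_quot
  q_le0_add q_le0_mul q_le0_anti q_sub_ge0 q_le0_total q_normN q_ge0_norm
  (fun _ _ => erefl : q_lt _ _ = _).

Definition pf_field : realFieldType := pf_quot.

Lemma pf_clsD x y : pf_cls (pf_add x y) = pf_cls x + pf_cls y :> pf_field.
Proof. by rewrite -q_addE. Qed.

Lemma pf_clsM x y : pf_cls (pf_mul x y) = pf_cls x * pf_cls y :> pf_field.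
Proof. by rewrite -q_mulE. Qed.

Lemma pf_clsN x : pf_cls (pf_opp x) = - pf_cls x :> pf_field.
Proof. by rewrite -q_oppE. Qed.

Lemma pf_cls_ge0 x : (0 <= pf_cls x :> pf_field) <-> pf_ge0 x.
Proof. by rewrite -q_ge0E -q_le0. Qed.

Lemma pf_cls_le x y : (pf_cls x <= pf_cls y :> pf_field) <-> pf_ge0 (pf_add y (pf_opp x)).
Proof. by rewrite -pf_cls_ge0 pf_clsD pf_clsN subr_ge0. Qed.

End Quotient.
End Quotients.

(** * Fractions over the numbers of a model *)

Module Fractions.
Import ssreflect ssrfun Setoid Ring Classical.
Import Completeness Semantics Interpretation Arithmetic Quotients.

Section Fractions.
Variable M : model.
Notation N := (M o).
Add Ring N_ring : (N_semiring M).

(* ((a, b), c) stands for (a - b)/(1 + c). *)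
Notation T := (N * N * N)%type.
Notation "x +' y" := (add x y) (at level 50).
Notation "x *' y" := (mul x y) (at level 40).
Let den (x : T) : N := one +' snd x.
Let num (x : T) : N := fst (fst x).
Let neg (x : T) : N := snd (fst x).

(** Cross-multiplication with the negative parts moved to the other side, as the numbers of the
    model form only a semiring. *)
Definition fr_eq (x y : T) : Prop :=
  (num x *' den y) +' (neg y *' den x) = (num y *' den x) +' (neg x *' den y).
(** This is [(1 + c)(1 + c') - 1], written without subtraction. *)
Definition fr_den (x y : T) : N := (snd x *' snd y) +' (snd x +' snd y).
Definition fr_add (x y : T) : T :=
  ((num x *' den y) +' (num y *' den x), (neg x *' den y) +' (neg y *' den x), fr_den x y).
Definition fr_opp (x : T) : T := (neg x, num x, snd x).
Definition fr_mul (x y : T) : T :=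
  ((num x *' num y) +' (neg x *' neg y), (num x *' neg y) +' (neg x *' num y), fr_den x y).
Definition fr_ge0 (x : T) : Prop := le (neg x) (num x).
Definition fr_nat (n : N) : T := (n, zero, zero).

Lemma den_nz x : den x <> zero.
Proof. by rewrite /den /one addSn => /succ_nz. Qed.

Lemma mul_den_cancel x a b : a *' den x = b *' den x -> a = b.
Proof. rewrite /den /one addSn. exact: mul_cancel. Qed.

Lemma add_cancel_r a b c : a +' c = b +' c -> a = b :> N.
Proof. by rewrite !(addC _ _ c); apply: add_cancel. Qed.

Ltac fr := intros; rewrite /fr_eq /fr_add /fr_opp /fr_mul /fr_den /den /num /neg /=; ring.

(** The two equations are brought to a common denominator and added; the terms with the numerator of
    [y], and at last its denominator, cancel. *)
Lemma fr_trans x y z : fr_eq x y -> fr_eq y z -> fr_eq x z.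
Proof.
rewrite /fr_eq => h1 h2. apply: (mul_den_cancel y).
apply: (add_cancel_r _ _ ((neg y *' den x *' den z) +' (num y *' den x *' den z))).
transitivity (add (mul (add (mul (num x) (den y)) (mul (neg y) (den x))) (den z))
  (mul (add (mul (num y) (den z)) (mul (neg z) (den y))) (den x))); first by ring.
rewrite h1 h2. ring.
Qed.

Lemma fr_sym x y : fr_eq x y -> fr_eq y x.
Proof. by rewrite /fr_eq => h; rewrite h. Qed.

Lemma fr_add_eq x x' y y' : fr_eq x x' -> fr_eq y y' -> fr_eq (fr_add x y) (fr_add x' y').
Proof.
rewrite /fr_eq => h1 h2.
transitivity (add (mul (add (mul (num x) (den x')) (mul (neg x') (den x))) (mul (den y) (den y')))
  (mul (add (mul (num y) (den y')) (mul (neg y') (den y))) (mul (den x) (den x')))).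
  by fr.
rewrite h1 h2. by fr.
Qed.

Lemma fr_opp_eq x x' : fr_eq x x' -> fr_eq (fr_opp x) (fr_opp x').
Proof.
rewrite /fr_eq /fr_opp /num /neg /den /= => h. by rewrite addC -h addC.
Qed.

Lemma fr_mulC x y : fr_eq (fr_mul x y) (fr_mul y x).
Proof. by fr. Qed.

Lemma fr_mul_eq_l x x' y : fr_eq x x' -> fr_eq (fr_mul x y) (fr_mul x' y).
Proof.
rewrite /fr_eq => h.
transitivity (add
  (mul (add (mul (num x) (den x')) (mul (neg x') (den x))) (mul (num y) (den y)))
  (mul (add (mul (num x') (den x)) (mul (neg x) (den x'))) (mul (neg y) (den y)))).
  by fr.
transitivity (add
  (mul (add (mul (num x') (den x)) (mul (neg x) (den x'))) (mul (num y) (den y)))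
  (mul (add (mul (num x) (den x')) (mul (neg x') (den x))) (mul (neg y) (den y)))).
  by rewrite h.
by fr.
Qed.

Lemma fr_mul_eq x x' y y' : fr_eq x x' -> fr_eq y y' -> fr_eq (fr_mul x y) (fr_mul x' y').
Proof.
move=> h1 h2. apply: fr_trans (fr_mul_eq_l _ _ _ h1) _.
apply: fr_trans (fr_mulC _ _) _. apply: fr_trans (fr_mul_eq_l _ _ _ h2) _.
exact: fr_mulC.
Qed.

Lemma fr_ge0_eq x x' : fr_eq x x' -> fr_ge0 x -> fr_ge0 x'.
Proof.
rewrite /fr_eq /fr_ge0 => h /leP[e he]. rewrite he in h.
have [//|/leP[f hf]] := le_total _ (neg x') (num x').
have : e *' den x' +' f *' den x = zero.
  apply: (add_cancel_r _ _ ((neg x *' den x') +' (num x' *' den x))).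
  rewrite add0n [RHS]addC -h hf. ring.
move=> /add_eq0[_ /mul_eq0[e0|/den_nz//]]. rewrite hf e0 add0. exact: le_refl.
Qed.

Lemma fr_inv x : ~ fr_eq x (fr_nat zero) -> exists y, fr_eq (fr_mul y x) (fr_nat one).
Proof.
move=> h. have [/leP[e he]|/leP[e he]] := le_total _ (neg x) (num x);
  have [z|[e' z]] := zero_or_succ _ e; rewrite z in he.
- by case: h; rewrite /fr_eq he; fr.
- exists (den x, zero, e').
  have {z}z : num x = neg x +' (one +' e') by rewrite he /one addSn add0n.
  move: z; rewrite /fr_eq /fr_mul /fr_den /den /num /neg /= => ->. by fr.
- by case: h; rewrite /fr_eq he; fr.
- exists (zero, den x, e').
  have {z}z : neg x = num x +' (one +' e') by rewrite he /one addSn add0n.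
  move: z; rewrite /fr_eq /fr_mul /fr_den /den /num /neg /= => ->. by fr.
Qed.

Lemma fr_ge0_add x y : fr_ge0 x -> fr_ge0 y -> fr_ge0 (fr_add x y).
Proof.
rewrite /fr_ge0 => /leP[e he] /leP[f hf]. apply/leP.
exists (e *' den y +' f *' den x).
by rewrite /fr_add /num /neg /= -/(num x) -/(num y) -/(neg x) -/(neg y) he hf; ring.
Qed.

Lemma fr_ge0_mul x y : fr_ge0 x -> fr_ge0 y -> fr_ge0 (fr_mul x y).
Proof.
rewrite /fr_ge0 => /leP[e he] /leP[f hf]. apply/leP.
exists (e *' f).
by rewrite /fr_mul /num /neg /= -/(num x) -/(num y) -/(neg x) -/(neg y) he hf; ring.
Qed.

Lemma fr_ge0_anti x : fr_ge0 x -> fr_ge0 (fr_opp x) -> fr_eq x (fr_nat zero).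
Proof.
rewrite /fr_ge0 /fr_eq => h1 h2. have -> : num x = neg x by apply: le_anti.
by rewrite /den /num /neg /=; ring.
Qed.

Lemma fr_nat_add a b : fr_eq (fr_nat (a +' b)) (fr_add (fr_nat a) (fr_nat b)).
Proof. by fr. Qed.

Lemma fr_nat_mul a b : fr_eq (fr_nat (a *' b)) (fr_mul (fr_nat a) (fr_nat b)).
Proof. by fr. Qed.

Lemma fr_nat_inj a b : fr_eq (fr_nat a) (fr_nat b) -> a = b.
Proof. by rewrite /fr_eq /fr_nat /den /num /neg /= => h; ring [h]. Qed.

Lemma fr_split a b c : fr_eq (fr_add (fr_mul (a, b, c) (fr_nat (one +' c))) (fr_nat b)) (fr_nat a).
Proof. by fr. Qed.

Definition Q_pre : prefield.
Proof.
refine {| pf_T := T; pf_eq := fr_eq; pf_zero := fr_nat zero; pf_one := fr_nat one;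
  pf_add := fr_add; pf_opp := fr_opp; pf_mul := fr_mul; pf_ge0 := fr_ge0;
  pf_sym := fr_sym; pf_trans := fr_trans; pf_add_eq := fr_add_eq;
  pf_opp_eq := fr_opp_eq; pf_mul_eq := fr_mul_eq; pf_ge0_eq := fr_ge0_eq;
  pf_mulC := fr_mulC; pf_inv := fr_inv; pf_ge0_add := fr_ge0_add;
  pf_ge0_mul := fr_ge0_mul; pf_ge0_anti := fr_ge0_anti |}; try solve [fr].
- move=> h. have : one = zero :> N by move: h; rewrite /fr_eq /den /num /neg /= => h; ring [h].
  exact: succ_nz.
- by move=> x; apply: le_total.
Defined.

End Fractions.
End Fractions.

(** * The field of rationals of a model, and values of codes *)

Module Rationals.
Import ssreflect ssrfun ssrbool eqtype choice ssralg ssrnum order ring lra.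
Import GRing.Theory Num.Theory.
Import Classical ClassicalEpsilon.
Import Completeness Semantics Interpretation Arithmetic Quotients Fractions.
Local Open Scope model_scope.
Local Open Scope ring_scope.
Arguments pi1 {M}.
Arguments pi2 {M}.
Arguments pair {M}.
Arguments tri {M}.
Arguments diag {M}.
Arguments rat {M}.
Arguments qpos {M}.
Arguments qneg {M}.
Arguments qden {M}.
Arguments qadd {M}.
Arguments qopp {M}.
Arguments qsub {M}.
Arguments qabs {M}.
Arguments qlt {M}.
Arguments qnat {M}.
Arguments qexp {M}.

Set Implicit Arguments.
Unset Strict Implicit.

(* The witness [the_rationals] is opaque so that conversion never unfolds the field. *)
Record rationals (M : model) := {
  rq_field : realFieldType;
  rq_iota : M Defs.o -> rq_field;
  rq_0 : rq_iota zero = 0;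
  rq_1 : rq_iota one = 1;
  rq_D : forall a b, rq_iota (add a b) = rq_iota a + rq_iota b;
  rq_M : forall a b, rq_iota (mul a b) = rq_iota a * rq_iota b;
  rq_ge0 : forall a, 0 <= rq_iota a;
  rq_inj : forall a b, rq_iota a = rq_iota b -> a = b;
  rq_frac : forall q, exists a b c, q * (1 + rq_iota c) = rq_iota a - rq_iota b
}.

Lemma the_rationals (M : model) : rationals M.
Proof.
pose Q : realFieldType := pf_field (Q_pre M).
pose io (n : M Defs.o) : Q := @pf_cls (Q_pre M) (fr_nat M n).
have ioD a b : io (add a b) = io a + io b.
  apply: etrans (pf_clsD (P := Q_pre M) _ _). apply/(pf_clsP (P := Q_pre M)). exact: fr_nat_add.
have ioM a b : io (mul a b) = io a * io b.
  apply: etrans (pf_clsM (P := Q_pre M) _ _). apply/(pf_clsP (P := Q_pre M)). exact: fr_nat_mul.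
apply: (@Build_rationals M Q io) => //.
- by move=> a; apply/(pf_cls_ge0 (P := Q_pre M)); apply: le0.
- by move=> a b /(pf_clsP (P := Q_pre M)); apply: fr_nat_inj.
- move=> q. have [[[a b] c] ->] := pf_cls_surj (P := Q_pre M) q. exists a, b, c.
have io1 : io one = 1 by [].
  have h : pf_cls (P := Q_pre M) (a, b, c) * io (add one c) + io b = io a :> Q.
    apply: etrans (_ : @pf_cls (Q_pre M) (fr_add M (fr_mul M (a, b, c)
      (fr_nat M (add one c))) (fr_nat M b)) = _).
      by rewrite (pf_clsD (P := Q_pre M)) (pf_clsM (P := Q_pre M)).
    by apply/(pf_clsP (P := Q_pre M)); apply: fr_split.
  by rewrite -io1 -ioD -h addrK.
Qed.

Definition Qf (M : model) : realFieldType := rq_field (the_rationals M).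

Section Iota.
Variable M : model.
Notation N := (M Defs.o).
Notation Q := (Qf M).
Implicit Types a b c d m n : N.

Definition iota n : Q := rq_iota (the_rationals M) n.

Lemma iota0 : iota zero = 0.
Proof. exact: rq_0. Qed.

Lemma iota1 : iota one = 1.
Proof. exact: rq_1. Qed.

Lemma iotaD a b : iota (add a b) = iota a + iota b.
Proof. exact: rq_D. Qed.

Lemma iotaM a b : iota (mul a b) = iota a * iota b.
Proof. exact: rq_M. Qed.

Lemma iota_ge0 a : 0 <= iota a.
Proof. exact: rq_ge0. Qed.

Lemma iota_inj a b : iota a = iota b -> a = b.
Proof. exact: rq_inj. Qed.

Lemma frac_surj (q : Q) : exists a b c, q * (1 + iota c) = iota a - iota b.
Proof. exact: rq_frac. Qed.

Lemma iotaS a : iota (succ a) = iota a + 1.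
Proof. by rewrite -iota1 -iotaD /one addS add0. Qed.

Lemma iota_le a b : le a b <-> (iota a <= iota b).
Proof.
split=> [/leP[d ->]|h]; first by rewrite iotaD; have := iota_ge0 d; lra.
have [//|/leP[d e]] := le_total _ a b.
move: h; rewrite e iotaD => h.
have /iota_inj -> : iota d = iota zero by have := iota_ge0 d; rewrite iota0; lra.
by rewrite add0; apply: le_refl.
Qed.

Lemma iota_lt a b : lt a b <-> (iota a + 1 <= iota b).
Proof. by rewrite -iotaS; apply: iota_le. Qed.

Lemma iota_nlt a b : iota a < iota b <-> (iota a + 1 <= iota b).
Proof.
split; last by lra.
move=> h; apply/iota_lt/lt_nle => /iota_le. by lra.
Qed.

Lemma iota_sub a b : le b a -> iota (sub a b) = iota a - iota b.
Proof. by move=> /leP[d ->]; rewrite addK iotaD; lra. Qed.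

Lemma sub_eq0 a b : le a b -> sub a b = zero.
Proof. by []. Qed.

Lemma den_gt0 c : 0 < 1 + iota c.
Proof. by have := iota_ge0 c; lra. Qed.

Definition frac a b c : Q := (iota a - iota b) / (1 + iota c).

Lemma fracP (q : Q) : exists a b c, q = frac a b c.
Proof.
have [a [b [c e]]] := frac_surj q. exists a, b, c. rewrite /frac -e mulfK //.
by have := den_gt0 c; lra.
Qed.

Lemma pow20 : iota (pow2 zero) = 1.
Proof. by rewrite /pow2 /pow2T; betas; rewrite rec0 iota1. Qed.

Lemma pow2S n : iota (pow2 (succ n)) = 2 * iota (pow2 n).
Proof.
rewrite /pow2 /pow2T; betas; rewrite recS; betas; rewrite iotaD; lra.
Qed.

Lemma N_ind_le (f g : N -> N) :
  Rep (fun e : env M (cons Defs.o nil) => f (snd e)) ->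
  Rep (fun e : env M (cons Defs.o nil) => g (snd e)) ->
  iota (f zero) <= iota (g zero) ->
  (forall n, iota (f n) <= iota (g n) -> iota (f (succ n)) <= iota (g (succ n))) ->
  forall n, iota (f n) <= iota (g n).
Proof.
move=> hf hg h0 hS n. apply/iota_le. move: n. apply: N_ind.
- exact: Dec_le.
- exact/iota_le.
- by move=> n /iota_le h; apply/iota_le/hS.
Qed.

Arguments N_ind_le : clear implicits.

Lemma pow2_gt n : iota n + 1 <= iota (pow2 n).
Proof.
rewrite -iotaS. apply: (N_ind_le (fun n => succ n) (fun n => pow2 n)); [by rep..| |].
- by rewrite pow20 iotaS iota0; lra.
- by move=> m; rewrite pow2S !iotaS; have := iota_ge0 m; lra.
Qed.

Lemma pow2D m n : iota (pow2 (add m n)) = iota (pow2 m) * iota (pow2 n).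
Proof.
rewrite -iotaM; congr iota.
apply: (N_ind_eq _ (fun n => pow2 (add m n)) (fun n => mul (pow2 m) (pow2 n))); [by rep..| |].
- by apply: iota_inj; rewrite iotaM add0 pow20; lra.
- by move=> k h; apply: iota_inj; rewrite addS pow2S h !iotaM pow2S; lra.
Qed.

Definition hf n : Q := (iota (pow2 n))^-1.

Lemma pow2_gt0 n : 0 < iota (pow2 n).
Proof. by have := pow2_gt n; have := iota_ge0 n; lra. Qed.

Lemma hf_gt0 n : 0 < hf n.
Proof. by rewrite invr_gt0 pow2_gt0. Qed.

Lemma hf_pow2 n : hf n * iota (pow2 n) = 1.
Proof. by rewrite mulVf //; have := pow2_gt0 n; lra. Qed.

Lemma hf0 : hf zero = 1.
Proof. by rewrite /hf pow20 invr1. Qed.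

Lemma hfS n : hf (succ n) = hf n / 2.
Proof. by rewrite /hf pow2S invfM; lra. Qed.

Lemma hfD m n : hf (add m n) = hf m * hf n.
Proof. by rewrite /hf pow2D invfM. Qed.

Lemma hf_le1 n : hf n <= 1.
Proof. by have := hf_pow2 n; have := pow2_gt n; have := iota_ge0 n; have := hf_gt0 n; nra. Qed.

Lemma hf_anti m n : le m n -> hf n <= hf m.
Proof. by move=> /leP[d ->]; rewrite hfD; have := hf_le1 d; have := hf_gt0 m; nra. Qed.

Lemma hf_nat n : iota n * hf n <= 1.
Proof. by have := hf_pow2 n; have := pow2_gt n; have := hf_gt0 n; nra. Qed.

Lemma iota_arch (q : Q) : exists n, q <= iota n.
Proof.
have [a [b [c ->]]] := fracP q. exists a. rewrite /frac.
have hc := den_gt0 c. rewrite ler_pdivrMr //.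
by have := iota_ge0 a; have := iota_ge0 b; have := iota_ge0 c; nra.
Qed.

Lemma hf_arch (q : Q) : 0 < q -> exists n, hf n < q.
Proof.
move=> hq. have [n hn] := iota_arch q^-1. exists n.
have hn' : iota n < iota (pow2 n) by have := pow2_gt n; lra.
have e : q^-1 * q = 1 by rewrite mulVf //; lra.
have := hf_pow2 n. have := hf_gt0 n. have := pow2_gt0 n.
move: (hf n) (iota (pow2 n)) hn' => h p h1 h2 h3 h4.
have h5 : q^-1 < p by lra.
have h6 : 1 < p * q by nra.
nra.
Qed.

Lemma triS n : tri (succ n) = add (tri n) (succ n).
Proof. by rewrite /tri /triT; betas; rewrite recS; betas. Qed.

Lemma tri0 : tri zero = zero :> N.
Proof. by rewrite /tri /triT; betas; rewrite rec0. Qed.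

Lemma ifzeroE c a b : ifzero M c a b = ite (c = zero) a b.
Proof.
rewrite /ifzero /ifzeroT; betas.
have [->|[d ->]] := zero_or_succ M c; first by rewrite rec0 ite_true.
by rewrite recS ite_false; [betas|apply: succ_nz].
Qed.

Lemma diag0 : diag zero = zero :> N.
Proof. by rewrite /diag /diagT; betas; rewrite rec0. Qed.

Lemma diagS n : diag (succ n) =
  ite (le (tri (succ (diag n))) (succ n)) (succ (diag n)) (diag n).
Proof.
rewrite {1}/diag /diagT; betas; rewrite recS; betas.
by rewrite ifzeroE /le /diag /diagT; betas.
Qed.

Lemma tri_mono m n : le m n -> iota (tri m) <= iota (tri n).
Proof.
move=> /leP[d ->]. apply: (N_ind_le (fun _ => tri m) (fun d => tri (add m d))); [by rep..| |].
- by rewrite add0.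
- by move=> k h; rewrite addS triS iotaD iotaS; have := iota_ge0 (add m k); lra.
Qed.

Lemma diag_spec n : le (tri (diag n)) n /\ lt n (tri (succ (diag n))).
Proof.
move: n. apply: N_ind; first by dec.
- rewrite diag0 tri0; split; first exact: le_refl.
  by apply/iota_lt; rewrite triS tri0 !(iotaD, iotaS, iota0); lra.
- move=> n [/iota_le h1 /iota_lt h2]. rewrite diagS.
  have [h|h] := classic (le (tri (succ (diag n))) (succ n)).
  + rewrite ite_true //; split=> //. apply/iota_lt. rewrite triS.
    by move: h h2 => /iota_le; rewrite !(iotaD, iotaS); have := iota_ge0 (diag n); lra.
  + rewrite ite_false //. move/lt_nle: h => /iota_lt. rewrite iotaS => h.
    by split; [apply/iota_le|apply/iota_lt]; rewrite iotaS; lra.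
Qed.

(** As [b <= a + b], the code lies from the triangular number of [a + b] on and below the next one,
    and this determines the diagonal. *)
Lemma diag_pair a b : diag (pair a b) = add a b.
Proof.
have e : iota (pair a b) = iota (tri (add a b)) + iota b.
  by rewrite -iotaD; congr iota; rewrite /pair /pairT; betas.
have [/iota_le h1 /iota_lt h2] := diag_spec (pair a b).
apply: le_anti.
- apply: NNPP => /lt_nle/tri_mono. rewrite triS !(iotaD, iotaS).
  by move: h1 e; have := iota_ge0 a; have := iota_ge0 b; lra.
- apply: NNPP => /lt_nle/tri_mono.
  by move: h2 e; have := iota_ge0 b; lra.
Qed.

Lemma pi2_pair a b : pi2 (pair a b) = b.
Proof.
rewrite /pi2 /pi2T; betas. rewrite diag_pair /pair /pairT; betas. by rewrite addK.
Qed.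

Lemma pi1_pair a b : pi1 (pair a b) = a.
Proof. by rewrite /pi1 /pi1T; betas; rewrite pi2_pair diag_pair addC addK. Qed.

End Iota.

#[global] Opaque iota hf addT mulT predT subT pow2T ifzeroT triT diagT pairT pi1T pi2T.

Section Codes.
Variable M : model.
Notation N := (M Defs.o).
Notation Q := (Qf M).
Implicit Types a b c d m n : N.

Definition v n : Q := frac (qpos n) (qneg n) (pi2 (pi2 n)).

Lemma v_rat a b c : v (rat a b c) = (iota a - iota b) / (1 + iota c).
Proof. by rewrite /v /qpos /qneg /rat !pi2_pair !pi1_pair. Qed.

Lemma vE n : v n = (iota (qpos n) - iota (qneg n)) / iota (qden n).
Proof. by rewrite /v /frac /qden iotaS [1 + _]addrC. Qed.

Lemma v_surj (q : Q) : exists n, q = v n.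
Proof.
have [a [b [c ->]]] := fracP q. exists (rat a b c). by rewrite v_rat.
Qed.

Lemma qden_gt0 n : 0 < iota (qden n).
Proof. by rewrite /qden iotaS; have := iota_ge0 (pi2 (pi2 n)); lra. Qed.

Lemma iota_pred a : 0 < iota a -> 1 + iota (pred a) = iota a.
Proof.
have [->|[b ->]] := zero_or_succ M a; first by rewrite iota0; lra.
by rewrite predS iotaS addrC.
Qed.

Lemma v_qadd p q : v (qadd p q) = v p + v q.
Proof.
rewrite /qadd /qaddT; betas. rewrite v_rat !vE.
have hp := qden_gt0 p; have hq := qden_gt0 q.
rewrite iota_pred; last by rewrite iotaM mulr_gt0.
rewrite [RHS]addf_div; [|exact: lt0r_neq0..]. rewrite !iotaD !iotaM.
move: (iota (qden p)) (iota (qden q)) (iota (qpos p)) (iota (qneg p)) (iota (qpos q))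
  (iota (qneg q)) => x y a b c d.
by have -> : a * y + c * x - (b * y + d * x) = (a - b) * y + (c - d) * x by ring.
Qed.

Lemma v_qopp p : v (qopp p) = - v p.
Proof.
rewrite /qopp /qoppT; betas. rewrite v_rat !vE iota_pred; last exact: qden_gt0.
by rewrite -mulNr opprB.
Qed.

Lemma v_qsub p q : v (qsub p q) = v p - v q.
Proof. by rewrite /qsub v_qadd v_qopp. Qed.

Lemma v_qabs p : v (qabs p) = `|v p|.
Proof.
rewrite /qabs /qabsT; betas. rewrite v_rat !vE iota_pred; last exact: qden_gt0.
rewrite iota0 subr0 iotaD normrM normfV (gtr0_norm (qden_gt0 p)); congr (_ / _).
have [h|h] := le_total M (qpos p) (qneg p); move/iota_le: (h) => h'.
- by rewrite (sub_eq0 h) (iota_sub h) iota0 ler0_norm; lra.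
- by rewrite (sub_eq0 h) (iota_sub h) iota0 ger0_norm; lra.
Qed.

Lemma qltP p q : qlt p q <-> v p < v q.
Proof.
rewrite /qlt. have hp := qden_gt0 p; have hq := qden_gt0 q.
rewrite !vE ltr_pdivrMr // mulrAC ltr_pdivlMr //.
split.
- by move=> /iota_lt/iota_nlt; rewrite !(iotaD, iotaM); lra.
- by move=> h; apply/iota_lt/iota_nlt; rewrite !(iotaD, iotaM); lra.
Qed.

Lemma v_qnat n : v (qnat n) = iota n.
Proof. by rewrite /qnat v_rat !iota0 subr0 addr0 divr1. Qed.

Lemma v_qexp n : v (qexp n) = hf n.
Proof.
rewrite /qexp v_rat iota_pred; last exact: pow2_gt0.
by rewrite iota0 iota1 subr0 mul1r.
Qed.

End Codes.
#[global] Opaque v frac qaddT qoppT qabsT.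
End Rationals.

(** * Completion of an ordered field along a directed index set *)

Module Reals.
Import ssreflect ssrfun ssrbool eqtype choice ssralg ssrnum order ring lra.
Import GRing.Theory Num.Theory.
Import Classical ClassicalEpsilon.
Import Completeness Semantics Interpretation Arithmetic Quotients Rationals.
Local Open Scope model_scope.
Local Open Scope ring_scope.
Set Implicit Arguments.
Unset Strict Implicit.

Section Completion.
Variables (Q : realFieldType) (N : Type) (le : N -> N -> Prop) (n0 : N).
Hypothesis le_refl : forall n, le n n.
Hypothesis le_trans : forall m n k, le m n -> le n k -> le m k.
Hypothesis le_directed : forall m n, exists k, le m k /\ le n k.

Definition evt (P : N -> Prop) : Prop := exists n, forall i, le n i -> P i.

Lemma evt_and (P P' : N -> Prop) : evt P -> evt P' -> evt (fun i => P i /\ P' i).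
Proof.
move=> [n hn] [m hm]. have [k [h1 h2]] := le_directed n m.
by exists k => i hi; split; [apply/hn/(le_trans h1 hi)|apply/hm/(le_trans h2 hi)].
Qed.

Lemma evt_imp (P P' : N -> Prop) : (forall i, P i -> P' i) -> evt P -> evt P'.
Proof. by move=> h [n hn]; exists n => i hi; apply/h/hn. Qed.

Lemma evt_true (P : N -> Prop) : (forall i, P i) -> evt P.
Proof. by move=> h; exists n0. Qed.

Lemma evt_ex (P : N -> Prop) : evt P -> exists i, P i.
Proof. by move=> [n h]; exists n; apply: h; apply: le_refl. Qed.

(** The indices will be the numbers of the model, but the sequences are arbitrary functions of the
    metatheory; so the completion may have more elements than the model has reals. *)
Definition cauchy (x : N -> Q) : Prop :=
  forall e : Q, 0 < e -> exists n, forall i j, le n i -> le n j -> `|x i - x j| < e.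

Definition null (x : N -> Q) : Prop := forall e : Q, 0 < e -> evt (fun i => `|x i| < e).

Definition cseq : Type := {x : N -> Q | cauchy x}.
Implicit Types x y z : cseq.
Notation sv := (@proj1_sig _ _).

Lemma cseq_bound x : exists B : Q, 0 < B /\ evt (fun i => `|sv x i| < B).
Proof.
case: x => x hx /=. have [n hn] := hx 1 ltr01.
exists (`|x n| + 1). split; first by have := normr_ge0 (x n); lra.
exists n => i hi. have := hn i n hi (le_refl n). have := ler_normD (x i - x n) (x n).
by rewrite subrK; lra.
Qed.

Lemma cauchy_add x y : cauchy (fun i => sv x i + sv y i).
Proof.
case: x y => x hx [y hy] e he /=. have he2 : 0 < e / 2 by lra.
have [n hn] := hx _ he2. have [m hm] := hy _ he2.
have [k hk] := le_directed n m.
exists k => i j hi hj.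
have h1 := hn i j (le_trans hk.1 hi) (le_trans hk.1 hj).
have h2 := hm i j (le_trans hk.2 hi) (le_trans hk.2 hj).
have := ler_normD (x i - x j) (y i - y j).
have -> : x i - x j + (y i - y j) = x i + y i - (x j + y j) by ring.
by lra.
Qed.

Lemma cauchy_opp x : cauchy (fun i => - sv x i).
Proof.
case: x => x hx e he /=. have [n hn] := hx _ he.
by exists n => i j hi hj; rewrite -opprD normrN; apply: hn.
Qed.

Lemma cauchy_mul x y : cauchy (fun i => sv x i * sv y i).
Proof.
have [A [hA [a ha]]] := cseq_bound x. have [B [hB [b hb]]] := cseq_bound y.
case: x y ha hb => x hx [y hy] /= ha hb e he.
have hd : 0 < e / (A + B) by rewrite divr_gt0 // addr_gt0.
have [n hn] := hx _ hd. have [m hm] := hy _ hd.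
have [k1 hk1] := le_directed n m. have [k2 hk2] := le_directed a b.
have [k hk] := le_directed k1 k2.
exists k => i j hi hj.
have [hi1 hi2] : le k1 i /\ le k2 i.
  by split; [apply: le_trans hk.1 hi|apply: le_trans hk.2 hi].
have [hj1 hj2] : le k1 j /\ le k2 j.
  by split; [apply: le_trans hk.1 hj|apply: le_trans hk.2 hj].
have h1 := hn i j (le_trans hk1.1 hi1) (le_trans hk1.1 hj1).
have h2 := hm i j (le_trans hk1.2 hi1) (le_trans hk1.2 hj1).
have h3 := ha i (le_trans hk2.1 hi2).
have h4 := hb j (le_trans hk2.2 hj2).
have -> : x i * y i - x j * y j = x i * (y i - y j) + (x i - x j) * y j by ring.
have e1 : e / (A + B) * (A + B) = e by rewrite divfK //; lra.
have := ler_normD (x i * (y i - y j)) ((x i - x j) * y j). rewrite !normrM.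
move: h1 h2 h3 h4 hd e1 (normr_ge0 (x i)) (normr_ge0 (y j)) (normr_ge0 (x i - x j))
  (normr_ge0 (y i - y j)).
move: (e / (A + B)) `|x i| `|y j| `|x i - x j| `|y i - y j| `|_ + _|.
move=> d p q r s t h1 h2 h3 h4 hd e1 p0 q0 r0 s0.
have : p * s <= A * d by nra.
have : r * q < d * B by nra.
by nra.
Qed.

Lemma cauchy_const (q : Q) : cauchy (fun _ => q).
Proof. by move=> e he; exists n0 => i j _ _; rewrite subrr normr0. Qed.

Definition c_add x y : cseq := exist _ _ (cauchy_add x y).
Definition c_opp x : cseq := exist _ _ (cauchy_opp x).
Definition c_mul x y : cseq := exist _ _ (cauchy_mul x y).
Definition c_const q : cseq := exist _ _ (cauchy_const q).
Definition c_eq x y : Prop := null (fun i => sv x i - sv y i).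
(** An arbitrarily small error is allowed because eventual nonnegativity of the terms does not
    respect [c_eq]. *)
Definition c_ge0 x : Prop := forall e : Q, 0 < e -> evt (fun i => - e < sv x i).

Lemma c_eq_pointwise x y : (forall i, sv x i = sv y i) -> c_eq x y.
Proof. by move=> h e he; apply: evt_true => i; rewrite h subrr normr0. Qed.

Lemma c_sym x y : c_eq x y -> c_eq y x.
Proof. by move=> h e /h; apply: evt_imp => i; rewrite distrC. Qed.

Lemma c_trans x y z : c_eq x y -> c_eq y z -> c_eq x z.
Proof.
move=> h1 h2 e he. have he2 : 0 < e / 2 by lra.
have := evt_and (h1 _ he2) (h2 _ he2). apply: evt_imp => i [h3 h4].
have := ler_normD (sv x i - sv y i) (sv y i - sv z i). by rewrite subrKA; lra.
Qed.

Lemma c_add_eq x x' y y' : c_eq x x' -> c_eq y y' -> c_eq (c_add x y) (c_add x' y').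
Proof.
move=> h1 h2 e he. have he2 : 0 < e / 2 by lra.
have := evt_and (h1 _ he2) (h2 _ he2). apply: evt_imp => i [h3 h4] /=.
have := ler_normD (sv x i - sv x' i) (sv y i - sv y' i).
have -> : sv x i - sv x' i + (sv y i - sv y' i) = sv x i + sv y i - (sv x' i + sv y' i) by ring.
by lra.
Qed.

Lemma c_opp_eq x x' : c_eq x x' -> c_eq (c_opp x) (c_opp x').
Proof. by move=> h e /h; apply: evt_imp => i /=; rewrite -opprD normrN. Qed.

Lemma c_mulC x y : c_eq (c_mul x y) (c_mul y x).
Proof. by apply: c_eq_pointwise => i /=; rewrite mulrC. Qed.

Lemma c_mul_eq_l x x' y : c_eq x x' -> c_eq (c_mul x y) (c_mul x' y).
Proof.
move=> h e he. have [B [hB hb]] := cseq_bound y.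
have hd : 0 < e / B by rewrite divr_gt0.
have := evt_and (h _ hd) hb. apply: evt_imp => i [h3 h4] /=.
rewrite -mulrBl normrM. have e1 : e / B * B = e by rewrite divfK //; lra.
move: h3 h4 e1 hd (normr_ge0 (sv x i - sv x' i)) (normr_ge0 (sv y i)).
move: `|sv x i - sv x' i| `|sv y i| (e / B) => p q d h3 h4 e1 hd p0 q0. nra.
Qed.

Lemma c_mul_eq x x' y y' : c_eq x x' -> c_eq y y' -> c_eq (c_mul x y) (c_mul x' y').
Proof.
move=> h1 h2. apply: c_trans (c_mul_eq_l y h1) _.
apply: c_trans (c_mulC _ _) _. apply: c_trans (c_mul_eq_l x' h2) _. exact: c_mulC.
Qed.

Lemma c_ge0_eq x x' : c_eq x x' -> c_ge0 x -> c_ge0 x'.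
Proof.
move=> h1 h2 e he. have he2 : 0 < e / 2 by lra.
have := evt_and (h1 _ he2) (h2 _ he2). apply: evt_imp => i [h3 h4].
by have := ler_norm (sv x i - sv x' i); lra.
Qed.

(** A Cauchy sequence that is not null keeps away from zero with a constant sign. Inverses and
    totality of the order both rest on this. *)
Lemma c_apart x : ~ c_eq x (c_const 0) ->
  exists e : Q, 0 < e /\ (evt (fun i => e < sv x i) \/ evt (fun i => sv x i < - e)).
Proof.
move=> h. apply: NNPP => H. apply: h => e he /=.
have he2 : 0 < e / 2 by lra.
have [n hn] := proj2_sig x _ he2. exists n => i hi. rewrite subr0.
have [//|hx] := ltrP `|sv x i| e. case: H. exists (e / 2). split=> //.
have [h0|h0] := lerP 0 (sv x i).
- left. exists n => j hj. have := hn i j hi hj. have := ler_norm (sv x i - sv x j).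
  by rewrite ger0_norm // in hx; lra.
- right. exists n => j hj. have := hn i j hi hj. have := ler_norm (sv x j - sv x i).
  by rewrite ltr0_norm // in hx; rewrite distrC; lra.
Qed.

Lemma c_inv x : ~ c_eq x (c_const 0) -> exists y, c_eq (c_mul y x) (c_const 1).
Proof.
move=> /c_apart [d [hd hx]].
have {hx} [n hn] : evt (fun i => d < `|sv x i|).
  case: hx; apply: evt_imp => i h.
  - by have := ler_norm (sv x i); lra.
  - by have := ler_norm (- sv x i); rewrite normrN; lra.
have hc : cauchy (fun i => (sv x i)^-1).
  move=> e he. have he2 : 0 < e * d * d by rewrite !mulr_gt0.
  have [m hm] := proj2_sig x _ he2.
  have [k [hk1 hk2]] := le_directed n m.
  exists k => i j hi hj.
  have h1 := hn i (le_trans hk1 hi). have h2 := hn j (le_trans hk1 hj).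
  have h3 := hm i j (le_trans hk2 hi) (le_trans hk2 hj).
  have n1 : sv x i != 0 by rewrite -normr_gt0; lra.
  have n2 : sv x j != 0 by rewrite -normr_gt0; lra.
  have -> : (sv x i)^-1 - (sv x j)^-1 = (sv x j - sv x i) / (sv x i * sv x j).
    by field; apply/andP.
  rewrite normrM normfV ltr_pdivrMr; last by rewrite normr_gt0 mulf_neq0.
  rewrite distrC normrM. move: h1 h2 h3 hd he.
  move: `|sv x i| `|sv x j| `|sv x i - sv x j| => p q r h1 h2 h3 hd he.
  have : d * d <= p * q by nra.
  by nra.
exists (exist _ _ hc) => e he. exists n => i /hn hi /=.
rewrite mulVf ?subrr ?normr0 // -normr_gt0. by lra.
Qed.

Lemma c_ge0_add x y : c_ge0 x -> c_ge0 y -> c_ge0 (c_add x y).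
Proof.
move=> h1 h2 e he. have he2 : 0 < e / 2 by lra.
by have := evt_and (h1 _ he2) (h2 _ he2); apply: evt_imp => i [h3 h4] /=; lra.
Qed.

Lemma c_ge0_total_strict x : ~ c_eq x (c_const 0) ->
  (exists e : Q, 0 < e /\ evt (fun i => e < sv x i)) \/ c_ge0 (c_opp x).
Proof.
move=> /c_apart [d [hd [h|h]]]; [left; exists d; split=> //|right].
by move=> e he; move: h; apply: evt_imp => i /=; lra.
Qed.

Lemma c_ge0_anti x : c_ge0 x -> c_ge0 (c_opp x) -> c_eq x (c_const 0).
Proof.
move=> h1 h2 e he. have := evt_and (h1 _ he) (h2 _ he).
by apply: evt_imp => i [h3 /= h4]; rewrite subr0 ltr_norml; apply/andP; split; lra.
Qed.

Lemma c_ge0_total x : c_ge0 x \/ c_ge0 (c_opp x).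
Proof.
have [h|h] := classic (c_eq x (c_const 0)).
- left => e /h. apply: evt_imp => i /=. rewrite subr0 => h'.
  by have := ler_norm (- sv x i); rewrite normrN; lra.
- have [[d [hd h1]]|] := c_ge0_total_strict h; [left|by right].
  by move=> e he; move: h1; apply: evt_imp => i; lra.
Qed.

Lemma c_ge0_mul x y : c_ge0 x -> c_ge0 y -> c_ge0 (c_mul x y).
Proof.
move=> h1 h2 e he.
have [A [hA hA']] := cseq_bound x. have [B [hB hB']] := cseq_bound y.
have hd : 0 < e / (A + B) by rewrite divr_gt0 // addr_gt0.
have := evt_and (evt_and (h1 _ hd) (h2 _ hd)) (evt_and hA' hB').
apply: evt_imp => i [[h3 h4] [h5 h6]] /=.
have e1 : e / (A + B) * (A + B) = e by rewrite divfK //; lra.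
move: h5 h6; rewrite !ltr_norml => /andP[h5 h5'] /andP[h6 h6'].
move: h3 h4 h5 h5' h6 h6' e1 hd. move: (e / (A + B)) (sv x i) (sv y i).
move=> d p q h3 h4 h5 h5' h6 h6' e1 hd.
have [p0|p0] := lerP 0 p; have [q0|q0] := lerP 0 q; nra.
Qed.

Definition R_pre : prefield.
Proof.
refine {| pf_T := cseq; pf_eq := c_eq; pf_zero := c_const 0; pf_one := c_const 1;
  pf_add := c_add; pf_opp := c_opp; pf_mul := c_mul; pf_ge0 := c_ge0;
  pf_sym := c_sym; pf_trans := c_trans; pf_add_eq := c_add_eq;
  pf_opp_eq := c_opp_eq; pf_mul_eq := c_mul_eq; pf_ge0_eq := c_ge0_eq;
  pf_mulC := c_mulC; pf_inv := c_inv; pf_ge0_add := c_ge0_add;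
  pf_ge0_mul := c_ge0_mul; pf_ge0_anti := c_ge0_anti;
  pf_ge0_total := c_ge0_total |}; try by intros; apply: c_eq_pointwise => i /=; ring.
move=> /(_ 1 ltr01) /evt_ex [i] /=. rewrite subr0 normr1. by lra.
Defined.

End Completion.
End Reals.

(** * Values of the model's reals in an ordered field *)

Module Values.
Import ssreflect ssrfun ssrbool eqtype choice ssralg ssrnum order ring lra.
Import GRing.Theory Num.Theory.
Import Classical ClassicalEpsilon.
Import Completeness Semantics Interpretation Arithmetic Quotients Rationals Reals.
Local Open Scope model_scope.
Local Open Scope ring_scope.
Set Implicit Arguments.
Unset Strict Implicit.
Arguments qexp' {M}.
Arguments isReal {M}.
Arguments req {M}.
Arguments rlt {M}.
Arguments rle {M}.
Arguments radd {M}.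
Arguments ropp {M}.
Arguments rsub {M}.
Arguments rabs {M}.
Arguments rnat {M}.
Arguments rexp {M}.
Arguments near {M}.
Notation rl := (Defs.o ~> Defs.o)%model.

Lemma le_directed (M : model) (m n : M Defs.o) : exists k, le m k /\ le n k.
Proof.
by have [h|h] := le_total M m n; [exists n|exists m]; split=> //; apply: le_refl.
Qed.

(* As for [the_rationals], the witness [the_reals] is opaque. *)
Record reals (M : model) := {
  rr_field : realFieldType;
  rr_lim : cseq (Qf M) (@le M) -> rr_field;
  rr_const q : rr_field := rr_lim (c_const le zero q);
  rr_0 : rr_const 0 = 0;
  rr_1 : rr_const 1 = 1;
  rr_D : forall p q, rr_const (p + q) = rr_const p + rr_const q;
  rr_M : forall p q, rr_const (p * q) = rr_const p * rr_const q;
  rr_N : forall p, rr_const (- p) = - rr_const p;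
  rr_lim_le : forall x q, evt le (fun i => proj1_sig x i <= q) -> rr_lim x <= rr_const q;
  rr_lim_ge : forall x q, evt le (fun i => q <= proj1_sig x i) -> rr_const q <= rr_lim x;
  rr_le : forall p q, rr_const p <= rr_const q -> p <= q;
  rr_gt0 : forall x, 0 < rr_lim x -> exists e : Qf M, 0 < e /\ rr_const e <= rr_lim x;
  rr_surj : forall r, exists x, r = rr_lim x
}.

Lemma the_reals (M : model) : reals M.
Proof.
pose P : prefield := R_pre (Qf M) zero (@le_refl M) (@le_trans M) (@le_directed M).
pose F : realFieldType := pf_field P.
pose L (x : cseq (Qf M) le) : F := pf_cls (P := P) x.
have L_eq (x y : cseq (Qf M) le) : (forall i, proj1_sig x i = proj1_sig y i) -> L x = L y.
  by move=> h; apply/(pf_clsP (P := P)); apply: (c_eq_pointwise zero h).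
have L_le (x : cseq (Qf M) le) q :
    evt le (fun i => proj1_sig x i <= q) -> L x <= L (c_const le zero q).
  move=> h. apply/(pf_cls_le (P := P)) => e he.
  by move: h; apply: evt_imp => i /= h; lra.
apply: (@Build_reals M F L) => //.
- by move=> p q; apply: etrans (pf_clsD (P := P) _ _); apply: L_eq.
- by move=> p q; apply: etrans (pf_clsM (P := P) _ _); apply: L_eq.
- by move=> p; apply: etrans (pf_clsN (P := P) _); apply: L_eq.
- move=> x q h. apply/(pf_cls_le (P := P)) => e he.
  by move: h; apply: evt_imp => i /= h; lra.
- move=> p q /(pf_cls_le (P := P)) h. apply: NNPP => /negP.
  rewrite -Order.TotalTheory.ltNge => hpq. have h3 : 0 < (p - q) / 2 by lra.
  have [i /=] := evt_ex (@le_refl M) (h _ h3). by lra.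
- move=> x h. have n0 : ~ c_eq x (c_const le zero 0).
    move/(pf_clsP (P := P)) => e. move: h. rewrite /L e.
    by have -> : pf_cls (P := P) (c_const le zero 0) = 0 :> F; [|rewrite Order.POrderTheory.ltxx].
  have [[e [he h1]]|h1] := c_ge0_total_strict n0.
  + exists e; split=> //. apply/(pf_cls_le (P := P)) => d hd.
    by move: h1; apply: evt_imp => i /= h1; lra.
  + have : L x <= L (c_const le zero 0).
      apply/(pf_cls_le (P := P)) => d hd.
      by have := h1 d hd; apply: evt_imp => i /= h2; lra.
    have -> : L (c_const le zero 0) = 0 by [].
    by rewrite Order.TotalTheory.leNgt h.
- by move=> r; apply: (pf_cls_surj (P := P)).
Qed.

Definition Rf (M : model) : realFieldType := rr_field (the_reals M).

Section Embedding.
Variable M : model.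
Notation N := (M Defs.o).
Notation Q := (Qf M).
Notation R := (Rf M).
Notation RL := (M rl).
Implicit Types (p q : Q) (m n : N) (x y : RL).

Definition lim (x : cseq Q le) : R := rr_lim (the_reals M) x.
Definition emb q : R := rr_const (the_reals M) q.

Lemma embD p q : emb (p + q) = emb p + emb q.
Proof. exact: rr_D. Qed.

Lemma embM p q : emb (p * q) = emb p * emb q.
Proof. exact: rr_M. Qed.

Lemma embN p : emb (- p) = - emb p.
Proof. exact: rr_N. Qed.

Lemma embB p q : emb (p - q) = emb p - emb q.
Proof. by rewrite embD embN. Qed.

Lemma emb0 : emb 0 = 0.
Proof. exact: rr_0. Qed.

Lemma emb1 : emb 1 = 1.
Proof. exact: rr_1. Qed.

Lemma lim_surj (r : R) : exists s, r = lim s.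
Proof. exact: rr_surj. Qed.

Lemma lim_le (x : cseq Q le) q : evt le (fun i => proj1_sig x i <= q) -> lim x <= emb q.
Proof. exact: rr_lim_le. Qed.

Lemma lim_ge (x : cseq Q le) q : evt le (fun i => q <= proj1_sig x i) -> emb q <= lim x.
Proof. exact: rr_lim_ge. Qed.

Lemma lim_gt0 (x : cseq Q le) : 0 < lim x -> exists e : Q, 0 < e /\ emb e <= lim x.
Proof. exact: rr_gt0. Qed.

Lemma emb_le p q : (emb p <= emb q) = (p <= q).
Proof.
apply/idP/idP; first exact: rr_le.
by move=> h; apply: lim_le; apply: (evt_true le zero).
Qed.

Lemma emb_lt p q : (emb p < emb q) = (p < q).
Proof. by rewrite !Order.TotalTheory.ltNge emb_le. Qed.

Lemma emb_ge0 q : (0 <= emb q) = (0 <= q).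
Proof. by rewrite -emb_le emb0. Qed.

Lemma emb_gt0 q : (0 < emb q) = (0 < q).
Proof. by rewrite -emb_lt emb0. Qed.

Lemma emb_lt0 q : (emb q < 0) = (q < 0).
Proof. by rewrite -emb_lt emb0. Qed.

Lemma emb_norm p : emb `|p| = `|emb p|.
Proof.
have [h|h] := lerP 0 p.
- by rewrite (ger0_norm h) ger0_norm // emb_ge0.
- by rewrite (ltr0_norm h) embN ltr0_norm // emb_lt0.
Qed.

Lemma lim_close (x : cseq Q le) q e :
  evt le (fun i => `|proj1_sig x i - q| <= e) -> `|lim x - emb q| <= emb e.
Proof.
move=> h. rewrite ler_norml; apply/andP; split.
- suff : emb (q - e) <= lim x by rewrite embB; lra.
  by apply: lim_ge; move: h; apply: evt_imp => i; rewrite ler_norml => /andP[]; lra.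
- suff : lim x <= emb (q + e) by rewrite embD; lra.
  by apply: lim_le; move: h; apply: evt_imp => i; rewrite ler_norml => /andP[]; lra.
Qed.

Definition hR (n : N) : R := emb (hf n).
Definition nR (n : N) : R := emb (iota n).

Lemma hR0 : hR zero = 1.
Proof. by rewrite /hR hf0 emb1. Qed.

Lemma hRS n : hR (succ n) = hR n / 2.
Proof.
have -> : hR n = emb (hf (succ n) + hf (succ n)) by rewrite /hR hfS; congr emb; lra.
by rewrite embD /hR; lra.
Qed.

Lemma hR_gt0 n : 0 < hR n.
Proof. by rewrite emb_gt0 hf_gt0. Qed.

Lemma hR_anti m n : le m n -> hR n <= hR m.
Proof. by rewrite emb_le; apply: hf_anti. Qed.

Lemma hR_pow2 n : hR n * nR (pow2 n) = 1.
Proof. by rewrite /hR /nR -embM hf_pow2 emb1. Qed.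

Lemma nR0 : nR zero = 0.
Proof. by rewrite /nR iota0 emb0. Qed.

Lemma nR1 : nR one = 1.
Proof. by rewrite /nR iota1 emb1. Qed.

Lemma nRS n : nR (succ n) = nR n + 1.
Proof. by rewrite /nR iotaS embD emb1. Qed.

Lemma nRD m n : nR (add m n) = nR m + nR n.
Proof. by rewrite /nR iotaD embD. Qed.

Lemma nRM m n : nR (mul m n) = nR m * nR n.
Proof. by rewrite /nR iotaM embM. Qed.

Lemma nR_ge0 n : 0 <= nR n.
Proof. by rewrite emb_ge0 iota_ge0. Qed.

Lemma nR_le m n : le m n <-> (nR m <= nR n).
Proof. by rewrite emb_le; apply: iota_le. Qed.

Lemma nR_lt m n : lt m n <-> (nR m + 1 <= nR n).
Proof. by rewrite -nRS; apply: nR_le. Qed.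

Lemma nR_nlt m n : nR m < nR n <-> (nR m + 1 <= nR n).
Proof. by rewrite -nRS emb_lt emb_le iotaS; apply: iota_nlt. Qed.

Lemma hR_arch (r : R) : 0 < r -> exists n, hR n < r.
Proof.
have [x ->] := lim_surj r. move=> /lim_gt0[e [he h]]. have [n hn] := hf_arch he.
by exists n; move: hn; rewrite -emb_lt -/(hR n); lra.
Qed.

Lemma nR_arch (r : R) : exists n, r <= nR n.
Proof.
have [x ->] := lim_surj r. have [B [_ h]] := cseq_bound (@le_refl M) x.
have [n hn] := iota_arch B. exists n. apply: lim_le.
by move: h; apply: evt_imp => i h; have := ler_norm (proj1_sig x i); lra.
Qed.

(** The Archimedean property with respect to the numbers of the model, in the form in which errors
    of approximation are removed. *)
Lemma le_hR (a b c : R) : (forall n, a <= b + c * hR n) -> a <= b.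
Proof.
move=> h. have [//|hab] := lerP a b.
have hc : 0 < c by have := h zero; rewrite hR0; lra.
have h0 : 0 < (a - b) / c by rewrite divr_gt0 //; lra.
have [n hn] := hR_arch h0.
by move: hn (h n); rewrite ltr_pdivlMr //; lra.
Qed.

Lemma isRealP (x : RL) : isReal x <->
  forall n i, `|v (x $ n) - v (x $ add n i)| < hf n.
Proof.
by split=> h n i; have := h n i; rewrite qltP v_qabs v_qsub v_qexp.
Qed.

Lemma real_cauchy (x : RL) : isReal x -> cauchy le (fun n => v (x $ n)).
Proof.
move/isRealP => h e he. have he2 : 0 < e / 2 by lra.
have [n hn] := hf_arch he2. exists n => i j /leP[a ->] /leP[b ->].
have := ler_normD (v (x $ add n a) - v (x $ n)) (v (x $ n) - v (x $ add n b)).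
by rewrite subrKA (distrC _ (v (x $ n))); have := h n a; have := h n b; lra.
Qed.

(** Zero is a default value for sequences that do not converge fast. *)
Definition val (x : RL) : R :=
  match excluded_middle_informative (isReal x) with
  | left h => lim (exist _ _ (real_cauchy h))
  | right _ => 0
  end.

Lemma val_close x n : isReal x -> `|val x - emb (v (x $ n))| <= hR n.
Proof.
move=> h. rewrite /val. case: excluded_middle_informative => // h'.
apply: lim_close => /=. exists n => i /leP[d ->].
by move/isRealP: h => /(_ n d); rewrite distrC; lra.
Qed.

Lemma val_closeP x n : isReal x ->
  emb (v (x $ n)) - hR n <= val x /\ val x <= emb (v (x $ n)) + hR n.
Proof. by move=> /(val_close n); rewrite ler_norml => /andP[]; split; lra. Qed.

Lemma v_qexp' n : v (qexp' n : N) = hf n + hf n.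
Proof. by rewrite /qexp' v_qadd v_qexp. Qed.

Lemma rltP x y : isReal x -> isReal y -> rlt x y <-> val x < val y.
Proof.
move=> hx hy; split.
- move=> [n]. rewrite qltP v_qadd v_qexp' -emb_lt !embD -/(hR n).
  by have := val_closeP n hx; have := val_closeP n hy; lra.
(* [rlt] asks for a gap of twice [2^-n], and each of the two approximations is off by at most
   [2^-n]. *)
- move=> h. have h4 : 0 < (val y - val x) / 4 by lra.
  have [n hn] := hR_arch h4. exists n.
  rewrite qltP v_qadd v_qexp' -emb_lt !embD -/(hR n).
  by have := val_closeP n hx; have := val_closeP n hy; lra.
Qed.

Lemma rleP x y : isReal x -> isReal y -> rle x y <-> val x <= val y.
Proof.
move=> hx hy; rewrite /rle rltP //; split; last by lra.
by have [] := lerP (val x) (val y).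
Qed.

Lemma reqP x y : isReal x -> isReal y -> req x y <-> val x = val y.
Proof.
move=> hx hy. have e n : qle M (qabs (qsub (x $ n) (y $ n))) (qexp' n) <->
    `|emb (v (x $ n)) - emb (v (y $ n))| <= hR n + hR n.
  rewrite /qle qltP v_qabs v_qsub v_qexp' -embB -emb_norm -embD emb_le.
  by have [] := lerP `|v (x $ n) - v (y $ n)| (hf n + hf n); split=> // h; lra.
split=> [h|h n].
- have h1 n : `|val x - val y| <= 0 + 4 * hR n.
    have /e := h n. have := val_closeP n hx. have := val_closeP n hy.
    by rewrite !ler_norml => h1 h2 /andP[h3 h4]; apply/andP; split; lra.
  by have := le_hR h1; rewrite normr_le0 subr_eq0 => /eqP.
- apply/e. have := val_closeP n hx. have := val_closeP n hy.
  by rewrite ler_norml => h1 h2; apply/andP; split; lra.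
Qed.

Lemma val_eq x (r : R) : isReal x ->
  (exists c : R, forall n, `|r - emb (v (x $ n))| <= c * hR n) -> val x = r.
Proof.
move=> hx [c hc]. have h n : `|val x - r| <= 0 + (c + 1) * hR n.
  have := hc n. have := val_closeP n hx.
  by rewrite !ler_norml => h1 /andP[h2 h3]; apply/andP; split; lra.
by have := le_hR h; rewrite normr_le0 subr_eq0 => /eqP.
Qed.

Lemma radd_app (x y : RL) n : radd x y $ n = qadd (x $ succ n) (y $ succ n).
Proof. by rewrite /radd /raddT; betas. Qed.

Lemma ropp_app (x : RL) n : ropp x $ n = qopp (x $ n).
Proof. by rewrite /ropp /roppT; betas. Qed.

Lemma rabs_app (x : RL) n : rabs x $ n = qabs (x $ n).
Proof. by rewrite /rabs /rabsT; betas. Qed.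

Lemma real_radd x y : isReal x -> isReal y -> isReal (radd x y).
Proof.
move=> /isRealP hx /isRealP hy. apply/isRealP => n i. rewrite !radd_app !v_qadd -addSn.
have := hx (succ n) i. have := hy (succ n) i. rewrite !hfS !ltr_norml.
by move=> /andP[h1 h2] /andP[h3 h4]; apply/andP; split; lra.
Qed.

Lemma val_radd x y : isReal x -> isReal y -> val (radd x y) = val x + val y.
Proof.
move=> hx hy. apply: val_eq; first exact: real_radd.
exists 1 => n. rewrite radd_app v_qadd embD.
have := val_closeP (succ n) hx. have := val_closeP (succ n) hy. rewrite hRS ler_norml.
by move=> h1 h2; apply/andP; split; lra.
Qed.

Lemma real_ropp x : isReal x -> isReal (ropp x).
Proof.
move=> /isRealP hx. apply/isRealP => n i.
by rewrite !ropp_app !v_qopp -opprD normrN.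
Qed.

Lemma val_ropp x : isReal x -> val (ropp x) = - val x.
Proof.
move=> hx. apply: val_eq; first exact: real_ropp.
exists 1 => n. rewrite ropp_app v_qopp embN mul1r -opprD normrN. exact: val_close.
Qed.

Lemma real_rsub x y : isReal x -> isReal y -> isReal (rsub x y).
Proof. by move=> hx hy; apply: real_radd => //; apply: real_ropp. Qed.

Lemma val_rsub x y : isReal x -> isReal y -> val (rsub x y) = val x - val y.
Proof. by move=> hx hy; rewrite val_radd ?val_ropp //; apply: real_ropp. Qed.

Lemma real_rabs x : isReal x -> isReal (rabs x).
Proof.
move=> /isRealP hx. apply/isRealP => n i. rewrite !rabs_app !v_qabs.
have := hx n i. have := ler_dist_dist (v (x $ n)) (v (x $ add n i)). by lra.
Qed.

Lemma val_rabs x : isReal x -> val (rabs x) = `|val x|.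
Proof.
move=> hx. apply: val_eq; first exact: real_rabs.
exists 1 => n. rewrite rabs_app v_qabs emb_norm mul1r.
have := ler_dist_dist (val x) (emb (v (x $ n))). by have := val_close n hx; lra.
Qed.

Lemma real_const n : isReal (s_K Defs.o Defs.o $ n).
Proof. by apply/isRealP => m i; rewrite !M_K subrr normr0 hf_gt0. Qed.

Lemma val_const n : val (s_K Defs.o Defs.o $ n) = emb (v n).
Proof.
apply: val_eq; first exact: real_const.
by exists 1 => m; rewrite M_K subrr normr0 mul1r; have := hR_gt0 m; lra.
Qed.

Lemma real_rnat (n : N) : isReal (rnat n).
Proof. exact: real_const. Qed.

Lemma val_rnat n : val (rnat n) = nR n.
Proof. by rewrite /rnat val_const v_qnat. Qed.

Lemma real_rexp (n : N) : isReal (rexp n).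
Proof. exact: real_const. Qed.

Lemma val_rexp n : val (rexp n) = hR n.
Proof. by rewrite /rexp val_const v_qexp. Qed.

Lemma nearP n x y : isReal x -> isReal y -> near n x y <-> `|val x - val y| < hR n.
Proof.
move=> hx hy. have h := real_rsub hx hy.
by rewrite /near rltP ?val_rabs ?val_rsub ?val_rexp //; [apply: real_rabs|apply: real_rexp].
Qed.

End Embedding.
#[global] Opaque val.
End Values.

(** * Closure properties of representable functions with rational and real values *)

Module RepresentableReals.
Import ssreflect ssrfun ssrbool eqtype choice ssralg ssrnum order ring lra.
Import GRing.Theory Num.Theory.
Import Classical ClassicalEpsilon.
Import Completeness Semantics Interpretation Arithmetic Rationals Reals Values.
Local Open Scope model_scope.
Local Open Scope ring_scope.
Set Implicit Arguments.
Unset Strict Implicit.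

Lemma maxr_spec (F : realFieldType) (x y : F) :
  [/\ x <= Num.max x y, y <= Num.max x y & Num.max x y = x \/ Num.max x y = y].
Proof. by case: (lerP x y) => h; split; lra. Qed.

Lemma minr_spec (F : realFieldType) (x y : F) :
  [/\ Num.min x y <= x, Num.min x y <= y & Num.min x y = x \/ Num.min x y = y].
Proof. by case: (lerP x y) => h; split; lra. Qed.

Ltac nring := apply: iota_inj; rewrite ?(iotaD, iotaS, iotaM, iota0, iota1); ring.

Section Rules.
Variable M : model.
Notation N := (M Defs.o).
Notation Q := (Qf M).
Notation R := (Rf M).
Notation RL := (M rl).
Notation o := Defs.o.
Implicit Types G : list Defs.ty.

(* Functions into the rationals, resp. the reals, given by terms of the model; in the
   case of the reals, on a domain [D] outside of which the term is unconstrained. *)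
Definition RepQ G (f : env M G -> Q) : Prop :=
  exists a : env M G -> N, Rep a /\ forall e, v (a e) = f e.

Definition RepR G (D : env M G -> Prop) (f : env M G -> R) : Prop :=
  exists a : env M G -> RL, Rep a /\ forall e, D e -> isReal (a e) /\ val (a e) = f e.

Lemma RepQ_ext G (f g : env M G -> Q) : (forall e, f e = g e) -> RepQ f -> RepQ g.
Proof. by move=> h [a [ha e]]; exists a; split=> // x; rewrite e. Qed.

Lemma RepQ_v G (a : env M G -> N) : Rep a -> RepQ (fun e => v (a e)).
Proof. by move=> h; exists a. Qed.

Lemma RepQ_const G (q : Q) : RepQ (fun _ : env M G => q).
Proof. by have [n ->] := v_surj q; apply: RepQ_v; rep. Qed.

Lemma RepQ_iota G (a : env M G -> N) : Rep a -> RepQ (fun e => iota (a e)).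
Proof. by exists (fun e => qnat (a e)); split=> [|e]; [rep|rewrite v_qnat]. Qed.

Lemma RepQ_hf G (a : env M G -> N) : Rep a -> RepQ (fun e => hf (a e)).
Proof. by exists (fun e => qexp (a e)); split=> [|e]; [rep|rewrite v_qexp]. Qed.

Lemma RepQ_add G (f g : env M G -> Q) : RepQ f -> RepQ g -> RepQ (fun e => f e + g e).
Proof.
move=> [a [ha ea]] [b [hb eb]]; exists (fun e => qadd (a e) (b e)).
by split=> [|e]; [rep|rewrite v_qadd ea eb].
Qed.

Lemma RepQ_opp G (f : env M G -> Q) : RepQ f -> RepQ (fun e => - f e).
Proof.
move=> [a [ha ea]]; exists (fun e => qopp (a e)).
by split=> [|e]; [rep|rewrite v_qopp ea].
Qed.

Lemma RepQ_norm G (f : env M G -> Q) : RepQ f -> RepQ (fun e => `|f e|).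
Proof.
move=> [a [ha ea]]; exists (fun e => qabs (a e)).
by split=> [|e]; [rep|rewrite v_qabs ea].
Qed.

Definition qmul (p q : N) : N :=
  rat (add (mul (qpos p) (qpos q)) (mul (qneg p) (qneg q)))
      (add (mul (qpos p) (qneg q)) (mul (qneg p) (qpos q)))
      (pred (mul (qden p) (qden q))).

Lemma v_qmul p q : v (qmul p q) = v p * v q.
Proof.
rewrite /qmul v_rat !vE. have hp := qden_gt0 p; have hq := qden_gt0 q.
rewrite iota_pred; last by rewrite iotaM mulr_gt0.
rewrite !iotaD !iotaM mulf_div.
move: (iota (qden p)) (iota (qden q)) (iota (qpos p)) (iota (qneg p)) (iota (qpos q))
  (iota (qneg q)) => x y a b c d.
by have -> : a * c + b * d - (a * d + b * c) = (a - b) * (c - d) by ring.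
Qed.

Lemma RepQ_mul G (f g : env M G -> Q) : RepQ f -> RepQ g -> RepQ (fun e => f e * g e).
Proof.
move=> [a [ha ea]] [b [hb eb]]; exists (fun e => qmul (a e) (b e)).
by split=> [|e]; [rewrite /qmul; rep|rewrite v_qmul ea eb].
Qed.

Lemma Dec_ltQ G (f g : env M G -> Q) : RepQ f -> RepQ g -> Dec (fun e => f e < g e).
Proof.
move=> [a [ha ea]] [b [hb eb]].
apply: (Dec_ext _ _ (fun e => qlt (a e) (b e))) => [e|]; first by rewrite qltP ea eb.
by rewrite /qlt; dec.
Qed.

Lemma Dec_leQ G (f g : env M G -> Q) : RepQ f -> RepQ g -> Dec (fun e => f e <= g e).
Proof.
move=> hf hg. apply: (Dec_ext _ _ (fun e => ~ (g e < f e))) => [e|].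
  by rewrite Order.TotalTheory.leNgt; split=> /negP.
by apply: Dec_not; apply: Dec_ltQ.
Qed.

Lemma Dec_eqQ G (f g : env M G -> Q) : RepQ f -> RepQ g -> Dec (fun e => f e = g e).
Proof.
move=> hf hg. apply: (Dec_ext _ _ (fun e => f e <= g e /\ g e <= f e)) => [e|].
  by split=> [[h1 h2]|->]; [lra|split; lra].
by apply: Dec_and; apply: Dec_leQ.
Qed.

Lemma RepQ_ite G (P : env M G -> Prop) (f g : env M G -> Q) (h : env M G -> Q) :
  Dec P -> RepQ f -> RepQ g -> (forall e, P e -> h e = f e) -> (forall e, ~ P e -> h e = g e) ->
  RepQ h.
Proof.
move=> hP [a [ha ea]] [b [hb eb]] h1 h2. exists (fun e => ite (P e) (a e) (b e)); split.
  exact: Rep_ite.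
move=> e. have [hp|hp] := classic (P e).
- by rewrite ite_true // h1.
- by rewrite ite_false // h2.
Qed.

Lemma RepQ_max G (f g : env M G -> Q) :
  RepQ f -> RepQ g -> RepQ (fun e => Num.max (f e) (g e)).
Proof.
move=> hf hg. apply: (RepQ_ite (Dec_leQ hf hg) hg hf) => e.
- by case: lerP.
- by case: lerP => // _ [].
Qed.

(** The inverse of a code is chosen rather than written down: its defining property is decidable, so
    [choice0] applies. *)
Lemma RepQ_inv G (f : env M G -> Q) : RepQ f -> RepQ (fun e => (f e)^-1).
Proof.
move=> [a [ha ea]].
have [||g hg] := choice0 M (fun n m => (v n <> 0 -> v m * v n = 1) /\ (v n = 0 -> v m = 0)).
- have h1 : RepQ (fun e : env M (cons o (cons o nil)) => v (snd (fst e))).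
    by apply: RepQ_v; rep.
  have h2 : RepQ (fun e : env M (cons o (cons o nil)) => v (snd e)) by apply: RepQ_v; rep.
  have h3 c := RepQ_const (cons o (cons o nil)) c.
  apply: Dec_and; apply: Dec_imp; try apply: Dec_not; apply: Dec_eqQ => //.
  exact: RepQ_mul.
- move=> n. have [h|h] := classic (v n = 0).
    by have [m hm] := v_surj (0 : Q); exists m; split.
  have [m hm] := v_surj (v n)^-1. exists m; split=> // _.
  by rewrite -hm mulVf //; apply/eqP.
- exists (fun e => g $ a e); split; first by rep.
  move=> e. have [h1 h2] := hg (a e). rewrite -ea.
  have [h|h] := classic (v (a e) = 0); first by rewrite (h2 h) h invr0.
  have nz : v (a e) != 0 by apply/eqP.
  by apply: (mulIf nz); rewrite (h1 h) mulVf.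
Qed.

(** The recursion keeps the code of the largest value met so far, so the maximum is one of the
    values. *)
Lemma RepQ_bigmax G (A : env M G -> N -> Q) (B : env M G -> N) :
  RepQ (fun e : env M (cons o G) => A (fst e) (snd e)) -> Rep B ->
  exists m : env M G -> Q, RepQ m /\ forall e,
    (forall n, le n (B e) -> A e n <= m e) /\ exists n, le n (B e) /\ m e = A e n.
Proof.
move=> [a [[g [hg eg]] ea]] hB.
have gA e n : v (g e $ n) = A e n by rewrite eg ea.
pose stp e := \ u k => ite (v u < v (g e $ succ k)) (g e $ succ k) u.
have hlt : Dec (fun e : env M (cons o (cons o G)) =>
    v (snd (fst e)) < v (g (fst (fst e)) $ succ (snd e))).
  by apply: Dec_ltQ; apply: RepQ_v; rep.
have hc e n : rec (succ n) (g e $ zero) (stp e) =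
    ite (v (rec n (g e $ zero) (stp e)) < v (g e $ succ n)) (g e $ succ n)
      (rec n (g e $ zero) (stp e)).
  have hlt' G' (x y : env M G' -> N) : Rep x -> Rep y -> Dec (fun e => v (x e) < v (y e)).
    by move=> hx hy; apply: Dec_ltQ; apply: RepQ_v.
  rewrite recS {1}/stp beta; last first.
    by rep; apply: Rep_ite; [apply: hlt'|..]; rep.
  by rewrite beta //; apply: Rep_ite; [apply: hlt'|..]; rep.
exists (fun e => v (rec (B e) (g e $ zero) (stp e))); split.
  apply: RepQ_v. rewrite /stp. rep. apply: Rep_ite => //; by rep.
move=> e. move: (B e) => n. split.
- move: n. apply: N_ind.
  + apply: (Dec_ext _ _ (fun x : env M (cons o nil) => forall i, le i (snd x) ->
      v (g e $ i) <= v (rec (snd x) (g e $ zero) (stp e)))).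
      by move=> x; split=> h i /h; rewrite gA.
    apply: (Dec_all_le M (cons o nil)
      (fun x i => v (g e $ i) <= v (rec (snd x) (g e $ zero) (stp e))) (fun x => snd x)).
      by apply: Dec_leQ; apply: RepQ_v; rep.
    by rep.
  + move=> i /(le_anti _ _ _)/(_ (le0 _ _)) ->. by rewrite rec0 gA.
  + move=> n IH i /le_succ. rewrite hc.
    have [h|h] := classic (v (rec n (g e $ zero) (stp e)) < v (g e $ succ n)).
    * rewrite ite_true // gA => -[/IH|->] //. by move: h; rewrite gA; lra.
    * rewrite ite_false // => -[/IH|->] //. move: h; rewrite gA.
      by have [] := lerP (A e (succ n)) (v (rec n (g e $ zero) (stp e))).
- have : exists i, le i n /\ rec n (g e $ zero) (stp e) = g e $ i.
    move: n. apply: N_ind.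
    + by dec.
    + by exists zero; rewrite rec0; split; first exact: le_refl.
    + move=> n [i [hi ei]]. rewrite hc.
      have [h|h] := classic (v (rec n (g e $ zero) (stp e)) < v (g e $ succ n)).
      * by rewrite ite_true //; exists (succ n); split; first exact: le_refl.
      * by rewrite ite_false //; exists i; split=> //; apply/le_succ; left.
  by move=> [i [hi ->]]; exists i; rewrite gA.
Qed.

Lemma RepR_limit G (D : env M G -> Prop) (A : env M G -> N -> Q) (c : env M G -> N) :
  RepQ (fun e : env M (cons o G) => A (fst e) (snd e)) -> Rep c ->
  (forall e, D e -> forall j i, `|A e j - A e (add j i)| <= iota (c e) * hf j) ->
  exists f : env M G -> R, RepR D f /\
    forall e, D e -> forall j, `|f e - emb (A e j)| <= nR (c e) * hR j.
Proof.
move=> [a [[g [hg eg]] ea]] hc hA.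
have gA e n : v (g e $ n) = A e n by rewrite eg ea.
(* As [c 2^-c <= 1], reading from index [k + 2 + c] on brings the error [c 2^-j] below [2^-k], as
   fast convergence requires. *)
pose x e := \ k => g e $ add (succ (succ k)) (c e).
have ex e k : v (x e $ k) = A e (add (succ (succ k)) (c e)).
  by rewrite /x beta ?gA //; rep.
have hx e : D e -> isReal (x e).
  move=> he. apply/isRealP => n i. rewrite !ex.
  have -> : add (succ (succ (add n i))) (c e) = add (add (succ (succ n)) (c e)) i.
    by nring.
  have := hA e he (add (succ (succ n)) (c e)) i.
  rewrite hfD !hfS. have := hf_nat (c e). have := hf_gt0 n. have := hf_gt0 (c e).
  by move: (hf n) (hf (c e)) (iota (c e)) `|_ - _| => p q r s h1 h2 h3 h4; nra.
exists (fun e => val (x e)); split.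
  exists x; split; first by rewrite /x; rep.
  by move=> e /hx.
move=> e he j. apply: (@le_hR M _ _ 1) => k.
have h1 := val_close (add k j) (hx e he).
rewrite ex in h1.
have : `|emb (A e j) - emb (A e (add (succ (succ (add k j))) (c e)))| <= nR (c e) * hR j.
  rewrite -embB -emb_norm. rewrite /nR /hR -embM emb_le.
  have -> : add (succ (succ (add k j))) (c e) = add j (add (succ (succ k)) (c e)).
    by nring.
  exact: hA.
have h3 : hR (add k j) <= hR k by apply: hR_anti; apply/leP; exists j.
move: h1; rewrite !ler_norml => /andP[h1 h1'] /andP[h2 h2'].
by apply/andP; split; lra.
Qed.

Lemma RepR_ext G (D : env M G -> Prop) (f g : env M G -> R) :
  (forall e, D e -> f e = g e) -> RepR D f -> RepR D g.
Proof.
by move=> h [a [ha ea]]; exists a; split=> // e he; have [h1 e1] := ea e he; rewrite e1 h.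
Qed.

(* Besides closure under composition, this is how real-valued functions are built:
   explicit rational approximations with error [c 2^-j]. *)
Lemma RepR_approx G (D : env M G -> Prop) (f : env M G -> R) (A : env M G -> N -> Q)
    (c : env M G -> N) :
  RepQ (fun e : env M (cons o G) => A (fst e) (snd e)) -> Rep c ->
  (forall e, D e -> forall j, `|f e - emb (A e j)| <= nR (c e) * hR j) -> RepR D f.
Proof.
move=> hA hc hf'. have [||f' [h1 h2]] := @RepR_limit G D A (fun e => add (c e) (c e)) hA.
- by rep.
- move=> e he j i. have h1 := hf' e he j. have h2 := hf' e he (add j i).
  have h3 : hR (add j i) <= hR j by apply: hR_anti; apply/leP; exists i.
  rewrite -emb_le emb_norm embB embM iotaD embD -/(nR _) -/(hR _).
  move: h1 h2; rewrite !ler_norml => /andP[h1 h1'] /andP[h2 h2'].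
  have h4 := nR_ge0 (c e). have h5 : nR (c e) * hR (add j i) <= nR (c e) * hR j by nra.
  by apply/andP; split; lra.
- apply: RepR_ext h1 => e he.
  have h3 k : `|f' e - f e| <= 0 + 3 * nR (c e) * hR k.
    have := h2 e he k. have := hf' e he k. rewrite nRD !ler_norml => /andP[h3 h3'] /andP[h4 h4'].
    by apply/andP; split; lra.
  by have := le_hR h3; rewrite normr_le0 subr_eq0 => /eqP.
Qed.

Lemma RepR_approxE G (D : env M G -> Prop) (f : env M G -> R) : RepR D f ->
  exists A : env M G -> N -> Q, RepQ (fun e : env M (cons o G) => A (fst e) (snd e)) /\
    forall e, D e -> forall j, `|f e - emb (A e j)| <= hR j.
Proof.
move=> [a [ha ea]]. exists (fun e j => v (a e $ j)); split.
  by apply: RepQ_v; rep.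
by move=> e he j; have [h1 <-] := ea e he; apply: val_close.
Qed.

Lemma RepR_val G (D : env M G -> Prop) (a : env M G -> RL) :
  Rep a -> (forall e, D e -> isReal (a e)) -> RepR D (fun e => val (a e)).
Proof. by move=> ha h; exists a; split=> // e he; split=> //; apply: h. Qed.

Lemma RepR_emb G (D : env M G -> Prop) (q : env M G -> Q) :
  RepQ q -> RepR D (fun e => emb (q e)).
Proof.
move=> hq. apply: (RepR_approx (A := fun e _ => q e) (c := fun _ => zero)).
- case: hq => a [ha ea]. by exists (fun e => a (fst e)); split=> [|e]; [rep|].
- by rep.
- by move=> e _ j; rewrite subrr normr0 nR0 mul0r.
Qed.

Lemma RepR_const G (D : env M G -> Prop) (x : RL) : isReal x -> RepR D (fun _ => val x).
Proof. by move=> hx; apply: RepR_val => //; rep. Qed.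

Lemma RepR_rat G (D : env M G -> Prop) (q : Q) : RepR D (fun _ : env M G => emb q).
Proof. by apply: RepR_emb; apply: RepQ_const. Qed.

Lemma RepR_nR G (D : env M G -> Prop) (n : env M G -> N) :
  Rep n -> RepR D (fun e => nR (n e)).
Proof. by move=> hn; apply: RepR_emb; apply: RepQ_iota. Qed.

Lemma RepR_hR G (D : env M G -> Prop) (n : env M G -> N) :
  Rep n -> RepR D (fun e => hR (n e)).
Proof. by move=> hn; apply: RepR_emb; apply: RepQ_hf. Qed.

Lemma RepR_add G (D : env M G -> Prop) (f g : env M G -> R) :
  RepR D f -> RepR D g -> RepR D (fun e => f e + g e).
Proof.
move=> /RepR_approxE[A [hA eA]] /RepR_approxE[B [hB eB]].
apply: (RepR_approx (A := fun e j => A e j + B e j) (c := fun _ => succ one)).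
- exact: RepQ_add.
- by rep.
- move=> e he j. have := eA e he j. have := eB e he j.
  rewrite embD nRS nR1 !ler_norml => /andP[h1 h1'] /andP[h2 h2'].
  by apply/andP; split; lra.
Qed.

Lemma RepR_opp G (D : env M G -> Prop) (f : env M G -> R) :
  RepR D f -> RepR D (fun e => - f e).
Proof.
move=> /RepR_approxE[A [hA eA]].
apply: (RepR_approx (A := fun e j => - A e j) (c := fun _ => one)).
- exact: RepQ_opp.
- by rep.
- by move=> e he j; rewrite embN nR1 mul1r -opprD normrN; apply: eA.
Qed.

Lemma RepR_scale G (D : env M G -> Prop) (n : env M G -> N) (f : env M G -> R) :
  Rep n -> RepR D f -> RepR D (fun e => nR (n e) * f e).
Proof.
move=> hn /RepR_approxE[A [hA eA]].
apply: (RepR_approx (A := fun e j => iota (n e) * A e j) (c := n)) => //.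
- apply: RepQ_mul => //. by apply: RepQ_iota; rep.
- move=> e he j. have := eA e he j. rewrite embM -/(nR _) -mulrBr normrM.
  by rewrite (ger0_norm (nR_ge0 _)) => h; apply: ler_wpM2l => //; apply: nR_ge0.
Qed.

Lemma RepR_max G (D : env M G -> Prop) (f g : env M G -> R) :
  RepR D f -> RepR D g -> RepR D (fun e => Num.max (f e) (g e)).
Proof.
move=> /RepR_approxE[A [hA eA]] /RepR_approxE[B [hB eB]].
apply: (RepR_approx (A := fun e j => Num.max (A e j) (B e j)) (c := fun _ => one)).
- exact: RepQ_max.
- by rep.
- move=> e he j. have := eA e he j. have := eB e he j.
  rewrite nR1 !ler_norml => /andP[h1 h1'] /andP[h2 h2'].
  have [m1 m2 m3] := maxr_spec (f e) (g e). have [k1 k2 k3] := maxr_spec (A e j) (B e j).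
  rewrite -!emb_le in k1 k2.
  by apply/andP; split; case: m3 k3 => m3 [] k3; rewrite ?m3 ?k3 in m1 m2 k1 k2 *; lra.
Qed.

Lemma RepR_min G (D : env M G -> Prop) (f g : env M G -> R) :
  RepR D f -> RepR D g -> RepR D (fun e => Num.min (f e) (g e)).
Proof.
move=> hf' hg'. apply: (RepR_ext (f := fun e => - Num.max (- f e) (- g e))).
  by move=> e _; rewrite oppr_max !opprK.
by apply: RepR_opp; apply: RepR_max; apply: RepR_opp.
Qed.

Lemma RepR_norm G (D : env M G -> Prop) (f : env M G -> R) :
  RepR D f -> RepR D (fun e => `|f e|).
Proof.
move=> hf'. apply: (RepR_ext (f := fun e => Num.max (f e) (- f e))).
  move=> e _. have [h|h] := lerP 0 (f e); have [m1 m2 m3] := maxr_spec (f e) (- f e).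
  - by rewrite ger0_norm //; case: m3 => m3; rewrite m3 in m1 m2 *; lra.
  - by rewrite ltr0_norm //; case: m3 => m3; rewrite m3 in m1 m2 *; lra.
by apply: RepR_max => //; apply: RepR_opp.
Qed.

(** The precision needed for an inverse depends on how near the argument is to zero, so a lower
    bound has to be supplied as a representable function. *)
Lemma RepR_inv G (D : env M G -> Prop) (n : env M G -> N) (f : env M G -> R) :
  Rep n -> RepR D f -> (forall e, D e -> hR (n e) <= f e) -> RepR D (fun e => (f e)^-1).
Proof.
move=> hn /RepR_approxE[A [hA eA]] hlow.
(* The maximum keeps the approximations away from zero. With both denominators at least [2^-n],
   inversion multiplies the error by at most [4^n]. *)
apply: (RepR_approx (A := fun e j => (Num.max (A e j) (hf (n e)))^-1)
  (c := fun e => mul (pow2 (n e)) (pow2 (n e)))).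
- by apply: RepQ_inv; apply: RepQ_max => //; apply: RepQ_hf; rep.
- by rep.
- move=> e he j. have h0 := hlow e he. have h1 := eA e he j.
  have [k1 k2 k3] := maxr_spec (A e j) (hf (n e)).
  set B := Num.max _ _ in k1 k2 k3 *.
  have p0 := hR_gt0 (n e). have e1 : nR (pow2 (n e)) = (hR (n e))^-1.
    by apply: (mulfI (_ : hR (n e) != 0)); [lra|rewrite hR_pow2 mulfV //; lra].
  have hB : hR (n e) <= emb B by rewrite emb_le.
  have hB' : `|f e - emb B| <= hR j.
    move: h1; rewrite !ler_norml => /andP[h1 h1'].
    rewrite -emb_le in k1. have hj := hR_gt0 j.
    by apply/andP; split; case: k3 => k3; rewrite k3 in k1 hB *; rewrite -?/(hR _) in k1 hB *; lra.
  have eV : emb B^-1 = (emb B)^-1.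
    have nB : emb B != 0 by lra.
    apply: (mulfI nB). rewrite mulfV // -embM mulfV ?emb1 //.
    by apply/eqP => b0; move: nB; rewrite b0 emb0 eqxx.
  have nf : f e != 0 by lra. have nB : emb B != 0 by lra.
  have -> : (f e)^-1 - emb B^-1 = (emb B - f e) / (f e * emb B).
    by rewrite eV; field; rewrite nf nB.
  rewrite normrM distrC normfV nRM e1 (gtr0_norm (_ : 0 < f e * emb B)); last first.
    by apply: mulr_gt0; lra.
  rewrite -invfM mulrC. have p1 : 0 < hR (n e) * hR (n e) by apply: mulr_gt0.
  have p2 : hR (n e) * hR (n e) <= f e * emb B by nra.
  apply: ler_pM => //; first by rewrite invr_ge0; lra.
  by rewrite lef_pV2 // Num.Theory.posrE; lra.
Qed.

(** Limit of the maxima of rational approximations. The index of the largest approximation may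
    change with the precision, so the second clause only speaks of values close to the maximum;
    [sup_attained] is needed for more. *)
Lemma RepR_bigmax G (D : env M G -> Prop) (t : env M G -> N -> R) (B : env M G -> N) :
  RepR (fun e : env M (cons o G) => D (fst e)) (fun e : env M (cons o G) => t (fst e) (snd e)) ->
  Rep B ->
  exists f : env M G -> R, RepR D f /\ forall e, D e ->
    (forall n, le n (B e) -> t e n <= f e) /\
    (forall z, z < f e -> exists n, le n (B e) /\ z < t e n).
Proof.
move=> /RepR_approxE[A [hA eA]] hB.
have hA' : RepQ (fun e : env M (cons o (cons o G)) => A (fst (fst e), snd e) (snd (fst e))).
  case: hA => a [[g1 [[g2 [hg eg2]] eg1]] ea].
  exists (fun e => g2 (fst (fst e)) $ snd e $ snd (fst e)); split; first by rep.
  by move=> e; rewrite eg2 eg1 ea.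
have [m [hm em]] := @RepQ_bigmax (cons o G) (fun e n => A (fst e, n) (snd e))
  (fun e => B (fst e)) hA' (Rep_wk _ _ _ _ _ hB).
have eA' e n j : D e -> t e n - hR j <= emb (A (e, n) j) /\ emb (A (e, n) j) <= t e n + hR j.
  by move=> he; have := eA (e, n) he j; rewrite ler_norml /= => /andP[]; split; lra.
have hRa j i : hR (add j i) <= hR j :> R by apply: hR_anti; apply/leP; exists i.
have [|||f [hf' ef]] := @RepR_limit G D (fun e j => m (e, j)) (fun _ => succ one).
- by apply: RepQ_ext hm => -[].
- by rep.
- move=> e he j i. rewrite -emb_le emb_norm embB embM -/(hR _) -/(nR _) nRS nR1 ler_norml.
  have [/= h1 [n1 [k1 e1]]] := em (e, j). have [/= h2 [n2 [k2 e2]]] := em (e, add j i).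
  have h3 := h1 n2 k2. have h4 := h2 n1 k1. rewrite -!emb_le in h3 h4.
  have a1 := eA' e n1 j he. have a2 := eA' e n2 j he.
  have a3 := eA' e n1 (add j i) he. have a4 := eA' e n2 (add j i) he.
  have := hRa j i. rewrite e1 e2 in h3 h4 *. by move=> h5; apply/andP; split; lra.
exists f; split=> // e he. split.
- move=> n hn. apply: (@le_hR M _ _ 3) => j. have [/= h1 _] := em (e, j).
  have h2 := h1 n hn. rewrite -emb_le in h2.
  have := ef e he j. rewrite nRS nR1 ler_norml => /andP[h3 h4].
  by have := eA' e n j he; lra.
- move=> z hz. have hz' : 0 < (f e - z) / 4 by lra. have [j hj] := hR_arch hz'.
  have [/= _ [n [hn en]]] := em (e, j). exists n; split=> //.
  have := ef e he j. rewrite en nRS nR1 ler_norml => /andP[h3 h4].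
  by have := eA' e n j he; lra.
Qed.

Lemma RepR_lim G (D : env M G -> Prop) (t : env M G -> N -> R) (c : env M G -> N) :
  RepR (fun e : env M (cons o G) => D (fst e)) (fun e : env M (cons o G) => t (fst e) (snd e)) ->
  Rep c -> (forall e, D e -> forall j i, `|t e j - t e (add j i)| <= nR (c e) * hR j) ->
  exists f : env M G -> R, RepR D f /\
    forall e, D e -> forall j, `|f e - t e j| <= (nR (c e) + 4) * hR j.
Proof.
move=> /RepR_approxE[A [hA eA]] hc ht.
have eA' e j : D e -> t e j - hR j <= emb (A (e, j) j) /\ emb (A (e, j) j) <= t e j + hR j.
  by move=> he; have := eA (e, j) he j; rewrite ler_norml /= => /andP[]; split; lra.
have hRa j i : hR (add j i) <= hR j :> R by apply: hR_anti; apply/leP; exists i.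
have [|||f [hf' ef]] := @RepR_limit G D (fun e j => A (e, j) j) (fun e => add (c e) (succ one)).
- case: hA => a [[g1 [[g2 [hg eg2]] eg1]] ea].
  exists (fun e => g2 (fst e) $ snd e $ snd e); split; first by rep.
  by move=> e; rewrite eg2 eg1 ea.
- by rep.
- move=> e he j i. rewrite -emb_le emb_norm embB embM -/(hR _) -/(nR _) nRD nRS nR1 ler_norml.
  have := eA' e j he. have := eA' e (add j i) he. have := hRa j i. have := ht e he j i.
  by rewrite ler_norml => /andP[h1 h2] h3 h4 h5; apply/andP; split; lra.
exists f; split=> // e he j. have := ef e he j. have := eA' e j he.
rewrite nRD nRS nR1 !ler_norml => h1 /andP[h2 h3]. have := hR_gt0 j.
by move=> h4; apply/andP; split; lra.
Qed.

End Rules.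
End RepresentableReals.

(** * Functions of the model acting on values of reals *)

Module RealFunctions.
Import ssreflect ssrfun ssrbool eqtype choice ssralg ssrnum order ring lra.
Import GRing.Theory Num.Theory.
Import Classical ClassicalEpsilon.
Import Completeness Semantics Interpretation Arithmetic Rationals Reals Values RepresentableReals.
Local Open Scope model_scope.
Local Open Scope ring_scope.
Set Implicit Arguments.
Unset Strict Implicit.
Arguments inR {M}.
Arguments inI {M}.
Arguments inSym {M}.
Arguments isFun {M}.
Arguments usco {M}.
Arguments lsco {M}.
Arguments cont {M}.
Arguments mem {M}.
Arguments memC {M}.
Arguments isOpen {M}.
Arguments isClosedI {M}.
Arguments memUpTo {M}.
Notation fn := (rl ~> rl)%model.

Section Functions.
Variable M : model.
Notation N := (M Defs.o).
Notation Q := (Qf M).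
Notation R := (Rf M).
Notation RL := (M rl).
Notation FN := (M fn).
Notation o := Defs.o.
Notation real := (@isReal M).

(** The values of reals of the model, over which the quantifiers of the statements range. *)
Definition Mr (r : R) : Prop := exists x, real x /\ val x = r.

Definition pick_real (r : R) : RL :=
  epsilon (inhabits (dflt M rl)) (fun x => real x /\ val x = r).

Lemma pick_realP r : Mr r -> real (pick_real r) /\ val (pick_real r) = r.
Proof. exact: epsilon_spec. Qed.

Lemma Mr_val x : real x -> Mr (val x).
Proof. by exists x. Qed.

Lemma Mr_RepR G (D : env M G -> Prop) f e : RepR D f -> D e -> Mr (f e).
Proof. by move=> [a [_ h]] /h[h1 h2]; exists (a e). Qed.

Lemma RepR_Mr G (D : env M G -> Prop) r : Mr r -> RepR D (fun _ => r).
Proof. by move=> [x [hx <-]]; apply: RepR_const. Qed.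

Notation ctx0 := (fun _ : env M nil => True).

Lemma Mr_emb q : Mr (emb q : R).
Proof. exact: (Mr_RepR (D := ctx0) (e := tt) (RepR_rat ctx0 q) I). Qed.

Lemma Mr_nR n : Mr (nR n).
Proof. exact: Mr_emb. Qed.

Lemma Mr_0 : Mr 0.
Proof. by rewrite -emb0; apply: Mr_emb. Qed.

Lemma Mr_1 : Mr 1.
Proof. by rewrite -emb1; apply: Mr_emb. Qed.

Lemma Mr_add r s : Mr r -> Mr s -> Mr (r + s).
Proof.
by move=> hr hs; apply: (Mr_RepR (D := ctx0) (e := tt) (RepR_add (RepR_Mr _ hr) (RepR_Mr _ hs))).
Qed.

Lemma Mr_opp r : Mr r -> Mr (- r).
Proof. by move=> hr; apply: (Mr_RepR (D := ctx0) (e := tt) (RepR_opp (RepR_Mr _ hr))). Qed.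

Lemma Mr_sub r s : Mr r -> Mr s -> Mr (r - s).
Proof. by move=> hr hs; apply: Mr_add => //; apply: Mr_opp. Qed.

Lemma Mr_scale n r : Mr r -> Mr (nR n * r).
Proof.
have hn : Rep (fun _ : env M nil => n) by rep.
by move=> hr; apply: (Mr_RepR (D := ctx0) (e := tt) (RepR_scale hn (RepR_Mr _ hr))).
Qed.

Lemma Mr_max r s : Mr r -> Mr s -> Mr (Num.max r s).
Proof.
by move=> hr hs; apply: (Mr_RepR (D := ctx0) (e := tt) (RepR_max (RepR_Mr _ hr) (RepR_Mr _ hs))).
Qed.

(** The action of [F] on values, through a chosen representative. By [isFun_fap] the choice does not
    matter if [F] respects equality of reals. *)
Definition fap (F : FN) (r : R) : R := val (F $ pick_real r).

Definition range (D : RL -> Prop) (P : R -> Prop) : Prop :=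
  forall x, D x <-> real x /\ P (val x).

Lemma range_R : range inR (fun _ => True).
Proof. by move=> x; rewrite /inR; tauto. Qed.

Definition unitI (r : R) : Prop := 0 <= r /\ r <= 1.
Definition symI (n : N) (r : R) : Prop := - nR n <= r /\ r <= nR n.

Lemma range_I : range inI unitI.
Proof.
move=> x; rewrite /inI /unitI; split.
- move=> [hx]. rewrite !rleP ?val_rnat ?nR0 ?nR1 //; exact: real_rnat.
- move=> [hx]. rewrite !rleP ?val_rnat ?nR0 ?nR1 //; exact: real_rnat.
Qed.

Lemma range_Sym n : range (inSym n) (symI n).
Proof.
move=> x; rewrite /inSym /symI. have h := real_rnat n; have h' := real_ropp h.
split.
- by move=> [hx]; rewrite !rleP // val_ropp // val_rnat.
- by move=> [hx]; rewrite !rleP // val_ropp // val_rnat.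
Qed.

Section OnRange.
Variables (D : RL -> Prop) (P : R -> Prop).
Hypothesis hD : range D P.

Lemma isFun_fap F x : isFun D F -> real x -> P (val x) ->
  real (F $ x) /\ fap F (val x) = val (F $ x).
Proof.
move=> [h1 h2] hx px. have hDx : D x by apply/hD.
have [hy ey] := pick_realP (Mr_val hx).
have hDy : D (pick_real (val x)) by apply/hD; rewrite ey.
split; first exact: h1. by apply/reqP; try exact: h1; apply: h2 => //; apply/reqP.
Qed.

Lemma isFunP F : isFun D F <-> (forall x, real x -> P (val x) -> real (F $ x)) /\
  (forall x y, real x -> real y -> P (val x) -> val x = val y -> val (F $ x) = val (F $ y)).
Proof.
split=> [[h1 h2]|[h1 h2]].
- split=> [x hx px|x y hx hy px e]; first by apply: h1; apply/hD.
  have px' : D x by apply/hD. have py' : D y by apply/hD; rewrite -e.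
  by apply/reqP; try exact: h1; apply: h2 => //; apply/reqP.
- split=> [x /hD[hx px]|x /hD[hx px] y /hD[hy py] /(reqP hx hy) e]; first exact: h1.
  by apply/reqP; try exact: h1; apply: h2.
Qed.

Lemma RepR_fap G (E : env M G -> Prop) (F : env M G -> FN) (g : env M G -> R) :
  Rep F -> RepR E g -> (forall e, E e -> isFun D (F e) /\ P (g e)) ->
  RepR E (fun e => fap (F e) (g e)).
Proof.
move=> hF [a [ha ea]] h. exists (fun e => F e $ a e); split; first by rep.
move=> e he. have [h1 h2] := h e he. have [h3 h4] := ea e he.
rewrite -h4 in h2 *. by have [h5 ->] := isFun_fap h1 h3 h2.
Qed.

Definition uscoR (f : R -> R) : Prop := forall r, Mr r -> P r -> forall e, 0 < e ->
  exists d, 0 < d /\ forall s, Mr s -> P s -> `|r - s| < d -> f s < f r + e.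
Definition lscoR (f : R -> R) : Prop := forall r, Mr r -> P r -> forall e, 0 < e ->
  exists d, 0 < d /\ forall s, Mr s -> P s -> `|r - s| < d -> f r - e < f s.

(** Both kinds of semicontinuity and continuity differ only in the relation between values, so the
    passage from errors [2^-k] to positive elements of the field is made once for all three. *)
Lemma usco_lsco_body F (rel : N -> RL -> RL -> Prop) (relR : R -> R -> R -> Prop) :
  isFun D F ->
  (forall k x y, real x -> real y -> rel k x y <-> relR (hR k) (val x) (val y)) ->
  (forall e e' r s, e <= e' -> relR e r s -> relR e' r s) ->
  (forall x, D x -> forall k : N, exists n : N, forall y, D y ->
    near n x y -> rel k (F $ y) (F $ x)) <->
  (forall r, Mr r -> P r -> forall e, 0 < e ->
    exists d, 0 < d /\ forall s, Mr s -> P s -> `|r - s| < d -> relR e (fap F s) (fap F r)).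
Proof.
move=> hF hrel hmono. split.
- move=> h r [x [hx <-]] px e he. have [k hk] := hR_arch he.
  have Dx : D x by apply/hD. have [n hn] := h x Dx k.
  exists (hR n); split; first exact: hR_gt0.
  move=> s [y [hy <-]] py hxy.
  have [h1 ->] := isFun_fap hF hx px. have [h2 ->] := isFun_fap hF hy py.
  apply: (hmono (hR k)); first by lra. apply/hrel => //. apply: hn; first exact/hD.
  exact/nearP.
- move=> h x /hD[hx px] k. have [d [hd hd']] := h _ (Mr_val hx) px _ (hR_gt0 k).
  have [n hn] := hR_arch hd. exists n => y /hD[hy py] /(nearP _ hx hy) hxy.
  have [h1 e1] := isFun_fap hF hx px. have [h2 e2] := isFun_fap hF hy py.
  apply/hrel => //. rewrite -e1 -e2. apply: hd' => //; first exact: Mr_val. by lra.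
Qed.

Lemma uscoP F : usco D F <-> isFun D F /\ uscoR (fap F).
Proof.
have h F' : isFun D F' -> (forall x, D x -> forall k : N, exists n : N, forall y, D y ->
    near n x y -> rlt (F' $ y) (radd (F' $ x) (rexp k))) <-> uscoR (fap F').
  move=> hF. apply: (usco_lsco_body (rel := fun k a b => rlt a (radd b (rexp k)))
    (relR := fun e a b => a < b + e)) => //.
  - move=> k x y hx hy. have hk := real_rexp k.
    by rewrite rltP ?val_radd ?val_rexp //; apply: real_radd.
  - by move=> e e' r s h1 h2; lra.
by split=> -[hF] hb; split=> //; apply/(h F hF).
Qed.

Lemma lscoP F : lsco D F <-> isFun D F /\ lscoR (fap F).
Proof.
have h F' : isFun D F' -> (forall x, D x -> forall k : N, exists n : N, forall y, D y ->
    near n x y -> rlt (rsub (F' $ x) (rexp k)) (F' $ y)) <-> lscoR (fap F').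
  move=> hF. apply: (usco_lsco_body (rel := fun k a b => rlt (rsub b (rexp k)) a)
    (relR := fun e a b => b - e < a)) => //.
  - move=> k x y hx hy. have hk := real_rexp k.
    by rewrite rltP ?val_rsub ?val_rexp //; apply: real_rsub.
  - by move=> e e' r s h1 h2; lra.
by split=> -[hF] hb; split=> //; apply/(h F hF).
Qed.

Lemma contP F : cont D F <-> isFun D F /\ (uscoR (fap F) /\ lscoR (fap F)).
Proof.
have h F' : isFun D F' -> (forall x, D x -> forall k : N, exists n : N, forall y, D y ->
    near n x y -> near k (F' $ x) (F' $ y)) <-> (uscoR (fap F') /\ lscoR (fap F')).
  move=> hF. rewrite (usco_lsco_body (rel := fun k a b => near k b a)
    (relR := fun e a b => `|b - a| < e)) //.
  - split.
    + move=> H; split=> r hr pr e he; have [d [hd hd']] := H r hr pr e he; exists d; split=> // s;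
      by move=> hs ps /(hd' s hs ps); rewrite ltr_norml => /andP[h1 h2]; lra.
    + move=> [H1 H2] r hr pr e he. have [d1 [hd1 h1]] := H1 r hr pr e he.
      have [d2 [hd2 h2]] := H2 r hr pr e he. have [m1 m2 m3] := minr_spec d1 d2.
      exists (Num.min d1 d2); split; first by case: m3 => ->.
      move=> s hs ps hrs. have k1 : `|r - s| < d1 by lra. have k2 : `|r - s| < d2 by lra.
      by have := h1 s hs ps k1; have := h2 s hs ps k2; rewrite ltr_norml => ? ?; apply/andP; split; lra.
  - by move=> k x y hx hy; apply: nearP.
  - by move=> e e' r s h1 h2; lra.
by split=> -[hF] hb; split=> //; apply/(h F hF).
Qed.

End OnRange.

Lemma memP F x : isFun inR F -> real x -> mem x F <-> 0 < fap F (val x).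
Proof.
move=> hF hx. have [h1 ->] := isFun_fap range_R hF hx I.
by rewrite /mem rltP ?val_rnat ?nR0 //; apply: real_rnat.
Qed.

Definition openR (A : R -> Prop) : Prop := forall r, Mr r -> A r ->
  exists d, 0 < d /\ forall s, Mr s -> `|r - s| < d -> A s.

Lemma isOpenP F : isOpen F <-> isFun inR F /\ openR (fun r => 0 < fap F r).
Proof.
split=> -[hF h]; split=> //.
- move=> r [x [hx <-]] /(memP hF hx) hm. have [n hn] := h x hx hm.
  exists (hR n); split; first exact: hR_gt0. move=> s [y [hy <-]] hxy.
  by apply/(memP hF hy)/hn => //; apply/nearP.
- move=> x hx /(memP hF hx) hm. have [d [hd hd']] := h _ (Mr_val hx) hm.
  have [n hn] := hR_arch hd. exists n => y hy /(nearP _ hx hy) hxy.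
  by apply/(memP hF hy)/hd'; [apply: Mr_val|lra].
Qed.

Lemma isFun_sub (D D' : RL -> Prop) F : (forall x, D' x -> D x) -> isFun D F -> isFun D' F.
Proof. by move=> h [h1 h2]; split=> [x /h|x /h hx y /h hy]; [apply: h1|apply: h2]. Qed.

Lemma inI_inR (x : RL) : inI x -> inR x.
Proof. by case. Qed.

(** Here [f] is computed from the representative; the second hypothesis makes it depend on the value
    only, so that its term respects equality of reals. *)
Lemma mkF (f : env M (cons rl nil) -> R) :
  RepR (fun e : env M (cons rl nil) => real (snd e)) f ->
  (forall x y, real x -> real y -> val x = val y -> f (tt, x) = f (tt, y)) ->
  exists F, isFun inR F /\ forall x, real x -> fap F (val x) = f (tt, x).
Proof.
move=> [a [[g [_ eg]] ea]] hf'.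
have ea' x : real x -> real (g tt $ x) /\ val (g tt $ x) = f (tt, x).
  by move=> hx; rewrite eg; apply: ea.
have hF : isFun inR (g tt).
  apply/(isFunP range_R); split=> [x hx _|x y hx hy _ e].
  - by case: (ea' x hx).
  - by have [_ ->] := ea' x hx; have [_ ->] := ea' y hy; apply: hf'.
exists (g tt); split=> // x hx. have [_ ->] := isFun_fap range_R hF hx I.
by case: (ea' x hx).
Qed.

Lemma mkF2 (f : env M (cons rl (cons o nil)) -> R) :
  RepR (fun e : env M (cons rl (cons o nil)) => real (snd e)) f ->
  (forall n x y, real x -> real y -> val x = val y -> f (tt, n, x) = f (tt, n, y)) ->
  exists F : M (o ~> fn), forall n, isFun inR (F $ n) /\
    forall x, real x -> fap (F $ n) (val x) = f (tt, n, x).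
Proof.
move=> [a [[g [[g' [_ eg']] eg]] ea]] hf'. exists (g' tt) => n.
have [F [hF eF]] : exists F, F = g' tt $ n /\ isFun inR F /\
    forall x, real x -> fap F (val x) = f (tt, n, x).
  exists (g' tt $ n); split=> //.
  have ea' x : real x -> real (g' tt $ n $ x) /\ val (g' tt $ n $ x) = f (tt, n, x).
    by move=> hx; rewrite eg' eg; apply: ea.
  have hF : isFun inR (g' tt $ n).
    apply/(isFunP range_R); split=> [x hx _|x y hx hy _ e].
    - by case: (ea' x hx).
    - by have [_ ->] := ea' x hx; have [_ ->] := ea' y hy; apply: hf'.
  split=> // x hx. have [_ ->] := isFun_fap range_R hF hx I.
  by case: (ea' x hx).
by rewrite -hF.
Qed.

Lemma mkF3 (f : env M (cons rl (cons o (cons o nil))) -> R) :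
  RepR (fun e : env M (cons rl (cons o (cons o nil))) => real (snd e)) f ->
  (forall m n x y, real x -> real y -> val x = val y -> f (tt, m, n, x) = f (tt, m, n, y)) ->
  exists F : M (o ~> o ~> fn), forall m n, isFun inR (F $ m $ n) /\
    forall x, real x -> fap (F $ m $ n) (val x) = f (tt, m, n, x).
Proof.
move=> [a [[g [[g' [[g'' [_ eg'']] eg']] eg]] ea]] hf'. exists (g'' tt) => m n.
have ea' x : real x -> real (g'' tt $ m $ n $ x) /\ val (g'' tt $ m $ n $ x) = f (tt, m, n, x).
  by move=> hx; rewrite eg'' eg' eg; apply: ea.
have hF : isFun inR (g'' tt $ m $ n).
  apply/(isFunP range_R); split=> [x hx _|x y hx hy _ e].
  - by case: (ea' x hx).
  - by have [_ ->] := ea' x hx; have [_ ->] := ea' y hy; apply: hf'.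
split=> // x hx. have [_ ->] := isFun_fap range_R hF hx I.
by case: (ea' x hx).
Qed.

Lemma not_real_witness (x : RL) : ~ real x ->
  exists k, ~ `|v (x $ pi1 k) - v (x $ add (pi1 k) (pi2 k))| < hf (pi1 k).
Proof.
move=> h. apply: NNPP => H. apply: h. apply/isRealP => n i. apply: NNPP => h.
by apply: H; exists (pair n i); rewrite pi1_pair pi2_pair.
Qed.

(** QF-AC^{1,0} demands a witness for every sequence, and being a real is not decidable. But failing
    to be one has a numerical witness, so a number is chosen that satisfies [P] or refutes that x is
    a real. *)
Lemma choose_real (P : RL -> N -> Prop) :
  Dec (fun e : env M (cons o (cons rl nil)) => P (snd (fst e)) (snd e)) ->
  (forall x, real x -> exists n, P x n) ->
  exists Y : M (rl ~> o), forall x, real x -> P x (Y $ x).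
Proof.
move=> hP h.
have [||Y hY] := choice1 M (fun x k => P x k \/
    ~ `|v (x $ pi1 k) - v (x $ add (pi1 k) (pi2 k))| < hf (pi1 k)).
- apply: Dec_or => //; apply: Dec_not; apply: Dec_ltQ; last by apply: RepQ_hf; rep.
  by apply: RepQ_norm; apply: RepQ_add; [|apply: RepQ_opp]; apply: RepQ_v; rep.
- move=> x. have [/h[n hn]|/not_real_witness[k hk]] := classic (real x).
  + by exists n; left.
  + by exists k; right.
- by exists Y => x hx; have [//|[]] := hY x; exact: (proj1 (isRealP x) hx).
Qed.

(** Bounded search, with the bound itself as the answer when nothing is found. *)
Lemma Rep_bsearch G (P : env M G -> N -> Prop) :
  Dec (fun e : env M (cons o G) => P (fst e) (snd e)) ->
  exists s : env M G -> N -> N, Rep (fun e : env M (cons o G) => s (fst e) (snd e)) /\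
    forall e n, [/\ le (s e n) n, forall k, lt k (s e n) -> ~ P e k
      & lt (s e n) n -> P e (s e n)].
Proof.
move=> [p [[g [hg eg]] ep]].
have gP e k : g e $ k = zero <-> P e k by rewrite eg ep.
pose s e n := rec n zero (\ u _ : N => ite (g e $ u = zero) u (succ u)).
exists s; split.
  by rewrite /s; dec.
have s0 e : s e zero = zero by rewrite /s rec0.
have sS e n : s e (succ n) = ite (P e (s e n)) (s e n) (succ (s e n)).
  rewrite /s recS beta; last by dec. rewrite beta; last by dec.
  have [h|h] := classic (P e (s e n)).
  - by rewrite !ite_true //; apply/gP.
  - by rewrite !ite_false // => /gP.
move=> e.
suff H n : le (s e n) n /\ ((forall k, lt k (s e n) -> g e $ k <> zero) /\
    (lt (s e n) n -> g e $ s e n = zero)).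
  move=> n; have [h1 [h2 h3]] := H n; split=> //.
  - by move=> k /h2 h /gP.
  - by move=> /h3 /gP.
move: n. apply: N_ind.
- by rewrite /s; dec.
- rewrite s0; split; first exact: le_refl.
  by split=> [k|] /lt_nle; [case; apply: le0|case; apply: le_refl].
- move=> n [h1 [h2 h3]]. rewrite sS.
  have [h|h] := classic (P e (s e n)).
  + rewrite ite_true //; split; first by apply/le_succ; left.
    by split=> // _; apply/gP.
  + rewrite ite_false //.
    have en : s e n = n.
      apply: le_anti => //. apply: NNPP => /lt_nle /h3 /gP. exact: h.
    rewrite en; split; first exact: le_refl.
    split; last by move=> /lt_nle []; apply: le_refl.
    move=> k /lt_succ hk. have [->|ne] := classic (k = n).
      by rewrite -{1}en => /gP.
    apply: h2. rewrite en. apply/lt_nle => hk'. by apply: ne; apply: le_anti.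
Qed.

End Functions.
End RealFunctions.

(** * Continuity of all functions in the absence of Kleene's quantifier *)

Module Dichotomy.
Import ssreflect ssrfun ssrbool eqtype choice ssralg ssrnum order ring lra.
Import GRing.Theory Num.Theory.
Import Classical ClassicalEpsilon.
Import Completeness Semantics Interpretation Arithmetic Rationals Reals Values RepresentableReals RealFunctions.
Local Open Scope model_scope.
Local Open Scope ring_scope.
Set Implicit Arguments.
Unset Strict Implicit.

Section Dichotomy.
Variable M : model.
Notation N := (M Defs.o).
Notation Q := (Qf M).
Notation R := (Rf M).
Notation RL := (M rl).
Notation FN := (M fn).
Notation o := Defs.o.
Notation real := (@isReal M).

(** The functional E^2, with value zero for a positive answer. *)
Definition kleene2 : Prop :=
  exists E : M (rl ~> o), forall f : RL, E $ f = zero <-> exists n, f $ n = zero.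

(* Grilliot's trick: the sequence that approximates t until a zero of f is found, and then
   stays at a rational close to t at which F jumps, has limit t iff f has no zero; so the
   value of F at the limit decides the latter. *)
Lemma grilliot_seq (F : FN) (t e : R) : isFun inR F -> Mr t -> 0 < e ->
  (forall k, exists q : Q, `|t - emb q| < hR k /\ e < `|fap F t - fap F (emb q)|) -> kleene2.
Proof.
move=> hF [x [hx <-]] he H.
(* Write h for [hR J]. The jumps exceed 8h. Compared at precision J they exceed 6h, a decidable
   condition, which in turn ensures a true jump above 4h; so the final test at precision J can have
   threshold 2h. *)
have he8 : 0 < e / 8 by lra. have [J hJ] := hR_arch he8.
pose kc c : RL := s_K o o $ c.
have [hy ey] := isFun_fap (@range_R M) hF hx I.
have hw c : real (F $ kc c) /\ fap F (emb (v c)) = val (F $ kc c).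
  have := isFun_fap (@range_R M) hF (real_const c) I. by rewrite val_const.
have [h2 eh2] : exists h2 : Q, emb h2 = 2 * hR J.
  by exists (hf J + hf J); rewrite embD -/(hR _); lra.
have [h6 eh6] : exists h6 : Q, emb h6 = 6 * hR J.
  by exists (h2 + h2 + h2); rewrite !embD eh2; lra.
pose P k c := `|v (x $ succ (succ k)) - v c| < hf (succ k) /\
  h6 < `|v (F $ x $ J) - v (F $ kc c $ J)|.
have [||g hg] := choice0 M P.
- apply: Dec_and; apply: Dec_ltQ; try exact: RepQ_const.
  + apply: RepQ_norm; apply: RepQ_add; last apply: RepQ_opp; apply: RepQ_v; by rep.
  + by apply: RepQ_hf; rep.
  + apply: RepQ_norm; apply: RepQ_add; last apply: RepQ_opp; apply: RepQ_v; by rewrite /kc; rep.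
- move=> k. have [q [h1 h3]] := H (succ (succ k)). have [c ec] := v_surj q. rewrite ec in h1 h3.
  exists c; rewrite /P. have [hc e2] := hw c. rewrite ey e2 in h3.
  have h4 := val_closeP (succ (succ k)) hx.
  have h5 := val_closeP J hy. have h6' := val_closeP J hc.
  split.
  + rewrite -emb_lt emb_norm embB -/(hR _). move: h1 h4. rewrite !hRS !ltr_norml.
    by move=> /andP[h1 h1'] h4; apply/andP; split; lra.
  + rewrite -emb_lt emb_norm embB eh6. apply: NNPP => /negP.
    rewrite -Order.TotalTheory.leNgt ler_norml => /andP[h7 h8].
    suff : `|val (F $ x) - val (F $ kc c)| <= 8 * hR J by lra.
    by rewrite ler_norml; apply/andP; split; lra.
have {hg} hg k : `|val x - emb (v (g $ k))| < hR k /\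
    4 * hR J < `|val (F $ x) - val (F $ kc (g $ k))|.
  have [h1 h3] := hg k. have [hc e2] := hw (g $ k).
  have h4 := val_closeP (succ (succ k)) hx.
  have h5 := val_closeP J hy. have h6' := val_closeP J hc.
  have p0 := hR_gt0 k.
  split.
  + move: h1; rewrite -emb_lt emb_norm embB -/(hR _); move: h4. rewrite !hRS !ltr_norml.
    by move=> h4 /andP[h1 h1']; apply/andP; split; lra.
  + move: h3; rewrite -emb_lt emb_norm embB eh6 => h3. apply: NNPP => /negP.
    rewrite -Order.TotalTheory.leNgt ler_norml => /andP[h7 h8].
    have : `|emb (v (F $ x $ J)) - emb (v (F $ kc (g $ k) $ J))| <= 6 * hR J.
      by rewrite ler_norml; apply/andP; split; lra.
    by lra.
have [|s [hs es]] := @Rep_bsearch M (cons rl nil) (fun e k => snd e $ k = zero).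
  by dec.
(* If the first zero k is found only after stage j, then [k >= j], and the jump point chosen for k
   is within [2^-k] of x; so the change of course does not spoil fast convergence. *)
pose A (f : env M (cons rl nil)) j : Q :=
  if excluded_middle_informative (lt (s f j) j) then v (g $ s f j) else v (x $ j).
have hA : RepQ (fun e : env M (cons o (cons rl nil)) => A (fst e) (snd e)).
  pose C := env M (cons o (cons rl nil)).
  apply: (RepQ_ite (P := fun e : C => lt (s (fst e) (snd e)) (snd e))
    (f := fun e : C => v (g $ s (fst e) (snd e))) (g := fun e : C => v (x $ snd e))).
  - by dec.
  - by apply: RepQ_v; rep.
  - by apply: RepQ_v; rep.
  - by move=> e' h; rewrite /A; case: excluded_middle_informative.
  - by move=> e' h; rewrite /A; case: excluded_middle_informative.
have least_s (f : RL) (j k : N) : f $ k = zero -> (forall i, lt i k -> f $ i <> zero) -> lt k j ->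
    s (tt, f) j = k.
  move=> fk fi kj. have [k1 k2 k3] := es (tt, f) j.
  have hlt : lt (s (tt, f) j) j.
    apply: NNPP => h. apply: (k2 k) => //. apply: NNPP => h'. apply: h.
    have /nR_lt h1 := kj. have h2' : le (s (tt, f) j) k by apply: NNPP => /lt_nle.
    by apply/nR_lt; move/nR_le: h2'; lra.
  by apply: le_anti; apply: NNPP => /lt_nle h; [apply: (k2 k h)|apply: (fi _ h) (k3 hlt)].
have A_found (f : RL) (j k : N) : f $ k = zero -> (forall i, lt i k -> f $ i <> zero) -> lt k j ->
    A (tt, f) j = v (g $ k).
  move=> h1 h3 h4. by rewrite /A (least_s f j k h1 h3 h4); case: excluded_middle_informative.
have A_none (f : RL) (j : N) : (forall i, lt i j -> f $ i <> zero) -> A (tt, f) j = v (x $ j).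
  move=> h. rewrite /A; case: excluded_middle_informative => //= h'.
  have [_ _ k3] := es (tt, f) j. by case: (h _ h'); apply: k3.
have first (f : RL) (j : N) : (forall i, lt i j -> f $ i <> zero) \/
    exists k, [/\ lt k j, f $ k = zero & forall i, lt i k -> f $ i <> zero].
  have [k1 k2 k3] := es (tt, f) j. have [h|h] := classic (lt (s (tt, f) j) j).
  - by right; exists (s (tt, f) j); split=> //; apply: k3.
  - have e1 : s (tt, f) j = j by apply: le_anti => //; apply: NNPP => /lt_nle.
    by left; move: k2; rewrite e1.
have [||z [hz ez]] := @RepR_limit M (cons rl nil) (fun _ => True) A (fun _ => succ one) hA.
- by rep.
- move=> [[] f] _ j i. rewrite -emb_le emb_norm embB embM -/(hR _) -/(nR _) nRS nR1.
  have p0 := hR_gt0 j. have le_j : le j (add j i) by apply/leP; exists i.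
  have hxj := val_closeP j hx. have hxi := val_closeP (add j i) hx.
  have [h|[k [k1 k2 k3]]] := first f j; last first.
    rewrite (A_found f j k) // (A_found f (add j i) k) //; first by rewrite subrr normr0; lra.
    by move/nR_lt: k1 => k1; move/nR_le: le_j => le_j; apply/nR_lt; lra.
  rewrite (A_none f j h). have := proj1 (isRealP x) hx j i.
  rewrite -emb_lt emb_norm embB -/(hR _) => h3.
  have [h'|[k [k1 k2 k3]]] := first f (add j i); first by rewrite (A_none f _ h'); lra.
  rewrite (A_found f _ k) //. have [h4 _] := hg k.
  have h5 : le j k by apply: NNPP => /lt_nle /h.
  have := hR_anti h5. move: h4; rewrite ler_norml ltr_norml => /andP[h4 h4'] h6'.
  by apply/andP; split; lra.
have {ez} ez (f : RL) (j : N) : `|z (tt, f) - emb (A (tt, f) j)| <= 2 * hR j.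
  by have := ez (tt, f) I j; rewrite nRS nR1; lra.
have [a [ha ea]] := hz.
have z_none (f : RL) : (forall i, f $ i <> zero) -> z (tt, f) = val x.
  move=> h. have h1 n : `|z (tt, f) - val x| <= 0 + 3 * hR n.
    have := ez f n. rewrite A_none //. have := val_closeP n hx. rewrite !ler_norml.
    by move=> h3 /andP[h4 h5]; apply/andP; split; lra.
  by have := le_hR h1; rewrite normr_le0 subr_eq0 => /eqP.
have z_found (f : RL) : (exists i, f $ i = zero) -> exists k, z (tt, f) = emb (v (g $ k)).
  move=> /(@N_least M (fun i => f $ i = zero)) [|k [k1 k2]]; first by dec.
  exists k. have h1 n : `|z (tt, f) - emb (v (g $ k))| <= 0 + 2 * hR n.
    have := ez f (add n (succ k)). rewrite (A_found f _ k) //; last first.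
      by apply/nR_lt; rewrite nRD nRS; have := nR_ge0 n; lra.
    have : hR (add n (succ k)) <= hR n by apply: hR_anti; apply/leP; exists (succ k).
    by lra.
  by have := le_hR h1; rewrite normr_le0 subr_eq0 => /eqP.
have hlt : Dec (fun f : env M (cons rl nil) =>
    h2 < `|v (F $ a f $ J) - v (F $ x $ J)|).
  apply: Dec_ltQ; first exact: RepQ_const.
  by apply: RepQ_norm; apply: RepQ_add; last apply: RepQ_opp; apply: RepQ_v; rep.
exists (\ f => ite (h2 < `|v (F $ a (tt, f) $ J) - v (F $ x $ J)|) zero one) => f.
rewrite beta; last first.
  apply: (Rep_ext _ _ _ (fun e => ite (h2 < `|v (F $ a e $ J) - v (F $ x $ J)|) zero one)).
    by move=> [[] f'].
  by apply: Rep_ite => //; rep.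
have [hra eva] := ea (tt, f) I.
have [hFa eFa] := isFun_fap (@range_R M) hF hra I.
have h5 := val_closeP J hy. have h6' := val_closeP J hFa.
split.
- have [h|h] := classic (h2 < `|v (F $ a (tt, f) $ J) - v (F $ x $ J)|); last first.
    by rewrite ite_false // => /succ_nz.
  move=> _. apply: NNPP => H'. move: h. apply/negP. rewrite -Order.TotalTheory.leNgt.
  have zx : z (tt, f) = val x by apply: z_none => i hi; apply: H'; exists i.
  have e3 : val (F $ a (tt, f)) = val (F $ x) by rewrite -eFa eva zx ey.
  rewrite -emb_le emb_norm embB eh2 ler_norml. rewrite e3 in h6'.
  by apply/andP; split; lra.
- move=> /z_found[k zk]. rewrite ite_true //.
  have [_ h7] := hg k. have [hc e2] := hw (g $ k).
  have e3 : val (F $ a (tt, f)) = val (F $ kc (g $ k)) by rewrite -eFa eva zk e2.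
  rewrite -emb_lt emb_norm embB eh2. apply: NNPP => /negP.
  rewrite -Order.TotalTheory.leNgt ler_norml => /andP[h8 h9].
  suff : `|val (F $ x) - val (F $ kc (g $ k))| <= 4 * hR J by lra.
  by rewrite -e3 ler_norml; apply/andP; split; lra.
Qed.

(** The jump points of [grilliot_seq] are rational. If the values at all rationals near [r] are
    close to that at [r], then a point [s] near [r] with a distant value is surrounded by rationals
    with values distant from its own, and the argument applies at [s]. *)
Lemma grilliot (F : FN) : isFun inR F -> ~ kleene2 -> forall r, Mr r -> forall e, 0 < e ->
  exists d, 0 < d /\ forall s, Mr s -> `|r - s| < d -> `|fap F r - fap F s| < e.
Proof.
move=> hF hE r hr e he. apply: NNPP => H.
have H1 d : 0 < d -> exists s, [/\ Mr s, `|r - s| < d & e <= `|fap F r - fap F s|].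
  move=> hd. apply: NNPP => H1. apply: H; exists d; split=> // s hs hrs.
  apply: NNPP => /negP. rewrite -Order.TotalTheory.leNgt => h. by apply: H1; exists s.
apply: hE.
have [H2|H2] := classic (forall k, exists q : Q, `|r - emb q| < hR k /\
    e / 2 < `|fap F r - fap F (emb q)|).
  by apply: (@grilliot_seq F r (e / 2)) => //; lra.
have [k hk] : exists k, forall q : Q, `|r - emb q| < hR k -> `|fap F r - fap F (emb q)| <= e / 2.
  apply: NNPP => H3. apply: H2 => k. apply: NNPP => H4. apply: H3. exists k => q hq.
  apply: NNPP => /negP. rewrite -Order.TotalTheory.ltNge => h. by apply: H4; exists q.
have [s [[x [hx xs]] hrs hs]] := H1 _ (hR_gt0 k).
apply: (@grilliot_seq F s (e / 4)) => //; [by exists x|by lra|].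
move=> j. have hd : 0 < hR k - `|r - s| by lra.
have [n hn] := hR_arch hd.
exists (v (x $ add n (succ j))).
have h1 : `|s - emb (v (x $ add n (succ j)))| <= hR (add n (succ j)).
  by rewrite -xs; apply: val_close.
have h2 : hR (add n (succ j)) <= hR n by apply: hR_anti; apply/leP; exists (succ j).
have h3 : hR (add n (succ j)) <= hR (succ j).
  by apply: hR_anti; apply/leP; exists n; rewrite addC.
have h4 : `|r - emb (v (x $ add n (succ j)))| < hR k.
  by have := ler_distD s r (emb (v (x $ add n (succ j)))); lra.
split; first by move: h3; rewrite hRS; have := hR_gt0 j; lra.
have := hk _ h4. have := ler_distD (fap F (emb (v (x $ add n (succ j))))) (fap F r) (fap F s).
by rewrite (distrC (fap F s)); lra.
Qed.

End Dichotomy.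
End Dichotomy.

(** * Semicontinuous ranks of open covers *)

Module SemicontinuousRank.
Import ssreflect ssrfun ssrbool eqtype choice ssralg ssrnum order ring lra.
Import GRing.Theory Num.Theory.
Import Classical ClassicalEpsilon.
Import Completeness Semantics Interpretation Arithmetic Rationals Reals Values RepresentableReals RealFunctions Dichotomy.
Local Open Scope model_scope.
Local Open Scope ring_scope.
Set Implicit Arguments.
Unset Strict Implicit.

Section Rank.
Variable M : model.
Notation N := (M Defs.o).
Notation Q := (Qf M).
Notation R := (Rf M).
Notation RL := (M rl).
Notation FN := (M fn).
Notation o := Defs.o.
Notation real := (@isReal M).
Notation everywhere := (fun _ : R => True).

Lemma nlt_le (a b : N) : ~ lt a b -> le b a.
Proof. by move=> h; apply: NNPP => /lt_nle. Qed.

Lemma hR_lt (m n : N) : hR m < hR n -> lt n m.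
Proof. by move=> h; apply: NNPP => /nlt_le /hR_anti; lra. Qed.

Lemma RepR_fap_val G (E : env M G -> Prop) (F : env M G -> FN) (x : env M G -> RL) :
  Rep F -> Rep x -> (forall e, E e -> isFun inR (F e) /\ real (x e)) ->
  RepR E (fun e => fap (F e) (val (x e))).
Proof.
move=> hF hx h. apply: (RepR_fap (D := inR) (P := everywhere)); first exact: range_R.
- exact: hF.
- by apply: RepR_val => // e /h[].
- by move=> e /h[].
Qed.

(** Terms with index beyond j are at most [2^-j], so the maxima of finitely many terms converge to
    the supremum fast enough. *)
Lemma RepR_sup G (D : env M G -> Prop) (t : env M G -> N -> R) :
  RepR (fun e : env M (cons o G) => D (fst e)) (fun e : env M (cons o G) => t (fst e) (snd e)) ->
  (forall e n, D e -> 0 <= t e n /\ t e n <= hR n) ->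
  exists f : env M G -> R, RepR D f /\ forall e, D e ->
    (forall n, t e n <= f e) /\ (forall z, z < f e -> exists n, z < t e n).
Proof.
move=> ht hb.
have [||S [hS eS]] := @RepR_bigmax M (cons o G) (fun e => D (fst e))
  (fun e n => t (fst e) n) (fun e => snd e).
- case: ht => a [[g [hg eg]] ea].
  exists (fun e : env M (cons o (cons o G)) => g (fst (fst e)) $ snd e); split.
    by rep; apply: Rep_wk; apply: Rep_wk.
  by move=> [[e j] n] /= he; have := ea (e, n) he; rewrite -eg.
- by rep.
have S_mono e j i : D e -> S (e, j) <= S (e, add j i).
  move=> he. apply: NNPP => /negP. rewrite -Order.TotalTheory.ltNge => h.
  have [_ /(_ _ h)[n [h1 h2]]] := eS (e, j) he. have [h3 _] := eS (e, add j i) he.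
  suff h4 : le n (add j i) by have := h3 n h4; rewrite /= in h2 *; lra.
  by apply: le_trans h1 _; apply/leP; exists i.
have S_ge e j n : D e -> le n j -> t e n <= S (e, j).
  by move=> he h; have [h1 _] := eS (e, j) he; apply: h1.
have S_step e j i : D e -> S (e, add j i) <= S (e, j) + hR j.
  move=> he. apply: NNPP => /negP. rewrite -Order.TotalTheory.ltNge => h.
  have [_ /(_ _ h)[n [h1 h2]]] := eS (e, add j i) he. rewrite /= in h2.
  have [h3|h3] := classic (le n j).
    by have := S_ge e j n he h3; have := hR_gt0 j; lra.
  have /hR_anti h4 : le j n by have [//|] := le_total _ j n.
  have h5 := S_ge e j zero he (le0 _ j).
  by have [k1 k2] := hb e n he; have [k3 k4] := hb e zero he; lra.
have [|||f [hf' ef]] := @RepR_lim M G D (fun e j => S (e, j)) (fun _ => one).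
- by apply: (RepR_ext (f := S)) => // -[].
- by rep.
- move=> e he j i. have h1 := S_mono e j i he. have h2 := S_step e j i he.
  by rewrite nR1 ler_norml; apply/andP; split; lra.
exists f; split=> // e he. have {ef}ef j := ef e he j. split.
- move=> n. apply: (@le_hR M _ _ 5) => j. have := ef (add j n).
  have h1 : hR (add j n) <= hR j by apply: hR_anti; apply/leP; exists n.
  have h2 : le n (add j n) by apply/leP; exists j; rewrite addC.
  have := S_ge e _ n he h2. rewrite nR1 ler_norml. have := hR_gt0 j.
  by move=> h3 h4 /andP[h5 h6]; lra.
- move=> z hz. have h0 : 0 < (f e - z) / 5 by lra. have [j hj] := hR_arch h0.
  have h1 : z < S (e, j).
    by have := ef j; rewrite nR1 ler_norml => /andP[h5 h6]; lra.
  by have [_ /(_ _ h1)[n [_ h2]]] := eS (e, j) he; exists n.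
Qed.

Lemma pos_witness (x : RL) : real x -> 0 < val x <-> exists k, hf k + hf k <= v (x $ k).
Proof.
move=> hx; split.
- move=> h. have h3 : 0 < val x / 3 by lra. have [k hk] := hR_arch h3. exists k.
  have := val_closeP k hx. by rewrite -emb_le embD -/(hR k); lra.
- move=> [k]. rewrite -emb_le embD -/(hR k) => h.
  by have := val_closeP k hx; have := hR_gt0 k; lra.
Qed.

Lemma lower_witness (x : RL) k : real x -> hf k + hf k <= v (x $ k) -> hR k <= val x.
Proof.
move=> hx. rewrite -emb_le embD -/(hR k) => h. by have := val_closeP k hx; lra.
Qed.

(** A positive lower bound for the value is found by [choose_real]. It may depend on the
    representative, but the inverse computed from it does not. *)
Lemma fap_inv (F : FN) : isFun inR F -> (forall r, Mr r -> 0 < fap F r) ->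
  exists F', isFun inR F' /\ forall r, Mr r -> fap F' r = (fap F r)^-1.
Proof.
move=> hF hpos.
have hFx x : real x -> real (F $ x) /\ fap F (val x) = val (F $ x).
  by move=> hx; apply: (isFun_fap (@range_R M)).
have [||Y hY] := @choose_real M (fun x k => hf k + hf k <= v (F $ x $ k)).
- by apply: Dec_leQ; [apply: RepQ_add; apply: RepQ_hf|apply: RepQ_v]; rep.
- move=> x hx. have [h1 h2] := hFx x hx. apply/pos_witness => //. rewrite -h2.
  by apply: hpos; apply: Mr_val.
have [||F' [hF' eF']] := @mkF M (fun e => (fap F (val (snd e)))^-1).
- apply: (RepR_inv (n := fun e : env M (cons rl nil) => Y $ snd e)); first by rep.
  + by apply: RepR_fap_val => //; rep.
  + move=> [[] x] /= hx. have [h1 ->] := hFx x hx. apply: lower_witness => //. exact: hY.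
- by move=> x y hx hy /= ->.
exists F'; split=> // r [x [hx <-]]. by rewrite eF'.
Qed.

Section Cover.
Variable O : M (o ~> fn).
Hypothesis hO : forall n, isOpen (O $ n).
Hypothesis covers : forall r, Mr r -> exists n, 0 < fap (O $ n) r.

Let isFunO n : isFun inR (O $ n).
Proof. by have /isOpenP[] := hO n. Qed.

Let openO n : openR (fun r => 0 < fap (O $ n) r).
Proof. by have /isOpenP[] := hO n. Qed.

Let fapO n x : real x -> real (O $ n $ x) /\ fap (O $ n) (val x) = val (O $ n $ x).
Proof. by move=> hx; apply: (isFun_fap (@range_R M)). Qed.

Definition usco_rank (F : FN) : Prop :=
  [/\ isFun inR F, uscoR everywhere (fap F) & forall r, Mr r -> forall n, fap F r <= nR n ->
    exists m, le m n /\ 0 < fap (O $ m) r].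
Definition lsco_rank (F : FN) : Prop :=
  [/\ isFun inR F, lscoR everywhere (fap F), forall r, Mr r -> 0 < fap F r &
    forall r, Mr r -> forall n, hR n < fap F r -> exists m, le m n /\ 0 < fap (O $ m) r].

(* With Kleene's quantifier the least index of a member of the cover is a function. *)
Lemma rank_discontinuous : kleene2 M -> (exists F, usco_rank F) /\ (exists F, lsco_rank F).
Proof.
move=> [E hE].
(* Zero iff x lies in the n-th set: E^2 looks for a precision at which the value of the representing
   function is seen to be positive. *)
pose p (x : RL) (n : N) : N := E $ (\ k => ite (hf k + hf k <= v (O $ n $ x $ k)) zero one).
have hk G (n : env M G -> N) (x : env M G -> RL) : Rep n -> Rep x ->
    Rep (fun e : env M (cons o G) =>
      ite (hf (snd e) + hf (snd e) <= v (O $ n (fst e) $ x (fst e) $ snd e)) zero one).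
  move=> hn hx. apply: Rep_ite; [|by rep|by rep].
  by apply: Dec_leQ; [apply: RepQ_add; apply: RepQ_hf|apply: RepQ_v]; rep.
have pP x n : real x -> p x n = zero <-> 0 < fap (O $ n) (val x).
  move=> hx. have [h1 ->] := fapO n hx. rewrite pos_witness // /p hE.
  have b k : (\ k => ite (hf k + hf k <= v (O $ n $ x $ k)) zero one) $ k
      = ite (hf k + hf k <= v (O $ n $ x $ k)) zero one.
    rewrite beta //. by apply: (hk nil (fun _ => n) (fun _ => x)); rep.
  split=> -[k hk']; exists k; move: hk'; rewrite ?b.
  - have [//|h] := classic (hf k + hf k <= v (O $ n $ x $ k)).
    by rewrite ite_false // => /succ_nz.
  - by move=> h; rewrite ite_true.
have hp : Dec (fun e : env M (cons o (cons rl nil)) => p (snd (fst e)) (snd e) = zero).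
  rewrite /p. apply: Dec_eq; last by rep. apply: Rep_ap; first by rep.
  apply: (Rep_lam _ _ _ _ (fun (e : env M (cons o (cons rl nil))) (k : N) =>
    ite (hf k + hf k <= v (O $ snd e $ snd (fst e) $ k)) zero one)).
  by apply: (hk (cons o (cons rl nil)) (fun e => snd e) (fun e => snd (fst e))); rep.
have [||mu hmu] := @choose_real M (fun x n => p x n = zero /\ forall i, lt i n -> p x i <> zero).
- apply: Dec_and => //. apply: (Dec_all_lt M (cons o (cons rl nil)) (fun e i => p (snd (fst e)) i <> zero)); last by rep.
  apply: Dec_not. case: hp => f [[g [hg eg]] ef].
  exists (fun e => g (fst (fst e)) $ snd e); split.
    by rep; apply: Rep_wk; apply: Rep_wk.
  by move=> [[e i] n]; rewrite eg ef.
- move=> x hx. apply: N_least.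
  + case: hp => f [[g [hg eg]] ef]. exists (fun e => g (tt, x) $ snd e); split; first by rep.
    by move=> [[] n]; rewrite eg ef.
  + by have [n hn] := covers (Mr_val hx); exists n; apply/pP.
have mu_pos x : real x -> 0 < fap (O $ (mu $ x)) (val x).
  by move=> hx; apply/pP => //; have [] := hmu x hx.
have mu_least x n : real x -> 0 < fap (O $ n) (val x) -> le (mu $ x) n.
  move=> hx /pP h. apply: NNPP => /lt_nle h'. have [_ /(_ _ h')[]] := hmu x hx. exact: h.
have mu_ext x y : real x -> real y -> val x = val y -> mu $ x = mu $ y.
  move=> hx hy e. by apply: le_anti; apply: mu_least => //; [rewrite e|rewrite -e]; apply: mu_pos.
split.
- have [||F [hF eF]] := @mkF M (fun e : env M (cons rl nil) => nR (mu $ snd e)).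
  + by apply: RepR_nR; rep.
  + by move=> x y hx hy e /=; rewrite (mu_ext x y).
  exists F; split=> //.
  (* Points near x still lie in the set with index [mu $ x], so the least index cannot be larger
     there. *)
  + move=> r [x [hx <-]] _ e he. have [d [hd hd']] := openO (Mr_val hx) (mu_pos x hx).
    exists d; split=> // s [y [hy <-]] _ hs. rewrite !eF //=.
    have /nR_le := mu_least y _ hy (hd' _ (Mr_val hy) hs). lra.
  + move=> r [x [hx <-]] n. rewrite eF //= => /nR_le h. exists (mu $ x); split=> //. exact: mu_pos.
- have [||F [hF eF]] := @mkF M (fun e : env M (cons rl nil) => hR (mu $ snd e)).
  + by apply: RepR_hR; rep.
  + by move=> x y hx hy e /=; rewrite (mu_ext x y).
  exists F; split=> //.
  + move=> r [x [hx <-]] _ e he. have [d [hd hd']] := openO (Mr_val hx) (mu_pos x hx).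
    exists d; split=> // s [y [hy <-]] _ hs. rewrite !eF //=.
    have /hR_anti := mu_least y _ hy (hd' _ (Mr_val hy) hs). lra.
  + by move=> r [x [hx <-]]; rewrite eF //; apply: hR_gt0.
  + move=> r [x [hx <-]] n. rewrite eF //= => /hR_lt /nR_lt h.
    exists (mu $ x); split; last exact: mu_pos. by apply/nR_le; lra.
Qed.

Lemma continuous_usco (F : FN) : isFun inR F -> ~ kleene2 M -> uscoR everywhere (fap F).
Proof.
move=> hF hE r hr _ e he. have [d [hd hd']] := grilliot hF hE hr he.
exists d; split=> // s hs _ /(hd' s hs). rewrite ltr_norml => /andP[]. lra.
Qed.

Lemma continuous_lsco (F : FN) : isFun inR F -> ~ kleene2 M -> lscoR everywhere (fap F).
Proof.
move=> hF hE r hr _ e he. have [d [hd hd']] := grilliot hF hE hr he.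
exists d; split=> // s hs _ /(hd' s hs). rewrite ltr_norml => /andP[]. lra.
Qed.

(* Otherwise every function is continuous, and the functions representing the members of
   the cover can be added up. *)
Lemma rank_continuous : ~ kleene2 M -> (exists F, usco_rank F) /\ (exists F, lsco_rank F).
Proof.
move=> hE.
pose t (e : env M (cons rl nil)) n := Num.min (hR n) (Num.max 0 (fap (O $ n) (val (snd e)))).
have tP x n : [/\ 0 <= t (tt, x) n, t (tt, x) n <= hR n,
    0 < fap (O $ n) (val x) -> 0 < t (tt, x) n &
    0 < t (tt, x) n -> 0 < fap (O $ n) (val x)].
  rewrite /t /=. have [m1 m2 m3] := maxr_spec 0 (fap (O $ n) (val x)).
  have := minr_spec (hR n) (Num.max 0 (fap (O $ n) (val x))) => -[k1 k2 k3].
  have := hR_gt0 n.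
  by split; case: m3 => m3; case: k3 => k3; rewrite ?m3 in m1 m2 k1 k2 k3 *; lra.
have [||f [hf' ef]] := @RepR_sup (cons rl nil) (fun e => real (snd e)) t.
- apply: RepR_min; first by apply: RepR_hR; rep.
  apply: RepR_max; first by rewrite -emb0; apply: RepR_rat.
  by apply: RepR_fap_val; rep.
- by move=> [[] x] n _; have [] := tP x n.
have f_ext x y : real x -> real y -> val x = val y -> f (tt, x) <= f (tt, y).
  move=> hx hy e. apply: NNPP => /negP. rewrite -Order.TotalTheory.ltNge => h.
  have [_ /(_ _ h)[n]] := ef (tt, x) hx. have [/(_ n)] := ef (tt, y) hy.
  by rewrite /t /= e; lra.
have [|F [hF eF]] := @mkF M f hf'.
  by move=> x y hx hy e; have := f_ext x y hx hy e; have := f_ext y x hy hx (esym e); lra.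
have Fpos r : Mr r -> 0 < fap F r.
  move=> [x [hx <-]]. have [n hn] := covers (Mr_val hx). rewrite eF //.
  have [_ _ /(_ hn) h _] := tP x n. by have [/(_ n)] := ef (tt, x) hx; lra.
(* The m-th term is at most [2^-m], so a term above [2^-n] has an index below n. *)
have Frank r n : Mr r -> hR n < fap F r -> exists m, le m n /\ 0 < fap (O $ m) r.
  move=> [x [hx <-]]. rewrite eF // => h. have [_ /(_ _ h)[m hm]] := ef (tt, x) hx.
  have [h1 h2 _ h3] := tP x m. have h0 := hR_gt0 n. have /hR_lt/nR_lt h4 : hR n < hR m by lra.
  by exists m; split; [apply/nR_le|apply: h3]; lra.
have [F' [hF' eF']] := fap_inv hF Fpos.
split; last by exists F; split=> // [|r hr n]; [apply: continuous_lsco|apply: Frank].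
exists F'; split=> //; first exact: continuous_usco.
move=> r hr n h. apply: Frank => //. rewrite eF' // in h. have h0 := Fpos r hr.
(* From [1 / phi <= n < 2^n] follows [phi > 2^-n]. *)
have e1 := hR_pow2 n. have h1 : nR n + 1 <= nR (pow2 n).
  by rewrite /nR -emb1 -embD emb_le; apply: pow2_gt.
have h2 := hR_gt0 n. apply: NNPP => /negP. rewrite -Order.TotalTheory.leNgt => h3.
have e2 : fap F r * (fap F r)^-1 = 1 by apply: divff; lra.
move: (fap F r)^-1 h e2 (nR_ge0 n) => i h e2 h4.
have : fap F r * i <= hR n * nR n by apply: ler_pM => //; nra.
by nra.
Qed.

Lemma exists_rank : (exists F, usco_rank F) /\ (exists F, lsco_rank F).
Proof.
by have [h|h] := classic (kleene2 M); [apply: rank_discontinuous|apply: rank_continuous].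
Qed.

End Cover.
End Rank.
End SemicontinuousRank.

(** * The statements in terms of values, and induction for membership in open sets *)

Module OpenSets.
Import ssreflect ssrfun ssrbool eqtype choice ssralg ssrnum order ring lra.
Import GRing.Theory Num.Theory.
Import Classical ClassicalEpsilon.
Import Completeness Semantics Interpretation Arithmetic Rationals Reals Values RepresentableReals RealFunctions Dichotomy SemicontinuousRank.
Local Open Scope model_scope.
Local Open Scope ring_scope.
Set Implicit Arguments.
Unset Strict Implicit.

Arguments isSup {M}.
Arguments attains {M}.
Arguments atMostOneMax {M}.

Section OpenSets.
Variable M : model.
Notation N := (M Defs.o).
Notation Q := (Qf M).
Notation R := (Rf M).
Notation RL := (M rl).
Notation FN := (M fn).
Notation o := Defs.o.
Notation real := (@isReal M).
Notation everywhere := (fun _ : R => True).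

Definition pos (F : FN) (r : R) : Prop := 0 < fap F r.

Lemma all_iff T (A B : T -> Prop) : (forall x, A x <-> B x) -> (forall x, A x) <-> (forall x, B x).
Proof. by move=> h; split=> H x; apply/h. Qed.

Lemma ex_iff T (A B : T -> Prop) : (forall x, A x <-> B x) -> (exists x, A x) <-> (exists x, B x).
Proof. by move=> h; split=> -[x H]; exists x; apply/h. Qed.

Lemma imp_iff (A A' B B' : Prop) : (A <-> A') -> (A' -> (B <-> B')) -> (A -> B) <-> (A' -> B').
Proof. by tauto. Qed.

Lemma and_iff (A A' B B' : Prop) : (A <-> A') -> (A' -> (B <-> B')) -> (A /\ B) <-> (A' /\ B').
Proof. by tauto. Qed.

Lemma all_inR (A : RL -> Prop) (B : R -> Prop) : (forall x, real x -> (A x <-> B (val x))) ->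
  (forall x, inR x -> A x) <-> (forall r, Mr r -> B r).
Proof.
move=> h; split=> [H r [x [hx <-]]|H x hx]; first by apply/h => //; apply: H.
by apply/h => //; apply: H; apply: Mr_val.
Qed.

Lemma ex_inR (A : RL -> Prop) (B : R -> Prop) : (forall x, real x -> (A x <-> B (val x))) ->
  (exists x, inR x /\ A x) <-> (exists r, Mr r /\ B r).
Proof.
move=> h; split=> [[x [hx]] /(h x hx) hB|[r [[x [hx <-]]] /(h x hx) hA]].
- by exists (val x); split=> //; apply: Mr_val.
- by exists x.
Qed.

Section OnRange.
Variables (D : RL -> Prop) (P : R -> Prop).
Hypothesis hD : range D P.

Lemma all_range (A : RL -> Prop) (B : R -> Prop) :
  (forall x, real x -> P (val x) -> (A x <-> B (val x))) ->
  (forall x, D x -> A x) <-> (forall r, Mr r -> P r -> B r).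
Proof.
move=> h; split=> [H r [x [hx <-]] px|H x /hD[hx px]].
- by apply/h => //; apply: H; apply/hD.
- by apply/h => //; apply: H => //; apply: Mr_val.
Qed.

Lemma ex_range (A : RL -> Prop) (B : R -> Prop) :
  (forall x, real x -> P (val x) -> (A x <-> B (val x))) ->
  (exists x, D x /\ A x) <-> (exists r, [/\ Mr r, P r & B r]).
Proof.
move=> h; split=> [[x [/hD[hx px] /(h x hx px) hB]]|[r [[x [hx <-]] px] /(h x hx px) hA]].
- by exists (val x); split=> //; apply: Mr_val.
- by exists x; split=> //; apply/hD.
Qed.

Lemma fap_app (F : FN) x : isFun D F -> real x -> P (val x) -> fap F (val x) = val (F $ x).
Proof. by move=> h1 h2 h3; have [_] := isFun_fap hD h1 h2 h3. Qed.

Lemma real_app (F : FN) x : isFun D F -> real x -> P (val x) -> real (F $ x).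
Proof. by move=> h1 h2 h3; have [] := isFun_fap hD h1 h2 h3. Qed.

End OnRange.

Lemma open_isFun (U : FN) : isOpen U -> isFun inR U.
Proof. by case. Qed.

Lemma mem_pos (U : FN) x : isOpen U -> real x -> mem x U <-> pos U (val x).
Proof. by move=> /open_isFun h hx; apply: memP. Qed.

Lemma memUpTo_pos (O : M (o ~> fn)) n x : (forall n, isOpen (O $ n)) -> real x ->
  memUpTo x O n <-> exists m, le m n /\ pos (O $ m) (val x).
Proof.
move=> hO hx; apply: ex_iff => m; apply: and_iff => // _. exact: mem_pos.
Qed.

Lemma isClosedIP (C : FN) : isClosedI C <-> isOpen C /\ forall r, Mr r -> ~ pos C r -> unitI r.
Proof.
apply: and_iff => // hC. apply: all_inR => x hx. apply: imp_iff.
- by rewrite /memC mem_pos.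
- by rewrite range_I; tauto.
Qed.

Lemma rle_fap D P (hD : range D P) (F : FN) x y : isFun D F -> real x -> P (val x) -> real y ->
  rle (F $ x) y <-> fap F (val x) <= val y.
Proof.
move=> hF hx px hy. rewrite rleP //; last exact: (real_app hD). by rewrite (fap_app hD).
Qed.

(** Here and in the lemmas that follow, quantifiers over representatives are exchanged for
    quantifiers over values, so that the implications can be proved in [Rf M]. *)
Lemma cover_c : stmt_c M <-> forall O : M (o ~> fn), (forall n, isOpen (O $ n)) ->
  (forall r, Mr r -> exists n, pos (O $ n) r) ->
  exists g : RL, forall n r, Mr r -> symI n r -> exists m, le m (g $ n) /\ pos (O $ m) r.
Proof.
apply: all_iff => O; apply: imp_iff => // hO; apply: imp_iff.
- by apply: all_inR => x hx; apply: ex_iff => n; apply: mem_pos.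
- move=> _; apply: ex_iff => g; apply: all_iff => n; apply: (all_range (@range_Sym M n)).
  by move=> x hx _; apply: memUpTo_pos.
Qed.

Lemma cover_d : stmt_d M <-> forall (O : M (o ~> o ~> fn)) (C : M (o ~> fn)),
  (forall n m, isOpen (O $ n $ m)) -> (forall n, isOpen (C $ n)) ->
  (forall n r, Mr r -> ~ pos (C $ n) r -> unitI r) ->
  (forall n r, Mr r -> ~ pos (C $ n) r -> exists m, pos (O $ n $ m) r) ->
  exists g : RL, forall n r, Mr r -> ~ pos (C $ n) r ->
    exists m, le m (g $ n) /\ pos (O $ n $ m) r.
Proof.
apply: all_iff => O; apply: all_iff => C; apply: imp_iff => // hO.
have -> : (forall n, isClosedI (C $ n)) <-> (forall n, isOpen (C $ n)) /\
    (forall n r, Mr r -> ~ pos (C $ n) r -> unitI r).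
  split=> [h|[h1 h2] n]; last by apply/isClosedIP; split=> // r; apply: h2.
  by split=> n; have /isClosedIP[] := h n.
split=> H.
- move=> hC hI hcov. have [|g hg] := H (conj hC hI).
    move=> n. apply: (proj2 (@all_inR _ (fun r => ~ pos (C $ n) r ->
      exists m, pos (O $ n $ m) r) _) (hcov n)).
    move=> x hx; apply: imp_iff; first by rewrite /memC mem_pos.
    by move=> _; apply: ex_iff => m; apply: mem_pos.
  exists g => n r [x [hx <-]] hr. apply/memUpTo_pos => //. apply: hg => //.
  by rewrite /memC mem_pos.
- move=> [hC hI] hcov. have [|g hg] := H hC hI.
    move=> n r [x [hx <-]] hr. have [|m hm] := hcov n x hx; first by rewrite /memC mem_pos.
    by exists m; apply/mem_pos.
  exists g => n x hx. rewrite /memC mem_pos // => hr. apply/memUpTo_pos => //.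
  by apply: hg => //; apply: Mr_val.
Qed.

Lemma bound_b : stmt_b M <-> forall f : M (o ~> fn), (forall n, usco inI (f $ n)) ->
  exists g : RL, forall n r, Mr r -> unitI r -> fap (f $ n) r <= nR (g $ n).
Proof.
apply: all_iff => f; apply: imp_iff => // hf'; apply: ex_iff => g; apply: all_iff => n.
apply: (all_range (@range_I M)) => x hx px. have [hF _] := hf' n.
by rewrite (rle_fap (@range_I M)) ?val_rnat //; apply: real_rnat.
Qed.

Lemma bound_a : stmt_a M <-> WKL M /\ forall f : FN, usco inR f ->
  exists g : FN, cont inR g /\ forall r, Mr r -> fap f r <= fap g r.
Proof.
apply: and_iff => // _; apply: all_iff => f; apply: imp_iff => // -[hf' _].
apply: ex_iff => g; apply: and_iff => // -[hg _]; apply: all_inR => x hx.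
rewrite (rle_fap (@range_R M)) ?(fap_app (@range_R M) hg) //; exact: (real_app (@range_R M)).
Qed.

Lemma chain_OC : OC00 M <-> forall O : M (o ~> fn), (forall n, isOpen (O $ n)) ->
  (forall n r, Mr r -> pos (O $ n) r -> pos (O $ succ n) r) ->
  (forall n, exists m, forall r, Mr r -> symI n r -> pos (O $ m) r) ->
  exists g : RL, forall n r, Mr r -> symI n r -> pos (O $ (g $ n)) r.
Proof.
apply: all_iff => O; apply: imp_iff => // hO; apply: imp_iff; last (move=> _; apply: imp_iff).
- apply: all_iff => n; apply: all_inR => x hx; apply: imp_iff; first exact: mem_pos.
  by move=> _; apply: mem_pos.
- apply: all_iff => n; apply: ex_iff => m; apply: (all_range (@range_Sym M n)) => x hx _.
  exact: mem_pos.
- move=> _; apply: ex_iff => g; apply: all_iff => n.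
  by apply: (all_range (@range_Sym M n)) => x hx _; apply: mem_pos.
Qed.

Lemma bound_e1 : stmt_e1 M <-> forall f : FN, usco inI f ->
  exists n, forall r, Mr r -> unitI r -> fap f r <= nR n.
Proof.
apply: all_iff => f; apply: imp_iff => // -[hF _]; apply: ex_iff => n.
apply: (all_range (@range_I M)) => x hx px.
by rewrite (rle_fap (@range_I M)) ?val_rnat //; apply: real_rnat.
Qed.

Lemma bound_e2 : stmt_e2 M <-> forall f : FN, lsco inI f ->
  (forall r, Mr r -> unitI r -> 0 < fap f r) ->
  exists n, forall r, Mr r -> unitI r -> hR n < fap f r.
Proof.
apply: all_iff => f; apply: imp_iff => // -[hF _]; apply: imp_iff.
- apply: (all_range (@range_I M)) => x hx px.
  rewrite rltP ?val_rnat ?nR0 ?(fap_app (@range_I M)) //; [exact: real_rnat|].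
  exact: (real_app (@range_I M)).
- move=> _; apply: ex_iff => n; apply: (all_range (@range_I M)) => x hx px.
  rewrite rltP ?val_rexp ?(fap_app (@range_I M)) //; [exact: real_rexp|].
  exact: (real_app (@range_I M)).
Qed.

Lemma cover_e3 : stmt_e3 M <-> forall O : M (o ~> fn), (forall n, isOpen (O $ n)) ->
  (forall r, Mr r -> unitI r -> exists n, pos (O $ n) r) ->
  exists n, forall r, Mr r -> unitI r -> exists m, le m n /\ pos (O $ m) r.
Proof.
apply: all_iff => O; apply: imp_iff => // hO; apply: imp_iff.
- by apply: (all_range (@range_I M)) => x hx _; apply: ex_iff => n; apply: mem_pos.
- move=> _; apply: ex_iff => n; apply: (all_range (@range_I M)) => x hx _.
  exact: memUpTo_pos.
Qed.

Lemma nested_e4 : stmt_e4 M <-> forall C : M (o ~> fn), (forall n, isOpen (C $ n)) ->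
  (forall n r, Mr r -> ~ pos (C $ n) r -> unitI r) ->
  (forall n r, Mr r -> pos (C $ n) r -> pos (C $ succ n) r) ->
  (forall n, exists r, Mr r /\ ~ pos (C $ n) r) ->
  exists r, Mr r /\ forall n, ~ pos (C $ n) r.
Proof.
apply: all_iff => C.
have -> : (forall n, isClosedI (C $ n)) <-> (forall n, isOpen (C $ n)) /\
    (forall n r, Mr r -> ~ pos (C $ n) r -> unitI r).
  split=> [h|[h1 h2] n]; last by apply/isClosedIP; split=> // r; apply: h2.
  by split=> n; have /isClosedIP[] := h n.
suff h : (forall n, isOpen (C $ n)) -> forall P : Prop,
    (((forall n x, inR x -> memC x (C $ succ n) -> memC x (C $ n)) ->
      (forall n, exists x, inR x /\ memC x (C $ n)) ->
      exists x, inR x /\ forall n, memC x (C $ n)) <->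
    ((forall n r, Mr r -> pos (C $ n) r -> pos (C $ succ n) r) ->
      (forall n, exists r, Mr r /\ ~ pos (C $ n) r) ->
      exists r, Mr r /\ forall n, ~ pos (C $ n) r)).
  by split=> H; [move=> h1 h2|move=> [h1 h2]]; apply/(h h1 True); apply: H.
move=> hC _. have hm x n : real x -> memC x (C $ n) <-> ~ pos (C $ n) (val x).
  by move=> hx; rewrite /memC mem_pos.
apply: imp_iff; last (move=> _; apply: imp_iff).
- apply: all_iff => n; apply: all_inR => x hx. rewrite !hm //.
  have [h|h] := classic (pos (C $ n) (val x)); have := classic (pos (C $ succ n) (val x)); tauto.
- by apply: all_iff => n; apply: ex_inR => x hx; apply: hm.
- by move=> _; apply: ex_inR => x hx; apply: all_iff => n; apply: hm.
Qed.

Lemma cover_e5 : stmt_e5 M <-> forall (f : M (o ~> fn)) (g : FN), (forall n, lsco inI (f $ n)) ->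
  (forall n r, Mr r -> unitI r -> fap (f $ n) r <= fap (f $ succ n) r) -> usco inI g ->
  (forall r, Mr r -> unitI r -> exists n, fap g r < fap (f $ n) r) ->
  exists n, forall r, Mr r -> unitI r -> fap g r < fap (f $ n) r.
Proof.
apply: all_iff => f; apply: all_iff => g; apply: imp_iff => // hf'.
have hF n : isFun inI (f $ n) by case: (hf' n).
apply: imp_iff.
- apply: all_iff => n; apply: (all_range (@range_I M)) => x hx px.
  by rewrite (rle_fap (@range_I M)) ?(fap_app (@range_I M)) //; apply: (real_app (@range_I M)).
- move=> _; apply: imp_iff => // -[hG _].
  have lt_fap n x : real x -> unitI (val x) ->
      rlt (g $ x) (f $ n $ x) <-> fap g (val x) < fap (f $ n) (val x).
    move=> hx px. by rewrite rltP ?(fap_app (@range_I M)) //; apply: (real_app (@range_I M)).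
  apply: imp_iff.
  + by apply: (all_range (@range_I M)) => x hx px; apply: ex_iff => n; apply: lt_fap.
  + by move=> _; apply: ex_iff => n; apply: (all_range (@range_I M)) => x hx px; apply: lt_fap.
Qed.

Lemma cover_e6 : stmt_e6 M <-> forall (C : FN) (O : M (o ~> fn)), isOpen C ->
  (forall r, Mr r -> ~ pos C r -> unitI r) -> (forall n, isOpen (O $ n)) ->
  (forall r, Mr r -> ~ pos C r -> exists n, pos (O $ n) r) ->
  exists n, forall r, Mr r -> ~ pos C r -> exists m, le m n /\ pos (O $ m) r.
Proof.
apply: all_iff => C; apply: all_iff => O. rewrite isClosedIP.
suff h : isOpen C -> (forall n, isOpen (O $ n)) ->
    (((forall x, inR x -> memC x C -> exists n : N, mem x (O $ n)) ->
      exists n0 : N, forall x, inR x -> memC x C -> memUpTo x O n0) <->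
    ((forall r, Mr r -> ~ pos C r -> exists n, pos (O $ n) r) ->
      exists n, forall r, Mr r -> ~ pos C r -> exists m, le m n /\ pos (O $ m) r)).
  by split=> H; [move=> h1 h2 h3|move=> [h1 h2] h3]; apply/(h h1 h3); apply: H.
move=> hC hO. have hm x : real x -> memC x C <-> ~ pos C (val x).
  by move=> hx; rewrite /memC mem_pos.
apply: imp_iff.
- apply: all_inR => x hx; apply: imp_iff; first exact: hm.
  by move=> _; apply: ex_iff => n; apply: mem_pos.
- move=> _; apply: ex_iff => n; apply: all_inR => x hx; apply: imp_iff; first exact: hm.
  by move=> _; apply: memUpTo_pos.
Qed.

Definition sup_I (f : FN) (y : R) : Prop := [/\ Mr y, forall r, Mr r -> unitI r -> fap f r <= y
  & forall z, Mr z -> (forall r, Mr r -> unitI r -> fap f r <= z) -> y <= z].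

Lemma isSup_I (f : FN) y : isFun inI f -> isSup f y <-> real y /\ sup_I f (val y).
Proof.
move=> hF. rewrite /sup_I.
have h z : real z -> (forall x, inI x -> rle (f $ x) z) <->
    (forall r, Mr r -> unitI r -> fap f r <= val z).
  move=> hz; apply: (all_range (@range_I M)) => x hx px.
  exact: (rle_fap (@range_I M)).
split.
- move=> [hy [/(h _ hy) h1 h2]]; do 2?split=> //; first exact: Mr_val.
  move=> z [w [hw <-]] /(h _ hw) h3. by apply/rleP => //; apply: h2.
- move=> [hy [_ h1 h2]]; do 2?split=> //; first exact/h.
  by move=> w hw /(h _ hw) h3; apply/rleP => //; apply: h2 => //; apply: Mr_val.
Qed.

Lemma attains_I (f : FN) y : isFun inI f -> real y ->
  attains f y <-> exists r, [/\ Mr r, unitI r & fap f r = val y].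
Proof.
move=> hF hy; apply: (ex_range (@range_I M)) => x hx px.
by rewrite reqP ?(fap_app (@range_I M)) //; apply: (real_app (@range_I M)).
Qed.

Lemma attains_e7 : stmt_e7 M <-> forall (f : FN) (y : R), usco inI f -> sup_I f y ->
  exists r, [/\ Mr r, unitI r & fap f r = y].
Proof.
split.
- move=> H f y hf' hs. have [[x [hx ex]] _ _] := hs.
  rewrite -ex in hs *. have [hF _] := hf'. apply/attains_I => //. apply: H => //. exact/isSup_I.
- move=> H f y hf' /isSup_I [|hy hs]; first by case: hf'.
  by apply/attains_I => //; [case: hf'|apply: H].
Qed.

(** If the supremum is not attained, all values lie strictly below it, so there is at most one
    maximum for a trivial reason and (e8) applies. *)
Lemma attains_e8 : stmt_e8 M -> stmt_e7 M.
Proof.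
move=> H f y hf' hs. apply: NNPP => hn. apply: hn. have [hF _] := hf'.
have /(isSup_I _ hF)[hy [_ hle _]] := hs.
have [h|h] := classic (atMostOneMax f y); first exact: H.
apply: NNPP => hn. apply: h => x hx x' hx' _. left.
have /(range_I x)[rx px] := hx.
have rfx := real_app (@range_I M) hF rx px.
apply/rltP => //. rewrite -(fap_app (@range_I M)) //.
have h1 := hle _ (Mr_val rx) px. apply: NNPP => h2. apply: hn. exists x; split=> //.
by apply/reqP => //; rewrite -(fap_app (@range_I M)) //; lra.
Qed.

(* Induction for [exists k, P n k] with [P] decidable follows from quantifier-free induction
   by choosing the witness for [succ n] as a function of the one for [n]. *)
Lemma N_ind_ex (P : N -> N -> Prop) :
  Dec (fun e : env M (cons o (cons o nil)) => P (snd (fst e)) (snd e)) ->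
  (exists k, P zero k) -> (forall n, (exists k, P n k) -> exists k, P (succ n) k) ->
  forall n, exists k, P n k.
Proof.
move=> hP [k0 hk0] hS.
have [p [[g [[g' [_ eg']] eg]] ep]] := hP.
have gP n k : g' tt $ n $ k = zero <-> P n k by rewrite eg' eg ep.
have [||s hs] := choice0 M (fun c m =>
    g' tt $ pi1 c $ pi2 c = zero -> g' tt $ succ (pi1 c) $ m = zero).
- by dec.
- move=> c. have [h|h] := classic (P (pi1 c) (pi2 c)); last by exists zero => /gP.
  have [|m hm] := hS (pi1 c); first by exists (pi2 c).
  by exists m => _; apply/gP.
pose w n := rec n k0 (\ u n : N => s $ pair n u).
suff H n : g' tt $ n $ w n = zero by move=> n; exists (w n); apply/gP.
move: n; apply: N_ind; first by rewrite /w; dec.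
- by rewrite /w rec0; apply/gP.
- move=> n h. rewrite /w recS. betas. have := hs (pair n (w n)). rewrite pi1_pair pi2_pair.
  exact.
Qed.

Lemma lt_witness (x y : RL) : real x -> real y ->
  val x < val y <-> exists k, v (x $ k) + (hf k + hf k) < v (y $ k).
Proof.
move=> hx hy. rewrite -rltP //. apply: ex_iff => k.
by rewrite qltP v_qadd v_qexp'.
Qed.

(** Strict inequality of reals is existential with a decidable matrix, which is within the reach of
    [N_ind_ex]. *)
Lemma Rlt_induction (a b : M (o ~> rl)) : (forall n, real (a $ n) /\ real (b $ n)) ->
  val (a $ zero) < val (b $ zero) ->
  (forall n, val (a $ n) < val (b $ n) -> val (a $ succ n) < val (b $ succ n)) ->
  forall n, val (a $ n) < val (b $ n).
Proof.
move=> hr h0 hS n.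
have h m : val (a $ m) < val (b $ m) <->
    exists k, v (a $ m $ k) + (hf k + hf k) < v (b $ m $ k).
  by have [h1 h2] := hr m; apply: lt_witness.
apply/h. move: n. apply: N_ind_ex.
- apply: Dec_ltQ; last by apply: RepQ_v; rep.
  by apply: RepQ_add; [apply: RepQ_v|apply: RepQ_add; apply: RepQ_hf]; rep.
- exact/h.
- by move=> n /h /hS /h.
Qed.

(** Membership in an open set is not decidable, so even this induction on the distance from [m] to
    [n] has to go through [Rlt_induction]. *)
Lemma increasing_open (O : M (o ~> fn)) : (forall n, isOpen (O $ n)) ->
  (forall n r, Mr r -> pos (O $ n) r -> pos (O $ succ n) r) ->
  forall m n r, Mr r -> le m n -> pos (O $ m) r -> pos (O $ n) r.
Proof.
move=> hO hS m n r [x [hx <-]] /leP[d ->] h.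
have hOx k : real (O $ k $ x) /\ fap (O $ k) (val x) = val (O $ k $ x).
  by apply: (isFun_fap (@range_R M)) => //; case: (hO k).
have [a ea] : exists a : M (o ~> rl), forall d, a $ d = O $ add m d $ x.
  by exists (\ d => O $ add m d $ x) => k; betas.
have [b eb] : exists b : M (o ~> rl), forall d, b $ d = rnat zero.
  by exists (s_K rl o $ rnat zero) => k; rewrite M_K.
have H k : pos (O $ add m k) (val x) <-> val (b $ k) < val (a $ k).
  by rewrite ea eb val_rnat nR0 /pos; case: (hOx (add m k)) => _ ->.
apply/H. apply: Rlt_induction.
- by move=> k; rewrite ea eb; split; [apply: real_rnat|case: (hOx (add m k))].
- by apply/H; rewrite add0.
- by move=> k /H h1; apply/H; rewrite addS; apply: hS => //; apply: Mr_val.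
Qed.

End OpenSets.
End OpenSets.

(** * Lipschitz maps, and their effect on open sets and semicontinuous functions *)

Module Compactness.
Import ssreflect ssrfun ssrbool eqtype choice ssralg ssrnum order ring lra.
Import GRing.Theory Num.Theory.
Import Classical ClassicalEpsilon.
Import Completeness Semantics Interpretation Arithmetic Rationals Reals Values RepresentableReals RealFunctions Dichotomy SemicontinuousRank OpenSets.
Local Open Scope model_scope.
Local Open Scope ring_scope.
Set Implicit Arguments.
Unset Strict Implicit.

Section Compactness.
Variable M : model.
Notation N := (M Defs.o).
Notation Q := (Qf M).
Notation R := (Rf M).
Notation RL := (M rl).
Notation FN := (M fn).
Notation o := Defs.o.
Notation real := (@isReal M).
Notation everywhere := (fun _ : R => True).

Lemma RepR_0 G (D : env M G -> Prop) : RepR D (fun _ => 0).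
Proof. by rewrite -emb0; apply: RepR_rat. Qed.

Lemma RepR_1 G (D : env M G -> Prop) : RepR D (fun _ => 1).
Proof. by rewrite -emb1; apply: RepR_rat. Qed.

Lemma RepR_mulQ G (D : env M G -> Prop) (q : Q) f : RepR D f -> RepR D (fun e => emb q * f e).
Proof.
move=> /RepR_approxE[A [hA eA]]. have [c hc] := iota_arch `|q|.
apply: (RepR_approx (A := fun e j => q * A e j) (c := fun _ => c)).
- by apply: RepQ_mul => //; apply: RepQ_const.
- by rep.
- move=> e he j. have := eA e he j. rewrite embM -mulrBr normrM -emb_norm.
  move: hc; rewrite -emb_le => hc h.
  by apply: ler_pM => //; rewrite ?normr_ge0 // emb_ge0 normr_ge0.
Qed.

Lemma RepR_fap_in (D : RL -> Prop) P G (E : env M G -> Prop) (F : env M G -> FN) (g : env M G -> R) :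
  range D P -> Rep F -> RepR E g -> (forall e, isFun D (F e) /\ P (g e)) ->
  RepR E (fun e => fap (F e) (g e)).
Proof. by move=> hD hF hg h; apply: (RepR_fap hD). Qed.

Lemma Mr_mulQ q r : Mr r -> Mr (emb q * r : R).
Proof.
move=> hr. exact: (Mr_RepR (D := fun _ : env M nil => True) (e := tt)
  (RepR_mulQ q (RepR_Mr _ hr)) I).
Qed.

Lemma mkS1 (phi : R -> R) :
  RepR (fun e : env M (cons rl nil) => real (snd e)) (fun e => phi (val (snd e))) ->
  exists F : FN, isFun inR F /\ forall r, Mr r -> fap F r = phi r.
Proof.
move=> /mkF[x y _ _ /= -> //|F [hF eF]].
by exists F; split=> // r [x [hx <-]]; rewrite eF.
Qed.

Lemma mkS2 (phi : N -> R -> R) :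
  RepR (fun e : env M (cons rl (cons o nil)) => real (snd e))
    (fun e => phi (snd (fst e)) (val (snd e))) ->
  exists F : M (o ~> fn), forall n, isFun inR (F $ n) /\
    forall r, Mr r -> fap (F $ n) r = phi n r.
Proof.
move=> /mkF2[n x y _ _ /= -> //|F hF].
by exists F => n; have [h1 h2] := hF n; split=> // r [x [hx <-]]; rewrite h2.
Qed.

Lemma mkS3 (phi : N -> N -> R -> R) :
  RepR (fun e : env M (cons rl (cons o (cons o nil))) => real (snd e))
    (fun e => phi (snd (fst (fst e))) (snd (fst e)) (val (snd e))) ->
  exists F : M (o ~> o ~> fn), forall m n, isFun inR (F $ m $ n) /\
    forall r, Mr r -> fap (F $ m $ n) r = phi m n r.
Proof.
move=> /mkF3[m n x y _ _ /= -> //|F hF].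
by exists F => m n; have [h1 h2] := hF m n; split=> // r [x [hx <-]]; rewrite h2.
Qed.

Lemma max_gt0 (a b : R) : 0 < Num.max a b <-> 0 < a \/ 0 < b.
Proof. have [h1 h2 h3] := maxr_spec a b; by split=> [|[] h]; lra. Qed.

Lemma min_gt0 (a b : R) : 0 < Num.min a b <-> 0 < a /\ 0 < b.
Proof. have [h1 h2 h3] := minr_spec a b; split=> [h|[]]; first lra. by case: h3 => ->. Qed.

Lemma openR_ext (A B : R -> Prop) : (forall r, Mr r -> A r <-> B r) -> openR A -> openR B.
Proof.
move=> h hA r hr /(h r hr) /(hA r hr)[d [hd hd']]. exists d; split=> // s hs rs.
by apply/h => //; apply: hd'.
Qed.

Lemma openR_and (A B : R -> Prop) : openR A -> openR B -> openR (fun r => A r /\ B r).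
Proof.
move=> hA hB r hr [/(hA r hr)[d [hd hd']] /(hB r hr)[e [he he']]].
have [m1 m2 m3] := minr_spec d e. exists (Num.min d e); split; first by case: m3 => ->.
by move=> s hs rs; split; [apply: hd'|apply: he'] => //; lra.
Qed.

Lemma openR_or (A B : R -> Prop) : openR A -> openR B -> openR (fun r => A r \/ B r).
Proof.
move=> hA hB r hr [/(hA r hr)|/(hB r hr)] [d [hd hd']]; exists d; split=> // s hs rs.
- by left; apply: hd'.
- by right; apply: hd'.
Qed.

Lemma openR_ex T (A : T -> R -> Prop) : (forall t, openR (A t)) -> openR (fun r => exists t, A t r).
Proof.
move=> hA r hr [t /(hA t r hr)[d [hd hd']]]; exists d; split=> // s hs rs.
by exists t; apply: hd'.
Qed.

(** All changes of variable below are Lipschitz, and composition with such maps preserves openness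
    and semicontinuity. *)
Definition lip (h : R -> R) : Prop :=
  (forall r, Mr r -> Mr (h r)) /\ exists c, 0 < c /\ forall r s, `|h r - h s| <= c * `|r - s|.

Lemma lip_id : lip id.
Proof. by split=> //; exists 1; split=> [|r s]; rewrite ?ltr01 //= mul1r Order.POrderTheory.lexx. Qed.

Lemma lip_const c : Mr c -> lip (fun _ => c).
Proof. by split=> //; exists 1; split=> [|r s]; rewrite ?ltr01 //= mul1r subrr normr0 normr_ge0. Qed.

Lemma lip_add h k : lip h -> lip k -> lip (fun r => h r + k r).
Proof.
move=> [h1 [c [hc h2]]] [k1 [d [hd k2]]]; split=> [r hr|]; first by apply: Mr_add; auto.
exists (c + d); split=> [|r s]; first lra. have := h2 r s; have := k2 r s.
have -> : h r + k r - (h s + k s) = (h r - h s) + (k r - k s) by ring.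
have := ler_normD (h r - h s) (k r - k s). rewrite mulrDl; lra.
Qed.

Lemma lip_opp h : lip h -> lip (fun r => - h r).
Proof.
move=> [h1 [c [hc h2]]]; split=> [r hr|]; first by apply: Mr_opp; auto.
by exists c; split=> // r s; rewrite -opprD normrN; apply: h2.
Qed.

Lemma lip_scale n h : lip h -> lip (fun r => nR n * h r).
Proof.
move=> [h1 [c [hc h2]]]; split=> [r hr|]; first by apply: Mr_scale; auto.
have hn := nR_ge0 n. exists (nR n * c + 1); split=> [|r s].
  by have := mulr_ge0 hn (Order.POrderTheory.ltW hc); lra.
rewrite -mulrBr normrM (ger0_norm hn) mulrDl mul1r -mulrA.
have := ler_wpM2l hn (h2 r s). have := normr_ge0 (r - s). lra.
Qed.

Lemma lip_max h k : lip h -> lip k -> lip (fun r => Num.max (h r) (k r)).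
Proof.
move=> [h1 [c [hc h2]]] [k1 [d [hd k2]]]; split=> [r hr|]; first by apply: Mr_max; auto.
exists (c + d); split=> [|r s]; first lra. have := h2 r s; have := k2 r s.
have p0 : 0 <= c * `|r - s| by apply: mulr_ge0; [lra|apply: normr_ge0].
have p1 : 0 <= d * `|r - s| by apply: mulr_ge0; [lra|apply: normr_ge0].
rewrite mulrDl !ler_norml => /andP[a1 a2] /andP[a3 a4].
have [m1 m2 m3] := maxr_spec (h r) (k r). have [n1 n2 n3] := maxr_spec (h s) (k s).
by case: m3 => m3; case: n3 => n3; apply/andP; split; lra.
Qed.

Lemma lip_min h k : lip h -> lip k -> lip (fun r => Num.min (h r) (k r)).
Proof.
move=> hh hk. have [h1 [c [hc h2]]] := lip_opp (lip_max (lip_opp hh) (lip_opp hk)).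
have e r : Num.min (h r) (k r) = - Num.max (- h r) (- k r) by rewrite oppr_max !opprK.
split=> [r hr|]; first by rewrite e; apply: h1.
by exists c; split=> // r s; rewrite !e; apply: h2.
Qed.

Lemma lip_norm h : lip h -> lip (fun r => `|h r|).
Proof.
move=> [h1 [c [hc h2]]]; split=> [r hr|].
  have e : `|h r| = Num.max (h r) (- h r).
    have [m1 m2 m3] := maxr_spec (h r) (- h r).
    have [p|p] := lerP 0 (h r).
    - by rewrite (ger0_norm p); case: m3 => m3; rewrite m3 in m1 m2 *; lra.
    - by rewrite (ltr0_norm p); case: m3 => m3; rewrite m3 in m1 m2 *; lra.
  by rewrite e; apply: Mr_max; last apply: Mr_opp; apply: h1.
exists c; split=> // r s. have := ler_dist_dist (h r) (h s). by have := h2 r s; lra.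
Qed.

Lemma openR_lip h (A : R -> Prop) : lip h -> openR A -> openR (fun r => A (h r)).
Proof.
move=> [h1 [c [hc h2]]] hA r hr /(hA _ (h1 r hr))[d [hd hd']].
exists (d / c); split=> [|s hs rs]; first by rewrite divr_gt0.
apply: hd'; first exact: h1. have := h2 r s. rewrite ltr_pdivlMr // mulrC in rs. lra.
Qed.

Lemma openR_gt0 : openR (fun r : R => 0 < r).
Proof.
move=> r hr h; exists r; split=> // s hs. by rewrite ltr_norml => /andP[]; lra.
Qed.

Lemma openR_pos h : lip h -> openR (fun r => 0 < h r).
Proof. by move=> hh; apply: (openR_lip hh openR_gt0). Qed.

(** Retraction onto the unit interval. A function [f] given there only is extended to the line as
    [f (clamp r)], and its semicontinuity survives. *)
Definition clamp (r : R) : R := Num.max 0 (Num.min 1 r).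

Lemma clamp_unitI r : unitI (clamp r).
Proof.
rewrite /clamp /unitI. have [m1 m2 m3] := maxr_spec 0 (Num.min 1 r).
have [n1 n2 n3] := minr_spec 1 r. by case: m3 => m3; case: n3 => n3; split; lra.
Qed.

Lemma clamp_id r : unitI r -> clamp r = r.
Proof.
rewrite /clamp /unitI => -[h1 h2]. have [m1 m2 m3] := maxr_spec 0 (Num.min 1 r).
have [n1 n2 n3] := minr_spec 1 r. by case: m3 => m3; case: n3 => n3; lra.
Qed.

Lemma lip_clamp : lip clamp.
Proof. by apply: lip_max; [|apply: lip_min; [|apply: lip_id]]; apply: lip_const; [apply: Mr_0|apply: Mr_1]. Qed.

Lemma usco_open (f : R -> R) c : uscoR (@unitI M) f -> openR (fun r => f (clamp r) < c).
Proof.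
move=> hf' r hr hlt. have [h1 [l [hl h2]]] := lip_clamp.
have he : 0 < c - f (clamp r) by lra.
have [d [hd hd']] := hf' _ (h1 r hr) (clamp_unitI r) _ he.
exists (d / l); split=> [|s hs rs]; first by rewrite divr_gt0.
have := hd' _ (h1 s hs) (clamp_unitI s). have := h2 r s.
rewrite ltr_pdivlMr // mulrC in rs. move=> h3 h4. have : `|clamp r - clamp s| < d by lra.
by move=> /h4; lra.
Qed.

Lemma lsco_opp P (f : R -> R) : lscoR P f -> uscoR P (fun r => - f r).
Proof.
move=> hf' r hr pr e he. have [d [hd hd']] := hf' r hr pr e he.
by exists d; split=> // s hs ps rs; have := hd' s hs ps rs; lra.
Qed.

Lemma usco_opp P (f : R -> R) : uscoR P f -> lscoR P (fun r => - f r).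
Proof.
move=> hf' r hr pr e he. have [d [hd hd']] := hf' r hr pr e he.
by exists d; split=> // s hs ps rs; have := hd' s hs ps rs; lra.
Qed.

Lemma usco_add P (f g : R -> R) : uscoR P f -> uscoR P g -> uscoR P (fun r => f r + g r).
Proof.
move=> hf' hg r hr pr e he. have he2 : 0 < e / 2 by lra.
have [d [hd hd']] := hf' r hr pr _ he2. have [b [hb hb']] := hg r hr pr _ he2.
have [m1 m2 m3] := minr_spec d b. exists (Num.min d b); split; first by case: m3 => ->.
move=> s hs ps rs. have h1 : `|r - s| < d by lra. have h2 : `|r - s| < b by lra.
by have := hd' s hs ps h1; have := hb' s hs ps h2; lra.
Qed.

Lemma usco_lip (f h : R -> R) P : lip h -> uscoR everywhere f ->
  uscoR P (fun r => f (h r)).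
Proof.
move=> [h1 [l [hl h2]]] hf' r hr _ e he. have [d [hd hd']] := hf' _ (h1 r hr) I e he.
exists (d / l); split=> [|s hs _ rs]; first by rewrite divr_gt0.
apply: hd' => //; first exact: h1. have := h2 r s. rewrite ltr_pdivlMr // mulrC in rs. lra.
Qed.

Lemma usco_sub (f : R -> R) P : uscoR everywhere f -> uscoR P f.
Proof.
move=> hf' r hr _ e he. have [d [hd hd']] := hf' r hr I e he.
by exists d; split=> // s hs _; apply: hd'.
Qed.

Lemma usco_ext P (f g : R -> R) : (forall r, Mr r -> P r -> f r = g r) -> uscoR P f -> uscoR P g.
Proof.
move=> e hf' r hr pr d hd. have [b [hb hb']] := hf' r hr pr d hd.
by exists b; split=> // s hs ps rs; rewrite -!e //; apply: hb'.
Qed.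

Lemma lsco_ext P (f g : R -> R) : (forall r, Mr r -> P r -> f r = g r) -> lscoR P f -> lscoR P g.
Proof.
move=> e hf' r hr pr d hd. have [b [hb hb']] := hf' r hr pr d hd.
by exists b; split=> // s hs ps rs; rewrite -!e //; apply: hb'.
Qed.

(** The affine map of [[0, 1]] onto [[-n, n]]; it carries statements about the unit interval to the
    intervals of (c). *)
Definition stretch (n : N) (r : R) : R := nR n * (r + r - 1).

Lemma lip_stretch n : lip (stretch n).
Proof.
apply: lip_scale. apply: lip_add; first by apply: lip_add; apply: lip_id.
by apply: lip_opp; apply: lip_const; apply: Mr_1.
Qed.

Lemma stretch_onto n r : Mr r -> symI n r -> exists s, [/\ Mr s, unitI s & stretch n s = r].
Proof.
rewrite /symI /stretch /unitI => hr [h1 h2]. have [z|z] := classic (n = zero).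
  exists 0; rewrite z nR0 in h1 h2 *; split; [exact: Mr_0|lra|].
  by rewrite mul0r; lra.
have hn : 0 < iota n.
  have [//|[m ->]] := zero_or_succ M n. by rewrite iotaS; have := iota_ge0 m; lra.
have hn' : 0 < nR n by rewrite emb_gt0.
have [i [ei' ei]] : exists i, i = emb (iota n)^-1 /\ nR n * i = 1.
  exists (emb (iota n)^-1); split=> //. rewrite -embM -emb1 divff //. by apply/eqP => e0; move: hn; rewrite e0; lra.
have er : nR n * (i * r) = r by rewrite mulrA ei mul1r.
have hr2 : Mr (hR one * (i * r + 1)).
  apply: Mr_mulQ. apply: Mr_add; last exact: Mr_1.
  by rewrite ei'; apply: Mr_mulQ.
exists (hR one * (i * r + 1)); split=> //.
- rewrite hRS hR0. have h3 : nR n * (i * r + 1) = r + nR n by rewrite mulrDr er mulr1.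
  by split; apply: NNPP => /negP; rewrite -Order.TotalTheory.ltNge => h4; nra.
- rewrite hRS hR0. by rewrite -[RHS]er; congr (_ * _); lra.
Qed.

End Compactness.
End Compactness.

(** * Implications between the covering, boundedness and maximum principles *)

Module Equivalences.
Import ssreflect ssrfun ssrbool eqtype choice ssralg ssrnum order ring lra.
Import GRing.Theory Num.Theory.
Import Classical ClassicalEpsilon.
Import Completeness Semantics Interpretation Arithmetic Rationals Reals Values RepresentableReals RealFunctions Dichotomy SemicontinuousRank OpenSets Compactness.
Local Open Scope model_scope.
Local Open Scope ring_scope.
Set Implicit Arguments.
Unset Strict Implicit.

Ltac repr := cbn beta; lazymatch goal with
  | |- RepR _ (fun _ => GRing.zero) => apply: RepR_0
  | |- RepR _ (fun _ => GRing.one _) => apply: RepR_1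
  | |- RepR _ (fun e => @GRing.add _ _ _) => apply: RepR_add; repr
  | |- RepR _ (fun e => @GRing.opp _ _) => apply: RepR_opp; repr
  | |- RepR _ (fun e => Num.max _ _) => apply: RepR_max; repr
  | |- RepR _ (fun e => Num.min _ _) => apply: RepR_min; repr
  | |- RepR _ (fun e => Num.norm _) => apply: RepR_norm; repr
  | |- RepR _ (fun e => nR _ * _) => apply: RepR_scale; [by rep|repr]
  | |- RepR _ (fun e => nR _) => apply: RepR_nR; first [by rep|by dec]
  | |- RepR _ (fun e => hR _) => apply: RepR_hR; by rep
  | |- RepR _ (fun e => val _) => apply: RepR_val; [by rep|by []]
  | |- _ => idtac
  end.

Section Equivalences.
Variable M : model.
Notation N := (M Defs.o).
Notation Q := (Qf M).
Notation R := (Rf M).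
Notation RL := (M rl).
Notation FN := (M fn).
Notation o := Defs.o.
Notation real := (@isReal M).
Notation everywhere := (fun _ : R => True).

Lemma fap_inR G (E : env M G -> Prop) (F : env M G -> FN) (g : env M G -> R) :
  Rep F -> RepR E g -> (forall e, isFun inR (F e)) -> RepR E (fun e => fap (F e) (g e)).
Proof. by move=> hF hg h; apply: (RepR_fap_in (@range_R M)) => // e; split. Qed.

Lemma fap_clamp G (E : env M G -> Prop) (F : env M G -> FN) (g : env M G -> R) :
  Rep F -> RepR E g -> (forall e, isFun inI (F e)) -> RepR E (fun e => fap (F e) (clamp (g e))).
Proof.
move=> hF hg h; apply: (RepR_fap_in (@range_I M)) => //; first by rewrite /clamp; repr.
by move=> e; split=> //; apply: clamp_unitI.
Qed.

Lemma mkOpen (phi : N -> R -> R) :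
  RepR (fun e : env M (cons rl (cons o nil)) => real (snd e))
    (fun e => phi (snd (fst e)) (val (snd e))) ->
  (forall n, openR (fun r => 0 < phi n r)) ->
  exists O : M (o ~> fn), (forall n, isOpen (O $ n)) /\
    forall n r, Mr r -> pos (O $ n) r <-> 0 < phi n r.
Proof.
move=> /mkS2[O hO] hphi. exists O; split=> n; have [h1 h2] := hO n.
- apply/isOpenP; split=> //. apply: openR_ext (hphi n) => r hr. by rewrite h2.
- by move=> r hr; rewrite /pos h2.
Qed.

Lemma mkOpen3 (phi : N -> N -> R -> R) :
  RepR (fun e : env M (cons rl (cons o (cons o nil))) => real (snd e))
    (fun e => phi (snd (fst (fst e))) (snd (fst e)) (val (snd e))) ->
  (forall m n, openR (fun r => 0 < phi m n r)) ->
  exists O : M (o ~> o ~> fn), (forall m n, isOpen (O $ m $ n)) /\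
    forall m n r, Mr r -> pos (O $ m $ n) r <-> 0 < phi m n r.
Proof.
move=> /mkS3[O hO] hphi. exists O; split=> m n; have [h1 h2] := hO m n.
- apply/isOpenP; split=> //. apply: openR_ext (hphi m n) => r hr. by rewrite h2.
- by move=> r hr; rewrite /pos h2.
Qed.

(** The union is represented by the supremum of the representing functions cut down to the range
    from 0 to [2^-n]: it is positive iff some term is. *)
Lemma mkUnion (phi : N -> N -> R -> R) :
  RepR (fun e : env M (cons o (cons rl (cons o nil))) => real (snd (fst e)))
    (fun e => phi (snd (fst (fst e))) (snd e) (val (snd (fst e)))) ->
  (forall m n, openR (fun r => 0 < phi m n r)) ->
  exists O : M (o ~> fn), (forall m, isOpen (O $ m)) /\
    forall m r, Mr r -> pos (O $ m) r <-> exists n, 0 < phi m n r.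
Proof.
move=> hphi hopen.
pose t (e : env M (cons rl (cons o nil))) n :=
  Num.min (hR n) (Num.max 0 (phi (snd (fst e)) n (val (snd e)))).
have tP e n : [/\ 0 <= t e n, t e n <= hR n &
    0 < t e n <-> 0 < phi (snd (fst e)) n (val (snd e))].
  have [m1 m2 m3] := maxr_spec 0 (phi (snd (fst e)) n (val (snd e))).
  have := minr_spec (hR n) (Num.max 0 (phi (snd (fst e)) n (val (snd e)))) => -[k1 k2 k3].
  have h := hR_gt0 n. rewrite /t; split.
  - by case: m3 => m3; case: k3 => k3; lra.
  - by [].
  - by rewrite min_gt0 max_gt0; split=> [[_ []]|]; [lra| |split; [|right]].
have [||f [hf' ef]] := @RepR_sup M (cons rl (cons o nil)) (fun e => real (snd e)) t.
- by apply: RepR_min; first repr; apply: RepR_max; first repr.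
- by move=> e n _; have [] := tP e n.
have f_ext m x y : real x -> real y -> val x = val y -> f (tt, m, x) <= f (tt, m, y).
  move=> hx hy e. apply: NNPP => /negP. rewrite -Order.TotalTheory.ltNge => h.
  have [_ /(_ _ h)[n]] := ef (tt, m, x) hx. have [/(_ n)] := ef (tt, m, y) hy.
  by rewrite /t /= e; lra.
have [|F hF] := @mkF2 M f hf'.
  move=> m x y hx hy e. have := f_ext m x y hx hy e. by have := f_ext m y x hy hx (esym e); lra.
have H m r : Mr r -> pos (F $ m) r <-> exists n, 0 < phi m n r.
  move=> [x [hx <-]]. have [_ h] := hF m. rewrite /pos h //. have [h1 h2] := ef (tt, m, x) hx.
  split=> [/h2[n hn]|[n hn]].
  - by exists n; have [_ _ [H _]] := tP (tt, m, x) n; apply: H.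
  - by have [_ _ [_ /(_ hn)]] := tP (tt, m, x) n; have := h1 n; lra.
exists F; split=> // m. have [h _] := hF m. apply/isOpenP; split=> //.
apply: (openR_ext (A := fun r => exists n, 0 < phi m n r)) => [r hr|].
  by rewrite -/(pos _ _) H.
by apply: openR_ex.
Qed.

Lemma openR_O (O : FN) : isOpen O -> openR (pos O).
Proof. by move=> /isOpenP[]. Qed.

Lemma stretch_cover (O : M (o ~> fn)) : (forall n, isOpen (O $ n)) ->
  exists P : M (o ~> o ~> fn), (forall n m, isOpen (P $ n $ m)) /\
    forall n m r, Mr r -> pos (P $ n $ m) r <-> pos (O $ m) (stretch n r).
Proof.
move=> hO. apply: (@mkOpen3 (fun n m r => fap (O $ m) (stretch n r))).
- apply: fap_inR; [by rep|by rewrite /stretch; repr|by move=> e; apply: open_isFun].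
- by move=> n m; apply: (openR_lip (A := pos (O $ m)) (lip_stretch n) (openR_O (hO m))).
Qed.

Definition outside (r : R) : R := Num.max (- r) (r - 1).

Lemma outsideP r : ~ 0 < outside r <-> unitI r.
Proof.
rewrite /outside max_gt0 /unitI. split.
- by move=> h; split; apply: NNPP => /negP; rewrite -Order.TotalTheory.ltNge => h'; apply: h; lra.
- by move=> [h1 h2] []; lra.
Qed.

Lemma lip_outside : lip outside.
Proof.
apply: lip_max; first by apply: lip_opp; apply: lip_id.
by apply: lip_add; [apply: lip_id|apply: lip_const; apply: Mr_opp; apply: Mr_1].
Qed.

(** Adding the complement of the unit interval to every member gives a cover of the line and changes
    nothing inside the interval. Ranks are available for covers of the line. *)
Lemma extend_cover (O : M (o ~> fn)) : (forall n, isOpen (O $ n)) ->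
  (forall r, Mr r -> unitI r -> exists n, pos (O $ n) r) ->
  exists V : M (o ~> fn), [/\ forall n, isOpen (V $ n), forall r, Mr r -> exists n, pos (V $ n) r &
    forall n r, Mr r -> unitI r -> pos (V $ n) r -> pos (O $ n) r].
Proof.
move=> hO hcov.
have [||V [hV eV]] := @mkOpen (fun n r => Num.max (outside r) (fap (O $ n) r)).
- apply: RepR_max; first by rewrite /outside; repr.
  by apply: fap_inR; [rep|repr|move=> e; apply: open_isFun].
- move=> n. apply: (openR_ext (A := fun r => 0 < outside r \/ pos (O $ n) r)) => [r _|].
    by rewrite max_gt0.
  by apply: openR_or; [apply: openR_pos; apply: lip_outside|apply: openR_O].
exists V; split=> //.
- move=> r hr. have [h|h] := classic (0 < outside r).
  + by exists zero; apply/eV => //; apply/max_gt0; left.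
  + have [n hn] := hcov r hr (proj1 (outsideP r) h).
    by exists n; apply/eV => //; apply/max_gt0; right.
- move=> n r hr /outsideP h /(eV n r hr) /max_gt0[/h|]; first by [].
  exact.
Qed.

(** A sequence as in OC^{0,0} covers the line, and because it increases, the union up to [g n] is
    its member with index [g n]. *)
Lemma c_OC : stmt_c M -> OC00 M.
Proof.
move=> /cover_c H. apply/chain_OC => O hO hmono hcov. have [|g hg] := H O hO.
- move=> r hr. have [n hn] := nR_arch `|r|. have [m hm] := hcov n. exists m. apply: hm => //.
  by move: hn; rewrite ler_norml => /andP[].
- exists g => n r hr hI. have [m [h1 h2]] := hg n r hr hI.
  exact: (increasing_open hO hmono hr h1 h2).
Qed.

Lemma c_e3 : stmt_c M -> stmt_e3 M.
Proof.
move=> /cover_c H. apply/cover_e3 => O hO /(extend_cover hO)[V [hV hcov hVO]].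
have [g hg] := H V hV hcov. exists (g $ one) => r hr hI.
have [|m [h1 h2]] := hg one r hr; first by move: hI; rewrite /unitI /symI nR1; lra.
by exists m; split=> //; apply: hVO.
Qed.

(** (e3) for the stretched covers bounds the index on each [[-n, n]] separately; OC^{0,0}, applied
    to the finite unions, turns these bounds into a function of n. *)
Lemma OC_e3_c : OC00 M /\ stmt_e3 M -> stmt_c M.
Proof.
move=> [/chain_OC H1 /cover_e3 H2]. apply/cover_c => O hO hcov.
(* The second term is positive exactly for [n <= i], so [U $ i] is the union up to index [i]. *)
have [||U [hU eU]] := @mkUnion (fun i n r => Num.min (fap (O $ n) r) (nR i + 1 - nR n)).
- apply: RepR_min; last by repr.
  by apply: fap_inR; [rep|repr|move=> e; apply: open_isFun].
- move=> i n. apply: (openR_ext (A := fun r => pos (O $ n) r /\ 0 < nR i + 1 - nR n)) => [r _|].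
    by rewrite min_gt0.
  apply: openR_and; first exact: openR_O. apply: openR_pos; apply: lip_const.
  by apply: Mr_sub; [apply: Mr_add; [|apply: Mr_1]|]; apply: Mr_nR.
have {}eU i r : Mr r -> pos (U $ i) r <-> exists m, le m i /\ pos (O $ m) r.
  move=> hr. rewrite eU //. apply: ex_iff => m. rewrite min_gt0 -/(pos _ _).
  suff -> : le m i <-> 0 < nR i + 1 - nR m by tauto.
  split=> [/nR_le|h]; first by lra.
  apply/nR_le. have : nR m < nR (succ i) by rewrite nRS; lra. by move/nR_nlt; rewrite nRS; lra.
have [P [hP eP]] := stretch_cover hO.
have [||g hg] := H1 U hU.
- move=> n r hr /eU h. apply/eU => //. have [m [h1 h2]] := h hr.
  by exists m; split=> //; apply/le_succ; left.
- move=> n. have [||m hm] := H2 (P $ n); first by move=> m; apply: hP.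
    move=> r hr _. have [lr _] := lip_stretch n. have [m hm] := hcov _ (lr r hr).
    by exists m; apply: (proj2 (eP n m r hr)).
  exists m => r hr hI. have [s [hs sI es]] := stretch_onto hr hI.
  have [k [h1 h2]] := hm s hs sI. apply/eU => //. exists k; split=> //.
  by rewrite -es; apply: (proj1 (eP n k s hs)).
- by exists g => n r hr hI; apply/eU => //; apply: hg.
Qed.

(** The intervals [(2n - 1, 2n + 2)] overlap, so a rational approximation with error 1/4 is enough
    to find one that contains [r]: the least k for which the approximation is at most [2k + 3/2]. *)
Lemma near_even (r : R) : Mr r -> 0 <= r -> exists n, nR n + nR n - 1 < r /\ r < nR n + nR n + 2.
Proof.
move=> [x [hx <-]] h0. have h := val_closeP (succ one) hx. rewrite !hRS hR0 in h.
have [th eth] : exists th : Q, emb th = 3 / 2 :> R.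
  exists (1 + hf one). rewrite embD emb1 -/(hR one) hRS hR0. lra.
have [||k [h1 h2]] := @N_least M (fun k => v (x $ succ one) <= iota k + iota k + th).
- apply: Dec_leQ; first by apply: RepQ_v; rep.
  apply: RepQ_add; last exact: RepQ_const. by apply: RepQ_add; apply: RepQ_iota; rep.
- have [n hn] := nR_arch (emb (v (x $ succ one)) : R).
  exists n. rewrite -emb_le !embD eth -/(nR n). by have := nR_ge0 n; lra.
exists k. rewrite -emb_le !embD eth -/(nR k) in h1. split; last by lra.
have [z|[m z]] := zero_or_succ M k; first by rewrite z nR0; lra.
have h3 : ~ v (x $ succ one) <= iota m + iota m + th.
  by apply: h2; rewrite z; apply/lt_succ; apply: le_refl.
rewrite z nRS. move/negP: h3. rewrite -Order.TotalTheory.ltNge -emb_lt !embD eth -/(nR m). lra.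
Qed.

(* The sets C_n are moved to the disjoint intervals [2n, 2n + 1], and the open sets
   O_{n,m} along with them. *)
Lemma c_d : stmt_c M -> stmt_d M.
Proof.
move=> /cover_c H. apply/cover_d => O C hO hC hI hcov.
pose sh n (r : R) : R := r - (nR n + nR n).
have lip_sh n : lip (sh n).
  apply: lip_add; first exact: lip_id.
  by apply: lip_const; apply: Mr_opp; apply: Mr_add; apply: Mr_nR.
(* A bump that is positive for [2n - 1 < r < 2n + 2]. The bumps overlap, so that one of them can
   always be found; yet a point of [[2n, 2n + 1]] lies in the n-th bump only. *)
pose tent n (r : R) : R := 1 + hR one - `|sh n r - hR one|.
have tentP n r : 0 < tent n r <-> nR n + nR n - 1 < r /\ r < nR n + nR n + 2.
  rewrite /tent /sh hRS hR0. have -> : 0 < 1 + 1 / 2 - `|r - (nR n + nR n) - 1 / 2| <->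
      `|r - (nR n + nR n) - 1 / 2| < 3 / 2 by split; lra.
  by rewrite ltr_norml; split=> [/andP[]|[h1 h2]]; [lra|apply/andP; split; lra].
have lip_tent n : lip (tent n).
  apply: lip_add; first by apply: lip_const; apply: Mr_add; [apply: Mr_1|apply: Mr_emb].
  apply: lip_opp; apply: lip_norm; apply: lip_add => //.
  by apply: lip_const; apply: Mr_opp; apply: Mr_emb.
(* [V $ m] consists of the negative numbers and, inside each bump n, of the translates of
   [O $ n $ m] and of the complement of [C $ n]. On the translate of [C $ n] only the former is
   left. *)
have [||V [hV eV]] := @mkUnion (fun m n r => Num.max (- r)
    (Num.min (tent n r) (Num.max (fap (O $ n $ m) (sh n r)) (fap (C $ n) (sh n r))))).
- repr; rewrite /tent /sh; repr.
  + by apply: fap_inR; [rep|repr|move=> e; apply: open_isFun].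
  + by apply: fap_inR; [rep|repr|move=> e; apply: open_isFun].
- move=> m n. apply: (openR_ext (A := fun r => 0 < - r \/ (0 < tent n r /\
      (pos (O $ n $ m) (sh n r) \/ pos (C $ n) (sh n r))))) => [r _|].
    by rewrite max_gt0 min_gt0 max_gt0.
  apply: openR_or; first by apply: openR_pos; apply: lip_opp; apply: lip_id.
  apply: openR_and; first exact: openR_pos.
  apply: openR_or; first exact: (openR_lip (A := pos (O $ n $ m)) (lip_sh n) (openR_O (hO n m))).
  exact: (openR_lip (A := pos (C $ n)) (lip_sh n) (openR_O (hC n))).
have {}eV m r : Mr r -> pos (V $ m) r <-> exists n, 0 < - r \/ (0 < tent n r /\
      (pos (O $ n $ m) (sh n r) \/ pos (C $ n) (sh n r))).
  by move=> hr; rewrite eV //; apply: ex_iff => n; rewrite max_gt0 min_gt0 max_gt0.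
have [|g hg] := H V hV.
  move=> r hr. have [h|h] := lerP 0 r; last first.
    by exists zero; apply/eV => //; exists zero; left; lra.
  have [n hn] := near_even hr h. have [h'|h'] := classic (pos (C $ n) (sh n r)).
    by exists zero; apply/eV => //; exists n; right; split; [apply/tentP|right].
  have [m hm] := hcov n _ (proj1 (lip_sh n) r hr) h'.
  by exists m; apply/eV => //; exists n; right; split; [apply/tentP|left].
(* The translate of [C $ n] is contained in [[2n, 2n + 1]], so it is covered by what (c) gives for
   [2n + 1]. *)
exists (\ n => g $ succ (add n n)) => n r hr hCr. rewrite beta; last by rep.
have rI := hI n r hr hCr. rewrite /unitI in rI. have p0 := nR_ge0 n.
have hs : Mr (r + (nR n + nR n)) by apply: Mr_add => //; apply: Mr_add; apply: Mr_nR.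
have [|m [h1 /(eV _ _ hs)[k hk]]] := hg (succ (add n n)) _ hs.
  by rewrite /symI nRS nRD; lra.
exists m; split=> //. case: hk => [|[/tentP h2 h3]]; first by lra.
have ekn : k = n.
  have a1 : nR n < nR (succ k) by rewrite nRS; lra.
  have a2 : nR k < nR (succ n) by rewrite nRS; lra.
  by apply: le_anti; apply/nR_le; move/nR_nlt: a1; move/nR_nlt: a2; rewrite !nRS; lra.
have er : sh n (r + (nR n + nR n)) = r by rewrite /sh addrK.
by rewrite ekn er in h3; case: h3.
Qed.

Lemma unit_interval : exists C : M (o ~> fn), (forall n, isOpen (C $ n)) /\
  forall n r, Mr r -> ~ pos (C $ n) r <-> unitI r.
Proof.
have [||C [hC eC]] := @mkOpen (fun _ r => outside r).
- by rewrite /outside; repr.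
- by move=> _; apply: openR_pos; apply: lip_outside.
by exists C; split=> // n r hr; rewrite eC // outsideP.
Qed.

(** Every closed set is taken to be the unit interval, and the n-th row of open sets is the given
    cover pulled back along [stretch n]. *)
Lemma d_c : stmt_d M -> stmt_c M.
Proof.
move=> /cover_d H. apply/cover_c => O hO hcov.
have [C [hC eC]] := unit_interval. have [P [hP eP]] := stretch_cover hO.
have [||g hg] := H P C hP hC.
- by move=> n r hr /(eC n r hr).
- move=> n r hr _. have [lr _] := lip_stretch n. have [m hm] := hcov _ (lr r hr).
  by exists m; apply: (proj2 (eP n m r hr)).
- exists g => n r hr hI. have [s [hs /(eC n s hs) sI es]] := stretch_onto hr hI.
  have [k [h1 h2]] := hg n s hs sI. exists k; split=> //. by rewrite -es; apply: (proj1 (eP n k s hs)).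
Qed.

Lemma bound_cover (f : M (o ~> fn)) : (forall n, usco inI (f $ n)) ->
  exists O : M (o ~> o ~> fn), (forall n m, isOpen (O $ n $ m)) /\
    forall n m r, Mr r -> pos (O $ n $ m) r <-> fap (f $ n) (clamp r) < nR m.
Proof.
move=> hf'.
have [||O [hO eO]] := @mkOpen3 (fun n m r => nR m - fap (f $ n) (clamp r)).
- repr. by apply: fap_clamp; [rep|repr|move=> e; case: (hf' (snd (fst (fst e))))].
- move=> n m. apply: (openR_ext (A := fun r => fap (f $ n) (clamp r) < nR m)) => [r _|].
    by split; lra.
  by apply: usco_open; have /(uscoP (@range_I M))[] := hf' n.
by exists O; split=> // n m r hr; rewrite eO //; split; lra.
Qed.

Lemma above (r : R) : exists m, r < nR m.
Proof. by have [n hn] := nR_arch r; exists (succ n); rewrite nRS; lra. Qed.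

Lemma d_b : stmt_d M -> stmt_b M.
Proof.
move=> /cover_d H. apply/bound_b => f hf'.
have [C [hC eC]] := unit_interval. have [O [hO eO]] := bound_cover hf'.
have [||g hg] := H O C hO hC.
- by move=> n r hr /(eC n r hr).
- by move=> n r hr _; have [m hm] := above (fap (f $ n) (clamp r)); exists m; apply/eO.
- exists g => n r hr hI. have [|m [/nR_le h1 /(eO n m r hr)]] := hg n r hr; first exact/eC.
  by rewrite clamp_id //; lra.
Qed.

Lemma usco_inI (F : FN) : isFun inR F -> uscoR (@unitI M) (fap F) -> usco inI F.
Proof.
by move=> h1 h2; apply/(uscoP (@range_I M)); split=> //; apply: isFun_sub h1; apply: inI_inR.
Qed.

Lemma lsco_inI (F : FN) : isFun inR F -> lscoR (@unitI M) (fap F) -> lsco inI F.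
Proof.
by move=> h1 h2; apply/(lscoP (@range_I M)); split=> //; apply: isFun_sub h1; apply: inI_inR.
Qed.

(** The usco rank composed with [stretch n] is a sequence of usco functions on the unit interval; a
    bound for the n-th one bounds the rank, hence an index, on [[-n, n]]. *)
Lemma b_c : stmt_b M -> stmt_c M.
Proof.
move=> /bound_b H. apply/cover_c => O hO hcov.
have [[F [hF hu hr]] _] := exists_rank hO hcov.
have [|f hf'] := @mkS2 M (fun n r => fap F (stretch n r)).
  by apply: fap_inR; [rep|rewrite /stretch; repr|].
have [|g hg] := H f.
  move=> n. have [h1 h2] := hf' n. apply: usco_inI => //.
  apply: (usco_ext (f := fun r => fap F (stretch n r))) => [r rr _|]; first by rewrite h2.
  by apply: (usco_lip (lip_stretch n)).
exists g => n r rr hI. have [s [hs sI es]] := stretch_onto rr hI.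
by apply: hr => //; have [_ h2] := hf' n; have := hg n s hs sI; rewrite h2 // es.
Qed.

Lemma e3_e1 : stmt_e3 M -> stmt_e1 M.
Proof.
move=> /cover_e3 H. apply/bound_e1 => f hf'.
have [O [hO eO]] : exists O : M (o ~> fn), (forall m, isOpen (O $ m)) /\
    forall m r, Mr r -> pos (O $ m) r <-> fap f (clamp r) < nR m.
  have [|O [hO eO]] := @bound_cover (s_K _ _ $ f); first by move=> n; rewrite M_K.
  exists (O $ zero); split=> [m|m r hr]; first exact: hO. by rewrite eO // M_K.
have [|n hn] := H O hO.
  by move=> r hr _; have [m hm] := above (fap f (clamp r)); exists m; apply/eO.
exists n => r hr hI. have [m [/nR_le h1 /(eO m r hr)]] := hn r hr hI.
by rewrite clamp_id //; lra.
Qed.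

Lemma e1_e3 : stmt_e1 M -> stmt_e3 M.
Proof.
move=> /bound_e1 H. apply/cover_e3 => O hO /(extend_cover hO)[V [hV hcov hVO]].
have [[F [hF hu hr]] _] := exists_rank hV hcov.
have [|n hn] := H F.
  by apply: usco_inI => //; apply: usco_sub.
exists n => r rr hI. have [m [h1 h2]] := hr r rr n (hn r rr hI).
by exists m; split=> //; apply: hVO.
Qed.

Lemma e2_e3 : stmt_e2 M -> stmt_e3 M.
Proof.
move=> /bound_e2 H. apply/cover_e3 => O hO /(extend_cover hO)[V [hV hcov hVO]].
have [_ [F [hF hu hp hr]]] := exists_rank hV hcov.
have [||n hn] := H F.
- apply: lsco_inI => //. move=> r rr _ e he. have [d [hd hd']] := hu r rr I e he.
  by exists d; split=> // s hs _; apply: hd'.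
- by move=> r rr _; apply: hp.
exists n => r rr hI. have [m [h1 h2]] := hr r rr n (hn r rr hI).
by exists m; split=> //; apply: hVO.
Qed.

Lemma e3_e4 : stmt_e3 M -> stmt_e4 M.
Proof.
move=> /cover_e3 H. apply/nested_e4 => C hC hI hmono hne. apply: NNPP => h.
have [|n hn] := H C hC.
  move=> r hr _. apply: NNPP => h'. apply: h; exists r; split=> // n hn. by apply: h'; exists n.
have [r [hr hr']] := hne n. have [m [h1 h2]] := hn r hr (hI n r hr hr').
by apply: hr'; apply: (increasing_open hC hmono hr h1).
Qed.

(** If no finite union covers, what the finite unions leave of the unit interval is a nested
    sequence of non-empty closed sets, and a common point would not be covered at all. *)
Lemma e4_e3 : stmt_e4 M -> stmt_e3 M.
Proof.
move=> /nested_e4 H. apply/cover_e3 => O hO hcov. apply: NNPP => hno.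
have [||C [hC eC]] := @mkUnion (fun i n r =>
    Num.max (outside r) (Num.min (fap (O $ n) r) (nR i + 1 - nR n))).
- apply: RepR_max; first by rewrite /outside; repr.
  apply: RepR_min; last by repr.
  by apply: fap_inR; [rep|repr|move=> e; apply: open_isFun].
- move=> i n. apply: (openR_ext (A := fun r => 0 < outside r \/
      (pos (O $ n) r /\ 0 < nR i + 1 - nR n))) => [r _|]; first by rewrite max_gt0 min_gt0.
  apply: openR_or; first by apply: openR_pos; apply: lip_outside.
  apply: openR_and; first exact: openR_O. apply: openR_pos; apply: lip_const.
  by apply: Mr_sub; [apply: Mr_add; [|apply: Mr_1]|]; apply: Mr_nR.
have {}eC i r : Mr r -> pos (C $ i) r <-> exists n, 0 < outside r \/
    (pos (O $ n) r /\ 0 < nR i + 1 - nR n).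
  by move=> hr; rewrite eC //; apply: ex_iff => n; rewrite max_gt0 min_gt0.
have out i r : Mr r -> ~ pos (C $ i) r -> unitI r.
  by move=> hr h; apply/outsideP => h'; apply: h; apply/eC => //; exists zero; left.
have [||r [hr h]] := H C hC out.
- move=> n r hr /(eC _ _ hr)[m [h|[h1 h2]]]; apply/eC => //; first by exists m; left.
  by exists m; right; split=> //; rewrite nRS; lra.
- move=> n. apply: NNPP => h. apply: hno. exists n => r hr rI.
  have h' : pos (C $ n) r by apply: NNPP => h'; apply: h; exists r.
  have [m [h1|[h1 h2]]] := proj1 (eC n r hr) h'; first by case: (proj2 (outsideP r) rI h1).
  exists m; split=> //. apply/nR_le. have : nR m < nR (succ n) by rewrite nRS; lra.
  by move/nR_nlt; rewrite nRS; lra.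
- have [n hn] := hcov r hr (out _ _ hr (h zero)). apply: (h n); apply/eC => //.
  by exists n; right; split=> //; lra.
Qed.

(** The complement of [C] is joined to every open set, which makes a cover of the unit interval. *)
Lemma e3_e6 : stmt_e3 M -> stmt_e6 M.
Proof.
move=> /cover_e3 H. apply/cover_e6 => C O hC hI hO hcov.
have [||V [hV eV]] := @mkOpen (fun n r => Num.max (fap C r) (fap (O $ n) r)).
- by apply: RepR_max; apply: fap_inR; try (by rep); try (by repr); move=> *; apply: open_isFun.
- move=> n. apply: (openR_ext (A := fun r => pos C r \/ pos (O $ n) r)) => [r _|].
    by rewrite max_gt0.
  by apply: openR_or; apply: openR_O.
have {}eV n r : Mr r -> pos (V $ n) r <-> pos C r \/ pos (O $ n) r.
  by move=> hr; rewrite eV // max_gt0.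
have [|n hn] := H V hV.
  move=> r hr _. have [h|h] := classic (pos C r); first by exists zero; apply/eV => //; left.
  by have [n hn] := hcov r hr h; exists n; apply/eV => //; right.
exists n => r hr hr'. have [m [h1 /(eV _ _ hr)[//|h2]]] := hn r hr (hI r hr hr').
by exists m.
Qed.

Lemma e6_e3 : stmt_e6 M -> stmt_e3 M.
Proof.
move=> /cover_e6 H. apply/cover_e3 => O hO hcov. have [C [hC eC]] := unit_interval.
have [|||n hn] := H (C $ zero) O (hC zero).
- by move=> r hr /(eC _ _ hr).
- exact: hO.
- by move=> r hr /(eC _ _ hr); apply: hcov.
- by exists n => r hr /(eC zero r hr); apply: hn.
Qed.

(** The sets where [f $ n] exceeds [g] are open, because the difference is lsco, and they increase
    with [n]. *)
Lemma e3_e5 : stmt_e3 M -> stmt_e5 M.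
Proof.
move=> /cover_e3 H. apply/cover_e5 => f g hf' hmono hg hcov.
have hfF n : isFun inI (f $ n) by case: (hf' n).
have hgF : isFun inI g by case: hg.
have [||O [hO eO]] := @mkOpen (fun n r => fap (f $ n) (clamp r) - fap g (clamp r)).
- by repr; apply: fap_clamp; try (by rep); try (by repr); move=> *.
- move=> n. apply: (openR_ext (A := fun r =>
      - fap (f $ n) (clamp r) + fap g (clamp r) < 0)) => [r _|]; first by split; lra.
  apply: (usco_open (f := fun r => - fap (f $ n) r + fap g r)). apply: usco_add.
  + by apply: lsco_opp; have /(lscoP (@range_I M))[] := hf' n.
  + by have /(uscoP (@range_I M))[] := hg.
have [|n hn] := H O hO.
  move=> r hr hI. have [n hn] := hcov r hr hI. exists n; apply/eO => //. rewrite clamp_id //; lra.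
exists n => r hr hI. have [m [h1 h2]] := hn r hr hI.
suff : pos (O $ n) r by move/(eO _ _ hr); rewrite clamp_id //; lra.
apply: (increasing_open hO _ hr h1 h2) => k s hs /(eO _ _ hs) h3. apply/eO => //.
by have := hmono k _ (proj1 (@lip_clamp M) s hs) (clamp_unitI s); lra.
Qed.

(** The functions [f - 2^-n] increase and eventually exceed the function 0 at each point; an [n]
    that serves all points gives the lower bound [2^-n]. *)
Lemma e5_e2 : stmt_e5 M -> stmt_e2 M.
Proof.
move=> /cover_e5 H. apply/bound_e2 => f hf' fpos. have [hF hl] := proj1 (lscoP (@range_I M) f) hf'.
have [|F hF'] := @mkS2 M (fun n r => fap f (clamp r) - hR n).
  by repr; apply: fap_clamp; try (by rep); try (by repr).
have [|Z [hZ eZ]] := @mkS1 M (fun r => 0); first by repr.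
have eF n r : Mr r -> unitI r -> fap (F $ n) r = fap f r - hR n.
  by move=> hr rI; have [_ ->] := hF' n; rewrite ?clamp_id.
have [||||n hn] := H F Z.
- move=> n. have [h1 h2] := hF' n. apply: lsco_inI => //.
  apply: (lsco_ext (f := fun r => fap f r - hR n)) => [r hr rI|]; first by rewrite eF.
  move=> r hr rI e he. have [d [hd hd']] := hl r hr rI e he.
  by exists d; split=> // s hs ps rs; have := hd' s hs ps rs; lra.
- by move=> n r hr rI; rewrite !eF // hRS; have := hR_gt0 n; lra.
- apply: usco_inI => //. apply: (usco_ext (f := fun=> 0)) => [r hr _|]; first by rewrite eZ.
  by move=> r hr _ e he; exists 1; split=> [|s hs _ _]; lra.
- move=> r hr rI. have [n hn] := hR_arch (fpos r hr rI). exists n. by rewrite eF // eZ //; lra.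
- by exists n => r hr rI; have := hn r hr rI; rewrite eF // eZ //; lra.
Qed.

(** If [y] is not attained, the open sets [f < y - 2^-n] cover the unit interval, and a finite
    subcover yields an upper bound smaller than the supremum. *)
Lemma e3_e7 : stmt_e3 M -> stmt_e7 M.
Proof.
move=> /cover_e3 H. apply/attains_e7 => f y hf' [hy h1 h2]. apply: NNPP => hno.
have [hF hu] := proj1 (uscoP (@range_I M) f) hf'.
have [||O [hO eO]] := @mkOpen (fun n r => y - hR n - fap f (clamp r)).
- repr; first exact: RepR_Mr. by apply: fap_clamp; try (by rep); try (by repr).
- move=> n. apply: (openR_ext (A := fun r => fap f (clamp r) < y - hR n)) => [r _|].
    by split; lra.
  exact: usco_open.
have [|n hn] := H O hO.
  move=> r hr rI. have h3 := h1 r hr rI.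
  have h4 : fap f r <> y by move=> h4; apply: hno; exists r.
  have h5 : 0 < y - fap f r.
    apply: NNPP => h5. apply: h4. apply: NNPP => h6. by apply: h6; lra.
  have [n hn] := hR_arch h5. exists n. apply/eO => //. rewrite clamp_id //; lra.
have : y <= y - hR n; last by have := hR_gt0 n; lra.
apply: h2; first by apply: Mr_sub => //; apply: Mr_emb.
move=> r hr rI. have [m [/hR_anti h3 /(eO _ _ hr)]] := hn r hr rI. rewrite clamp_id //; lra.
Qed.

(** If a positive lsco function had no positive lower bound, its negative would be usco with
    supremum 0, which it would not attain. *)
Lemma e7_e2 : stmt_e7 M -> stmt_e2 M.
Proof.
move=> /attains_e7 H. apply/bound_e2 => f hf' fpos. have [hF hl] := proj1 (lscoP (@range_I M) f) hf'.
apply: NNPP => hno.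
have [|F [hF' eF]] := @mkS1 M (fun r => - fap f (clamp r)).
  by repr; apply: fap_clamp; try (by rep); try (by repr).
have {}eF r : Mr r -> unitI r -> fap F r = - fap f r.
  by move=> hr rI; rewrite eF ?clamp_id.
have [||r [hr rI]] := H F 0.
- apply: usco_inI => //. apply: (usco_ext (f := fun r => - fap f r)) => [r hr rI|].
    by rewrite eF.
  exact: lsco_opp.
- split; first exact: Mr_0.
  + by move=> r hr rI; rewrite eF //; have := fpos r hr rI; lra.
  + move=> z hz h. apply: NNPP => /negP. rewrite -Order.TotalTheory.ltNge => h0.
    have h3 : 0 < - z by lra. have [n hn] := hR_arch h3. apply: hno; exists n => r hr rI.
    by have := h r hr rI; rewrite eF //; lra.
- by rewrite eF //; have := fpos r hr rI; lra.
Qed.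

Lemma e8_e7 : stmt_e8 M -> stmt_e7 M.
Proof. exact: attains_e8. Qed.

Lemma e7_e8 : stmt_e7 M -> stmt_e8 M.
Proof. by move=> H f y h1 h2 _; apply: H. Qed.

Lemma c_iff : stmt_c M <-> OC00 M /\ stmt_e3 M.
Proof. by split=> [h|]; [split; [apply: c_OC|apply: c_e3]|apply: OC_e3_c]. Qed.

End Equivalences.
End Equivalences.

(** * Weak König's lemma from nested closed sets *)

Module Trees.
Import ssreflect ssrfun ssrbool eqtype choice ssralg ssrnum order ring lra.
Import GRing.Theory Num.Theory.
Import Classical ClassicalEpsilon.
Import Completeness Semantics Interpretation Arithmetic Rationals Reals Values RepresentableReals RealFunctions Dichotomy SemicontinuousRank OpenSets Compactness Equivalences.
Local Open Scope model_scope.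
Local Open Scope ring_scope.
Set Implicit Arguments.
Unset Strict Implicit.

Arguments initseg {M}.
Arguments initsegT {M}.

Section Trees.
Variable M : model.
Notation N := (M Defs.o).
Notation Q := (Qf M).
Notation R := (Rf M).
Notation RL := (M rl).
Notation FN := (M fn).
Notation o := Defs.o.
Notation real := (@isReal M).

(** The numbers up to [B] may be infinitely many, so a common bound needs an argument inside the
    model: witnesses are chosen by a function, which has a maximum up to [B]. *)
Lemma bounded_collection (P : N -> N -> Prop) (B : N) :
  Dec (fun e : env M (cons o (cons o nil)) => P (snd (fst e)) (snd e)) ->
  (forall n k k', le k k' -> P n k -> P n k') ->
  (forall n, le n B -> exists k, P n k) -> exists k, forall n, le n B -> P n k.
Proof.
move=> hP mono h.
have [||g hg] := choice0 M (fun n k => le n B -> P n k).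
- by apply: Dec_imp => //; dec.
- move=> n. have [h'|h'] := classic (le n B); last by exists zero.
  by have [k hk] := h n h'; exists k.
have [||m [_ hm]] := @RepQ_bigmax M nil (fun _ n => iota (g $ n)) (fun _ => B).
- by apply: RepQ_iota; rep.
- by rep.
have [k hk] := iota_arch (m tt). exists k => n hn. apply: mono (hg n hn).
by apply/iota_le; have [/(_ n hn)] := hm tt; lra.
Qed.

(** Two parts of the gap absorb the errors of approximation; the third is left as a lower bound for
    the distance of the values. *)
Lemma lt_gap (x y : RL) : real x -> real y -> val x < val y <-> exists k,
  v (x $ k) + (hf k + hf k + hf k) < v (y $ k).
Proof.
move=> hx hy; split.
- move=> h. have h0 : 0 < (val y - val x) / 5 by lra. have [k hk] := hR_arch h0. exists k.
  rewrite -emb_lt !embD -/(hR k). by have := val_closeP k hx; have := val_closeP k hy; lra.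
- move=> [k]. rewrite -emb_lt !embD -/(hR k).
  by have := val_closeP k hx; have := val_closeP k hy; have := hR_gt0 k; lra.
Qed.

(** Collection makes the precision at which [a $ n] is seen to be below [c] uniform in [n]; so the
    maximum cannot reach [c] without some [a $ n] reaching it. *)
Lemma sup_attained (a : M (o ~> rl)) (B : N) (c : R) : (forall n, real (a $ n)) -> Mr c ->
  (forall n, le n B -> val (a $ n) < c) -> exists k, forall n, le n B -> val (a $ n) < c - hR k.
Proof.
move=> ha [y [hy <-]] h.
have [|||k hk] := @bounded_collection (fun n k => exists i, le i k /\
    v (a $ n $ i) + (hf i + hf i + hf i) < v (y $ i)) B.
- apply: (Dec_ex_le M (cons o (cons o nil)) (fun e i =>
    v (a $ snd (fst e) $ i) + (hf i + hf i + hf i) < v (y $ i)) (fun e => snd e)); last by rep.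
  apply: Dec_ltQ; last by apply: RepQ_v; rep.
  by apply: RepQ_add; [apply: RepQ_v|repeat apply: RepQ_add; apply: RepQ_hf]; rep.
- by move=> n k k' kk' [i [h1 h2]]; exists i; split=> //; apply: le_trans h1 kk'.
- move=> n hn. have /lt_gap-/(_ (ha n) hy)[k hk] := h n hn.
  by exists k, k; split=> //; apply: le_refl.
exists k => n hn. have [i [/hR_anti h1]] := hk n hn. rewrite -emb_lt !embD -/(hR i).
by have := val_closeP i (ha n); have := val_closeP i hy; lra.
Qed.

(** The minimum over [s <= B n], as the negative of a maximum. The last clause, from [sup_attained],
    says that the set where the minimum is at most zero is the union of the corresponding sets for
    the [phi n s]. *)
Lemma mkInf (phi : N -> N -> R -> R) (B : N -> N) :
  RepR (fun e : env M (cons o (cons rl (cons o nil))) => real (snd (fst e)))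
    (fun e => phi (snd (fst (fst e))) (snd e) (val (snd (fst e)))) ->
  Rep (fun e : env M (cons rl (cons o nil)) => B (snd (fst e))) ->
  exists F : M (o ~> fn), forall n, isFun inR (F $ n) /\ forall r, Mr r ->
    (forall s, le s (B n) -> fap (F $ n) r <= phi n s r) /\
    (forall z, fap (F $ n) r < z -> exists s, le s (B n) /\ phi n s r < z) /\
    (fap (F $ n) r <= 0 -> exists s, le s (B n) /\ phi n s r <= 0).
Proof.
move=> hphi hB.
have [||f [hf' ef]] := @RepR_bigmax M (cons rl (cons o nil)) (fun e => real (snd e))
  (fun e s => - phi (snd (fst e)) s (val (snd e))) (fun e => B (snd (fst e))).
- exact: RepR_opp.
- exact: hB.
have f_ext n x y : real x -> real y -> val x = val y -> f (tt, n, x) <= f (tt, n, y).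
  move=> hx hy e. apply: NNPP => /negP. rewrite -Order.TotalTheory.ltNge => h.
  have [_ /(_ _ h)[s [h1 h2]]] := ef (tt, n, x) hx. have [/(_ s h1)] := ef (tt, n, y) hy.
  by rewrite /= e in h2 *; lra.
have [||F hF] := @mkF2 M (fun e => - f e).
- exact: RepR_opp.
- by move=> n x y hx hy e; have := f_ext n x y hx hy e; have := f_ext n y x hy hx (esym e); lra.
exists F => n; have [h1 h2] := hF n; split=> // r [x [hx <-]]; rewrite h2 //.
have [h3 h4] := ef (tt, n, x) hx; rewrite /= in h3 h4; split; last split.
- by move=> s /h3; lra.
- move=> z hz. have [|s [h5 h6]] := h4 (- z); first lra. by exists s; split=> //; lra.
- move=> h0. apply: NNPP => hno. case: hphi => a [[g [hg eg]] ea].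
  have ha s : real (g (tt, n, x) $ s) /\ val (g (tt, n, x) $ s) = phi n s (val x).
    by rewrite eg; apply: (ea (tt, n, x, s)).
  have [ay hay] : exists ay : M (o ~> rl), forall s,
      real (ay $ s) /\ val (ay $ s) = - phi n s (val x).
    exists (\ s => ropp (g (tt, n, x) $ s)) => s. rewrite beta; last by rep.
    by have [k1 k2] := ha s; split; [apply: real_ropp|rewrite val_ropp ?k2].
  have [|||k hk] := @sup_attained ay (B n) 0.
  + by move=> s; case: (hay s).
  + exact: Mr_0.
  + move=> s hs. have [_ ->] := hay s. apply: NNPP => h5. apply: hno; exists s; split=> //. lra.
  + have [|s [h5 h6]] := h4 (- hR k); first by have := hR_gt0 k; lra.
    by have := hk s h5; have [_ ->] := hay s; lra.
Qed.

Lemma iota_lt_le (a b : N) : iota a < iota b + 1 -> iota a <= iota b.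
Proof.
move=> h. apply/iota_le. apply: nlt_le => /iota_lt h'. lra.
Qed.

Lemma N_eqP (a b : N) : iota a < iota b + 1 -> iota b < iota a + 1 -> a = b.
Proof. by move=> h1 h2; apply: le_anti; apply/iota_le; apply: iota_lt_le. Qed.

Lemma half_step (s s' : N) : iota s + iota s < iota s' + 1 -> iota s' < iota s + iota s + 2 ->
  s' = add s s \/ s' = succ (add s s).
Proof.
move=> h1 h2. have [h|h] := classic (lt s' (succ (add s s))).
- left; apply: N_eqP; rewrite iotaD //; move/iota_lt: h; rewrite iotaS iotaD; lra.
- right; apply: N_eqP; rewrite iotaS iotaD; first by lra.
  by have /iota_le := nlt_le h; rewrite iotaS iotaD; lra.
Qed.

Lemma initseg0 (b : RL) : initseg b zero = one.
Proof. by rewrite /initseg /initsegT; betas; rewrite rec0. Qed.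

Lemma initsegS (b : RL) n :
  initseg b (succ n) = add (add (initseg b n) (initseg b n)) (b $ n).
Proof. by rewrite /initseg /initsegT; betas; rewrite recS; betas. Qed.

Definition binary (b : RL) : Prop := forall n, le (b $ n) one.
Definition chain (S : N -> N) : Prop :=
  forall n, S (succ n) = add (S n) (S n) \/ S (succ n) = succ (add (S n) (S n)).

Lemma chain_bits (S : RL) : S $ zero = one -> chain (fun n => S $ n) ->
  let b := \ n => sub (S $ succ n) (add (S $ n) (S $ n)) in
  binary b /\ forall n, initseg b n = S $ n.
Proof.
move=> h0 hS. pose bt (n : N) := sub (S $ succ n) (add (S $ n) (S $ n)).
have hb n : (\ n => bt n) $ n = bt n by rewrite beta // /bt; rep.
have hbt n : add (add (S $ n) (S $ n)) (bt n) = S $ succ n /\ le (bt n) one.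
  have h : le (add (S $ n) (S $ n)) (S $ succ n) /\ iota (S $ succ n) <= 2 * iota (S $ n) + 1.
    by have [->|->] := hS n; rewrite ?iotaS iotaD; split; try apply/iota_le; rewrite ?iotaS ?iotaD; lra.
  have [h1 h2] := h. split.
  - by apply: iota_inj; rewrite iotaD /bt iota_sub //; ring.
  - by apply/iota_le; rewrite /bt iota_sub // iotaD iota1; lra.
split=> [n|]; first by rewrite hb; case: (hbt n).
apply: N_ind_eq; try by rep.
- by rewrite initseg0.
- by move=> n h; rewrite initsegS h hb; case: (hbt n).
Qed.

(* A tree path is read off the binary expansion of a point common to the sets covered by
   the intervals [s / 2^n - 1, (s + 1) / 2^n - 1] for s in the tree.  If [w] is rational, the
   expansions from the left and from the right are both computable. *)
Lemma e4_WKL : stmt_e4 M -> WKL M.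
Proof.
move=> /nested_e4 H T hT hex.
pose U n s := [/\ le (pow2 n) s, lt s (pow2 (succ n)) & T $ s = zero].
(* The nodes of length n again, as a conjunction of the shape that [dec] recognizes. *)
pose U' n s := le (pow2 n) s /\ lt s (pow2 (succ n)) /\ T $ s = zero.
have UE n s : U n s <-> U' n s by split=> [[]|[? []]].
have U_half n s s' : U (succ n) s' -> s' = add s s \/ s' = succ (add s s) -> U n s.
  move=> [/iota_le h1 /iota_lt h2 h3] h4. rewrite !pow2S in h1 h2.
  have h5 : 2 * iota s <= iota s' /\ iota s' <= 2 * iota s + 1.
    by case: h4 => ->; rewrite ?iotaS iotaD; lra.
  move: h4 => _. have h6 : le (pow2 n) s.
    apply/iota_le. apply: iota_lt_le. lra.
  split=> //; first by apply/iota_lt/iota_nlt; rewrite pow2S; lra.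
  have e1 : iota (pow2 (@one M)) = 2 by rewrite -[@one M]/(succ zero) pow2S pow20; lra.
  apply: (hT s one (sub s' (add s s))).
  - move/iota_le: h6 => h6; apply/iota_le. by rewrite iota1; have := pow2_gt n; have := iota_ge0 n; lra.
  - apply/iota_lt; rewrite e1 iota_sub ?iotaD; first lra. by apply/iota_le; rewrite iotaD; lra.
  - have <- : s' = add (mul s (pow2 one)) (sub s' (add s s)) => //.
    apply: iota_inj. rewrite iotaD iotaM e1 iota_sub ?iotaD; first ring.
    by apply/iota_le; rewrite iotaD; lra.
(* It is enough to meet the tree at arbitrarily high levels: each element of a chain is the parent
   of the next one, and the tree is closed under parents. *)
have goal_of (S : RL) : chain (fun n => S $ n) -> (forall n, exists m, le n m /\ U m (S $ m)) ->
    exists b : RL, (forall n : N, le (b $ n) one) /\ forall n : N, T $ initseg b n = zero.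
  move=> hS hU.
  have down n k : U' (add n k) (S $ add n k) -> U' n (S $ n).
    move: k; apply: N_ind; first by rewrite /U'; dec.
    - by rewrite add0.
    - move=> k h; rewrite addS => h'; apply: h; apply/UE.
      by apply: (U_half _ _ (S $ succ (add n k))); [exact/UE|exact: hS].
  have hUn n : U n (S $ n).
    by have [m [/leP[k ->] /UE/down/UE]] := hU n.
  have [|hb eb] := chain_bits _ hS.
    have [/iota_le h1 /iota_lt h2 _] := hUn zero. rewrite pow2S pow20 in h1 h2.
    by apply: N_eqP; rewrite iota1; lra.
  by eexists; split; [exact: hb|] => n; rewrite eb; case: (hUn n).
(* At most zero iff s is a node of length n and [r + 1] lies in [[s 2^-n, (s + 1) 2^-n]]; for other
   s the last term makes it at least 1/2. The shift by 1 is due to the leading 1 in the codes, which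
   puts [s 2^-n] between 1 and 2. *)
pose phi n s (r : R) := `|nR (pow2 n) * (r + 1) - nR s - hR one| - hR one +
  nR (ite (U' n s) zero one).
have [||F hF] := @mkInf phi (fun n => pow2 (succ n)).
- by rewrite /phi /U'; repr.
- by rep.
have phiP n s r : phi n s r <= 0 -> [/\ U n s, nR s <= nR (pow2 n) * (r + 1) &
    nR (pow2 n) * (r + 1) <= nR s + 1].
  rewrite /phi hRS hR0. have h0 := normr_ge0 (nR (pow2 n) * (r + 1) - nR s - 1 / 2).
  have [h|h] := classic (U' n s); last by rewrite ite_false // nR1 => h1; exfalso; lra.
  rewrite ite_true // nR0 => h1.
  have : `|nR (pow2 n) * (r + 1) - nR s - 1 / 2| <= 1 / 2 by lra.
  by rewrite ler_norml => /andP[h2 h3]; split; [exact/UE|lra|lra].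
have phi_mid n s : U n s -> exists r, Mr r /\ phi n s r <= 0.
  move=> hU. exists (hR n * (nR s + hR one) - 1); split.
    apply: Mr_sub; last exact: Mr_1. apply: Mr_mulQ. apply: Mr_add; exact: Mr_emb.
  rewrite /phi ite_true; last exact/UE.
  have -> : nR (pow2 n) * (hR n * (nR s + hR one) - 1 + 1) - nR s - hR one = 0.
    rewrite subrK mulrA (mulrC (nR _)) hR_pow2; ring.
  by rewrite normr0 nR0; have := hR_gt0 (@one M); lra.
have level n s : U n s -> le s (pow2 (succ n)).
  by move=> [_ /iota_lt h _]; apply/iota_le; lra.
have F_le0 n r : Mr r -> ~ pos (F $ n) r -> exists s, phi n s r <= 0.
  move=> hr h. have [_ /(_ r hr)[_ [_ h1]]] := hF n.
  have [|s [_ hs]] := h1; last by exists s. apply: NNPP => h2. apply: h. rewrite /pos. lra.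
have F_pos n r s : Mr r -> phi n s r <= 0 -> ~ pos (F $ n) r.
  move=> hr hs. have [hU _ _] := phiP n s r hs. have [_ /(_ r hr)[h1 _]] := hF n.
  by have := h1 s (level n s hU); rewrite /pos; lra.
have Fopen n : isOpen (F $ n).
  have [h1 h2] := hF n. apply/isOpenP; split=> // r hr hpos.
  have hp : 0 < nR (pow2 n) by rewrite emb_gt0; apply: pow2_gt0.
  exists (fap (F $ n) r / 2 / nR (pow2 n)); split; first by rewrite !divr_gt0 //; lra.
  move=> s hs hrs. have {}hrs : nR (pow2 n) * `|r - s| < fap (F $ n) r / 2.
    by rewrite mulrC -ltr_pdivlMr.
  apply: NNPP => hn. have hn' : fap (F $ n) s < fap (F $ n) r / 2 by lra.
  have [h3 _] := h2 r hr. have [_ [/(_ _ hn')[t [h4 h5]] _]] := h2 s hs.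
  have := h3 t h4. rewrite /phi in h5 *.
  have : `|nR (pow2 n) * (r + 1) - nR t - hR one| - `|nR (pow2 n) * (s + 1) - nR t - hR one|
      <= nR (pow2 n) * `|r - s|.
    have -> : nR (pow2 n) * `|r - s| = `|(nR (pow2 n) * (r + 1) - nR t - hR one) -
        (nR (pow2 n) * (s + 1) - nR t - hR one)|.
      have -> : (nR (pow2 n) * (r + 1) - nR t - hR one) - (nR (pow2 n) * (s + 1) - nR t - hR one)
          = nR (pow2 n) * (r - s) by ring.
      by rewrite normrM (ger0_norm (Order.POrderTheory.ltW hp)).
    exact: lerB_dist.
  lra.
have halves n s' : U (succ n) s' -> exists s, s' = add s s \/ s' = succ (add s s).
  move=> _. move: s'. apply: N_ind_ex => //.
  - by dec.
  - by exists zero; left; rewrite add0.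
  - move=> k [s [->|->]]; first by exists s; right.
    by exists (succ s); left; rewrite addSn addS.
have [|||r [hr hall]] := H F Fopen.
- move=> n r hr h. have [s hs] := F_le0 n r hr h.
  have [[/iota_le h1 /iota_lt h2 _] h3 h4] := phiP n s r hs.
  rewrite pow2S in h2. rewrite -emb_le in h1. rewrite -emb_le embD emb1 in h2.
  have e2 : emb (2 * iota (pow2 n)) = 2 * nR (pow2 n) :> R.
    by rewrite (_ : 2 * iota (pow2 n) = iota (pow2 n) + iota (pow2 n)) ?embD /nR; lra.
  rewrite e2 -/(nR s) in h2. rewrite -/(nR _) -/(nR s) in h1.
  have hp : 0 < nR (pow2 n) by rewrite emb_gt0; apply: pow2_gt0.
  have k1 : nR (pow2 n) * 0 <= nR (pow2 n) * r by lra.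
  have k2 : nR (pow2 n) * r <= nR (pow2 n) * 1 by lra.
  by split; [move: k1|move: k2]; rewrite ler_pM2l.
- move=> n r hr h. apply: NNPP => h'.
  have [s' hs'] := F_le0 (succ n) r hr h'. have [hU' h1 h2] := phiP (succ n) s' r hs'.
  have [s hs] := halves n s' hU'. apply: (F_pos n r s hr _ h).
  have hU := U_half n s s' hU' hs. rewrite /phi ite_true; last exact/UE.
  have e2 : nR (pow2 (succ n)) = 2 * nR (pow2 n).
    rewrite /nR pow2S. by rewrite (_ : 2 * iota (pow2 n) = iota (pow2 n) + iota (pow2 n)) ?embD; lra.
  rewrite e2 in h1 h2.
  have h3 : 2 * nR s <= nR s' /\ nR s' <= 2 * nR s + 1.
    by case: hs => ->; rewrite ?nRS nRD; lra.
  have : `|nR (pow2 n) * (r + 1) - nR s - hR one| <= hR one.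
    by rewrite ler_norml hRS hR0; apply/andP; split; lra.
  rewrite nR0; lra.
- move=> n. have [s [h1 [h2 h3]]] := hex n. have [|r [hr hs]] := phi_mid n s; first by split.
  by exists r; split=> //; apply: F_pos hs.
set w := r + 1 in hF *.
have hU n : exists s, [/\ U n s, nR s <= nR (pow2 n) * w & nR (pow2 n) * w <= nR s + 1].
  have [s hs] := F_le0 n r hr (hall n). by exists s; apply: phiP.
have w_ge1 : 1 <= w.
  have [s [[/iota_le h1 _ _] h2 _]] := hU zero. rewrite -emb_le -/(nR s) pow20 emb1 in h1.
  by rewrite /nR pow20 emb1 -/(nR s) in h2; lra.
have pow_ge1 (n : N) : 1 <= nR (pow2 n).
  rewrite /nR -emb1 emb_le. by have := pow2_gt n; have := iota_ge0 n; lra.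
have nP (a b : N) : iota a < iota b + 1 <-> nR a < nR b + 1.
  by rewrite -(emb_lt _ (iota b + 1)) embD emb1.
have half_stepR (s s' : N) : nR s + nR s < nR s' + 1 -> nR s' < nR s + nR s + 2 ->
    s' = add s s \/ s' = succ (add s s).
  move=> h1 h2; apply: half_step; first by rewrite -iotaD; apply/nP; rewrite nRD.
  rewrite -[2]/(1 + 1) addrA -iotaD -iotaS; apply/nP; rewrite nRS nRD; lra.
have eqR (a b : N) : nR a < nR b + 1 -> nR b < nR a + 1 -> a = b.
  by move=> h1 h2; apply: N_eqP; apply/nP.
have e2 n : nR (pow2 (succ n)) * w = 2 * (nR (pow2 n) * w).
  have -> : nR (pow2 (succ n)) = 2 * nR (pow2 n).
    rewrite /nR pow2S. by rewrite (_ : 2 * iota (pow2 n) = iota (pow2 n) + iota (pow2 n)) ?embD; lra.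
  by rewrite mulrA.
(* For rational w comparisons are decidable, so both roundings of [2^n w] are sequences of the
   model: [L] rounds down with the lower bound strict, [K] with the upper bound strict. Each is a
   chain. *)
have [[q eq]|irr] := classic (exists q, w = emb q).
- have wq n : emb (iota (pow2 n) * q) = nR (pow2 n) * w by rewrite embM eq.
  have hq : RepQ (fun e : env M (cons o (cons o nil)) => iota (pow2 (snd (fst e))) * q).
    by apply: RepQ_mul; [apply: RepQ_iota; rep|apply: RepQ_const].
  have least (P : N -> N -> Prop) n : Dec (fun e : env M (cons o nil) => P n (snd e)) ->
      (exists s, P n s) -> exists s, P n s /\ (s = zero \/ exists k, s = succ k /\ ~ P n k).
    move=> /N_least h /h [s [h1 h2]]. exists s; split=> //.
    have [->|[k ek]] := zero_or_succ M s; [by left|right]. exists k; split=> //.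
    by apply: h2; rewrite ek; apply/lt_succ; apply: le_refl.
  have archq n : exists s, iota (pow2 n) * q < iota s + 1.
    by have [s hs] := iota_arch (iota (pow2 n) * q); exists s; lra.
  have hqn n : RepQ (fun e : env M (cons o nil) => iota (pow2 n) * q) by apply: RepQ_const.
  have hs1 : RepQ (fun e : env M (cons o (cons o nil)) => iota (snd e) + 1).
    by apply: RepQ_add; [apply: RepQ_iota; rep|apply: RepQ_const].
  have hs1' : RepQ (fun e : env M (cons o nil) => iota (snd e) + 1).
    by apply: RepQ_add; [apply: RepQ_iota; rep|apply: RepQ_const].
  have q_ge n : 1 <= iota (pow2 n) * q.
    by rewrite -emb_le emb1 wq; have := pow_ge1 n; move: (nR (pow2 n)) => a ha; nra.
  have [||L hL] := choice0 M (fun n s => iota s < iota (pow2 n) * q /\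
      iota (pow2 n) * q <= iota s + 1).
  + apply: Dec_and; [apply: Dec_ltQ|apply: Dec_leQ] => //. by apply: RepQ_iota; rep.
  + move=> n. have [||s [h1 h2]] := least (fun n s => iota (pow2 n) * q <= iota s + 1) n.
    * exact: Dec_leQ.
    * by have [s hs] := archq n; exists s; lra.
    * exists s; split=> //. case: h2 => [->|[k [-> /negP h]]]; first by rewrite iota0; have := q_ge n; lra.
      by rewrite -Order.TotalTheory.ltNge in h; rewrite iotaS.
  have [||K hK] := choice0 M (fun n s => iota s <= iota (pow2 n) * q /\
      iota (pow2 n) * q < iota s + 1).
  + apply: Dec_and; [apply: Dec_leQ|apply: Dec_ltQ] => //. by apply: RepQ_iota; rep.
  + move=> n. have [||s [h1 h2]] := least (fun n s => iota (pow2 n) * q < iota s + 1) n.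
    * exact: Dec_ltQ.
    * exact: archq.
    * exists s; split=> //. case: h2 => [->|[k [-> /negP h]]]; first by rewrite iota0; have := q_ge n; lra.
      by rewrite -Order.TotalTheory.leNgt in h; rewrite iotaS.
  have {}hL n : nR (L $ n) < nR (pow2 n) * w /\ nR (pow2 n) * w <= nR (L $ n) + 1.
    by have := hL n; rewrite -emb_lt -emb_le embD emb1 wq.
  have {}hK n : nR (K $ n) <= nR (pow2 n) * w /\ nR (pow2 n) * w < nR (K $ n) + 1.
    by have := hK n; rewrite -emb_lt -emb_le embD emb1 wq.
  have chL : chain (fun n => L $ n).
    by move=> n; have := hL n; have := hL (succ n); rewrite e2 => h1 h2; apply: half_stepR; lra.
  have chK : chain (fun n => K $ n).
    by move=> n; have := hK n; have := hK (succ n); rewrite e2 => h1 h2; apply: half_stepR; lra.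
  have [hall'|hno] := classic (forall n, exists m, le n m /\ U m (L $ m)).
    exact: goal_of hall'.
  apply: (goal_of K) => // n.
  (* Beyond [n0] the node known to contain w is never on the left expansion. So w is the left end of
     its interval, and the node is on the right expansion. *)
  have [n0 hn0] : exists n0, forall m, le n0 m -> ~ U m (L $ m).
    apply: NNPP => h; apply: hno => k; apply: NNPP => h'; apply: h; exists k => m h1 h2.
    by apply: h'; exists m.
  exists (add n n0); split; first by apply/leP; exists n0.
  have [s [h1 h2 h3]] := hU (add n n0). have := hL (add n n0). have := hK (add n n0) => -[k1 k2] [l1 l2].
  have h4 : ~ nR s < nR (pow2 (add n n0)) * w.
    move=> h4. apply: (hn0 (add n n0)); first by apply/leP; exists n; rewrite addC.
    by rewrite (eqR (L $ add n n0) s) //; lra.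
  by rewrite (eqR (K $ add n n0) s) //; lra.
- have [X [hX eX]] : Mr w by apply: Mr_add => //; apply: Mr_1.
  have strict n s : nR s <> nR (pow2 n) * w.
    move=> h. apply: irr. exists (hf n * iota s). rewrite embM -/(hR n) -/(nR s) h mulrA hR_pow2 mul1r //.
  (* The pair consists of a node s and a precision at which [2^n w] is seen to lie strictly between
     s and s + 1. It exists since an irrational w is never an endpoint, and the condition is
     decidable. *)
  pose A n c := iota (pi1 c) < iota (pow2 n) * (v (X $ pi2 c) - hf (pi2 c)) /\
    iota (pow2 n) * (v (X $ pi2 c) + hf (pi2 c)) < iota (pi1 c) + 1.
  have [||g hg] := choice0 M A.
  + have h1 : RepQ (fun e : env M (cons o (cons o nil)) => iota (pow2 (snd (fst e)))).
      by apply: RepQ_iota; rep.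
    have h2 : RepQ (fun e : env M (cons o (cons o nil)) => v (X $ pi2 (snd e))).
      by apply: RepQ_v; rep.
    have h3 : RepQ (fun e : env M (cons o (cons o nil)) => hf (pi2 (snd e))).
      by apply: RepQ_hf; rep.
    have h4 : RepQ (fun e : env M (cons o (cons o nil)) => iota (pi1 (snd e))).
      by apply: RepQ_iota; rep.
    apply: Dec_and; apply: Dec_ltQ => //.
    * by apply: RepQ_mul => //; apply: RepQ_add => //; apply: RepQ_opp.
    * by apply: RepQ_mul => //; apply: RepQ_add.
    * by apply: RepQ_add => //; apply: RepQ_const.
  + move=> n. have [s [_ h1 h2]] := hU n. have h3 := strict n s. have h4 := strict n (succ s).
    rewrite nRS in h4.
    have h5 : 0 < nR (pow2 n) * w - nR s.
      by apply: NNPP => h5; apply: h3; apply: NNPP => h6; apply: h6; lra.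
    have h6 : 0 < nR s + 1 - nR (pow2 n) * w.
      by apply: NNPP => h6; apply: h4; apply: NNPP => h7; apply: h7; lra.
    have hp : 0 < nR (pow2 n) by have := pow_ge1 n; lra.
    have [d [hd hd1 hd2]] : exists d, [/\ 0 < d, d <= nR (pow2 n) * w - nR s
        & d <= nR s + 1 - nR (pow2 n) * w].
      have [m1 m2 m3] := minr_spec (nR (pow2 n) * w - nR s) (nR s + 1 - nR (pow2 n) * w).
      by exists (Num.min (nR (pow2 n) * w - nR s) (nR s + 1 - nR (pow2 n) * w)); split=> //; case: m3 => ->.
    have hd3 : 0 < d / nR (pow2 n) / 2 by rewrite !divr_gt0.
    have [k hk] := hR_arch hd3.
    have hk' : nR (pow2 n) * (hR k + hR k) < d.
      by rewrite mulrC -ltr_pdivlMr //; lra.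
    exists (pair s k). rewrite /A pi1_pair pi2_pair -!emb_lt !embM !embD embN emb1.
    rewrite -/(nR s) -/(nR _) -/(hR k). have := val_closeP k hX; rewrite eX => -[k1 k2].
    have k3 : nR (pow2 n) * (w - (emb (v (X $ k)) - hR k)) <= nR (pow2 n) * (hR k + hR k).
      by rewrite ler_pM2l //; lra.
    have k4 : nR (pow2 n) * (emb (v (X $ k)) + hR k - w) <= nR (pow2 n) * (hR k + hR k).
      by rewrite ler_pM2l //; lra.
    rewrite mulrBr in k3. rewrite mulrBr in k4. split; lra.
  have hS n : nR (pi1 (g $ n)) < nR (pow2 n) * w /\ nR (pow2 n) * w < nR (pi1 (g $ n)) + 1.
    have := hg n. rewrite /A -!emb_lt !embM !embD embN emb1 -/(nR _) -/(nR (pow2 n)).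
    move: (pi2 (g $ n)) => k. rewrite -/(hR k). have := val_closeP k hX; rewrite eX => -[k1 k2].
    have hp : 0 < nR (pow2 n) by have := pow_ge1 n; lra.
    have k3 : nR (pow2 n) * (emb (v (X $ k)) - hR k) <= nR (pow2 n) * w by rewrite ler_pM2l.
    have k4 : nR (pow2 n) * w <= nR (pow2 n) * (emb (v (X $ k)) + hR k) by rewrite ler_pM2l.
    lra.
  have hb n : (\ n => pi1 (g $ n)) $ n = pi1 (g $ n) by rewrite beta //; rep.
  apply: (goal_of (\ n => pi1 (g $ n))).
  + by move=> n; rewrite !hb; have := hS n; have := hS (succ n); rewrite e2 => h1 h2; apply: half_stepR; lra.
  + move=> n. exists n; split; first exact: le_refl. rewrite hb.
    have [s [h1 h2 h3]] := hU n. by rewrite (eqR (pi1 (g $ n)) s) //; have := hS n; lra.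
Qed.

End Trees.
End Trees.

(** * Weak König's lemma as compactness of Cantor space, and points chosen before an event *)

Module Separation.
Import ssreflect ssrfun ssrbool eqtype choice ssralg ssrnum order ring lra.
Import GRing.Theory Num.Theory.
Import Classical ClassicalEpsilon.
Import Completeness Semantics Interpretation Arithmetic Rationals Reals Values RepresentableReals RealFunctions Dichotomy SemicontinuousRank OpenSets Compactness Equivalences Trees.
Local Open Scope model_scope.
Local Open Scope ring_scope.
Set Implicit Arguments.
Unset Strict Implicit.

Section Separation.
Variable M : model.
Notation N := (M Defs.o).
Notation Q := (Qf M).
Notation R := (Rf M).
Notation RL := (M rl).
Notation FN := (M fn).
Notation o := Defs.o.
Notation real := (@isReal M).

Lemma pow2_mono (m n : N) : le m n -> iota (pow2 m) <= iota (pow2 n).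
Proof.
move=> /leP[d ->]. rewrite pow2D. have := pow2_gt0 m. have := pow2_gt d. have := iota_ge0 d.
move: (iota (pow2 m)) (iota (pow2 d)) (iota d) => a b c h1 h2 h3; nra.
Qed.

Lemma level_uniq (u m n : N) : le (pow2 m) u -> lt u (pow2 (succ m)) ->
  le (pow2 n) u -> lt u (pow2 (succ n)) -> m = n.
Proof.
have H (a b : N) : iota (pow2 a) <= iota u -> iota u + 1 <= iota (pow2 (succ b)) -> le a b.
  move=> h1 h2. apply: nlt_le => /pow2_mono h3. lra.
by move=> /iota_le h1 /iota_lt h2 /iota_le h3 /iota_lt h4; apply: le_anti; apply: H.
Qed.

Lemma initseg_level (b : RL) n : binary b -> le (pow2 n) (initseg b n) /\ lt (initseg b n) (pow2 (succ n)).
Proof.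
move=> hb. move: n. apply: N_ind; first by dec.
- rewrite initseg0; split; first by apply/iota_le; rewrite pow20 iota1.
  by apply/iota_lt; rewrite pow2S pow20 iota1; lra.
- move=> n [/iota_le h1 /iota_lt h2]. have /iota_le := hb n. rewrite iota1 => h3.
  have h4 := iota_ge0 (b $ n).
  by rewrite initsegS; split; [apply/iota_le|apply/iota_lt]; rewrite !pow2S !iotaD in h2 *; lra.
Qed.

Lemma lt_succ_cases (i n : N) : lt i (succ n) -> lt i n \/ i = n.
Proof.
move/lt_succ => h. have [->|ne] := classic (i = n); [by right|left].
by apply/lt_nle => h'; apply: ne; apply: le_anti.
Qed.

Lemma initseg_agree (b b' : RL) n : binary b -> binary b' -> initseg b n = initseg b' n ->
  forall j, lt j n -> b $ j = b' $ j.
Proof.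
move=> hb hb'. move: n. apply: N_ind; first by dec.
- by move=> _ j /lt_nle[]; apply: le0.
- move=> n IH; rewrite !initsegS => e.
  have e' : iota (add (add (initseg b n) (initseg b n)) (b $ n)) =
    iota (add (add (initseg b' n) (initseg b' n)) (b' $ n)) by rewrite e.
  rewrite !iotaD in e'. have /iota_le := hb n. have /iota_le := hb' n. rewrite iota1 => h1 h2.
  have h3 := iota_ge0 (b $ n). have h4 := iota_ge0 (b' $ n).
  have en : initseg b n = initseg b' n by move: e => _; apply: N_eqP; lra.
  rewrite en in e'. move=> j /lt_succ_cases[/(IH en)//|->]. by move: e en => _ _; apply: iota_inj; lra.
Qed.

Lemma initseg_ext (b b' : RL) n : (forall j, lt j n -> b $ j = b' $ j) -> initseg b n = initseg b' n.
Proof.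
move: n. apply: N_ind; first by dec.
- by rewrite !initseg0.
- move=> n IH h; rewrite !initsegS h; last by apply/lt_succ; apply: le_refl.
  by rewrite IH // => j hj; apply: h; apply/lt_succ; move/iota_lt: hj => hj; apply/iota_le; lra.
Qed.

Lemma initseg_extend (b : RL) n k : binary b ->
  iota (initseg b n) * iota (pow2 k) <= iota (initseg b (add n k)) /\
  iota (initseg b (add n k)) + 1 <= (iota (initseg b n) + 1) * iota (pow2 k).
Proof.
move=> hb. suff : le (mul (initseg b n) (pow2 k)) (initseg b (add n k)) /\
    lt (initseg b (add n k)) (mul (succ (initseg b n)) (pow2 k)).
  by move=> [/iota_le h1 /iota_lt h2]; rewrite !iotaM iotaS in h1 h2.
move: k. apply: N_ind; first by dec.
- rewrite add0; split; first by apply/iota_le; rewrite iotaM pow20 mulr1.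
  by apply/iota_lt; rewrite iotaM iotaS pow20 mulr1.
- move=> k [/iota_le h1 /iota_lt h2]. have /iota_le := hb (add n k). rewrite iota1 => h3.
  have h4 := iota_ge0 (b $ add n k). rewrite iotaM in h1. rewrite iotaM iotaS in h2.
  rewrite addS initsegS; split; [apply/iota_le|apply/iota_lt];
    rewrite iotaM ?iotaS pow2S !iotaD.
  + lra.
  + lra.
Qed.

(** Binary expansions of the rationals in [[1, 2)], uniformly in the code. The integral digit 1 is
    the leading 1 of the codes of finite sequences, so the initial segments are the roundings of
    [2^n v c]. *)
Lemma rational_digits : exists D : M (o ~> rl), forall c, 1 <= v c -> v c < 2 ->
  binary (D $ c) /\ forall n, iota (initseg (D $ c) n) <= iota (pow2 n) * v c /\
    iota (pow2 n) * v c < iota (initseg (D $ c) n) + 1.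
Proof.
pose C := env M (cons o (cons o nil)).
have [||fl hfl] := choice0 M (fun p s => (1 <= v (pi1 p) /\ v (pi1 p) < 2) ->
    iota s <= iota (pow2 (pi2 p)) * v (pi1 p) /\ iota (pow2 (pi2 p)) * v (pi1 p) < iota s + 1).
- have h1 : RepQ (fun e : C => v (pi1 (snd (fst e)))) by apply: RepQ_v; rep.
  have h2 : RepQ (fun e : C => iota (pow2 (pi2 (snd (fst e)))) * v (pi1 (snd (fst e)))).
    by apply: RepQ_mul => //; apply: RepQ_iota; rep.
  have h3 : RepQ (fun e : C => iota (snd e)) by apply: RepQ_iota; rep.
  apply: Dec_imp; apply: Dec_and.
  + by apply: Dec_leQ => //; apply: RepQ_const.
  + by apply: Dec_ltQ => //; apply: RepQ_const.
  + exact: Dec_leQ.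
  + by apply: Dec_ltQ => //; apply: RepQ_add => //; apply: RepQ_const.
- move=> p. have [h|h] := classic (1 <= v (pi1 p) /\ v (pi1 p) < 2); last by exists zero.
  set q := iota (pow2 (pi2 p)) * v (pi1 p).
  have [||s [h1 h2]] := @N_least M (fun s => q < iota s + 1).
  + apply: Dec_ltQ; first exact: RepQ_const.
    by apply: RepQ_add; [apply: RepQ_iota; rep|apply: RepQ_const].
  + by have [s hs] := iota_arch q; exists s; lra.
  + exists s => _; split=> //. have [->|[k ek]] := zero_or_succ M s.
      rewrite iota0 /q; have := pow2_gt0 (pi2 p); case: h => h3 _.
      by move: (iota (pow2 (pi2 p))) (v (pi1 p)) h3 => a b; nra.
    have /negP : ~ q < iota k + 1 by apply: h2; rewrite ek; apply/lt_succ; apply: le_refl.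
    by rewrite ek iotaS -Order.TotalTheory.leNgt.
have hS c : 1 <= v c -> v c < 2 -> forall n, iota (fl $ pair c n) <= iota (pow2 n) * v c /\
    iota (pow2 n) * v c < iota (fl $ pair c n) + 1.
  by move=> h1 h2 n; have := hfl (pair c n); rewrite pi1_pair pi2_pair; apply.
exists (\ c n => sub (fl $ pair c (succ n)) (add (fl $ pair c n) (fl $ pair c n))) => c h1 h2.
rewrite beta; last by rep. have {}hS := hS c h1 h2.
have [S eS] : exists S : RL, forall n, S $ n = fl $ pair c n.
  by exists (\ n => fl $ pair c n) => n; rewrite beta //; rep.
have -> : (\ n => sub (fl $ pair c (succ n)) (add (fl $ pair c n) (fl $ pair c n))) =
    \ n => sub (S $ succ n) (add (S $ n) (S $ n)).
  apply: M_ext => n. rewrite !beta ?eS //; by rep.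
have [||hb eb] := @chain_bits M S.
- have := hS zero. rewrite eS pow20 mul1r => -[h3 h4]. apply: N_eqP; rewrite iota1; lra.
- move=> n. have := hS n. have := hS (succ n). rewrite !eS pow2S => h3 h4.
  by apply: half_step; lra.
by split=> // n; rewrite eb eS.
Qed.

Definition agree (b b' : RL) n := forall j, lt j n -> b $ j = b' $ j.

(** Weak König's lemma for a decidable predicate of infinite sequences of which level [n] depends on
    the first [n] bits only. This spares the coding of finite sequences later. *)
Lemma WKL_compact (P : RL -> N -> Prop) : WKL M ->
  Dec (fun e : env M (cons o (cons rl nil)) => P (snd (fst e)) (snd e)) ->
  (forall b b' n, binary b -> binary b' -> agree b b' n -> P b n -> P b' n) ->
  (forall b n, binary b -> P b (succ n) -> P b n) ->
  (forall n, exists b, binary b /\ P b n) ->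
  exists b, binary b /\ forall n, P b n.
Proof.
move=> hW hP hext hmono hex. have [D hD] := rational_digits.
(* The rational [u / 2^n], whose expansion begins with the bits of the node [u]: a uniform way to
   extend nodes to infinite sequences on which [P] can be tested. *)
pose code u n : N := rat u zero (pred (pow2 n)).
have vcode u n : v (code u n) = iota u / iota (pow2 n).
  by rewrite /code v_rat iota0 subr0 iota_pred //; apply: pow2_gt0.
have hcode u n : le (pow2 n) u -> lt u (pow2 (succ n)) ->
    binary (D $ code u n) /\ initseg (D $ code u n) n = u.
  move=> /iota_le h1 /iota_lt h2. rewrite pow2S in h2. have hp := pow2_gt0 n.
  have [||hb hs] := hD (code u n).
  - by rewrite vcode ler_pdivlMr ?mul1r.
  - by rewrite vcode ltr_pdivrMr //; lra.
  - split=> //. have := hs n. rewrite vcode mulrCA divff ?mulr1; last by apply: lt0r_neq0.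
    by move=> [h3 h4]; apply: N_eqP; lra.
pose lev (u n : N) := le (pow2 n) u /\ lt u (pow2 (succ n)).
(* The length of a node is not part of its code. A bounded quantifier recovers it, as a node has
   just one length and that is at most [u]. *)
pose K (u : N) := forall n, le n u -> (lev u n -> P (D $ code u n) n).
have hK : Dec (fun e : env M (cons o nil) => K (snd e)).
  apply: (Dec_all_le M (cons o nil) (fun e n => lev (snd e) n -> P (D $ code (snd e) n) n));
    last by rep.
  apply: Dec_imp; first by rewrite /lev; dec.
  case: hP => f [[g [[g' [hg' eg']] eg]] ef].
  exists (fun e : env M (cons o (cons o nil)) => g' tt $ (D $ code (snd (fst e)) (snd e)) $ snd e).
  split; first by rewrite /code; rep.
  by move=> e; rewrite eg' eg ef.
have hKT : Rep (fun e : env M (cons o nil) => ite (K (snd e)) zero one).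
  by apply: Rep_ite => //; rep.
have [T hT] : exists T : RL, forall u, T $ u = zero <-> K u.
  exists (\ u => ite (K u) zero one) => u. rewrite beta //.
  by have [h|h] := classic (K u); [rewrite ite_true|rewrite ite_false //; split=> // /succ_nz].
have lev_le u n : lev u n -> le n u.
  by move=> [/iota_le h _]; apply/iota_le; have := pow2_gt n; lra.
have hTl u n : lev u n -> T $ u = zero <-> P (D $ code u n) n.
  move=> hu. rewrite hT; split=> [h|h k _ [h1 h2]]; first by apply: h => //; apply: lev_le.
  by case: hu => h3 h4; rewrite (level_uniq h1 h2 h3 h4).
have down b n k : binary b -> P b (add n k) -> P b n.
  move=> hb. move: k. apply: N_ind; last 1 first.
  - by move=> k IH; rewrite addS => /(hmono _ _ hb).
  - apply: Dec_imp; last by dec.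
    case: hP => f [[g [[g' [hg' eg']] eg]] ef].
    exists (fun e : env M (cons o nil) => g' tt $ b $ add n (snd e)).
    by split; [rep|move=> e; rewrite eg' eg ef].
  - by rewrite add0.
have [||b [hb hbT]] := hW T.
- move=> s k r hs hr hz.
  apply/hT => n _ hsn. have [h1 h2] := hsn. move/iota_le: h1 => h1; move/iota_lt: h2 => h2.
  set u := add (mul s (pow2 k)) r in hz. move/iota_lt: hr => hr. have hr0 := iota_ge0 r.
  have eu : iota u = iota s * iota (pow2 k) + iota r by rewrite iotaD iotaM.
  have hk := pow2_gt0 k. have hn := pow2_gt0 n. rewrite pow2S in h2.
  have k1 : iota (pow2 n) * iota (pow2 k) <= iota s * iota (pow2 k) by rewrite ler_pM2r.
  have k2 : (iota s + 1) * iota (pow2 k) <= 2 * iota (pow2 n) * iota (pow2 k) by rewrite ler_pM2r.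
  have hu : lev u (add n k).
    by split; [apply/iota_le|apply/iota_lt]; rewrite ?pow2S pow2D eu; lra.
  have [hb1 e1] : binary (D $ code u (add n k)) /\ initseg (D $ code u (add n k)) (add n k) = u.
    by case: hu => *; apply: hcode.
  have [hb2 e2] : binary (D $ code s n) /\ initseg (D $ code s n) n = s.
    by case: hsn => *; apply: hcode.
  have := proj1 (hTl _ _ hu) hz. move/(down _ _ _ hb1). apply: hext => //.
  apply: initseg_agree => //. rewrite e2. have := @initseg_extend _ n k hb1. rewrite e1 eu.
  move: (iota (pow2 k)) (iota (initseg (D $ code u (add n k)) n)) (N_eqP (a := initseg (D $ code u (add n k)) n) (b := s)) hk hr.
  move: (iota r) hr0 => a0 ha0 a x h ha hr' [h3 h4]. apply: h; apply: NNPP => /negP;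
    rewrite -Order.TotalTheory.leNgt => h5; nra.
- move=> n. have [b [hb hbP]] := hex n. have [h1 h2] := initseg_level n hb.
  exists (initseg b n); do 2!split=> //. apply/(hTl (initseg b n) n) => //.
  have [hb' e'] := hcode _ _ h1 h2. apply: hext hbP => //. by apply: initseg_agree.
- exists b; split=> // n. have [h1 h2] := initseg_level n hb. have [hb' e'] := hcode _ _ h1 h2.
  have /(hTl (initseg b n) n) h := hbT n. apply: hext (h _) => //.
  exact: initseg_agree.
Qed.

Definition first (A : N -> N -> Prop) n s := A n s /\ forall s', lt s' s -> ~ A n s'.

Lemma first_uniq A n s s' : first A n s -> first A n s' -> s = s'.
Proof.
move=> [h1 h2] [h3 h4]. by apply: le_anti; apply: nlt_le => h; [apply: (h2 _ h)|apply: (h4 _ h)].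
Qed.

(** Whether an event ever occurs is not decidable, but a sequence can be fixed in advance that turns
    out to be the one prescribed by the first event. The constraints from events before a given
    stage are decidable and can be satisfied, so compactness satisfies all of them. The sequences
    for all [n] are interleaved in a single one. *)
Lemma first_event (A : N -> N -> Prop) (B : M (o ~> o ~> rl)) : WKL M ->
  Dec (fun e : env M (cons o (cons o nil)) => A (snd (fst e)) (snd e)) ->
  (forall n s, A n s -> binary (B $ n $ s)) ->
  exists z : M (o ~> rl), forall n, binary (z $ n) /\ forall s, first A n s -> z $ n = B $ n $ s.
Proof.
move=> hW hA hB.
have hfirst G (n s : env M G -> N) : Rep n -> Rep s -> Dec (fun e => first A (n e) (s e)).
  move=> hn hs. have [f [[g [[g' [_ eg']] eg]] ef]] := hA.
  have gA n' s' : g' tt $ n' $ s' = zero <-> A n' s' by rewrite eg' eg ef.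
  apply: (Dec_ext _ _ (fun e => g' tt $ n e $ s e = zero /\
      forall i, lt i (s e) -> ~ g' tt $ n e $ i = zero)).
    move=> e; rewrite /first gA; split=> -[h1 h2]; split=> // i hi; have := h2 i hi; rewrite gA //.
  apply: Dec_and; first by dec.
  apply: (Dec_all_lt M G (fun e i => ~ g' tt $ n e $ i = zero)) => //.
  by dec; apply: Rep_wk.
have [||||b [hb hbP]] := @WKL_compact (fun b n => forall j, lt j n ->
    forall s, lt s n -> first A (pi1 j) s -> b $ j = B $ pi1 j $ s $ pi2 j) hW.
- apply: (Dec_all_lt M (cons o (cons rl nil)) (fun e j => forall s, lt s (snd e) ->
    first A (pi1 j) s -> snd (fst e) $ j = B $ pi1 j $ s $ pi2 j)); last by rep.
  apply: (Dec_all_lt M (cons o (cons o (cons rl nil))) (fun e s =>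
    first A (pi1 (snd e)) s -> snd (fst (fst e)) $ snd e = B $ pi1 (snd e) $ s $ pi2 (snd e)));
    last by rep.
  apply: Dec_imp; first by apply: hfirst; rep.
  by dec.
- move=> b b' n _ _ hag h j hj s hs hf. by rewrite -(hag j hj); apply: h.
- have lt_S i n : lt i n -> lt i (succ n) by move/iota_lt => h; apply/iota_lt; rewrite iotaS; lra.
  by move=> b n _ h j hj s hs; apply: h; apply: lt_S.
(* As only events before stage n count, the demand on each bit is decidable; it can be met because a
   row has at most one first event. *)
- move=> n. have [||b hb] := choice0 M (fun j m => le m one /\ forall s, lt s n ->
      first A (pi1 j) s -> m = B $ pi1 j $ s $ pi2 j).
  + apply: Dec_and; first by dec.
    apply: (Dec_all_lt M (cons o (cons o nil)) (fun e s => first A (pi1 (snd (fst e))) s ->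
      snd e = B $ pi1 (snd (fst e)) $ s $ pi2 (snd (fst e)))); last by rep.
    by apply: Dec_imp; [apply: hfirst; rep|dec].
  + move=> j. have [[s hs]|h] := classic (exists s, first A (pi1 j) s).
      exists (B $ pi1 j $ s $ pi2 j); split; first by apply: hB; case: hs.
      by move=> s' _ hs'; rewrite (first_uniq hs hs').
    by exists zero; split=> [|s _ hs]; [apply: le0|case: h; exists s].
  + exists b; split=> [j|j _ s hs hf]; first by case: (hb j).
    by have [_ h] := hb j; apply: h.
have ez n i : (\ n i => b $ pair n i) $ n $ i = b $ pair n i.
  by rewrite beta; [rewrite beta //|]; rep.
exists (\ n i => b $ pair n i) => n; split=> [i|s hs]; first by rewrite ez; apply: hb.
apply: M_ext => i. rewrite ez.
have [m [h1 h2]] : exists m, lt (pair n i) m /\ lt s m.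
  exists (succ (add (pair n i) s)); split; apply/lt_succ; apply/leP; first by exists s.
  by exists (pair n i); rewrite addC.
have := hbP m (pair n i) h1 s h2. by rewrite pi1_pair pi2_pair; apply.
Qed.

(** The number in [[0, 1]] with binary digits [b]; subtracting 1 removes the contribution of the
    leading 1 in [initseg]. *)
Lemma binary_point : exists P : FN, forall b, binary b -> [/\ real (P $ b), unitI (val (P $ b)) &
  forall j, `|val (P $ b) - (nR (initseg b j) * hR j - 1)| <= hR j].
Proof.
have [|||f [[a [[g [_ eg]] ea]] ef]] := @RepR_limit M (cons rl nil) (fun e => binary (snd e))
  (fun e j => iota (initseg (snd e) j) * hf j - 1) (fun _ => one).
- apply: RepQ_add; last exact: RepQ_const.
  by apply: RepQ_mul; [apply: RepQ_iota|apply: RepQ_hf]; rep.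
- by rep.
- move=> [[] b] /= hb j i. have [h1 h2] := @initseg_extend b j i hb.
  rewrite iota1 mul1r hfD.
  have p1 := hf_gt0 i; have p2 := hf_gt0 j. have p3 := hf_pow2 i. have p4 := pow2_gt0 i.
  rewrite (_ : _ - _ = (iota (initseg b j) - iota (initseg b (add j i)) * hf i) * hf j); last ring.
  rewrite normrM (gtr0_norm p2). apply: ler_piMl; first exact: Order.POrderTheory.ltW.
  move: (iota (pow2 i)) (hf i) (iota (initseg b j)) (iota (initseg b (add j i))) h1 h2 p1 p3 p4.
  move=> p h x y h1 h2 p1 p3 p4. rewrite ler_norml.
  have k1 : x * p * h <= y * h by rewrite ler_pM2r.
  have k2 : (y + 1) * h <= (x + 1) * p * h by rewrite ler_pM2r.
  rewrite -!mulrA (mulrC p) p3 !mulr1 in k1 k2. by apply/andP; split; lra.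
exists (g tt) => b hb. have [h1 h2] := ea (tt, b) hb. rewrite eg h2.
have h3 j : `|f (tt, b) - (nR (initseg b j) * hR j - 1)| <= hR j.
  by have := ef (tt, b) hb j; rewrite nR1 mul1r embB embM emb1.
split=> //. have h4 j : 0 <= f (tt, b) + 1 * hR j /\ f (tt, b) <= 1 + 1 * hR j.
  have := h3 j. have [/iota_le k1 /iota_lt k2] := initseg_level j hb. rewrite pow2S in k2.
  have k3 := hf_pow2 j. have k4 := hf_gt0 j.
  have k5 : iota (pow2 j) * hf j <= iota (initseg b j) * hf j by rewrite ler_pM2r.
  have k6 : (iota (initseg b j) + 1) * hf j <= 2 * iota (pow2 j) * hf j by rewrite ler_pM2r.
  rewrite -mulrA !(mulrC (iota (pow2 j))) k3 in k5 k6.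
  rewrite mulrDl mul1r mulr1 in k6.
  rewrite -emb_le emb1 embM -/(nR _) -/(hR _) in k5.
  rewrite -emb_le embD embM -/(nR _) -/(hR _) (_ : emb 2 = 2) in k6; last first.
    by rewrite -[2]/(1 + 1) embD emb1.
  by rewrite ler_norml => /andP[k7 k8]; split; lra.
split.
- by apply: (@le_hR M 0 _ 1) => j; case: (h4 j).
- by apply: (@le_hR M _ 1 1) => j; case: (h4 j).
Qed.

End Separation.
End Separation.

(** * Bounds of continuous functions from weak König's lemma, and the equivalence of (a) with (c) *)

Module Bounds.
Import ssreflect ssrfun ssrbool eqtype choice ssralg ssrnum order ring lra.
Import GRing.Theory Num.Theory.
Import Classical ClassicalEpsilon.
Import Completeness Semantics Interpretation Arithmetic Rationals Reals Values RepresentableReals RealFunctions Dichotomy SemicontinuousRank OpenSets Compactness Equivalences Trees Separation.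
Local Open Scope model_scope.
Local Open Scope ring_scope.
Set Implicit Arguments.
Unset Strict Implicit.

Section Bounds.
Variable M : model.
Notation N := (M Defs.o).
Notation Q := (Qf M).
Notation R := (Rf M).
Notation RL := (M rl).
Notation FN := (M fn).
Notation o := Defs.o.
Notation real := (@isReal M).
Notation everywhere := (fun _ : R => True).

(** The point 1 has to be avoided, because [rational_digits] expands [q + 1] only when it is less
    than 2. *)
Lemma rational_near (r : R) k : Mr r -> unitI r ->
  exists q : Q, [/\ 0 <= q, q < 1 & `|r - emb q| <= 2 * hR k].
Proof.
move=> [x [hx <-]] [h0 h1]. have [k1 k2] := val_closeP k hx. have p := hf_gt0 k.
have p' := hR_gt0 k. have p1 := hf_le1 k.
have [h2|h2] := lerP 0 (v (x $ k)); last first.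
  exists 0; split; [lra|lra|rewrite emb0 subr0 ger0_norm //].
  by move: h2; rewrite -emb_lt emb0; lra.
have [h3|h3] := lerP (v (x $ k)) (1 - hf k).
  by exists (v (x $ k)); split; [lra|lra|rewrite ler_norml; apply/andP; split; lra].
exists (1 - hf k); split; [lra|lra|]. move: h3; rewrite -emb_lt embB emb1 -/(hR k) => h3.
by rewrite ler_norml; apply/andP; split; lra.
Qed.

Section Sequence.
Variables (G : M (o ~> fn)).
Hypothesis hW : WKL M.
Hypothesis hG : forall n, isFun inI (G $ n).
Hypothesis uG : forall n, uscoR (@unitI M) (fap (G $ n)).
Hypothesis lG : forall n, lscoR (@unitI M) (fap (G $ n)).

Section Unbounded.
Variables (P : FN) (n : N) (x : M (o ~> rl)).
Hypothesis hP : forall b, binary b -> [/\ real (P $ b), unitI (val (P $ b)) &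
  forall j, `|val (P $ b) - (nR (initseg b j) * hR j - 1)| <= hR j].
Hypothesis hx : forall C, binary (x $ C).
Hypothesis unbounded : forall C, nR C < fap (G $ n) (val (P $ (x $ C))) + 2.

Let y b : RL := G $ n $ (P $ b).

Let hy b : binary b -> real (y b) /\ fap (G $ n) (val (P $ b)) = val (y b).
Proof. by move=> /hP[h1 h2 _]; apply: (isFun_fap (@range_I M)). Qed.

(* The values of an unbounded function along a sequence of points bound the first stage at
   which an event occurs, if that stage is used to choose the point. *)
Lemma unbounded_jump (A : N -> N -> Prop) :
  Dec (fun e : env M (cons o (cons o nil)) => A (snd (fst e)) (snd e)) ->
  exists d : RL, forall k, (exists s, A k s) -> exists s, le s (d $ k) /\ A k s.
Proof.
move=> hA.
(* If the first event occurs at stage s, the point is [x $ (s + 3)], where the function exceeds s +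
   1 and its approximation with error 1 exceeds s. So that approximation, rounded up, bounds s. *)
have [B eB] : exists B : M (o ~> o ~> rl), forall k s, B $ k $ s = x $ succ (succ (succ s)).
  exists (\ k s => x $ succ (succ (succ s))) => k s. by rewrite beta; [rewrite beta //|]; rep.
have [|w hw] := @first_event M A B hW hA.
  by move=> k s _; rewrite eB; apply: hx.
have [||d hd] := choice0 M (fun k m => v (y (w $ k) $ zero) <= iota m).
- by apply: Dec_leQ; [apply: RepQ_v|apply: RepQ_iota]; rewrite /y; rep.
- by move=> k; apply: iota_arch.
exists d => k /(@N_least M (fun s => A k s))[|s [h1 h2]].
  case: hA => f [[g [[g' [_ eg']] eg]] ef]. exists (fun e => g' tt $ k $ snd e).
  by split; [rep|move=> e; rewrite eg' eg ef].
exists s; split=> //. have [hb h] := hw k. have := h s (conj h1 h2). rewrite eB => ew.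
have := unbounded (succ (succ (succ s))). rewrite !nRS -ew. have [h3 ->] := hy hb.
have [_ h4] := val_closeP zero h3. rewrite hR0 in h4. have := hd k. rewrite -emb_le -/(nR _) => h5 h6.
by apply/nR_le; lra.
Qed.

(** The points [x $ C] have a cluster point: whether some of them with [C >= L] begins with given L
    bits can be decided by a search that [unbounded_jump] bounds, so [WKL_compact] applies. Near the
    cluster point the function is bounded by upper semicontinuity, while its values at the points
    [x $ C] grow. *)
Lemma unbounded_absurd : False.
Proof.
have [|d hd] := @unbounded_jump (fun k s => le (pi2 k) s /\ initseg (x $ s) (pi2 k) = pi1 k).
  by dec.
pose E b L C := le L C /\ initseg (x $ C) L = initseg b L.
have hE b L : (exists C, E b L C) -> exists C, le C (d $ pair (initseg b L) L) /\ E b L C.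
  by have := hd (pair (initseg b L) L); rewrite pi1_pair pi2_pair.
have [||||b [hb hbE]] := @WKL_compact M (fun b L => exists C,
    le C (d $ pair (initseg b L) L) /\ E b L C) hW.
- apply: (Dec_ex_le M (cons o (cons rl nil)) (fun e C => E (snd (fst e)) (snd e) C)
    (fun e => d $ pair (initseg (snd (fst e)) (snd e)) (snd e))); last by rep.
  by rewrite /E; dec.
- move=> b b' L _ _ hag. by rewrite /E (initseg_ext hag).
- move=> b L hb [C [_ [/iota_le h1 h2]]]. apply: hE. exists C; split.
    by apply/iota_le; rewrite iotaS in h1; lra.
  apply: initseg_ext => j hj. apply: (initseg_agree (hx C) hb h2).
  by apply/lt_succ; move/iota_lt: hj => hj; apply/iota_le; lra.
- move=> L. exists (x $ L); split=> //. apply: hE. exists L; split=> //. exact: le_refl.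
have [hPb uPb aPb] := hP hb.
have [dl [hdl hu]] := uG n (Mr_val hPb) uPb (ltr01 : 0 < 1 :> R).
have h0 : 0 < dl / 2 by lra. have [L0 hL0] := hR_arch h0.
have [L1 hL1] := nR_arch (fap (G $ n) (val (P $ b)) + 3).
have [C [_ [hC eC]]] := hbE (add L0 L1).
have [hPx uPx aPx] := hP (hx C).
have h1 : hR (add L0 L1) <= hR L0 by apply: hR_anti; apply/leP; exists L1.
have h2 : `|val (P $ b) - val (P $ (x $ C))| < dl.
  have := aPb (add L0 L1). have := aPx (add L0 L1). rewrite eC !ler_norml ltr_norml.
  by move=> /andP[k1 k2] /andP[k3 k4]; apply/andP; split; lra.
have h3 := hu _ (Mr_val hPx) uPx h2. have h4 := unbounded C.
have h5 : nR L1 <= nR C.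
  apply/nR_le; apply: le_trans hC; apply/leP; exists L0; exact: addC.
lra.
Qed.

End Unbounded.

(* Weak König's lemma yields a point x at which G_n exceeds C if there is any such rational
   point; the value of G_n at x then tells whether this is the case. *)
Lemma WKL_bound : exists g : RL, forall n r, Mr r -> unitI r -> fap (G $ n) r <= nR (g $ n).
Proof.
have [D hD] := rational_digits M. have [P hP] := binary_point M.
pose y n b : RL := G $ n $ (P $ b).
have hy n b : binary b -> real (y n b) /\ fap (G $ n) (val (P $ b)) = val (y n b).
  by move=> /hP[h1 h2 _]; apply: (isFun_fap (@range_I M)).
(* The event for the pair of n and C: the rational with code c, less 1, is a point of [[0, 1)] at
   which the approximation of the n-th function exceeds C + 1. *)
pose A p c := (1 <= v c /\ v c < 2) /\ iota (pi2 p) + 1 < v (y (pi1 p) (D $ c) $ zero).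
have hA : Dec (fun e : env M (cons o (cons o nil)) => A (snd (fst e)) (snd e)).
  have h1 : RepQ (fun e : env M (cons o (cons o nil)) => v (snd e)) by apply: RepQ_v; rep.
  apply: Dec_and; first apply: Dec_and.
  - by apply: Dec_leQ => //; apply: RepQ_const.
  - by apply: Dec_ltQ => //; apply: RepQ_const.
  - apply: Dec_ltQ; last by apply: RepQ_v; rewrite /y; rep.
    by apply: RepQ_add; [apply: RepQ_iota; rep|apply: RepQ_const].
have [|z hz] := @first_event M A (s_K _ _ $ D) hW hA.
  by move=> p c [[h1 h2] _]; rewrite M_K; case: (hD c h1 h2).
pose low n C := v (y n (z $ pair n C) $ zero) <= iota C - 1.
have D_point c : 1 <= v c -> v c < 2 -> val (P $ (D $ c)) = emb (v c) - 1.
  move=> h1 h2. have [hb hs] := hD c h1 h2. have [_ _ ha] := hP _ hb.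
  have h j : `|val (P $ (D $ c)) - (emb (v c) - 1)| <= 0 + 2 * hR j.
    have := ha j. have [h3 h4] := hs j. have p := hf_gt0 j. have e := hf_pow2 j.
    have k1 : iota (initseg (D $ c) j) * hf j <= v c.
      have : iota (initseg (D $ c) j) * hf j <= iota (pow2 j) * v c * hf j by rewrite ler_pM2r.
      by rewrite mulrC mulrAC (mulrC _ (hf j)) e mul1r.
    have k2 : v c <= (iota (initseg (D $ c) j) + 1) * hf j.
      have : iota (pow2 j) * v c * hf j <= (iota (initseg (D $ c) j) + 1) * hf j.
        by rewrite ler_pM2r //; lra.
      by rewrite mulrAC (mulrC _ (hf j)) e mul1r.
    rewrite mulrDl mul1r in k2. rewrite -emb_le embM -/(nR _) -/(hR _) in k1.
    rewrite -emb_le embD embM -/(nR _) -/(hR _) in k2.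
    by rewrite !ler_norml => /andP[k3 k4]; apply/andP; split; lra.
  by have := le_hR h; rewrite normr_le0 subr_eq0 => /eqP.
(* A value above C + 3 would be above C + 2 at a rational point nearby, and above C + 1 in its
   approximation. So the event would occur, and the value at the chosen point would contradict
   [low]. *)
have low_bound n C : low n C -> forall r, Mr r -> unitI r -> fap (G $ n) r <= nR C + 3.
  move=> hlow r hr rI. apply: NNPP => /negP. rewrite -Order.TotalTheory.ltNge => hgt.
  have [d [hd hl]] := lG n hr rI (ltr01 : 0 < 1 :> R).
  have h0 : 0 < d / 2 by lra. have [k hk] := hR_arch h0.
  have [q [q0 q1 hq]] := rational_near k hr rI. have [c ec] := v_surj (q + 1).
  have c1 : 1 <= v c by rewrite -ec; lra. have c2 : v c < 2 by rewrite -ec; lra.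
  have eq : val (P $ (D $ c)) = emb q by rewrite D_point // -ec embD emb1 addrK.
  have [hb _] := hD c c1 c2. have [hPb uPb _] := hP _ hb. have [hy1 hy2] := hy n _ hb.
  have h1 : nR C + 2 < val (y n (D $ c)).
    have := hl _ (Mr_val hPb) uPb. rewrite hy2 eq => h. have : `|r - emb q| < d by lra.
    by move=> /h; lra.
  have hev : exists c, A (pair n C) c.
    exists c; rewrite /A pi1_pair pi2_pair; split=> //. rewrite -emb_lt embD emb1 -/(nR C).
    by have := val_closeP zero hy1; rewrite hR0; lra.
  have [|c' [hc' hc'2]] := @N_least M (fun c => A (pair n C) c) _ hev.
    case: hA => f [[g [[g' [_ eg']] eg]] ef]. exists (fun e => g' tt $ pair n C $ snd e).
    by split; [rep|move=> e; rewrite eg' eg ef].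
  have [hzb /(_ c' (conj hc' hc'2)) ez] := hz (pair n C). rewrite M_K in ez.
  have [_] := hc'. rewrite pi1_pair pi2_pair -ez. move: hlow; rewrite /low. lra.
have [hall|hno] := classic (forall n, exists C, low n C).
- have [|g hg] := choice0 M low _ hall.
    apply: Dec_leQ; first by apply: RepQ_v; rewrite /y; rep.
    by apply: RepQ_add; [apply: RepQ_iota; rep|apply: RepQ_const].
  exists (\ n => succ (succ (succ (g $ n)))) => n r hr rI. rewrite beta; last by rep.
  by have := low_bound n _ (hg n) r hr rI; rewrite !nRS; lra.
(* If [low n C] fails for every C, the n-th function exceeds C - 2 at the point chosen for C, which
   is the hypothesis of [unbounded_absurd]. *)
- exfalso. have [n hn] : exists n, forall C, ~ low n C.
    apply: NNPP => h; apply: hno => n; apply: NNPP => h'; apply: h; exists n => C hC.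
    by apply: h'; exists C.
  have [x ex] : exists x : M (o ~> rl), forall C, x $ C = z $ pair n C.
    by exists (\ C => z $ pair n C) => C; rewrite beta //; rep.
  have hx C : binary (x $ C) by rewrite ex; case: (hz (pair n C)).
  apply: (@unbounded_absurd P n x hP hx) => C.
  have [h1 ->] := hy n _ (hx C). have := hn C. rewrite /low -ex => /negP.
  rewrite -Order.TotalTheory.ltNge -emb_lt embB emb1 -/(nR C).
  by have := val_closeP zero h1; rewrite hR0; lra.
Qed.

End Sequence.

Lemma lsco_lip (f h : R -> R) P : lip h -> lscoR everywhere f -> lscoR P (fun r => f (h r)).
Proof.
move=> hh /lsco_opp hf'. apply: (lsco_ext (f := fun r => - - f (h r))) => [r _ _|].
  by rewrite opprK.
apply: usco_opp. exact: (usco_lip (f := fun r => - f r) hh hf').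
Qed.

(** A continuous majorant of the usco rank has bounds on the intervals [[-n, n]] that form a
    function of n, by [WKL_bound] for its stretched copies. *)
Lemma a_c : stmt_a M -> stmt_c M.
Proof.
move=> /bound_a[hW H]. apply/cover_c => O hO hcov.
have [[F [hF hu hr]] _] := exists_rank hO hcov.
have [|g [hg hle]] := H F; first by apply/(uscoP (@range_R M)).
have [hgF [ug lg]] := proj1 (contP (@range_R M) g) hg.
have [|G hG] := @mkS2 M (fun n r => fap g (stretch n r)).
  by apply: fap_inR; [rep|rewrite /stretch; repr|].
have [|||b hb] := @WKL_bound G hW.
- by move=> n; have [h _] := hG n; apply: isFun_sub h; apply: inI_inR.
- move=> n. have [_ h] := hG n.
  apply: (usco_ext (f := fun r => fap g (stretch n r))) => [r rr _|]; first by rewrite h.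
  exact: (usco_lip (lip_stretch n)).
- move=> n. have [_ h] := hG n.
  apply: (lsco_ext (f := fun r => fap g (stretch n r))) => [r rr _|]; first by rewrite h.
  exact: (lsco_lip (lip_stretch n)).
exists b => n r rr hI. have [s [hs sI es]] := stretch_onto rr hI. apply: hr => //.
have := hb n s hs sI. have [_ ->] := hG n => //. rewrite es. have := hle r rr. lra.
Qed.

Lemma clamp_lip1 (a b : R) : `|clamp a - clamp b| <= `|a - b|.
Proof.
rewrite /clamp. have [m1 m2 m3] := maxr_spec 0 (Num.min 1 a). have [n1 n2 n3] := minr_spec 1 a.
have [m1' m2' m3'] := maxr_spec 0 (Num.min 1 b). have [n1' n2' n3'] := minr_spec 1 b.
have := ler_norm (a - b). have := ler_norm (- (a - b)). rewrite normrN => h1 h2.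
rewrite ler_norml. case: m3 => m3; case: n3 => n3; case: m3' => m3'; case: n3' => n3';
  apply/andP; split; lra.
Qed.

(** The majorant is the supremum of ramps in [|r|] that rise from 0 at [2n - 2] to [g (2n + 2)] at
    [2n - 1]. By [near_even] some n has [2n - 1 < |r| < 2n + 2]; its ramp has reached full height at
    r, and [g (2n + 2)] bounds [f r]. Only finitely many ramps, in the sense of the model, are
    non-zero near a point. *)
Lemma majorant (f : FN) (g : RL) : (forall n r, Mr r -> symI n r -> fap f r <= nR (g $ n)) ->
  exists F : FN, cont inR F /\ forall r, Mr r -> fap f r <= fap F r.
Proof.
move=> hfg.
have [h eh] : exists h : RL, forall n, h $ n = g $ succ (succ (add n n)).
  by exists (\ n => g $ succ (succ (add n n))) => n; rewrite beta //; rep.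
pose T n (r : R) := nR (h $ n) * clamp (`|r| - (nR n + nR n) + (1 + 1)).
have T0 n r : 0 <= T n r.
  by apply: mulr_ge0; [apply: nR_ge0|case: (clamp_unitI (`|r| - (nR n + nR n) + (1 + 1)))].
have Tfar n r : `|r| + 1 <= nR n -> T n r = 0.
  move=> hn. rewrite /T /clamp. have h0 := normr_ge0 r.
  have [m1 m2 m3] := maxr_spec 0 (Num.min 1 (`|r| - (nR n + nR n) + (1 + 1))).
  have [n1 n2 n3] := minr_spec 1 (`|r| - (nR n + nR n) + (1 + 1)).
  rewrite (_ : Num.max _ _ = 0) ?mulr0 //. by case: m3 => m3; case: n3 => n3; lra.
have Tlip n r s : `|T n r - T n s| <= nR (h $ n) * `|r - s|.
  rewrite /T -mulrBr normrM (ger0_norm (nR_ge0 _)). apply: ler_wpM2l; first exact: nR_ge0.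
  have h1 := clamp_lip1 (`|r| - (nR n + nR n) + (1 + 1)) (`|s| - (nR n + nR n) + (1 + 1)).
  have h2 := ler_dist_dist r s.
  have e : `|r| - (nR n + nR n) + (1 + 1) - (`|s| - (nR n + nR n) + (1 + 1)) = `|r| - `|s| by ring.
  rewrite e in h1. lra.
have [||Y hY] := @choose_real M (fun x k => `|v (x $ zero)| + 1 <= iota k).
- apply: Dec_leQ; last by apply: RepQ_iota; rep.
  by apply: RepQ_add; [apply: RepQ_norm; apply: RepQ_v; rep|apply: RepQ_const].
- by move=> x _; apply: iota_arch.
have hYb x : real x -> `|val x| <= nR (Y $ x).
  move=> hx. have := hY x hx. rewrite -emb_le embD emb1 emb_norm -/(nR _).
  have := val_close zero hx. rewrite hR0. have := ler_normD (val x - emb (v (x $ zero))) (emb (v (x $ zero))).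
  rewrite subrK. lra.
have [||S [hS eS]] := @RepR_bigmax M (cons rl nil) (fun e => real (snd e))
  (fun e n => T n (val (snd e))) (fun e => Y $ snd e).
- by rewrite /T /clamp; repr.
- by rep.
have S_all x n : real x -> T n (val x) <= S (tt, x).
  move=> hx. have [h1 _] := eS (tt, x) hx. have [hn|hn] := classic (le n (Y $ x)); first exact: h1.
  have /nR_lt h2 : lt (Y $ x) n by apply/lt_nle.
  rewrite Tfar; first by have := h1 zero (le0 _ _); have := T0 zero (val x); rewrite /=; lra.
  by have := hYb x hx; lra.
have S_sup x t : real x -> t < S (tt, x) -> exists n, t < T n (val x).
  by move=> hx; have [_ h2] := eS (tt, x) hx => /h2[n [_ hn]]; exists n.
have S_ext x x' : real x -> real x' -> val x = val x' -> S (tt, x) <= S (tt, x').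
  move=> hx hx' e. apply: NNPP => /negP. rewrite -Order.TotalTheory.ltNge => /(S_sup _ _ hx)[n].
  by have := S_all x' n hx'; rewrite e; lra.
have [|F [hF eF]] := @mkF M S hS.
  by move=> x x' hx hx' e; have := S_ext x x' hx hx' e; have := S_ext x' x hx' hx (esym e); lra.
have F_all r n : Mr r -> T n r <= fap F r by move=> [x [hx <-]]; rewrite eF //; apply: S_all.
have F_sup r t : Mr r -> t < fap F r -> exists n, t < T n r.
  by move=> [x [hx <-]]; rewrite eF //; apply: S_sup.
exists F; split; last first.
  move=> r hr. have hr' : Mr `|r|.
    exact: (Mr_RepR (D := fun _ : env M nil => True) (e := tt) (RepR_norm (RepR_Mr _ hr)) I).
  have [n [h1 h2]] := near_even hr' (normr_ge0 r).
  have h3 : fap f r <= nR (h $ n).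
    rewrite eh. apply: hfg => //. rewrite /symI !nRS nRD.
    have := ler_norm r. have := ler_norm (- r). rewrite normrN. lra.
  have := F_all r n hr. rewrite /T (_ : clamp _ = 1) ?mulr1; first by lra.
  rewrite /clamp.
  have [m1 m2 m3] := maxr_spec 0 (Num.min 1 (`|r| - (nR n + nR n) + (1 + 1))).
  have [n1 n2 n3] := minr_spec 1 (`|r| - (nR n + nR n) + (1 + 1)).
  by case: m3 => m3; case: n3 => n3; lra.
apply/(contP (@range_R M)); split=> //; split=> r hr _ e he.
(* Within distance 1 of r the ramps beyond k vanish, so the largest slope up to k gives a common
   Lipschitz constant. *)
- have [k hk] := nR_arch (`|r| + 2).
  have [||m [_ hm]] := @RepQ_bigmax M nil (fun _ n => iota (h $ n)) (fun _ => k).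
  + by apply: RepQ_iota; rep.
  + by rep.
  have {hm} hm n : le n k -> nR (h $ n) <= emb (m tt).
    by move=> hn; rewrite emb_le; have [h1 _] := hm tt; apply: h1.
  set c := emb (m tt) in hm. have c0 : 0 <= c by have := hm zero (le0 _ _); have := nR_ge0 (h $ zero); lra.
  pose d := e / 2 / (c + 1).
  have hd : 0 < d by rewrite /d !divr_gt0 //; lra.
  have [m1 m2 m3] := minr_spec 1 d. exists (Num.min 1 d); split; first by case: m3 => ->; lra.
  move=> s hs _ hrs. apply: NNPP => /negP. rewrite -Order.TotalTheory.leNgt => hge.
  have [|n hn] := F_sup s (fap F r + e / 2) hs; first by lra.
  have h1 := F_all r n hr. have h2 := T0 n r. have h3 := Tlip n r s.
  have h4 : `|s| <= `|r| + `|r - s| by have := ler_dist_dist s r; rewrite (distrC s) => h4; have := ler_norm (`|s| - `|r|); lra.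
  have [hnk|hnk] := classic (le n k); last first.
    have /nR_lt hnk' : lt k n by apply/lt_nle.
    by rewrite (Tfar n s) in hn; lra.
  have h5 : nR (h $ n) * `|r - s| <= e / 2.
    have h6 := hm n hnk. have h7 : `|r - s| <= d by lra.
    have h8 : nR (h $ n) * `|r - s| <= (c + 1) * d.
      by apply: ler_pM => //; [apply: nR_ge0|lra].
    by rewrite /d mulrCA divff ?mulr1 // in h8; apply: lt0r_neq0; lra.
  by move: h3; rewrite ler_norml => /andP[h6 h7]; lra.
- have [|n hn] := F_sup r (fap F r - e / 2) hr; first by lra.
  pose d := e / 2 / (nR (h $ n) + 1). have h0 := nR_ge0 (h $ n).
  have hd : 0 < d by rewrite /d !divr_gt0 //; lra.
  exists d; split=> // s hs _ hrs. have h1 := F_all s n hs. have h3 := Tlip n r s.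
  have h5 : nR (h $ n) * `|r - s| <= e / 2.
    have h8 : nR (h $ n) * `|r - s| <= (nR (h $ n) + 1) * d.
      by apply: ler_pM => //; lra.
    by rewrite /d mulrCA divff ?mulr1 // in h8; apply: lt0r_neq0; lra.
  by move: h3; rewrite ler_norml => /andP[h6 h7]; lra.
Qed.

Lemma c_a : stmt_c M -> stmt_a M.
Proof.
move=> hc. apply/bound_a; split; first by apply: e4_WKL; apply: e3_e4; apply: c_e3.
move=> f /(uscoP (@range_R M))[hF hu].
have /bound_b hb : stmt_b M by apply: d_b; apply: c_d.
have [|F hF'] := @mkS2 M (fun n r => fap f (stretch n r)).
  by apply: fap_inR; [rep|rewrite /stretch; repr|].
have [|g hg] := hb F.
  move=> n. have [h1 h2] := hF' n. apply: usco_inI => //.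
  apply: (usco_ext (f := fun r => fap f (stretch n r))) => [r rr _|]; first by rewrite h2.
  by apply: (usco_lip (lip_stretch n)).
apply: (@majorant f g) => n r rr hI. have [s [hs sI es]] := stretch_onto rr hI.
by have := hg n s hs sI; have [_ ->] := hF' n => //; rewrite es.
Qed.

End Bounds.
End Bounds.

(** * Provability of all the implications *)

Module Equivalence.
Import Defs List.
Import Semantics Interpretation Equivalences Trees Bounds.

Lemma equivalent_c (p : bform) : In p equivalents -> exists P : model -> Prop,
  (forall (M : model) (w : world M), fev p w (P M)) /\
  forall M : model, P M <-> Interpretation.stmt_c M.
Proof.
  assert (e : forall (q : bform) (Q : model -> Prop),
    (forall (M : model) (w : world M), fev q w (Q M)) ->
    (forall M, Q M <-> Interpretation.stmt_e3 M) ->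
    exists P : model -> Prop,
      (forall (M : model) (w : world M), fev (Defs.OC00 &&& q) w (P M)) /\
      forall M : model, P M <-> Interpretation.stmt_c M).
  { intros q Q hq h. exists (fun M => Interpretation.OC00 M /\ Q M). split.
    - intros M w. apply fev_and; [apply fev_OC00 | apply hq].
    - intros M. rewrite c_iff, h. reflexivity. }
  simpl. intros h.
  repeat (destruct h as [<- | h]); [..|destruct h].
  - exists Interpretation.stmt_a. split; [intros; apply fev_stmt_a|].
    split; [apply a_c | apply c_a].
  - exists Interpretation.stmt_b. split; [intros; apply fev_stmt_b|].
    split; [apply b_c | intros hc; apply d_b, c_d, hc].
  - exists Interpretation.stmt_c. split; [intros; apply fev_stmt_c | tauto].
  - exists Interpretation.stmt_d. split; [intros; apply fev_stmt_d|].
    split; [apply d_c | apply c_d].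
  - apply (e _ Interpretation.stmt_e1); [intros; apply fev_stmt_e1|].
    split; [apply e1_e3 | apply e3_e1].
  - apply (e _ Interpretation.stmt_e2); [intros; apply fev_stmt_e2|].
    split; [apply e2_e3 | intros h; apply e7_e2, e3_e7, h].
  - apply (e _ Interpretation.stmt_e3); [intros; apply fev_stmt_e3 | tauto].
  - apply (e _ Interpretation.stmt_e4); [intros; apply fev_stmt_e4|].
    split; [apply e4_e3 | apply e3_e4].
  - apply (e _ Interpretation.stmt_e5); [intros; apply fev_stmt_e5|].
    split; [intros h; apply e2_e3, e5_e2, h | apply e3_e5].
  - apply (e _ Interpretation.stmt_e6); [intros; apply fev_stmt_e6|].
    split; [apply e6_e3 | apply e3_e6].
  - apply (e _ Interpretation.stmt_e7); [intros; apply fev_stmt_e7|].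
    split; [intros h; apply e2_e3, e7_e2, h | apply e3_e7].
  - apply (e _ Interpretation.stmt_e8); [intros; apply fev_stmt_e8|].
    split; [intros h; apply e2_e3, e7_e2, e8_e7, h | intros h; apply e7_e8, e3_e7, h].
Qed.

Lemma equivalents_imply (p q : bform) :
  In p equivalents -> In q equivalents -> RCA0w_proves (p --> q).
Proof.
  intros hp hq. destruct (equivalent_c p hp) as [P [hP eP]].
  destruct (equivalent_c q hq) as [Q [hQ eQ]].
  apply (proves_imp p q P Q hP hQ). intros M h. apply eQ, eP, h.
Qed.

End Equivalence.

Require Import Defs.
From Stdlib Require Import List.

Theorem theorem2p12 (p q : bform)
  (hp : In p equivalents) (hq : In q equivalents) :
  RCA0w_proves (p --> q).
Proof. exact (Equivalence.equivalents_imply p q hp hq). Qed.
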